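(* Let $S$ be a finite-dimensional quantum system with Hamiltonian $H_S$, let $\beta>0$ be a fixed inverse temperature, and let $\rho,\rho'$ be two states on $S$ with $\mathcal{C}(\rho')\subseteq\mathcal{C}(\rho)$. Then the following are equivalent: (i) $\rho$ can be converted to $\rho'$ by a thermal operation with a correlated catalyst with arbitrary accuracy, i.e., for every $\varepsilon>0$ there exist a finite-dimensional catalyst system $C$ (with some Hamiltonian $H_C$), a state $c$ on $C$, and a thermal operation $\Lambda$ on $S\otimes C$ such that $\pi_{SC}:=\Lambda(\rho\otimes c)$ satisfies $\mathrm{Tr}_S(\pi_{SC})=c$ exactly and $\|\mathrm{Tr}_C(\pi_{SC})-\rho'\|_1\le\varepsilon$; (ii) $F(\rho)\ge F(\rho')$. Moreover, whenever $F(\rho)\ge F(\rho')$, for every $\varepsilon>0$ the catalyst and thermal operation in (i) can be chosen so that in addition the correlation between system and catalyst is at most $\varepsilon$, i.e., $\|\pi_{SC}-\mathrm{Tr}_C(\pi_{SC})\otimes c\|_1\le\varepsilon$.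
   Context: Gibbs state of a system $X$ with Hamiltonian $H_X$: $\tau_{\mathrm{Gibbs},X}=e^{-\beta H_X}/\mathrm{Tr}(e^{-\beta H_X})$. A thermal operation from $S$ to $S'$ is a channel of the form $\Lambda(\rho)=\mathrm{Tr}_E[V(\rho\otimes\tau_{\mathrm{Gibbs},E})V^\dagger]$, where $E$ is an environment with Hamiltonian $H_E$ and $V:SE\to S'E$ is an energy-conserving (partial) isometry, $V(H_S+H_E)=(H_{S'}+H_E)V$. For a composite system the Hamiltonian is the sum of local Hamiltonians. Nonequilibrium free energy: $F(\rho)=\mathrm{Tr}(\rho H_S)-S(\rho)/\beta$ with $S(\rho)=-\mathrm{Tr}\rho\log\rho$. Coherent modes: $\mathcal{D}(\rho)=\{E-E' : \Pi_E\rho\Pi_{E'}\neq 0\}$, where $\Pi_E$ is the projector onto the eigenspace of $H_S$ with eigenvalue $E$ (equivalently, the energy differences $E_i-E_j$ for energy eigenstates $|E_i\rangle,|E_j\rangle$ with $\langle E_i|\rho|E_j\rangle\ne0$). Resonant coherent modes: $\mathcal{C}(\rho)=\{\sum_{\Delta\in\mathcal{D}(\rho)}a_\Delta\Delta : a_\Delta\in\mathbb{Z}\}$ (finite sums). *)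

(* Defs.v *)
From HB Require Import structures.
From mathcomp Require Import all_boot all_order all_algebra.
From mathcomp Require Import complex mxtens.
From mathcomp Require Import reals sequences exp.

Set Implicit Arguments.
Unset Strict Implicit.
Unset Printing Implicit Defensive.

Import Order.TTheory GRing.Theory Num.Theory.
Local Open Scope ring_scope.

Definition dag {R : realType} {m n : nat} (M : 'M[R[i]]_(m, n)) : 'M[R[i]]_(n, m) :=
  \matrix_(i, j) conjc (M j i).

Definition is_hermitian {R : realType} {n : nat} (A : 'M[R[i]]_n) : Prop :=
  dag A = A.

Definition psd {R : realType} {n : nat} (A : 'M[R[i]]_n) : Prop :=
  is_hermitian A /\ forall v : 'cV[R[i]]_n, 0 <= (dag v *m A *m v) 0 0.

Definition density {R : realType} {n : nat} (rho : 'M[R[i]]_n) : Prop :=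
  psd rho /\ \tr rho = 1.

(* eigenvalues of a Hermitian (more generally normal) matrix, from the
   library's spectral decomposition  A = M^* diag(d) M, M unitary *)
Definition eig {R : realType} {n : nat} (A : 'M[R[i]]_n) (k : 'I_n) : R :=
  complex.Re (spectral_diag A 0 k).

Definition mxfun {R : realType} {n : nat} (f : R -> R) (A : 'M[R[i]]_n)
  : 'M[R[i]]_n :=
  dag (spectralmx A) *m diag_mx (\row_k real_complex R (f (eig A k)))
    *m spectralmx A.

Definition gibbs {R : realType} {n : nat} (beta : R) (H : 'M[R[i]]_n)
  : 'M[R[i]]_n :=
  (\tr (mxfun (fun x => expR (- (beta * x))) H))^-1
    *: mxfun (fun x => expR (- (beta * x))) H.

Definition hsum {R : realType} {a b : nat} (HA : 'M[R[i]]_a) (HB : 'M[R[i]]_b)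
  : 'M[R[i]]_(a * b) :=
  HA *t (1%:M : 'M[R[i]]_b) + (1%:M : 'M[R[i]]_a) *t HB.

Definition ptr1 {R : realType} {a b : nat} (X : 'M[R[i]]_(a * b)) : 'M[R[i]]_b :=
  \matrix_(j, j') \sum_(i < a) X (mxtens_index (i, j)) (mxtens_index (i, j')).

Definition ptr2 {R : realType} {a b : nat} (X : 'M[R[i]]_(a * b)) : 'M[R[i]]_a :=
  \matrix_(i, i') \sum_(j < b) X (mxtens_index (i, j)) (mxtens_index (i', j)).

Definition thermal_op {R : realType} (beta : R) {m m' : nat}
  (HS : 'M[R[i]]_m) (HS' : 'M[R[i]]_m') (L : 'M[R[i]]_m -> 'M[R[i]]_m') : Prop :=
  exists (e : nat) (HE : 'M[R[i]]_e) (V : 'M[R[i]]_(m' * e, m * e)),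
    [/\ is_hermitian HE,
        V *m dag V *m V = V,
        V *m hsum HS HE = hsum HS' HE *m V,
        (forall X, L X = ptr2 (V *m (X *t gibbs beta HE) *m dag V)) &
        (forall X, \tr (L X) = \tr X)].

Definition trnorm {R : realType} {n : nat} (X : 'M[R[i]]_n) : R :=
  \sum_(k < n) Num.sqrt (eig (dag X *m X) k).

(* von Neumann entropy  S(rho) = - Tr rho log rho  (with 0 log 0 = 0,
   which holds since ln 0 = 0 in mathcomp-analysis) *)
Definition entropy {R : realType} {n : nat} (rho : 'M[R[i]]_n) : R :=
  - \sum_(k < n) eig rho k * ln (eig rho k).

Definition free_energy {R : realType} {n : nat} (beta : R) (H : 'M[R[i]]_n)
  (rho : 'M[R[i]]_n) : R :=
  complex.Re (\tr (rho *m H)) - entropy rho / beta.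

(* projector onto the eigenspace of H with eigenvalue E (0 if E is not an
   eigenvalue) *)
Definition eproj {R : realType} {n : nat} (H : 'M[R[i]]_n) (E : R) : 'M[R[i]]_n :=
  mxfun (fun x => if x == E then 1 else 0) H.

Definition coh_modes {R : realType} {n : nat} (H : 'M[R[i]]_n)
  (rho : 'M[R[i]]_n) (d : R) : Prop :=
  exists E E' : R, d = E - E' /\ eproj H E *m rho *m eproj H E' <> 0.

Definition res_modes {R : realType} {n : nat} (H : 'M[R[i]]_n)
  (rho : 'M[R[i]]_n) (x : R) : Prop :=
  exists s : seq (int * R),
    (forall p, p \in s -> coh_modes H rho p.2) /\
    x = \sum_(p <- s) p.2 *~ p.1.

(* Main.v *)
Require Import Defs.
From HB Require Import structures.
From mathcomp Require Import all_boot all_order all_algebra.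
From mathcomp Require Import complex mxtens.
From mathcomp Require Import boolp.
From mathcomp Require Import reals sequences exp.
From mathcomp Require Import ring lra zify.

Set Implicit Arguments.
Unset Strict Implicit.
Unset Printing Implicit Defensive.

Import Order.TTheory GRing.Theory Num.Theory.
Local Open Scope ring_scope.
Local Open Scope complex_scope.

(** Necessity is a second-law argument from which the catalyst drops out. Since a thermal operation
    preserves the trace and the bath state has full rank, its partial isometry is a unitary [U]
    commuting with the total Hamiltonian. Klein's inequality for the final state of [SCE] against
    the product of a slightly depolarized [rho'], a slightly depolarized [c] and the Gibbs state,
    combined with conservation of entropy and energy under [U], cancels every catalyst and bath term
    up to the price [ln (1 - d)] of depolarizing, which does not depend on dimensions. What remains
    is beta F(rho') <= beta F(rho) plus the pairing of the deviation from [rho'] with an operator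
    depending only on the target and [d] ([converse_bound], [catalysis_bound]), so accuracy tending
    to zero gives the claim.

    Sufficiency rests on a cyclic catalyst ([duan_core], [duan_slots]). Suppose one thermal
    operation turns many copies of [rho] into a register most of whose slots are nearly in state
    [sigma] and nearly decoupled from everything else. Take as catalyst the uniform mixture, over a
    clock, of registers partly refreshed with [rho]: each use swaps the system with the next slot,
    and a full round ends with the collective operation. The catalyst is returned exactly, and the
    joint output is close to [sigma] tensor the catalyst, the error being the average slot error.
    Accuracy and small correlation therefore come together.

    The collective operation ([decouple_exists]) is built when the free energy drops strictly. Group
    the copies into blocks. By the law of large numbers a block of [rho'] is close to a uniform
    mixture of orthonormal vectors chosen by a random label, each within one coherence class
    ([target_exists]), and many blocks of [rho] nearly lie in the span of energy eigenvectors with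
    small partition function ([source_exists]). The gap in free energy lets a finite bath absorb the
    source label injectively while the target label is taken from thermal randomness, with energies
    balanced ([reservoir]).

    The target vectors superpose different energies, so an energy [D y] depending on the
    configuration [y] must be exchanged with a phase reference. The reference is a supply of further
    copies of [rho]. As C(rho') lies in C(rho), [D y] is a sum of energy gaps between levels joined
    by nonzero entries of [rho]; a product of the corresponding matrix units shifts the energy by
    [D y] and has nonzero mean. Averaged over many groups of copies it acts almost as a scalar on
    the reference, and its polar part, completed to a unitary with the help of an energy ladder,
    shifts energy while hardly disturbing the reference ([frame_exists]). These unitaries commute,
    so for any given slot its own shift may be regarded as the first one to act on the still fresh
    reference. The slot error is thus independent of the number of slots, and a reference of fixed
    size serves arbitrarily many of them; its copies are a negligible fraction of the register
    ([cat_decoupled]).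

    A second use of the cyclic catalyst passes from blocks to single copies ([cat_main]). Equality
    of free energies is reached by mixing [rho'] with the Gibbs state, which strictly lowers its
    free energy unless it is already Gibbs ([cat_weak]). Everything is done in energy eigenbases
    over finite types and transported back to matrices in [thermal_catalysis]. *)

Section Basics.
Variable R : realType.
Local Notation C := R[i].

(** * Adjoints, Hilbert-Schmidt norm and trace-norm witnesses *)

Lemma dagE m n (A : 'M[C]_(m,n)) i j : dag A i j = conjc (A j i).
Proof. by rewrite mxE. Qed.

Lemma dagK m n (A : 'M[C]_(m,n)) : dag (dag A) = A.
Proof. by apply/matrixP => i j; rewrite !mxE conjcK. Qed.

Lemma dag_trC m n (A : 'M[C]_(m,n)) : dag A = (map_mx conjc A)^T.
Proof. by apply/matrixP => i j; rewrite !mxE. Qed.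

Lemma dag_mul m n p (A : 'M[C]_(m,n)) (B : 'M[C]_(n,p)) :
  dag (A *m B) = dag B *m dag A.
Proof.
apply/matrixP => i j; rewrite !mxE rmorph_sum /=.
by apply: eq_bigr => k _; rewrite rmorphM /= !mxE mulrC.
Qed.

Lemma dagD m n (A B : 'M[C]_(m,n)) : dag (A + B) = dag A + dag B.
Proof. by apply/matrixP => i j; rewrite !mxE rmorphD. Qed.

Lemma dagN m n (A : 'M[C]_(m,n)) : dag (- A) = - dag A.
Proof. by apply/matrixP => i j; rewrite !mxE rmorphN. Qed.

Lemma dagB m n (A B : 'M[C]_(m,n)) : dag (A - B) = dag A - dag B.
Proof. by rewrite dagD dagN. Qed.

Lemma dag0 m n : dag (0 : 'M[C]_(m,n)) = 0.
Proof. by apply/matrixP => i j; rewrite !mxE conjc0. Qed.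

Lemma dag_sum (I : Type) (r : seq I) (P : pred I) m n (F : I -> 'M[C]_(m,n)) :
  dag (\sum_(i <- r | P i) F i) = \sum_(i <- r | P i) dag (F i).
Proof.
elim/big_rec2: _ => [|i A B _ <-]; first exact: dag0.
exact: dagD.
Qed.

Lemma dagZ m n a (A : 'M[C]_(m,n)) : dag (a *: A) = conjc a *: dag A.
Proof. by apply/matrixP => i j; rewrite !mxE rmorphM. Qed.

Lemma dag1 n : dag (1%:M : 'M[C]_n) = 1%:M.
Proof.
by apply/matrixP => i j; rewrite !mxE eq_sym; case: (_ == _); rewrite ?conjc1 ?conjc0.
Qed.

Lemma dag_row m n1 n2 (A : 'M[C]_(m,n1)) (B : 'M[C]_(m,n2)) :
  dag (row_mx A B) = col_mx (dag A) (dag B).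
Proof.
apply/matrixP => i j; rewrite !mxE.
by case: splitP => k Hk; rewrite !mxE.
Qed.

Lemma tr_dag n (A : 'M[C]_n) : \tr (dag A) = conjc (\tr A).
Proof. by rewrite /mxtrace rmorph_sum; apply: eq_bigr => i _; rewrite mxE. Qed.

Definition sqn (z : C) : R := complex.Re z ^+ 2 + complex.Im z ^+ 2.

Lemma sqn_ge0 z : 0 <= sqn z.
Proof. by rewrite addr_ge0 ?sqr_ge0. Qed.

Lemma sqnE z : conjc z * z = (sqn z)%:C.
Proof. by case: z => a b; rewrite /sqn; simpc; congr (_ +i* _); rewrite /=; ring. Qed.

Lemma sqn0 : sqn 0 = 0.
Proof. by rewrite /sqn /= expr0n addr0. Qed.
Lemma sqn1 : sqn 1 = 1.
Proof. by rewrite /sqn /= expr1n expr0n addr0. Qed.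

Lemma sqn_eq0 z : (sqn z == 0) = (z == 0).
Proof.
case: z => a b; rewrite /sqn /= paddr_eq0 ?sqr_ge0 // !sqrf_eq0.
by rewrite eq_complex.
Qed.

Lemma sqnM z w : sqn (z * w) = sqn z * sqn w.
Proof. by case: z w => a b [c d]; rewrite /sqn /=; ring. Qed.

Lemma sqnN z : sqn (- z) = sqn z.
Proof. by case: z => a b; rewrite /sqn /=; ring. Qed.

Lemma sqnJ z : sqn (conjc z) = sqn z.
Proof. by case: z => a b; rewrite /sqn /=; ring. Qed.

Lemma sqnC (x : R) : sqn x%:C = x ^+ 2.
Proof. by rewrite /sqn /= expr0n addr0. Qed.

Lemma sqnD_le z w : sqn (z + w) <= 2 * sqn z + 2 * sqn w.
Proof.
case: z w => a b [c d]; rewrite /sqn /=.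
have H1 := sqr_ge0 (a - c); have H2 := sqr_ge0 (b - d).
nra.
Qed.

Lemma sqnB_le z w : sqn (z - w) <= 2 * sqn z + 2 * sqn w.
Proof. by apply: le_trans (sqnD_le _ _) _; rewrite sqnN. Qed.

(** The squared Hilbert-Schmidt norm. Approximations are made on amplitudes [w] of states
    [w *m dag w], where it is a Euclidean distance, and pass to the trace norm through [tn_diff]. *)
Definition N2 m n (A : 'M[C]_(m,n)) : R := \sum_i \sum_j sqn (A i j).

Lemma N2_ge0 m n (A : 'M[C]_(m,n)) : 0 <= N2 A.
Proof. by apply: sumr_ge0 => i _; apply: sumr_ge0 => j _; exact: sqn_ge0. Qed.

Lemma N2_0 m n : N2 (0 : 'M[C]_(m,n)) = 0.
Proof. by rewrite /N2 big1 // => i _; rewrite big1 // => j _; rewrite mxE sqn0. Qed.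

Lemma rc_sum (I : Type) (r : seq I) (P : pred I) (F : I -> R) :
  (\sum_(i <- r | P i) F i)%:C = \sum_(i <- r | P i) (F i)%:C.
Proof. exact: rmorph_sum. Qed.

Lemma N2E m n (A : 'M[C]_(m,n)) : \tr (dag A *m A) = (N2 A)%:C.
Proof.
rewrite /N2 exchange_big /mxtrace rc_sum; apply: eq_bigr => j _.
rewrite mxE rc_sum; apply: eq_bigr => i _.
by rewrite mxE sqnE.
Qed.

Lemma N2_dag m n (A : 'M[C]_(m,n)) : N2 (dag A) = N2 A.
Proof.
rewrite /N2 exchange_big; apply: eq_bigr => i _; apply: eq_bigr => j _.
by rewrite mxE sqnJ.
Qed.

Lemma N2E' m n (A : 'M[C]_(m,n)) : \tr (A *m dag A) = (N2 A)%:C.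
Proof. by rewrite -N2_dag -N2E dagK. Qed.

Lemma rcI : injective (fun x : R => x%:C).
Proof. by move=> x y []. Qed.

Lemma N2N m n (A : 'M[C]_(m,n)) : N2 (- A) = N2 A.
Proof. by apply: eq_bigr => i _; apply: eq_bigr => j _; rewrite mxE sqnN. Qed.

Lemma N2Z m n a (A : 'M[C]_(m,n)) : N2 (a *: A) = sqn a * N2 A.
Proof.
rewrite /N2 mulr_sumr; apply: eq_bigr => i _; rewrite mulr_sumr.
by apply: eq_bigr => j _; rewrite mxE sqnM.
Qed.

Lemma N2D_le m n (A B : 'M[C]_(m,n)) : N2 (A + B) <= 2 * N2 A + 2 * N2 B.
Proof.
rewrite /N2 !mulr_sumr -big_split; apply: ler_sum => i _ /=.
rewrite !mulr_sumr -big_split; apply: ler_sum => j _ /=.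
by rewrite mxE sqnD_le.
Qed.

Lemma N2B_le m n (A B : 'M[C]_(m,n)) : N2 (A - B) <= 2 * N2 A + 2 * N2 B.
Proof. by apply: le_trans (N2D_le _ _) _; rewrite N2N. Qed.

Lemma N2_isom m n p (U : 'M[C]_(m,n)) (A : 'M[C]_(n,p)) :
  dag U *m U = 1%:M -> N2 (U *m A) = N2 A.
Proof.
move=> HU; apply: rcI; rewrite -!N2E dag_mul -!mulmxA [dag U *m _]mulmxA HU.
by rewrite mul1mx.
Qed.

Lemma N2_projD m n (P : 'M[C]_m) (A : 'M[C]_(m,n)) :
  dag P = P -> P *m P = P -> N2 A = N2 (P *m A) + N2 (A - P *m A).
Proof.
move=> Ph PP; apply: rcI; rewrite rmorphD /= -!N2E -mxtraceD; congr (\tr _).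
rewrite dagB dag_mul Ph mulmxBl !mulmxBr.
rewrite -!mulmxA ![P *m (P *m A)]mulmxA PP.
by rewrite subrr subr0 addrC subrK.
Qed.

Lemma N2_proj_le m n (P : 'M[C]_m) (A : 'M[C]_(m,n)) :
  dag P = P -> P *m P = P -> N2 (P *m A) <= N2 A.
Proof. by move=> h1 h2; rewrite (N2_projD A h1 h2) lerDl N2_ge0. Qed.

Lemma N2_row m n1 n2 (A : 'M[C]_(m,n1)) (B : 'M[C]_(m,n2)) :
  N2 (row_mx A B) = N2 A + N2 B.
Proof.
apply: rcI; rewrite rmorphD /= -!N2E' -mxtraceD.
by rewrite dag_row mul_row_col.
Qed.

(** [tn X e] witnesses that the trace norm of [X] is at most [e]. *)
Definition tn n (X : 'M[C]_n) (e : R) : Prop :=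
  exists k, exists v w : 'M[C]_(n,k), [/\ X = v *m dag w, N2 v <= e & N2 w <= e].

Lemma tn_ge0 n (X : 'M[C]_n) e : tn X e -> 0 <= e.
Proof. by case=> k [v [w [_ H _]]]; apply: le_trans H; exact: N2_ge0. Qed.

Lemma tn_le n (X : 'M[C]_n) e e' : e <= e' -> tn X e -> tn X e'.
Proof.
move=> h [k [v [w [HX Hv Hw]]]]; exists k, v, w; split=> //; exact: le_trans h.
Qed.

Lemma tn0 n : tn (0 : 'M[C]_n) 0.
Proof. by exists n, 0, 0; rewrite mul0mx N2_0. Qed.

Lemma tnD n (X Y : 'M[C]_n) e f : tn X e -> tn Y f -> tn (X + Y) (e + f).
Proof.
move=> [k [v [w [-> Hv Hw]]]] [k' [v' [w' [-> Hv' Hw']]]].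
exists (k + k')%N, (row_mx v v'), (row_mx w w'); split.
- by rewrite dag_row mul_row_col.
- by rewrite N2_row lerD.
- by rewrite N2_row lerD.
Qed.

Lemma tnN n (X : 'M[C]_n) e : tn X e -> tn (- X) e.
Proof.
move=> [k [v [w [-> Hv Hw]]]]; exists k, (- v), w; split; rewrite ?N2N //.
by rewrite mulNmx.
Qed.

Lemma tnB n (X Y : 'M[C]_n) e f : tn X e -> tn Y f -> tn (X - Y) (e + f).
Proof. by move=> hX hY; apply: tnD => //; exact: tnN. Qed.

Lemma tnBC n (X Y : 'M[C]_n) e : tn (X - Y) e -> tn (Y - X) e.
Proof. by move=> /tnN; rewrite opprB. Qed.

Lemma tn_trans n (X Y Z : 'M[C]_n) e f :
  tn (X - Y) e -> tn (Y - Z) f -> tn (X - Z) (e + f).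
Proof. by move=> h1 h2; rewrite -(subrKA Y); exact: tnD. Qed.

Lemma tnZ n (X : 'M[C]_n) e (a : R) : 0 <= a -> tn X e -> tn (a%:C *: X) (a * e).
Proof.
move=> ha [k [v [w [-> Hv Hw]]]].
have hs : sqn (Num.sqrt a)%:C = a by rewrite sqnC sqr_sqrtr.
exists k, ((Num.sqrt a)%:C *: v), ((Num.sqrt a)%:C *: w); split.
- rewrite dagZ -scalemxAl -scalemxAr scalerA conjc_real -rmorphM /=.
  by rewrite -expr2 sqr_sqrtr.
- by rewrite N2Z hs ler_wpM2l.
- by rewrite N2Z hs ler_wpM2l.
Qed.

Lemma tn_sum (I : Type) (r : seq I) (P : pred I) n (F : I -> 'M[C]_n) (e : I -> R) :
  (forall i, P i -> tn (F i) (e i)) ->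
  tn (\sum_(i <- r | P i) F i) (\sum_(i <- r | P i) e i).
Proof.
move=> H; elim/big_rec2: _ => [|i x y Pi IH]; first exact: tn0.
by apply: tnD => //; exact: H.
Qed.

Lemma tn_isom m n (V : 'M[C]_(m,n)) (X : 'M[C]_n) e :
  dag V *m V = 1%:M -> tn X e -> tn (V *m X *m dag V) e.
Proof.
move=> HV [k [v [w [-> Hv Hw]]]]; exists k, (V *m v), (V *m w).
by rewrite !N2_isom //; split=> //; rewrite dag_mul !mulmxA.
Qed.

(** The difference splits as [v *m dag (v - w)] plus the adjoint of [w *m dag (v - w)], and each
    term is a product of a vector of norm at most 1 with one of norm at most [d]. *)
Lemma tn_diff n k (v w : 'M[C]_(n,k)) (d : R) :
  0 <= d -> N2 v <= 1 -> N2 w <= 1 -> N2 (v - w) <= d ^+ 2 ->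
  tn (v *m dag v - w *m dag w) (2 * d).
Proof.
move=> d0 Hv Hw Hd.
(* Multiplying [x] by the square root of [d] and dividing [y] by it balances the factors at squared
   norm at most [d]; for [d = 0] the second factor vanishes. *)
have K (x y : 'M[C]_(n,k)) : N2 x <= 1 -> N2 y <= d ^+ 2 -> tn (x *m dag y) d.
  move=> hx hy; case: (eqVneq d 0) => [d0'|dn0].
    have y0 : N2 y = 0 by apply/eqP; rewrite eq_le N2_ge0 andbT (le_trans hy) // d0' expr0n.
    suff -> : y = 0 by rewrite dag0 mulmx0 d0'; exact: tn0.
    apply/matrixP => i j; rewrite mxE; apply/eqP; rewrite -sqn_eq0.
    move/eqP: y0; rewrite psumr_eq0; last by move=> *; apply: sumr_ge0 => *; exact: sqn_ge0.
    move=> /allP /(_ i); rewrite mem_index_enum => /(_ isT) /=.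
    rewrite psumr_eq0; last by move=> *; exact: sqn_ge0.
    by move=> /allP /(_ j); rewrite mem_index_enum => /(_ isT).
  have dp : 0 < d by rewrite lt0r dn0.
  exists k, ((Num.sqrt d)%:C *: x), ((Num.sqrt d)^-1%:C *: y); split.
  - rewrite dagZ -scalemxAl -scalemxAr scalerA conjc_real -rmorphM /=.
    by rewrite divff ?scale1r // sqrtr_eq0 -ltNge.
  - by rewrite N2Z sqnC sqr_sqrtr // -[leRHS]mulr1 ler_wpM2l.
  - rewrite N2Z sqnC exprVn sqr_sqrtr // mulrC ler_pdivrMr //.
have -> : v *m dag v - w *m dag w = v *m dag (v - w) + dag (w *m dag (v - w)).
  by rewrite dag_mul dagK dagB mulmxBr mulmxBl subrKA.
have -> : 2 * d = d + d by ring.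
apply: tnD; first exact: K.
rewrite dag_mul dagK.
have [k' [a [b [E Ha Hb]]]] := K _ _ Hw Hd.
exists k', b, a; split=> //.
by rewrite -[LHS]dagK dag_mul dagK E dag_mul dagK.
Qed.

(** Positivity is recorded as the existence of an amplitude; [dens_density] and [density_dens]
    identify this with [density]. *)
Definition dens n (X : 'M[C]_n) : Prop :=
  (exists k, exists w : 'M[C]_(n,k), X = w *m dag w) /\ \tr X = 1.

End Basics.
Arguments tn {R n}. Arguments dens {R n}. Arguments N2 {R m n}.

(** * Operators indexed by finite types: Kraus maps, tensor products, partial traces *)

Section FinOp.
Variable R : realType.
Local Notation C := R[i].
Local Notation op T U := 'M[C]_(#|{: T}|, #|{: U}|).

Lemma conjc_natr n : conjc (n%:R : C) = n%:R.
Proof. exact: rmorph_nat. Qed.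

Lemma sum_rank (V : nmodType) (T : finType) (F : 'I_#|T| -> V) :
  \sum_i F i = \sum_(x : T) F (enum_rank x).
Proof. by apply: reindex; exists enum_val => x _; rewrite ?enum_rankK ?enum_valK. Qed.

(** Matrices are addressed by elements of finite types through [enum_val], so that a tensor product
    lives on a product type and a tensor power on a function type, without index arithmetic. *)
Definition mk (T U : finType) (f : T -> U -> C) : op T U :=
  \matrix_(i, j) f (enum_val i) (enum_val j).
Definition en (T U : finType) (A : op T U) (x : T) (y : U) : C :=
  A (enum_rank x) (enum_rank y).

Lemma en_mk (T U : finType) (f : T -> U -> C) x y : en (mk f) x y = f x y.
Proof. by rewrite /en mxE !enum_rankK. Qed.

Lemma enP (T U : finType) (A B : op T U) : (forall x y, en A x y = en B x y) -> A = B.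
Proof.
move=> H; apply/matrixP => i j; have := H (enum_val i) (enum_val j).
by rewrite /en !enum_valK.
Qed.

Lemma en_mul (T U V : finType) (A : op T U) (B : op U V) x y :
  en (A *m B) x y = \sum_z en A x z * en B z y.
Proof. by rewrite /en mxE sum_rank. Qed.

Lemma en_dag (T U : finType) (A : op T U) x y : en (dag A) x y = conjc (en A y x).
Proof. by rewrite /en mxE. Qed.
Lemma en_add (T U : finType) (A B : op T U) x y : en (A + B) x y = en A x y + en B x y.
Proof. by rewrite /en mxE. Qed.
Lemma en_opp (T U : finType) (A : op T U) x y : en (- A) x y = - en A x y.
Proof. by rewrite /en mxE. Qed.
Lemma en_sub (T U : finType) (A B : op T U) x y : en (A - B) x y = en A x y - en B x y.
Proof. by rewrite /en !mxE. Qed.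
Lemma en_scale (T U : finType) a (A : op T U) x y : en (a *: A) x y = a * en A x y.
Proof. by rewrite /en mxE. Qed.
Lemma en_sum (T U : finType) (I : Type) (r : seq I) (P : pred I) (F : I -> op T U) x y :
  en (\sum_(i <- r | P i) F i) x y = \sum_(i <- r | P i) en (F i) x y.
Proof. by rewrite /en summxE. Qed.
Lemma en1 (T : finType) (x y : T) : en (1%:M : op T T) x y = (x == y)%:R.
Proof. by rewrite /en mxE (inj_eq enum_rank_inj). Qed.
Lemma en_0 (T U : finType) (x : T) (y : U) : en (0 : op T U) x y = 0.
Proof. by rewrite /en mxE. Qed.
Lemma tr_en (T : finType) (A : op T T) : \tr A = \sum_x en A x x.
Proof. by rewrite /mxtrace sum_rank. Qed.
Lemma N2_en (T U : finType) (A : op T U) : N2 A = \sum_x \sum_y sqn (en A x y).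
Proof. by rewrite /N2 sum_rank; apply: eq_bigr => x _; rewrite sum_rank. Qed.

Lemma kraus_N2 m n k (A : finType) (K : A -> 'M[C]_(m,n)) (v : 'M[C]_(n,k)) :
  \sum_a dag (K a) *m K a = 1%:M -> \sum_a N2 (K a *m v) = N2 v.
Proof.
move=> H; apply: rcI; rewrite rc_sum -N2E.
have -> : dag v *m v = \sum_a dag (K a *m v) *m (K a *m v).
  rewrite -[v in X in _ *m X]mul1mx -H mulmx_suml mulmx_sumr.
  by apply: eq_bigr => a _; rewrite dag_mul !mulmxA.
by rewrite raddf_sum /=; apply: eq_bigr => a _; rewrite -N2E.
Qed.

(** Stinespring dilation on amplitudes: the matrices [K a *m v] are placed side by side. A Kraus map
    thus acts on a factorization [v *m dag w] without changing norms, which makes it a trace-norm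
    contraction preserving states. *)
Definition kraus_amp m n k (A : finType) (K : A -> 'M[C]_(m,n)) (v : 'M[C]_(n,k)) :
  'M[C]_(m, #|{: A * 'I_k}|) :=
  \matrix_(i, j) (K (enum_val j).1 *m v) i (enum_val j).2.

Lemma kraus_ampM m n k (A : finType) (K : A -> 'M[C]_(m,n)) (v w : 'M[C]_(n,k)) :
  kraus_amp K v *m dag (kraus_amp K w) = \sum_a K a *m (v *m dag w) *m dag (K a).
Proof.
apply/matrixP => i j; rewrite mxE sum_rank summxE.
under eq_bigr => p _ do rewrite !mxE !enum_rankK.
rewrite -(pair_bigA _ (fun a l => (\sum_(j0 < n) K a i j0 * v j0 l) *
   (\sum_(j0 < n) K a j j0 * w j0 l)^*)) /=.
apply: eq_bigr => a _.
have -> : K a *m (v *m dag w) *m dag (K a) = (K a *m v) *m dag (K a *m w).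
  by rewrite dag_mul !mulmxA.
by rewrite mxE; apply: eq_bigr => l _; rewrite !mxE.
Qed.

Lemma kraus_ampN2 m n k (A : finType) (K : A -> 'M[C]_(m,n)) (v : 'M[C]_(n,k)) :
  \sum_a dag (K a) *m K a = 1%:M -> N2 (kraus_amp K v) = N2 v.
Proof.
move=> H; rewrite -(kraus_N2 v H) /N2.
rewrite [RHS]exchange_big /=; apply: eq_bigr => i _.
rewrite sum_rank pair_bigA /=; apply: eq_bigr => p _.
by rewrite /kraus_amp [in LHS]mxE enum_rankK.
Qed.

Definition krausmap m n (A : finType) (K : A -> 'M[C]_(m,n)) (X : 'M[C]_n) : 'M[C]_m :=
  \sum_a K a *m X *m dag (K a).

Lemma kraus_tn m n (A : finType) (K : A -> 'M[C]_(m,n)) X e :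
  \sum_a dag (K a) *m K a = 1%:M -> tn X e -> tn (krausmap K X) e.
Proof.
move=> H [k [v [w [-> Hv Hw]]]]; exists #|{: A * 'I_k}|, (kraus_amp K v), (kraus_amp K w).
by rewrite !kraus_ampN2 // kraus_ampM.
Qed.

Lemma kraus_tr m n (A : finType) (K : A -> 'M[C]_(m,n)) X :
  \sum_a dag (K a) *m K a = 1%:M -> \tr (krausmap K X) = \tr X.
Proof.
move=> H; rewrite -[X in RHS]mul1mx -H mulmx_suml !raddf_sum /=.
by apply: eq_bigr => a _; rewrite mxtrace_mulC mulmxA.
Qed.

Lemma kraus_dens m n (A : finType) (K : A -> 'M[C]_(m,n)) X :
  \sum_a dag (K a) *m K a = 1%:M -> dens X -> dens (krausmap K X).
Proof.
move=> H [[k [w E]] T]; split; last by rewrite kraus_tr.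
exists #|{: A * 'I_k}|, (kraus_amp K w); by rewrite kraus_ampM E.
Qed.

Lemma krausB m n (A : finType) (K : A -> 'M[C]_(m,n)) X Y :
  krausmap K (X - Y) = krausmap K X - krausmap K Y.
Proof. by rewrite /krausmap -sumrB; apply: eq_bigr => a _; rewrite mulmxBr mulmxBl. Qed.

Definition tens (T T' U U' : finType) (A : op T T') (B : op U U') : op (T * U) (T' * U') :=
  mk (fun p q => en A p.1 q.1 * en B p.2 q.2).

Lemma en_tens (T T' U U' : finType) (A : op T T') (B : op U U') p q :
  en (tens A B) p q = en A p.1 q.1 * en B p.2 q.2.
Proof. exact: en_mk. Qed.

Lemma tens_mul (T T' T'' U U' U'' : finType) (A : op T T') (B : op U U')
    (A' : op T' T'') (B' : op U' U'') :
  tens A B *m tens A' B' = tens (A *m A') (B *m B').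
Proof.
apply: enP => x y; rewrite en_mul en_tens !en_mul mulr_suml.
under [RHS]eq_bigr => z _ do rewrite mulr_sumr.
rewrite pair_bigA; apply: eq_bigr => z _ /=.
by rewrite !en_tens mulrACA.
Qed.

Lemma tens_dag (T T' U U' : finType) (A : op T T') (B : op U U') :
  dag (tens A B) = tens (dag A) (dag B).
Proof. by apply: enP => x y; rewrite en_dag !en_tens !en_dag rmorphM. Qed.

Lemma tens11 (T U : finType) : tens (1%:M : op T T) (1%:M : op U U) = 1%:M.
Proof.
by apply: enP => -[x u] [y v]; rewrite en_tens !en1 /= xpair_eqE -natrM mulnb.
Qed.

Lemma tensDl (T T' U U' : finType) (A A' : op T T') (B : op U U') :
  tens (A + A') B = tens A B + tens A' B.
Proof. by apply: enP => x y; rewrite en_add !en_tens en_add mulrDl. Qed.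
Lemma tensDr (T T' U U' : finType) (A : op T T') (B B' : op U U') :
  tens A (B + B') = tens A B + tens A B'.
Proof. by apply: enP => x y; rewrite en_add !en_tens en_add mulrDr. Qed.
Lemma tensBl (T T' U U' : finType) (A A' : op T T') (B : op U U') :
  tens (A - A') B = tens A B - tens A' B.
Proof. by apply: enP => x y; rewrite en_sub !en_tens en_sub mulrBl. Qed.
Lemma tensBr (T T' U U' : finType) (A : op T T') (B B' : op U U') :
  tens A (B - B') = tens A B - tens A B'.
Proof. by apply: enP => x y; rewrite en_sub !en_tens en_sub mulrBr. Qed.
Lemma tensZl (T T' U U' : finType) a (A : op T T') (B : op U U') :
  tens (a *: A) B = a *: tens A B.
Proof. by apply: enP => x y; rewrite en_scale !en_tens en_scale mulrA. Qed.
Lemma tensZr (T T' U U' : finType) a (A : op T T') (B : op U U') :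
  tens A (a *: B) = a *: tens A B.
Proof. by apply: enP => x y; rewrite en_scale !en_tens en_scale mulrCA. Qed.
Lemma tens_suml (T T' U U' : finType) (I : finType) (A : I -> op T T') (B : op U U') :
  tens (\sum_i A i) B = \sum_i tens (A i) B.
Proof.
apply: enP => x y; rewrite en_sum en_tens en_sum mulr_suml.
by apply: eq_bigr => i _; rewrite en_tens.
Qed.
Lemma tens0l (T T' U U' : finType) (B : op U U') : tens (0 : op T T') B = 0.
Proof. by apply: enP => x y; rewrite en_tens !en_0 mul0r. Qed.

Lemma tens_tr (T U : finType) (A : op T T) (B : op U U) : \tr (tens A B) = \tr A * \tr B.
Proof.
rewrite !tr_en mulr_suml; under [RHS]eq_bigr => z _ do rewrite mulr_sumr.
by rewrite pair_bigA; apply: eq_bigr => z _; rewrite en_tens.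
Qed.

Lemma N2_tens (T T' U U' : finType) (A : op T T') (B : op U U') :
  N2 (tens A B) = N2 A * N2 B.
Proof. by apply: rcI; rewrite rmorphM /= -!N2E tens_dag tens_mul tens_tr. Qed.

Definition pt1 (T U : finType) (X : op (T * U) (T * U)) : op U U :=
  mk (fun u v => \sum_x en X (x, u) (x, v)).
Definition pt2 (T U : finType) (X : op (T * U) (T * U)) : op T T :=
  mk (fun x y => \sum_u en X (x, u) (y, u)).

(** The bra at [u] on the second factor. Writing partial traces as Kraus maps of such bras lets them
    inherit contractivity and preservation of states. *)
Definition pt2K (T U : finType) (u : U) : op T (T * U) :=
  mk (fun x p => ((x == p.1) && (u == p.2))%:R).
Definition pt1K (T U : finType) (x : T) : op U (T * U) :=
  mk (fun u p => ((x == p.1) && (u == p.2))%:R).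

Lemma sum_pick (T : finType) (x : T) (F : T -> C) :
  \sum_y (x == y)%:R * F y = F x.
Proof.
rewrite (bigD1 x) //= eqxx mul1r big1 ?addr0 // => y ny.
by rewrite eq_sym (negbTE ny) mul0r.
Qed.

Lemma sum_pickr (T : finType) (x : T) (F : T -> C) :
  \sum_y F y * (x == y)%:R = F x.
Proof. by rewrite -[RHS]sum_pick; apply: eq_bigr => y _; rewrite mulrC. Qed.

Lemma pt2KE (T U : finType) (X : op (T * U) (T * U)) : krausmap (@pt2K T U) X = pt2 X.
Proof.
apply: enP => x y; rewrite en_sum en_mk; apply: eq_bigr => u _.
rewrite en_mul.
under eq_bigr => p _ do rewrite en_mul en_dag !en_mk conjc_natr -xpair_eqE -surjective_pairing.
by rewrite sum_pickr; under eq_bigr => p _ do rewrite en_mk -xpair_eqE -surjective_pairing;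
  rewrite sum_pick.
Qed.

Lemma pt1KE (T U : finType) (X : op (T * U) (T * U)) : krausmap (@pt1K T U) X = pt1 X.
Proof.
apply: enP => x y; rewrite en_sum en_mk; apply: eq_bigr => u _.
rewrite en_mul.
under eq_bigr => p _ do rewrite en_mul en_dag !en_mk conjc_natr -xpair_eqE -surjective_pairing.
by rewrite sum_pickr; under eq_bigr => p _ do rewrite en_mk -xpair_eqE -surjective_pairing;
  rewrite sum_pick.
Qed.

Lemma pt2K1 (T U : finType) : \sum_u dag (@pt2K T U u) *m @pt2K T U u = 1%:M.
Proof.
apply: enP => -[x u] [y v]; rewrite en_sum en1 xpair_eqE (bigD1 u) //= big1 => [|w nw].
  rewrite addr0 en_mul (bigD1 x) //= big1 => [|z nz].
    by rewrite addr0 en_dag !en_mk conjc_natr !eqxx mul1r.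
  by rewrite en_dag !en_mk conjc_natr /= (negbTE nz) mul0r.
rewrite en_mul big1 // => z _.
by rewrite en_dag !en_mk conjc_natr /= (negbTE nw) andbF mul0r.
Qed.

Lemma pt1K1 (T U : finType) : \sum_u dag (@pt1K T U u) *m @pt1K T U u = 1%:M.
Proof.
apply: enP => -[x u] [y v]; rewrite en_sum en1 xpair_eqE (bigD1 x) //= big1 => [|w nw].
  rewrite addr0 en_mul (bigD1 u) //= big1 => [|z nz].
    by rewrite addr0 en_dag !en_mk conjc_natr !eqxx mul1r.
  by rewrite en_dag !en_mk conjc_natr /= (negbTE nz) andbF mul0r.
rewrite en_mul big1 // => z _.
by rewrite en_dag !en_mk conjc_natr /= (negbTE nw) mul0r.
Qed.

Lemma tn_pt1 (T U : finType) (X : op (T * U) (T * U)) e : tn X e -> tn (pt1 X) e.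
Proof. by rewrite -pt1KE; apply: kraus_tn; exact: pt1K1. Qed.
Lemma tn_pt2 (T U : finType) (X : op (T * U) (T * U)) e : tn X e -> tn (pt2 X) e.
Proof. by rewrite -pt2KE; apply: kraus_tn; exact: pt2K1. Qed.
Lemma dens_pt1 (T U : finType) (X : op (T * U) (T * U)) : dens X -> dens (pt1 X).
Proof. by rewrite -pt1KE; apply: kraus_dens; exact: pt1K1. Qed.
Lemma dens_pt2 (T U : finType) (X : op (T * U) (T * U)) : dens X -> dens (pt2 X).
Proof. by rewrite -pt2KE; apply: kraus_dens; exact: pt2K1. Qed.
Lemma tr_pt1 (T U : finType) (X : op (T * U) (T * U)) : \tr (pt1 X) = \tr X.
Proof. by rewrite -pt1KE; apply: kraus_tr; exact: pt1K1. Qed.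
Lemma tr_pt2 (T U : finType) (X : op (T * U) (T * U)) : \tr (pt2 X) = \tr X.
Proof. by rewrite -pt2KE; apply: kraus_tr; exact: pt2K1. Qed.
Lemma pt1B (T U : finType) (X Y : op (T * U) (T * U)) : pt1 (X - Y) = pt1 X - pt1 Y.
Proof. by rewrite -!pt1KE krausB. Qed.
Lemma pt2B (T U : finType) (X Y : op (T * U) (T * U)) : pt2 (X - Y) = pt2 X - pt2 Y.
Proof. by rewrite -!pt2KE krausB. Qed.

Lemma pt1_tens (T U : finType) (A : op T T) (B : op U U) : pt1 (tens A B) = \tr A *: B.
Proof.
apply: enP => x y; rewrite en_mk en_scale tr_en mulr_suml.
by apply: eq_bigr => z _; rewrite en_tens.
Qed.
Lemma pt2_tens (T U : finType) (A : op T T) (B : op U U) : pt2 (tens A B) = \tr B *: A.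
Proof.
apply: enP => x y; rewrite en_mk en_scale tr_en mulr_suml.
by apply: eq_bigr => z _; rewrite en_tens mulrC.
Qed.

Lemma dens_isom m n (V : 'M[C]_(m,n)) (X : 'M[C]_n) :
  dag V *m V = 1%:M -> dens X -> dens (V *m X *m dag V).
Proof.
move=> HV [[k [w ->]] T]; split.
  by exists k, (V *m w); rewrite dag_mul !mulmxA.
by rewrite mxtrace_mulC !mulmxA HV mul1mx.
Qed.

Lemma dens_en (T : finType) (X : op T T) :
  dens X -> exists U : finType, exists w : op T U, X = w *m dag w.
Proof.
move=> [[k [w ->]] _]; exists 'I_k.
exists (mk (fun x j => w (enum_rank x) j)); apply: enP => x y.
rewrite /en !mxE sum_rank; apply: eq_bigr => l _.
by rewrite !mxE !enum_rankK ?enum_valK.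
Qed.

Lemma dens_N2 n k (w : 'M[C]_(n,k)) : \tr (w *m dag w) = 1 -> N2 w = 1.
Proof. by rewrite N2E' => /(congr1 (@complex.Re R)). Qed.

Lemma dens_tens (T U : finType) (A : op T T) (B : op U U) :
  dens A -> dens B -> dens (tens A B).
Proof.
move=> dA dB; have [V [v Ev]] := dens_en dA; have [W [w Ew]] := dens_en dB.
split; last by rewrite tens_tr (proj2 dA) (proj2 dB) mulr1.
exists #|{: V * W}|, (tens v w); by rewrite tens_dag tens_mul Ev Ew.
Qed.

Lemma tn_en (T : finType) (X : op T T) e :
  tn X e -> exists U : finType, exists v w : op T U,
    [/\ X = v *m dag w, N2 v <= e & N2 w <= e].
Proof.
move=> [k [v [w [-> Hv Hw]]]]; exists 'I_k.
exists (mk (fun x j => v (enum_rank x) j)), (mk (fun x j => w (enum_rank x) j)).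
have K (u : 'M[C]_(#|{: T}|, k)) :
    N2 (mk (fun x j => u (enum_rank x) j)) = N2 u.
  rewrite N2_en /N2 sum_rank; apply: eq_bigr => x _; apply: eq_bigr => j _.
  by rewrite en_mk.
rewrite !K; split=> //.
apply: enP => x y; rewrite /en !mxE sum_rank; apply: eq_bigr => l _.
by rewrite !mxE !enum_rankK ?enum_valK.
Qed.

Lemma tn_tensr (T U : finType) (X : op T T) (B : op U U) e :
  dens B -> tn X e -> tn (tens X B) e.
Proof.
move=> dB /tn_en [V [v [w [-> Hv Hw]]]]; have [W [u Eu]] := dens_en dB.
have u1 : N2 u = 1 by apply: dens_N2; rewrite -Eu (proj2 dB).
exists #|{: V * W}|, (tens v u), (tens w u).
by rewrite !N2_tens u1 !mulr1 tens_dag tens_mul Eu.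
Qed.
Lemma tn_tensl (T U : finType) (X : op T T) (B : op U U) e :
  dens B -> tn X e -> tn (tens B X) e.
Proof.
move=> dB /tn_en [V [v [w [-> Hv Hw]]]]; have [W [u Eu]] := dens_en dB.
have u1 : N2 u = 1 by apply: dens_N2; rewrite -Eu (proj2 dB).
exists #|{: W * V}|, (tens u v), (tens u w).
by rewrite !N2_tens u1 !mul1r tens_dag tens_mul Eu.
Qed.

Lemma dens_mix n (I : finType) (p : I -> R) (X : I -> 'M[C]_n) :
  (forall i, 0 <= p i) -> \sum_i p i = 1 -> (forall i, dens (X i)) ->
  dens (\sum_i (p i)%:C *: X i).
Proof.
move=> p0 p1 H; split; last first.
  rewrite raddf_sum /= -[RHS](rmorph1 (real_complex R)) -p1 rmorph_sum.
  by apply: eq_bigr => i _; rewrite mxtraceZ (proj2 (H i)) mulr1.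
have {}H i : exists kw : {k & 'M[C]_(n,k)}, X i = projT2 kw *m dag (projT2 kw).
  by have [[k [w E]] _] := H i; exists (existT _ k w).
pose P (Y : 'M[C]_n) := exists k, exists w : 'M[C]_(n,k), Y = w *m dag w.
suff : P (\sum_i (p i)%:C *: X i) by [].
apply: (big_ind P).
- by exists 0, 0; rewrite mul0mx.
- move=> A B [k [w ->]] [l [v ->]]; exists (k + l)%N, (row_mx w v).
  by rewrite dag_row mul_row_col.
- move=> i _; have [[k w] /= ->] := H i; exists k, ((Num.sqrt (p i))%:C *: w).
  rewrite dagZ -scalemxAl -scalemxAr scalerA conjc_real -rmorphM /=.
  by rewrite -expr2 sqr_sqrtr.
Qed.

End FinOp.

(** * Joint diagonalization, and completion of partial isometries to unitaries *)

Section Spec.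
Variable R : realType.
Local Notation C := R[i].
Local Notation op T U := 'M[C]_(#|{: T}|, #|{: U}|).

Lemma dag_trmxC m n (A : 'M[C]_(m,n)) : (A ^t Num.conj)%sesqui = dag A.
Proof. by apply/matrixP => i j; rewrite !mxE. Qed.

Lemma unitarymx_dag m n (U : 'M[C]_(m, n)) : U \is unitarymx -> U *m dag U = 1%:M.
Proof. by move=> /unitarymxP; rewrite dag_trmxC. Qed.

Lemma unitarymx_dag' n (U : 'M[C]_n) : U \is unitarymx -> dag U *m U = 1%:M.
Proof. by move=> /unitarymx_dag /mulmx1C. Qed.

Lemma spectral_dagE n (A : 'M[C]_n) : A *m dag A = dag A *m A ->
  A = dag (spectralmx A) *m diag_mx (spectral_diag A) *m spectralmx A.
Proof.
move=> HA; have : A \is normalmx by apply/normalmxP; rewrite dag_trmxC.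
move=> /orthomx_spectralP E.
have := invmx_unitary (spectral_unitarymx A); rewrite dag_trmxC => <-.
exact: E.
Qed.

(* A commuting pair A, B of Hermitian matrices is diagonalised at once through
   the normal matrix A + iB; here B is a numbering of the classes of kappa. *)
Lemma spectral_class n (K : eqType) (kappa : 'I_n -> K) (A : 'M[C]_n) :
  dag A = A -> (forall i j, A i j != 0 -> kappa i = kappa j) ->
  exists (U : 'M[C]_n) (d : 'I_n -> R) (c : 'I_n -> K),
    [/\ dag U *m U = 1%:M, A = dag U *m diag_mx (\row_k (d k)%:C) *m U &
        forall k i, U k i != 0 -> kappa i = c k].
Proof.
move=> Ah Hk.
pose code i : R := (index (kappa i) [seq kappa j | j : 'I_n])%:R.
pose B : 'M[C]_n := diag_mx (\row_i (code i)%:C).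
have codeI i j : code i = code j -> kappa i = kappa j.
  move=> /eqP; rewrite eqr_nat => /eqP h.
  by rewrite -[LHS](nth_index (kappa i) (image_f kappa (_ : i \in predT))) // h nth_index // image_f.
have Bh : dag B = B.
  apply/matrixP => i j; rewrite !mxE eq_sym.
  by case: eqVneq => [->|_]; rewrite ?mulr1n ?mulr0n ?conjc_real ?conjc0.
have AB : A *m B = B *m A.
  apply/matrixP => i j; rewrite mul_mx_diag mul_diag_mx !mxE.
  have [->|/Hk h] := eqVneq (A i j) 0; first by rewrite mul0r mulr0.
  by rewrite mulrC /code h.
pose M := A + 'i%C *: B.
have Mh : dag M = A - 'i%C *: B.
  rewrite dagD dagZ Ah Bh -scaleNr; congr (_ + _ *: _).
  by rewrite /=; congr (_ +i* _); rewrite oppr0.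
have Mn : M *m dag M = dag M *m M.
  rewrite Mh mulmxBl mulmxBr /M !mulmxDl !mulmxDr -!scalemxAl -!scalemxAr AB.
  by rewrite !opprD !addrA; congr (_ - _); rewrite addrAC.
have HM := spectral_dagE Mn.
set U := spectralmx M in HM; set D := spectral_diag M in HM.
have UU : dag U *m U = 1%:M by apply: unitarymx_dag'; exact: spectral_unitarymx.
have UU' : U *m dag U = 1%:M by apply: unitarymx_dag; exact: spectral_unitarymx.
clearbody U D.
have dM : dag M = dag U *m diag_mx (\row_k conjc (D 0 k)) *m U.
  rewrite HM !dag_mul dagK -mulmxA; congr (_ *m (_ *m _)).
  apply/matrixP => i j; rewrite !mxE eq_sym.
  by case: eqVneq => [->|_]; rewrite ?mulr1n ?mulr0n ?conjc0.
have two : (2%:R : C) != 0 by rewrite pnatr_eq0.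
have HA : A = dag U *m diag_mx (\row_k (complex.Re (D 0 k))%:C) *m U.
  have -> : A = 2%:R^-1 *: (M + dag M).
    rewrite Mh /M addrACA subrr addr0.
    have -> : A + A = (2%:R : C) *: A by rewrite scaler_nat mulr2n.
    by rewrite scalerA mulVf // scale1r.
  rewrite dM {1}HM -mulmxDl -mulmxDr -raddfD /= scalemxAl scalemxAr -linearZ /=.
  congr (_ *m diag_mx _ *m _); apply/rowP => k; rewrite !mxE.
  apply: (mulfI two); rewrite mulrA divff // mul1r.
  by case: (D 0 k) => a b; simpc; rewrite /=; congr (_ +i* _); ring.
have HB : B = dag U *m diag_mx (\row_k (complex.Im (D 0 k))%:C) *m U.
  have i0 : ('i%C : C) != 0 by rewrite -sqn_eq0 /sqn /= expr0n expr1n add0r oner_eq0.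
  have -> : B = (2%:R * 'i%C)^-1 *: (M - dag M).
    rewrite Mh /M opprB addrC addrA subrK.
    have -> : 'i%C *: B + 'i%C *: B = (2%:R : C) *: ('i%C *: B) by rewrite scaler_nat mulr2n.
    rewrite !scalerA mulVf ?scale1r // mulf_neq0 //.
  rewrite dM {1}HM -mulmxBl -mulmxBr -raddfB /= scalemxAl scalemxAr -linearZ /=.
  congr (_ *m diag_mx _ *m _); apply/rowP => k; rewrite !mxE.
  apply: (mulfI (mulf_neq0 two i0)); rewrite mulrA divff ?mulf_neq0 // mul1r.
  by case: (D 0 k) => a b; simpc; rewrite /=; congr (_ +i* _); ring.
have UB k i : U k i * (code i)%:C = (complex.Im (D 0 k))%:C * U k i.
  have : U *m B = diag_mx (\row_k (complex.Im (D 0 k))%:C) *m U.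
    by rewrite HB !mulmxA UU' mul1mx.
  by rewrite mul_mx_diag mul_diag_mx => /matrixP /(_ k i); rewrite !mxE.
have HU k : exists i, U k i != 0.
  apply/existsP; rewrite -negb_forall; apply/negP => /forallP H.
  have := UU' => /matrixP /(_ k k); rewrite !mxE eqxx big1 => [/eqP|i _].
    by rewrite eq_sym oner_eq0.
  by rewrite (eqP (H i)) mul0r.
exists U, (fun k => complex.Re (D 0 k)), (fun k => kappa (xchoose (HU k))); split=> //.
move=> k i Uki; have Ukj := xchooseP (HU k); apply: codeI; apply: rcI.
have E1 := UB k i; have E2 := UB k (xchoose (HU k)).
apply: (mulfI Uki); rewrite E1 mulrC; congr (_ * _).
by apply: (mulfI Ukj); rewrite E2 mulrC.
Qed.

(* The characteristic function of V at a point z of the unit circle. *)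
Definition complet n (z : C) (V : 'M[C]_n) : 'M[C]_n :=
  V + z *: ((1%:M - V *m dag V) *m invmx (1%:M - z *: dag V) *m (1%:M - dag V *m V)).

(** Let [D], [D'] project onto the orthogonal complements of the initial and final spaces of [V],
    and let [T] be the inverse of [1 - z dag V] applied to [D]. The added piece is [z D' T],
    orthogonal to the range of [V] since [dag V D' = 0]. From [T = D + z dag V T] and [D T = D] one
    gets |D'T|^2 = |T|^2 - |dag V T|^2 = |T|^2 - |T - D|^2 = D. *)
Lemma complet_isom n (z : C) (V : 'M[C]_n) :
  V *m dag V *m V = V -> sqn z = 1 -> 1%:M - z *: dag V \in unitmx ->
  dag (complet z V) *m complet z V = 1%:M.
Proof.
move=> HV Hz Hu; set S := invmx (1%:M - z *: dag V).
set P := dag V *m V; set Q := V *m dag V.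
have HV' : dag V *m V *m dag V = dag V.
  by have := congr1 (@dag _ _ _) HV; rewrite !dag_mul dagK mulmxA.
have Pd : dag P = P by rewrite dag_mul dagK.
have Qd : dag Q = Q by rewrite dag_mul dagK.
have PP : P *m P = P by rewrite /P mulmxA HV'.
have QQ : Q *m Q = Q by rewrite /Q mulmxA HV.
have VQ : dag V *m (1%:M - Q) = 0.
  by rewrite mulmxBr mulmx1 /Q mulmxA HV' subrr.
have DV : (1%:M - P) *m dag V = 0 by rewrite mulmxBl mul1mx HV' subrr.
have DD : (1%:M - P) *m (1%:M - P) = 1%:M - P.
  by rewrite mulmxBl mulmxBr mulmx1 mul1mx mulmxBr mulmx1 PP subrr subr0.
have Ed : dag (1%:M - P) = 1%:M - P by rewrite dagB dag1 Pd.
have Eq : dag (1%:M - Q) = 1%:M - Q by rewrite dagB dag1 Qd.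
have Q2 : (1%:M - Q) *m (1%:M - Q) = 1%:M - Q.
  by rewrite mulmxBl mulmxBr mulmx1 mul1mx mulmxBr mulmx1 QQ subrr subr0.
set D := 1%:M - P in DV DD Ed *; set D' := 1%:M - Q in VQ Eq Q2 *.
have DS : D *m S = D.
  have : D *m (1%:M - z *: dag V) = D.
    by rewrite mulmxBr mulmx1 -scalemxAr DV scaler0 subr0.
  by move=> {1}<-; rewrite mulmxK.
pose T := S *m D.
have ET : T = D + z *: (dag V *m T).
  have : (1%:M - z *: dag V) *m T = D by rewrite /T mulmxA mulmxV // mul1mx.
  by rewrite mulmxBl mul1mx -scalemxAl => <-; rewrite subrK.
have DT : D *m T = D by rewrite /T mulmxA DS DD.
have TD : dag T *m D = D by rewrite -[in LHS]Ed -dag_mul DT Ed.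
have EC : complet z V = V + z *: (D' *m T).
  by rewrite /complet -/S -/P -/Q -/D -/D' /T mulmxA.
rewrite {}EC.
have EP : 1%:M - D = dag V *m V by rewrite /D opprB addrC subrK.
have EQ : 1%:M - D' = V *m dag V by rewrite /D' opprB addrC subrK.
clearbody D D' T; clear S DS P Q Pd Qd PP QQ.
have c1 : dag V *m (z *: (D' *m T)) = 0 by rewrite -scalemxAr mulmxA VQ mul0mx scaler0.
have c2 : dag (z *: (D' *m T)) *m V = 0 by rewrite -[V in LHS]dagK -dag_mul c1 dag0.
have zz (Y : 'M[C]_n) : dag (z *: Y) *m (z *: Y) = dag Y *m Y.
  by rewrite dagZ -scalemxAl -scalemxAr scalerA sqnE Hz scale1r.
rewrite dagD mulmxDl !mulmxDr c1 c2 addr0 add0r zz dag_mul Eq.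
rewrite mulmxA -[dag T *m D' *m D']mulmxA Q2.
suff -> : dag T *m D' *m T = D by rewrite -EP subrK.
have : dag (z *: (dag V *m T)) *m (z *: (dag V *m T)) = dag T *m (1%:M - D') *m T.
  by rewrite zz dag_mul dagK EQ !mulmxA.
have -> : z *: (dag V *m T) = T - D by rewrite [X in _ = X - D]ET [D + _]addrC addrK.
rewrite dagB Ed mulmxBl !mulmxBr mulmx1 mulmxBl TD DT DD subrr subr0 => E.
have -> : dag T *m D' *m T = dag T *m T - (dag T *m T - dag T *m D' *m T).
  by rewrite opprB addrC subrK.
by rewrite -E opprB addrC subrK.
Qed.

Lemma complet_ext n (z : C) (V : 'M[C]_n) :
  V *m dag V *m V = V -> complet z V *m (dag V *m V) = V.
Proof.
move=> HV.
have HV' : dag V *m V *m (dag V *m V) = dag V *m V.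
  by rewrite -mulmxA (mulmxA V) HV.
have E0 : (1%:M - dag V *m V) *m (dag V *m V) = 0 by rewrite mulmxBl mul1mx HV' subrr.
rewrite /complet (mulmxDl V) (mulmxA V) HV -scalemxAl.
by rewrite -(mulmxA _ (1%:M - dag V *m V)) E0 mulmx0 scaler0 addr0.
Qed.

(** The completion is a rational expression in [V] and [dag V], hence commutes with all that
    commutes with both. Energy conservation and the mutual commutation of the frame unitaries both
    rest on this property of the chosen completion. *)
Lemma complet_comm n (z : C) (V H : 'M[C]_n) :
  V *m H = H *m V -> dag V *m H = H *m dag V -> 1%:M - z *: dag V \in unitmx ->
  complet z V *m H = H *m complet z V.
Proof.
move=> HV HV' Hu.
have HS : invmx (1%:M - z *: dag V) *m H = H *m invmx (1%:M - z *: dag V).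
  have E : H *m (1%:M - z *: dag V) = (1%:M - z *: dag V) *m H.
    by rewrite mulmxBl mulmxBr mul1mx mulmx1 -scalemxAl -scalemxAr HV'.
  move: (1%:M - _) Hu E => B Hu E.
  by rewrite -[LHS](mulmxK Hu) -(mulmxA (invmx B) H) E (mulmxA (invmx B)) mulVmx // mul1mx.
have E1 : (1%:M - dag V *m V) *m H = H *m (1%:M - dag V *m V).
  by rewrite mulmxBl mulmxBr mul1mx mulmx1 -mulmxA HV !mulmxA HV'.
have E2 : (1%:M - V *m dag V) *m H = H *m (1%:M - V *m dag V).
  by rewrite mulmxBl mulmxBr mul1mx mulmx1 -mulmxA HV' !mulmxA HV.
rewrite /complet (mulmxDl V) (mulmxDr H) HV; congr (_ + _).
rewrite -scalemxAl -scalemxAr; congr (_ *: _).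
move: (1%:M - dag V *m V) (1%:M - V *m dag V) (invmx _) E1 E2 HS => D D' S E1 E2 HS.
by rewrite -(mulmxA _ D H) E1 (mulmxA _ H D) -(mulmxA D' S H) HS (mulmxA D' H) E2 -!mulmxA.
Qed.

End Spec.

(** * Operators that shift the energy by a fixed amount *)

Section Raise.
Variable R : realType.
Local Notation C := R[i].
Local Notation op T U := 'M[C]_(#|{: T}|, #|{: U}|).

(** In terms of diagonal Hamiltonians this is the commutation relation [H A = A H + D A] ([raiseE]);
    shift zero is conservation of energy. *)
Definition raise (T U : finType) (hT : T -> R) (hU : U -> R) (D : R) (A : op T U) : Prop :=
  forall x y, en A x y != 0 -> hT x = hU y + D.

Lemma raise_mul (T U V : finType) (hT : T -> R) (hU : U -> R) (hV : V -> R) D D'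
  (A : op T U) (B : op U V) :
  raise hT hU D A -> raise hU hV D' B -> raise hT hV (D' + D) (A *m B).
Proof.
move=> HA HB x y; rewrite en_mul => n0.
have [z /andP[]] : exists z, (en A x z != 0) && (en B z y != 0).
  apply/existsP; apply: contraNT n0; rewrite negb_exists => /forallP H; apply/eqP.
  rewrite big1 // => z _; have := H z; rewrite negb_and !negbK.
  by case/orP => /eqP ->; rewrite ?mul0r ?mulr0.
by move=> /HA -> /HB ->; rewrite addrA.
Qed.

Lemma raise_dag (T U : finType) (hT : T -> R) (hU : U -> R) D (A : op T U) :
  raise hT hU D A -> raise hU hT (- D) (dag A).
Proof.
move=> HA x y; rewrite en_dag => n0; rewrite (HA y x) ?addrK //.
by apply: contra n0 => /eqP ->; rewrite conjc0.
Qed.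

Lemma raiseD (T U : finType) (hT : T -> R) (hU : U -> R) D (A B : op T U) :
  raise hT hU D A -> raise hT hU D B -> raise hT hU D (A + B).
Proof.
move=> HA HB x y; rewrite en_add.
have [->|/HA //] := eqVneq (en A x y) 0; rewrite add0r; exact: HB.
Qed.

Lemma raiseZ (T U : finType) (hT : T -> R) (hU : U -> R) D a (A : op T U) :
  raise hT hU D A -> raise hT hU D (a *: A).
Proof. by move=> HA x y; rewrite en_scale mulf_eq0 => /norP[_]; apply: HA. Qed.

Lemma raiseB (T U : finType) (hT : T -> R) (hU : U -> R) D (A B : op T U) :
  raise hT hU D A -> raise hT hU D B -> raise hT hU D (A - B).
Proof. by move=> HA HB; rewrite -scaleN1r; apply: raiseD => //; exact: raiseZ. Qed.

Lemma raise0 (T U : finType) (hT : T -> R) (hU : U -> R) D : raise hT hU D (0 : op T U).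
Proof. by move=> x y; rewrite en_0 eqxx. Qed.

Lemma raise_sum (T U : finType) (hT : T -> R) (hU : U -> R) D
  (I : Type) (r : seq I) (P : pred I) (F : I -> op T U) :
  (forall i, P i -> raise hT hU D (F i)) -> raise hT hU D (\sum_(i <- r | P i) F i).
Proof.
move=> H; elim/big_rec: _ => [|i A Pi HA]; first exact: raise0.
by apply: raiseD => //; exact: H.
Qed.

Lemma raise1 (T : finType) (h : T -> R) : raise h h 0 (1%:M : op T T).
Proof.
move=> x y; rewrite en1 addr0; case: (eqVneq x y) => [->//|_].
by rewrite eqxx.
Qed.

Definition hsum2 (T U : finType) (hT : T -> R) (hU : U -> R) (p : T * U) : R := hT p.1 + hU p.2.

Lemma raise_tens (T T' U U' : finType) (hT : T -> R) (hT' : T' -> R) (hU : U -> R)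
  (hU' : U' -> R) D D' (A : op T T') (B : op U U') :
  raise hT hT' D A -> raise hU hU' D' B ->
  raise (hsum2 hT hU) (hsum2 hT' hU') (D + D') (tens A B).
Proof.
move=> HA HB x y; rewrite en_tens mulf_eq0 => /norP[/HA a /HB b].
by rewrite /hsum2 a b addrACA.
Qed.

Definition econs (T : finType) (h : T -> R) (A : op T T) := raise h h 0 A.

Definition hdiag (T : finType) (h : T -> R) : op T T := mk (fun x y => if x == y then (h x)%:C else 0).

Lemma hdiagl (T U : finType) (h : T -> R) (A : op T U) x y : en (hdiag h *m A) x y = (h x)%:C * en A x y.
Proof.
rewrite en_mul (bigD1 x) //= en_mk eqxx big1 ?addr0 // => z nz.
by rewrite en_mk eq_sym (negbTE nz) mul0r.
Qed.
Lemma hdiagr (T U : finType) (h : U -> R) (A : op T U) x y : en (A *m hdiag h) x y = en A x y * (h y)%:C.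
Proof.
rewrite en_mul (bigD1 y) //= en_mk eqxx big1 ?addr0 // => z nz.
by rewrite en_mk (negbTE nz) mulr0.
Qed.
Lemma hdiag_dag (T : finType) (h : T -> R) : dag (hdiag h) = hdiag h.
Proof.
apply: enP => x y; rewrite en_dag !en_mk eq_sym.
by case: eqVneq => [->|_]; rewrite ?conjc_real ?conjc0.
Qed.

Lemma raiseE (T U : finType) (hT : T -> R) (hU : U -> R) D (A : op T U) :
  raise hT hU D A <-> hdiag hT *m A = A *m hdiag hU + D%:C *: A.
Proof.
split=> H.
  apply: enP => x y; rewrite en_add en_scale hdiagl hdiagr mulrC.
  have [->|/H ->] := eqVneq (en A x y) 0; first by rewrite mul0r mulr0 mul0r addr0.
  by rewrite rmorphD /= mulrDr; congr (_ + _); rewrite mulrC.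
move=> x y n0; apply: rcI; apply: (mulIf n0); rewrite -hdiagl H en_add en_scale hdiagr.
by rewrite rmorphD /= mulrDl; congr (_ + _); rewrite mulrC.
Qed.

Lemma econsE (T : finType) (h : T -> R) (A : op T T) :
  econs h A <-> A *m hdiag h = hdiag h *m A.
Proof.
rewrite /econs raiseE scale0r addr0; by split=> ->.
Qed.

(** The rational parametrization of the unit circle, used as an explicit infinite supply of
    unimodular numbers. *)
Definition unimod (k : nat) : C :=
  let d := (1 + k%:R ^+ 2 : R) in ((1 - k%:R ^+ 2) / d) +i* (2 * k%:R / d).

Lemma unimod_sqn k : sqn (unimod k) = 1.
Proof.
have d0 : (1 + k%:R ^+ 2 : R) != 0 by rewrite gt_eqF // ltr_pwDl // sqr_ge0.
by rewrite /sqn /=; field.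
Qed.

Lemma unimod_inj : injective unimod.
Proof.
move=> k l [] H _.
have dk : (1 + k%:R ^+ 2 : R) != 0 by rewrite gt_eqF // ltr_pwDl // sqr_ge0.
have dl : (1 + l%:R ^+ 2 : R) != 0 by rewrite gt_eqF // ltr_pwDl // sqr_ge0.
have H' : (1 - k%:R ^+ 2) * (1 + l%:R ^+ 2) = (1 - l%:R ^+ 2) * (1 + k%:R ^+ 2) :> R.
  by apply/eqP; rewrite -eqr_div //; apply/eqP.
have : (k%:R : R) ^+ 2 = l%:R ^+ 2 by nra.
by move=> /eqP; rewrite eqrXn2 // eqr_nat => /eqP.
Qed.

(** The characteristic polynomial has degree [n], so among [n + 2] distinct points of the unit
    circle one is not an eigenvalue; its inverse is the required [z]. *)
Lemma exists_completion n (A : 'M[C]_n) :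
  exists z : C, sqn z = 1 /\ 1%:M - z *: A \in unitmx.
Proof.
have [k Hk] : exists k, ~~ root (char_poly A) (unimod k).
  case: (boolP (all (root (char_poly A)) [seq unimod k | k <- iota 0 n.+2])) => [H|].
    have pn0 : char_poly A != 0 by exact/monic_neq0/char_poly_monic.
    have := max_poly_roots pn0 H; rewrite map_inj_uniq ?iota_uniq; last exact: unimod_inj.
    by rewrite size_char_poly size_map size_iota => /(_ isT); rewrite ltnNge leqnSn.
  by move=> /allPn [_ /mapP [k _ ->] H]; exists k.
have u0 : unimod k != 0 by rewrite -sqn_eq0 unimod_sqn oner_eq0.
exists (unimod k)^-1; split.
  have := sqnM (unimod k) (unimod k)^-1; rewrite divff // unimod_sqn mul1r sqn1.
  by move=> <-.
have -> : 1%:M - (unimod k)^-1 *: A = - (unimod k)^-1 *: (A - (unimod k)%:M).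
  by rewrite scaleNr scalerBr opprB scale_scalar_mx mulVf.
rewrite unitmxZ ?unitfE ?oppr_eq0 ?invr_eq0 // -row_free_unit -kermx_eq0.
by move: Hk; rewrite -eigenvalue_root_char /eigenvalue negbK.
Qed.

Lemma unitary_completion (T : finType) (h : T -> R) (V : op T T) :
  V *m dag V *m V = V -> econs h V ->
  exists U : op T T, [/\ dag U *m U = 1%:M, econs h U & U *m (dag V *m V) = V].
Proof.
move=> HV /econsE Hh; have [z [z1 zu]] := exists_completion (dag V).
exists (complet z V); split; [exact: complet_isom| |exact: complet_ext].
apply/econsE; apply: complet_comm => //.
by rewrite -[hdiag h]hdiag_dag -!dag_mul Hh.
Qed.

End Raise.

(** * Functional calculus and polar partial isometries *)

Section MxFun.
Variable R : realType.
Local Notation C := R[i].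

Lemma spectral_isom n (A : 'M[C]_n) : dag (spectralmx A) *m spectralmx A = 1%:M.
Proof. by apply: unitarymx_dag'; exact: spectral_unitarymx. Qed.
Lemma spectral_isom' n (A : 'M[C]_n) : spectralmx A *m dag (spectralmx A) = 1%:M.
Proof. by apply: unitarymx_dag; exact: spectral_unitarymx. Qed.

Lemma mxfunM n (f g : R -> R) (A : 'M[C]_n) :
  mxfun f A *m mxfun g A = mxfun (fun x => f x * g x) A.
Proof.
rewrite /mxfun !mulmxA -(mulmxA _ (spectralmx A)) spectral_isom' mulmx1.
rewrite -(mulmxA (dag _)); congr (_ *m _ *m _).
rewrite mulmx_diag; congr diag_mx; apply/rowP => k.
by rewrite !mxE rmorphM.
Qed.

Lemma mxfunB n (f g : R -> R) (A : 'M[C]_n) :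
  mxfun f A - mxfun g A = mxfun (fun x => f x - g x) A.
Proof.
rewrite /mxfun -mulmxBl -mulmxBr -raddfB; congr (_ *m diag_mx _ *m _).
by apply/rowP => k; rewrite !mxE rmorphB.
Qed.

Lemma mxfun_eq n (f g : R -> R) (A : 'M[C]_n) :
  (forall k, f (eig A k) = g (eig A k)) -> mxfun f A = mxfun g A.
Proof.
move=> H; rewrite /mxfun; congr (_ *m diag_mx _ *m _).
by apply/rowP => k; rewrite !mxE H.
Qed.

Lemma diag_dag n (d : 'I_n -> R) :
  dag (diag_mx (\row_k (d k)%:C)) = diag_mx (\row_k (d k)%:C).
Proof.
apply/matrixP => i j; rewrite !mxE eq_sym.
by case: (eqVneq i j) => [->|_]; rewrite ?mulr1n ?mulr0n ?conjc_real ?conjc0.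
Qed.

Lemma mxfun_dag n (f : R -> R) (A : 'M[C]_n) : dag (mxfun f A) = mxfun f A.
Proof. by rewrite /mxfun !dag_mul dagK mulmxA diag_dag. Qed.

Lemma mxfun1 n (A : 'M[C]_n) : mxfun (fun=> 1) A = 1%:M.
Proof.
rewrite /mxfun; have -> : diag_mx (\row_k (1 : R)%:C) = 1%:M :> 'M[C]_n.
  by apply/matrixP => i j; rewrite !mxE.
by rewrite mulmx1 spectral_isom.
Qed.

Lemma spectral_herm n (A : 'M[C]_n) : dag A = A ->
  A = dag (spectralmx A) *m diag_mx (\row_k (eig A k)%:C) *m spectralmx A.
Proof.
move=> HA; have E : A = dag (spectralmx A) *m diag_mx (spectral_diag A) *m spectralmx A.
  by apply: spectral_dagE; rewrite HA.
rewrite {1}E; congr (_ *m _ *m _).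
have D : diag_mx (spectral_diag A) = spectralmx A *m A *m dag (spectralmx A).
  rewrite {3}E !mulmxA spectral_isom' mul1mx -mulmxA spectral_isom' mulmx1.
  by [].
have Dd : dag (diag_mx (spectral_diag A)) = diag_mx (spectral_diag A).
  by rewrite D !dag_mul dagK HA mulmxA.
congr diag_mx; apply/rowP => k; rewrite !mxE /eig.
have /matrixP /(_ k k) := Dd; rewrite !mxE eqxx !mulr1n.
case: (spectral_diag A 0 k) => a b [] /=; move=> /eqP; rewrite -subr_eq0 -opprD oppr_eq0.
by rewrite -mulr2n mulrn_eq0 /= => /eqP ->.
Qed.

Lemma mxfun_id n (A : 'M[C]_n) : dag A = A -> mxfun id A = A.
Proof. by move=> HA; rewrite [RHS]spectral_herm. Qed.

Lemma mxfun_comm n (f : R -> R) (A B : 'M[C]_n) : dag A = A ->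
  A *m B = B *m A -> mxfun f A *m B = B *m mxfun f A.
Proof.
move=> HA AB; have E := spectral_herm HA.
set U := spectralmx A in E *.
have U1 : dag U *m U = 1%:M by exact: spectral_isom.
have U2 : U *m dag U = 1%:M by exact: spectral_isom'.
pose B' := U *m B *m dag U.
have EB : B = dag U *m B' *m U.
  by rewrite /B' !mulmxA U1 mul1mx -mulmxA U1 mulmx1.
have cm : diag_mx (\row_k (eig A k)%:C) *m B' = B' *m diag_mx (\row_k (eig A k)%:C).
  have -> : diag_mx (\row_k (eig A k)%:C) = U *m A *m dag U.
    by rewrite [A in U *m A]E !mulmxA U2 mul1mx -mulmxA U2 mulmx1.
  rewrite /B' !mulmxA -(mulmxA (U *m A)) U1 mulmx1 -(mulmxA U A B) AB.
  by rewrite -(mulmxA (U *m B) (dag U) U) U1 mulmx1 !mulmxA.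
have cf : diag_mx (\row_k (f (eig A k))%:C) *m B' = B' *m diag_mx (\row_k (f (eig A k))%:C).
  apply/matrixP => i j; move/matrixP: cm => /(_ i j).
  rewrite !mul_mx_diag !mul_diag_mx !mxE => /eqP.
  rewrite mulrC -subr_eq0 -mulrBr mulf_eq0 subr_eq0 => /orP[/eqP ->|/eqP /rcI ->].
    by rewrite mulr0 mul0r.
  by rewrite mulrC.
clearbody B'; rewrite /mxfun -/U EB !mulmxA -!(mulmxA _ U (dag U)) U2 !mulmx1.
by rewrite -(mulmxA (dag U)) cf !mulmxA.
Qed.

Lemma N2_rows m n (A : 'M[C]_(m,n)) : N2 A = \sum_i \sum_j sqn (A i j).
Proof. by []. Qed.

Lemma mxfun_N2 n k (f : R -> R) (A : 'M[C]_n) (w : 'M[C]_(n,k)) :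
  N2 (mxfun f A *m w) = \sum_i (f (eig A i)) ^+ 2 * (\sum_j sqn ((spectralmx A *m w) i j)).
Proof.
rewrite /mxfun -!mulmxA N2_isom; last by rewrite dagK spectral_isom'.
rewrite /N2; apply: eq_bigr => i _; rewrite mulr_sumr; apply: eq_bigr => j _.
by rewrite mul_diag_mx !mxE sqnM sqnC.
Qed.

Lemma mxfun_N2_le n k (f g : R -> R) (A : 'M[C]_n) (w : 'M[C]_(n,k)) :
  (forall i, (f (eig A i)) ^+ 2 <= (g (eig A i)) ^+ 2) ->
  N2 (mxfun f A *m w) <= N2 (mxfun g A *m w).
Proof.
move=> H; rewrite !mxfun_N2; apply: ler_sum => i _; apply: ler_wpM2r => //.
by apply: sumr_ge0 => j _; exact: sqn_ge0.
Qed.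

Lemma eig_gram_ge0 m n (A : 'M[C]_(m,n)) k : 0 <= eig (dag A *m A) k.
Proof.
set M := dag A *m A.
have HM : dag M = M by rewrite dag_mul dagK.
have E := spectral_herm HM.
have D : diag_mx (\row_k (eig M k)%:C) = dag (A *m dag (spectralmx M)) *m (A *m dag (spectralmx M)).
  move: (spectral_isom' M) E; set U := spectralmx M => U2 E.
  rewrite dag_mul dagK mulmxA -(mulmxA U (dag A) A) -/M [X in U *m X]E.
  by rewrite !mulmxA U2 mul1mx -mulmxA U2 mulmx1.
have /matrixP /(_ k k) := D; rewrite [LHS]mxE mxE eqxx mulr1n mxE => Ek.
suff -> : eig M k = \sum_i sqn ((A *m dag (spectralmx M)) i k).
  by apply: sumr_ge0 => i _; exact: sqn_ge0.
apply: rcI; rewrite Ek rc_sum; apply: eq_bigr => i _.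
by rewrite [X in X * _]mxE sqnE.
Qed.

(** Inverse square root, set to zero off the positive reals so that the polar factor vanishes on the
    kernel. *)
Definition rsq (s : R) : R := if 0 < s then (Num.sqrt s)^-1 else 0.

(** The polar partial isometry of [A]. *)
Definition polar n (A : 'M[C]_n) : 'M[C]_n := A *m mxfun rsq (dag A *m A).

Section Polar.
Variables (n : nat) (A : 'M[C]_n).
Let M := dag A *m A.
Let Mh : dag M = M. Proof. by rewrite dag_mul dagK. Qed.

Lemma polar_gram : dag (polar A) *m polar A = mxfun (fun s => (0 < s)%R%:R) M.
Proof.
rewrite /polar dag_mul mxfun_dag -/M -mulmxA (mulmxA (dag A)) -/M.
rewrite -[M in _ *m (M *m _)](mxfun_id Mh) !mxfunM.
apply: mxfun_eq => k; rewrite /rsq; case: ltP => [h|_]; last by rewrite mul0r.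
rewrite mulrCA -expr2 exprVn sqr_sqrtr ?divff // ?gt_eqF //; exact: ltW.
Qed.

Lemma polar_pisom : polar A *m dag (polar A) *m polar A = polar A.
Proof.
rewrite -mulmxA polar_gram /polar -mulmxA mxfunM; congr (_ *m _).
by apply: mxfun_eq => k; rewrite /rsq; case: ltP => _; rewrite ?mulr1 ?mulr0.
Qed.

Lemma polar_comm (B : 'M[C]_n) :
  A *m B = B *m A -> dag A *m B = B *m dag A -> polar A *m B = B *m polar A.
Proof.
move=> h1 h2; have HM : M *m B = B *m M by rewrite -mulmxA h1 mulmxA h2 -mulmxA.
by rewrite /polar -mulmxA (mxfun_comm rsq Mh HM) mulmxA h1 -mulmxA.
Qed.

(** On the spectrum of [M], which is nonnegative, the indicator of zero is bounded by |s - 1|: a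
    vector nearly fixed by [M] nearly lies in the initial space. *)
Lemma polar_def k (w : 'M[C]_(n,k)) :
  N2 (w - dag (polar A) *m polar A *m w) <= N2 (M *m w - w).
Proof.
have -> : M *m w - w = mxfun (fun x => x - 1) M *m w.
  by rewrite -mxfunB mxfun1 mxfun_id // mulmxBl mul1mx.
have -> : w - dag (polar A) *m polar A *m w = mxfun (fun x => 1 - (0 < x)%R%:R) M *m w.
  by rewrite -mxfunB mxfun1 mulmxBl mul1mx polar_gram.
apply: mxfun_N2_le => i; have := eig_gram_ge0 A i; rewrite -/M le_eqVlt.
by case/orP => [/eqP <-|->]; rewrite ?ltxx ?sub0r ?subr0 ?sqrrN // subrr expr0n sqr_ge0.
Qed.

(** [A] acting after a function of [M] has the norm of the square root of [M] after it, and |1 -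
    sqrt s| <= |s - 1|. Passing from [A] to its polar part thus costs no more than the defect of
    [M]. *)
Lemma polar_close k (w : 'M[C]_(n,k)) :
  N2 (polar A *m w - w) <= 2 * N2 (M *m w - w) + 2 * N2 (A *m w - w).
Proof.
have -> : polar A *m w - w = (polar A *m w - A *m w) + (A *m w - w) by rewrite subrKA.
apply: le_trans (N2D_le _ _) _; rewrite lerD2r ler_wpM2l //.
have -> : polar A *m w - A *m w = A *m (mxfun (fun x => rsq x - 1) M *m w).
  by rewrite -mxfunB mxfun1 mulmxBl mul1mx mulmxBr /polar mulmxA.
have -> : N2 (A *m (mxfun (fun x => rsq x - 1) M *m w))
   = N2 (mxfun (fun x => Num.sqrt x * (rsq x - 1)) M *m w).
  have := mxfun_dag (fun x => rsq x - 1) M.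
  have := mxfun_dag (fun x => Num.sqrt x * (rsq x - 1)) M.
  have : mxfun (fun x => rsq x - 1) M *m M *m mxfun (fun x => rsq x - 1) M =
    mxfun (fun x => Num.sqrt x * (rsq x - 1)) M *m mxfun (fun x => Num.sqrt x * (rsq x - 1)) M.
    rewrite -{2}[M](mxfun_id Mh) !mxfunM; apply: mxfun_eq => i.
    by have h := eig_gram_ge0 A i; rewrite -/M in h *; rewrite -{2}(sqr_sqrtr h); ring.
  move: (mxfun _ M) (mxfun _ M) => Z Z' ZZ Zd' Zd.
  apply: rcI; rewrite -!N2E !dag_mul Zd Zd' -!mulmxA; congr (\tr (_ *m _)).
  by rewrite !mulmxA -(mulmxA _ (dag A) A) -/M ZZ.
have -> : M *m w - w = mxfun (fun x => x - 1) M *m w.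
  by rewrite -mxfunB mxfun1 mxfun_id // mulmxBl mul1mx.
apply: mxfun_N2_le => i; have := eig_gram_ge0 A i; rewrite -/M le_eqVlt.
case/orP => [/eqP <-|h]; first by rewrite sqrtr0 mul0r expr0n sqr_ge0.
rewrite /rsq h; have s0 : 0 < Num.sqrt (eig M i) by rewrite sqrtr_gt0.
rewrite mulrBr divff ?gt_eqF // mulr1.
have -> : eig M i - 1 = Num.sqrt (eig M i) ^+ 2 - 1 by rewrite sqr_sqrtr // ltW.
move: (Num.sqrt _) s0 => s s0.
have -> : (s ^+ 2 - 1) ^+ 2 = (1 - s) ^+ 2 * (1 + s) ^+ 2 by ring.
rewrite ler_peMr ?sqr_ge0 //; nra.
Qed.

End Polar.
End MxFun.

(** * Tensor powers *)

Section Prod.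
Variable R : realType.
Local Notation C := R[i].
Local Notation op T U := 'M[C]_(#|{: T}|, #|{: U}|).
Variable I : finType.

Definition prodop (T U : finType) (A : I -> op T U) : op {ffun I -> T} {ffun I -> U} :=
  mk (fun (x : {ffun I -> T}) (y : {ffun I -> U}) => \prod_i en (A i) (x i) (y i)).

Lemma en_prod (T U : finType) (A : I -> op T U) x y :
  en (prodop A) x y = \prod_i en (A i) (x i) (y i).
Proof. exact: en_mk. Qed.

Lemma prod_mul (T U V : finType) (A : I -> op T U) (B : I -> op U V) :
  prodop A *m prodop B = prodop (fun i => A i *m B i).
Proof.
apply: enP => x y; rewrite en_mul en_prod.
under [RHS]eq_bigr => i _ do rewrite en_mul.
rewrite bigA_distr_bigA; apply: eq_bigr => z _.
by rewrite !en_prod -big_split.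
Qed.

Lemma prod_dag (T U : finType) (A : I -> op T U) :
  dag (prodop A) = prodop (fun i => dag (A i)).
Proof.
apply: enP => x y; rewrite en_dag !en_prod rmorph_prod.
by apply: eq_bigr => i _; rewrite en_dag.
Qed.

Lemma prod_tr (T : finType) (A : I -> op T T) : \tr (prodop A) = \prod_i \tr (A i).
Proof.
rewrite tr_en; under [RHS]eq_bigr => i _ do rewrite tr_en.
by rewrite bigA_distr_bigA; apply: eq_bigr => z _; rewrite en_prod.
Qed.

Lemma eq_prod (T U : finType) (A B : I -> op T U) : A =1 B -> prodop A = prodop B.
Proof.
move=> H; apply: enP => x y; rewrite !en_prod.
by apply: eq_bigr => i _; rewrite H.
Qed.

Lemma prod1 (T : finType) : prodop (fun=> 1%:M : op T T) = 1%:M.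
Proof.
apply: enP => x y; rewrite en_prod en1.
under eq_bigr => i _ do rewrite en1.
case: (eqVneq x y) => [->|nxy]; first by rewrite big1 // => i _; rewrite eqxx.
have [i Hi] : exists i, x i != y i.
  apply/existsP; apply: contraNT nxy; rewrite negb_exists => /forallP H.
  by apply/eqP/ffunP => i; have := H i; rewrite negbK => /eqP.
by rewrite (bigD1 i) //= (negbTE Hi) mul0r.
Qed.

Lemma N2_prod (T U : finType) (A : I -> op T U) : N2 (prodop A) = \prod_i N2 (A i).
Proof.
apply: rcI; rewrite -N2E prod_dag prod_mul prod_tr rmorph_prod.
by apply: eq_bigr => i _; rewrite N2E.
Qed.

Definition hpow (T : finType) (h : T -> R) (x : {ffun I -> T}) : R := \sum_i h (x i).

Lemma raise_prod (T U : finType) (hT : T -> R) (hU : U -> R) (D : I -> R) (A : I -> op T U) :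
  (forall i, raise hT hU (D i) (A i)) ->
  raise (hpow hT) (hpow hU) (\sum_i D i) (prodop A).
Proof.
move=> H x y; rewrite en_prod => /prodf_neq0 n0.
by rewrite /hpow -big_split; apply: eq_bigr => i _; apply: H; exact: n0.
Qed.

Definition powop (T U : finType) (A : op T U) := prodop (fun=> A).

Lemma dens_pow (T : finType) (A : op T T) : dens A -> dens (powop A).
Proof.
move=> dA; have [U [w E]] := dens_en dA; split.
  exists #|{: {ffun I -> U}}|, (prodop (fun=> w)).
  by rewrite prod_dag prod_mul /powop; apply: eq_prod => i.
by rewrite prod_tr big1 // => i _; exact: (proj2 dA).
Qed.

End Prod.

(** * Cyclic energy ladders *)

Section Ladder.
Variable R : realType.
Local Notation C := R[i].
Local Notation op T U := 'M[C]_(#|{: T}|, #|{: U}|).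

Definition permop (T : finType) (f : T -> T) : op T T := mk (fun x y => (x == f y)%:R).

Lemma permop_mul (T : finType) (f g : T -> T) : permop f *m permop g = permop (f \o g).
Proof.
apply: enP => x y; rewrite en_mul en_mk (bigD1 (g y)) //= !en_mk eqxx mulr1.
by rewrite big1 ?addr0 // => z nz; rewrite !en_mk (negbTE nz) mulr0.
Qed.

Lemma permop_dag (T : finType) (f g : T -> T) : cancel f g -> cancel g f ->
  dag (permop f) = permop g.
Proof.
move=> fg gf; apply: enP => x y; rewrite en_dag !en_mk conjc_natr.
by rewrite -(can2_eq fg gf) eq_sym.
Qed.

Lemma permop_id (T : finType) (f : T -> T) : f =1 id -> permop f = 1%:M.
Proof. by move=> H; apply: enP => x y; rewrite en_mk en1 H. Qed.

Variables (Y : finType) (Lm : nat).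
(** One cyclic counter for each [y], whose rungs are spaced by [D y] (see [hlad]). Cyclicity makes
    the shifts unitary; the price is a wrong energy at the wrap-around. *)
Definition ladder := {ffun Y -> 'I_Lm.+1}.

Definition lup (y : Y) (l : ladder) : ladder :=
  [ffun z => if z == y then (l z + inZp 1)%R else l z].
Definition ldown (y : Y) (l : ladder) : ladder :=
  [ffun z => if z == y then (l z - inZp 1)%R else l z].

Lemma lupK y : cancel (lup y) (ldown y).
Proof. by move=> l; apply/ffunP => z; rewrite !ffunE; case: eqP => // _; rewrite addrK. Qed.
Lemma ldownK y : cancel (ldown y) (lup y).
Proof. by move=> l; apply/ffunP => z; rewrite !ffunE; case: eqP => // _; rewrite subrK. Qed.

Lemma lupC y z l : lup y (lup z l) = lup z (lup y l).
Proof. by apply/ffunP => u; rewrite !ffunE; case: eqP => ?; case: eqP. Qed.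
Lemma lup_downC y z l : lup y (ldown z l) = ldown z (lup y l).
Proof. by apply/ffunP => u; rewrite !ffunE; case: eqP => ?; case: eqP => // _; rewrite addrAC. Qed.

Definition lT (y : Y) : op ladder ladder := permop (lup y).

Lemma eq_permop (T : finType) (f g : T -> T) : f =1 g -> permop f = permop g.
Proof. by move=> H; apply: enP => a b; rewrite !en_mk H. Qed.

Lemma lT_dag y : dag (lT y) = permop (ldown y).
Proof. exact: permop_dag (lupK y) (ldownK y). Qed.
Lemma lT_isom y : dag (lT y) *m lT y = 1%:M.
Proof. by rewrite lT_dag permop_mul permop_id // => l; exact: lupK. Qed.
Lemma lT_isom' y : lT y *m dag (lT y) = 1%:M.
Proof. exact/mulmx1C/lT_isom. Qed.
Lemma lT_comm y z : lT y *m lT z = lT z *m lT y.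
Proof. by rewrite !permop_mul; apply: eq_permop => l /=; rewrite lupC. Qed.
Lemma lT_commd y z : lT y *m dag (lT z) = dag (lT z) *m lT y.
Proof. by rewrite lT_dag !permop_mul; apply: eq_permop => l /=; rewrite lup_downC. Qed.

Variable D : Y -> R.
Definition hlad (l : ladder) : R := \sum_y D y * (l y)%:R.

Variables (F : finType) (hF : F -> R).

(* Energy raising by [E] that only holds away from the wrap-around of the cyclic ladders. *)
Definition crz (b : nat) (E : R) (A : op (F * ladder) (F * ladder)) : Prop :=
  forall p q, en A p q != 0 -> (forall y, q.2 y + b <= Lm)%N ->
    (forall y, p.2 y <= q.2 y + b)%N /\ hsum2 hF hlad p = hsum2 hF hlad q + E.

(** The budget bounds how many rungs an operator may climb; far enough below the top no wrap-around
    happens, so budgets add like energies under composition. *)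
Lemma crz_mul b b' E E' A B : crz b E A -> crz b' E' B -> crz (b + b') (E' + E) (A *m B).
Proof.
move=> HA HB p q; rewrite en_mul => n0 hq.
have [z /andP[n1 n2]] : exists z, (en A p z != 0) && (en B z q != 0).
  apply/existsP; apply: contraNT n0; rewrite negb_exists => /forallP H; apply/eqP.
  rewrite big1 // => z _; have := H z; rewrite negb_and !negbK.
  by case/orP => /eqP ->; rewrite ?mul0r ?mulr0.
have [hz ez] := HB _ _ n2 (fun y => leq_trans (leq_add (leqnn _) (leq_addl b b')) (hq y)).
have hz' y : (z.2 y + b <= Lm)%N.
  by have := hq y; have := hz y; lia.
have [hp ep] := HA _ _ n1 hz'; split=> [y|].
  by have := hp y; have := hz y; lia.
by rewrite ep ez addrA.
Qed.

Lemma crzD b E A B : crz b E A -> crz b E B -> crz b E (A + B).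
Proof.
move=> HA HB p q; rewrite en_add => n0 hq.
case: (eqVneq (en A p q) 0) n0 => [->|n0 _]; last exact: HA.
by rewrite add0r => n0; exact: HB.
Qed.

Lemma crz_le b b' E A : (b <= b')%N -> crz b E A -> crz b' E A.
Proof.
move=> hb HA p q n0 hq.
have [hp ->] := HA _ _ n0 (fun y => leq_trans (leq_add (leqnn _) hb) (hq y)).
by split=> // y; apply: leq_trans (hp y) _; rewrite leq_add2l.
Qed.

Lemma crz1 : crz 0 0 1%:M.
Proof.
move=> p q; rewrite en1; case: (eqVneq p q) => [->|]; rewrite ?eqxx // => _ _.
by split=> [y|]; rewrite ?addn0 ?addr0.
Qed.

Lemma crz0 b E : crz b E 0.
Proof. by move=> p q; rewrite en_0 eqxx. Qed.

Lemma crz_sum b E (I : Type) (r : seq I) (P : pred I) (A : I -> _) :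
  (forall i, P i -> crz b E (A i)) -> crz b E (\sum_(i <- r | P i) A i).
Proof.
move=> H; elim/big_rec: _ => [|i B Pi HB]; first exact: crz0.
by apply: crzD => //; exact: H.
Qed.

Lemma crz_tens1 E (A : op F F) : raise hF hF E A -> crz 0 E (tens A 1%:M).
Proof.
move=> HA [p l] [q l']; rewrite en_tens en1 /=.
case: (eqVneq l l') => [<-|]; last by rewrite mulr0 eqxx.
rewrite mulr1 => /HA Eh _; split=> [y|]; rewrite ?addn0 // /hsum2 /= Eh.
by rewrite addrAC.
Qed.

Lemma crz_tensT E (A : op F F) y : raise hF hF E A -> crz 1 (E + D y) (tens A (lT y)).
Proof.
move=> HA [p l] [q l']; rewrite en_tens en_mk /=.
case: (eqVneq l (lup y l')) => [->|]; last by rewrite mulr0 eqxx.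
rewrite mulr1 => /HA Eh hl.
have ly : (lup y l' y = l' y + 1 :> nat)%N.
  by rewrite ffunE eqxx /= modnDmr modn_small // ltnS; exact: hl.
split=> [z|].
  rewrite ffunE; case: (eqVneq z y) => [->|_]; last exact: leq_addr.
  by move: ly; rewrite ffunE eqxx => ->.
rewrite /hsum2 /= Eh -!addrA; congr (_ + _); rewrite addrCA; congr (_ + _).
rewrite /hlad (bigD1 y) //= ly natrD mulrDr mulr1 [in RHS](bigD1 y) //=.
rewrite addrAC; congr (_ + _ + _); apply: eq_bigr => z nz.
by rewrite ffunE (negbTE nz).
Qed.

End Ladder.

(** * Completing one energy shift to a unitary with a ladder *)

Section Pow.
Variable R : realType.
Local Notation C := R[i].
Local Notation op T U := 'M[C]_(#|{: T}|, #|{: U}|).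

Definition mpow n (A : 'M[C]_n) k : 'M[C]_n := iter k (mulmx A) 1%:M.

Lemma mpow_tele n (A : 'M[C]_n) m :
  (1%:M - A) *m (\sum_(j < m) mpow A j) = 1%:M - mpow A m.
Proof.
elim: m => [|m IH]; first by rewrite big_ord0 mulmx0 subrr.
rewrite big_ord_recr mulmxDr IH mulmxBl mul1mx /= addrA.
by rewrite subrK.
Qed.

Lemma mpow_inv n (A : 'M[C]_n) m : mpow A m = 0 ->
  1%:M - A \in unitmx /\ invmx (1%:M - A) = \sum_(j < m) mpow A j.
Proof.
move=> H; have := mpow_tele A m; rewrite H subr0 => E.
have [U _] := mulmx1_unit E; split=> //.
have := congr1 (mulmx (invmx (1%:M - A))) E; by rewrite mulmx1 mulKmx.
Qed.

Lemma mpow_tens (T U : finType) (A : op T T) (B : op U U) k :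
  mpow (tens A B) k = tens (mpow A k) (mpow B k).
Proof. by elim: k => [|k IH] /=; rewrite ?tens11 // IH tens_mul. Qed.

Lemma raise_mpow (T : finType) (h : T -> R) E (A : op T T) k :
  raise h h E A -> raise h h (E *+ k) (mpow A k).
Proof.
move=> HA; elim: k => [|k IH]; first exact: raise1.
by rewrite mulrSr /=; exact: raise_mul IH.
Qed.

(** Each factor moves the energy by [E], and finitely many levels span a bounded interval, so a high
    power has nowhere to go. *)
Lemma raise_nilp (T : finType) (h : T -> R) E (A : op T T) :
  raise h h E A -> E != 0 -> exists m, forall k, (m <= k)%N -> mpow A k = 0.
Proof.
move=> HA E0; pose B : R := \sum_x `|h x|.
have Bx x : `|h x| <= B by rewrite /B (bigD1 x) //= lerDl sumr_ge0.
exists (Num.truncn (2 * B / `|E|)).+1 => k hk; apply: enP => x y; rewrite en_0.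
apply/eqP; apply/negP => /negP /(raise_mpow HA) H.
have Ep : 0 < `|E| by rewrite normr_gt0.
have h1 : `|E| * k%:R <= 2 * B.
  have -> : `|E| * k%:R = `|h x - h y|.
    by rewrite H addrC addKr normrMn mulr_natr.
  by apply: le_trans (ler_normB _ _) _; rewrite mulr_natl mulr2n lerD.
have h2 : 2 * B / `|E| < k%:R.
  by apply: lt_le_trans (truncnS_gt _) _; rewrite ler_nat.
by move: h2; rewrite ltr_pdivrMr // [k%:R * _]mulrC ltNge h1.
Qed.

Lemma complet_cross n (z : C) (V : 'M[C]_n) k (u : 'M[C]_(n,k)) :
  V *m dag V *m V = V -> complet z V *m u - V *m u = complet z V *m (u - dag V *m V *m u).
Proof. by move=> HV; rewrite mulmxBr mulmxA complet_ext. Qed.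

Variables (Y F : finType) (Lm : nat) (D : Y -> R) (hF : F -> R).
Local Notation L := (ladder Y Lm).

(** Pairing [X] with one rung down gives a partial isometry with no net energy change away from the
    wrap-around, which is completed to a unitary; the rung is then given back. On the initial space
    of [X] the result is [X] tensor the identity. *)
Definition Yiso (y : Y) (X : op F F) : op (F * L) (F * L) :=
  tens 1%:M (lT R Lm y) *m complet 1 (tens X (dag (lT R Lm y))).

Section One.
Variables (y : Y) (X : op F F) (m : nat).
Hypothesis Xp : X *m dag X *m X = X.
Hypothesis Xm : mpow (dag X) m = 0.
Let T := lT R Lm y.
Let V := tens X (dag T).

Let Vp : V *m dag V *m V = V.
Proof. by rewrite tens_dag !tens_mul dagK Xp lT_isom mul1mx. Qed.

Let Vm : 1%:M - 1 *: dag V \in unitmx /\ invmx (1%:M - 1 *: dag V) = \sum_(j < m) mpow (dag V) j.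
Proof.
rewrite scale1r; apply: mpow_inv; rewrite /V tens_dag mpow_tens Xm.
by apply: enP => a b; rewrite en_tens !en_0 mul0r.
Qed.

Lemma Yiso_isom : dag (Yiso y X) *m Yiso y X = 1%:M.
Proof.
rewrite /Yiso dag_mul !mulmxA -(mulmxA _ (dag (tens 1%:M T))).
rewrite tens_dag dag1 tens_mul mul1mx lT_isom tens11 mulmx1.
by apply: complet_isom => //; [rewrite sqn1|case: Vm].
Qed.

Lemma Yiso_comm (B : op (F * L) (F * L)) :
  B *m tens 1%:M T = tens 1%:M T *m B -> B *m V = V *m B -> B *m dag V = dag V *m B ->
  B *m Yiso y X = Yiso y X *m B.
Proof.
move=> h1 h2 h3; rewrite /Yiso mulmxA h1 -!mulmxA; congr (_ *m _).
by apply/esym; apply: complet_comm; [rewrite h2|rewrite h3|case: Vm].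
Qed.

Lemma Yiso_commT (z : Y) : tens 1%:M (lT R Lm z) *m Yiso y X = Yiso y X *m tens 1%:M (lT R Lm z).
Proof.
apply: Yiso_comm; rewrite ?tens_dag !tens_mul !mul1mx ?mulmx1 ?dagK.
- by rewrite lT_comm.
- by rewrite lT_commd.
- by rewrite lT_comm.
Qed.

(** The completed operator equals [X] on the initial space of [X], and the component of [wF] outside
    is carried isometrically. The ladder state enters only through its norm: no ladder coherence is
    consumed. *)
Lemma Yiso_close (W : finType) (wF : op F W) (U : finType) (wL : op L U) :
  N2 (Yiso y X *m tens wF wL - tens wF wL) <=
  (2 * N2 (X *m wF - wF) + 2 * N2 (wF - dag X *m X *m wF)) * N2 wL.
Proof.
pose u := tens wF wL; rewrite -/u.
have E : Yiso y X *m u = tens (X *m wF) wL + Yiso y X *m tens (wF - dag X *m X *m wF) wL.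
  have -> : tens (wF - dag X *m X *m wF) wL = u - dag V *m V *m u.
    rewrite tens_dag tens_mul dagK lT_isom' tens_mul mul1mx.
    by rewrite tensBl.
  rewrite /Yiso -/T -/V -!(mulmxA (tens 1%:M T) (complet 1 V)) -(complet_cross _ _ Vp) mulmxBr addrC.
  rewrite [tens 1%:M _ *m (V *m u)]mulmxA !tens_mul !mul1mx lT_isom' mul1mx.
  by rewrite subrK.
rewrite E addrAC; apply: le_trans (N2D_le _ _) _.
rewrite -tensBl (N2_isom _ Yiso_isom) !N2_tens.
by rewrite [leRHS]mulrDl !mulrA.
Qed.

(** Nilpotency makes the inverse in the completion a finite Neumann sum in [dag X] tensor one rung
    up, each power having net energy zero. Hence a climb budget of [m], plus one for the rung given
    back. *)
Lemma Yiso_crz : raise hF hF (D y) X -> crz D hF m.+1 (D y) (Yiso y X).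
Proof.
move=> HX; rewrite /Yiso /complet !scale1r (mulmxDr (tens 1%:M _)); apply: crzD.
  rewrite tens_mul mul1mx lT_isom'; apply: (crz_le (leq0n _)); exact: crz_tens1.
have -> : m.+1 = (1 + (0 + m + 0))%N by rewrite addn0.
have -> : D y = (0 + (0 + 0) + (0 + D y))%R by rewrite !add0r.
have HX' := raise_dag HX.
apply: crz_mul; first by apply: crz_tensT; exact: raise1.
apply: crz_mul; last first.
  rewrite tens_dag dagK tens_mul lT_isom' -tens11 -tensBl; apply: crz_tens1.
  apply: raiseB; first exact: raise1.
  by rewrite -(subrr (D y)); exact: raise_mul HX.
apply: crz_mul.
  rewrite tens_dag dagK tens_mul lT_isom -tens11 -tensBl; apply: crz_tens1.
  apply: raiseB; first exact: raise1.
  by rewrite -(addNr (D y)); exact: raise_mul HX'.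
have := proj2 Vm; rewrite scale1r /V tens_dag dagK => ->; apply: crz_sum => j _.
apply: (@crz_le _ _ _ _ _ _ j); first by rewrite ltnW.
elim: (j : nat) => [|i IH] /=; first exact: crz1.
rewrite -[i.+1]add1n -[0 : R]addr0 -{2}(addNr (D y)); apply: crz_mul IH.
exact: crz_tensT.
Qed.

End One.
End Pow.

(** * Law of large numbers for products of matrix units *)

Section Avg.
Variable R : realType.
Local Notation C := R[i].
Local Notation op T U := 'M[C]_(#|{: T}|, #|{: U}|).

Lemma N2_pisom_le n m k (B : 'M[C]_(n,m)) (w : 'M[C]_(m,k)) :
  B *m dag B *m B = B -> N2 (B *m w) <= N2 w.
Proof.
move=> HB; have -> : N2 (B *m w) = N2 (dag B *m B *m w).
  apply: rcI; rewrite -!N2E !dag_mul dagK -!mulmxA; congr (\tr (_ *m (_ *m _))).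
  by rewrite !mulmxA HB.
apply: N2_proj_le; first by rewrite dag_mul dagK.
by rewrite -!mulmxA (mulmxA B) HB.
Qed.

Lemma sqn_sum_le (N : nat) (z : 'I_N -> C) :
  sqn (\sum_c z c) <= N%:R * \sum_c sqn (z c).
Proof.
have K (M : nat) (x : 'I_M -> R) : (\sum_c x c) ^+ 2 <= M%:R * \sum_c x c ^+ 2.
  case: M x => [|M] x; first by rewrite !big_ord0 expr0n mul0r.
  set N' := M.+1; have N0 : (0 < N')%N by [].
  have N0' : (0 : R) < N'%:R by rewrite ltr0n.
  set S := \sum_c x c.
  have : 0 <= \sum_c (N'%:R * x c - S) ^+ 2 by apply: sumr_ge0 => c _; exact: sqr_ge0.
  have -> : \sum_c (N'%:R * x c - S) ^+ 2 = N'%:R * (N'%:R * (\sum_c x c ^+ 2) - S ^+ 2).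
    under eq_bigr => c _ do
      have -> : (N'%:R * x c - S) ^+ 2 = N'%:R ^+ 2 * x c ^+ 2 - 2 * N'%:R * S * x c + S ^+ 2 by ring.
    rewrite big_split sumrB /= -!mulr_sumr sumr_const card_ord -[S *+ _]mulr_natl -/S -/N'; ring.
  by rewrite pmulr_rge0 // subr_ge0.
have hre : complex.Re (\sum_c z c) = \sum_c complex.Re (z c) by exact: raddf_sum.
have him : complex.Im (\sum_c z c) = \sum_c complex.Im (z c) by exact: raddf_sum.
rewrite /sqn hre him big_split /= mulrDr; apply: lerD; exact: K.
Qed.

Lemma N2_avg_le n k (N : nat) (v : 'I_N -> 'M[C]_(n,k)) (K : R) :
  (0 < N)%N -> (forall c, N2 (v c) <= K) -> N2 ((N%:R^-1 : R)%:C *: \sum_c v c) <= K.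
Proof.
move=> N0 HK; have N0' : (0 : R) < N%:R by rewrite ltr0n.
have H : N2 (\sum_c v c) <= N%:R * \sum_c N2 (v c).
  rewrite /N2 [in leRHS]exchange_big mulr_sumr; apply: ler_sum => i _.
  rewrite exchange_big mulr_sumr; apply: ler_sum => j _.
  by rewrite summxE; exact: sqn_sum_le.
rewrite N2Z sqnC exprVn mulrC ler_pdivrMr ?exprn_gt0 //.
apply: le_trans H _; rewrite expr2 mulrCA ler_pM2l // mulrC.
have -> : N%:R * K = \sum_(c < N) K by rewrite sumr_const card_ord mulr_natl.
exact: ler_sum.
Qed.

(** Pythagoras: the mean of [N] orthogonal vectors has its squared norm reduced by the factor
    [N]. *)
Lemma N2_avg_orth n k (N : nat) (v : 'I_N -> 'M[C]_(n,k)) (K : R) :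
  (0 < N)%N -> (forall c, N2 (v c) <= K) ->
  (forall c d, c != d -> \tr (dag (v c) *m v d) = 0) ->
  N2 ((N%:R^-1 : R)%:C *: \sum_c v c) <= K / N%:R.
Proof.
move=> N0 HK Ho; have N0' : (0 : R) < N%:R by rewrite ltr0n.
have -> : N2 ((N%:R^-1 : R)%:C *: \sum_c v c) = N%:R^-1 ^+ 2 * \sum_c N2 (v c).
  rewrite N2Z sqnC; congr (_ * _); apply: rcI; rewrite -N2E dag_sum mulmx_suml raddf_sum rc_sum /=.
  apply: eq_bigr => c _; rewrite mulmx_sumr raddf_sum /= (bigD1 c) //= big1 ?addr0 ?N2E //.
  by move=> d nd; apply: Ho; rewrite eq_sym.
rewrite exprVn mulrC ler_pdivrMr ?exprn_gt0 //.
have -> : K / N%:R * N%:R ^+ 2 = \sum_(c < N) K.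
  by rewrite sumr_const card_ord -mulr_natr; field; rewrite gt_eqF.
exact: ler_sum.
Qed.

Definition dlt (T : finType) (a b : T) : op T T := mk (fun x y => ((x == a) && (y == b))%:R).

Lemma dlt_dag (T : finType) (a b : T) : dag (dlt a b) = dlt b a.
Proof. by apply: enP => x y; rewrite en_dag !en_mk conjc_natr andbC. Qed.

Lemma dlt_mul (T : finType) (a b c : T) : dlt a b *m dlt b c = dlt a c.
Proof.
apply: enP => x y; rewrite en_mul en_mk (bigD1 b) //= big1 => [|z nz].
  by rewrite !en_mk !eqxx addr0 andbT -natrM mulnb.
by rewrite !en_mk (negbTE nz) andbF mul0r.
Qed.

Lemma tr_dlt (T : finType) (A : op T T) a b : \tr (A *m dlt a b) = en A b a.
Proof.
rewrite tr_en (bigD1 b) //= big1 => [|z nz]; last first.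
  by rewrite en_mul big1 // => u _; rewrite en_mk (negbTE nz) andbF mulr0.
rewrite addr0 en_mul (bigD1 a) //= big1 => [|u nu]; last first.
  by rewrite en_mk (negbTE nu) mulr0.
by rewrite en_mk !eqxx mulr1 addr0.
Qed.

Lemma raise_dlt (T : finType) (h : T -> R) a b : raise h h (h a - h b) (dlt a b).
Proof.
move=> x y; rewrite en_mk; case: (eqVneq x a) => [->|_]; case: (eqVneq y b) => [->|_] /=;
  rewrite ?eqxx // => _; by rewrite addrC subrK.
Qed.

Variables (T : finType) (h : T -> R) (rho : op T T) (W : finType) (w : op T W).
Hypothesis rhoE : rho = w *m dag w.
Hypothesis rho1 : \tr rho = 1.
Variables (Y : finType) (l Nc : nat) (word : Y -> 'I_l -> T * T).
Hypothesis word0 : forall y q, en rho (word y q).2 (word y q).1 != 0.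
Hypothesis Nc0 : (0 < Nc)%N.

Local Notation I := (Y * 'I_Nc * 'I_l)%type.
Local Notation F := {ffun I -> T}.

Definition wordD (y : Y) : R := \sum_q (h (word y q).1 - h (word y q).2).
(** The mean, in a product of [l] copies of [rho], of the matrix units prescribed by [word y]. It is
    nonzero, so the observable can be normalized to mean 1. *)
Definition beta_ (y : Y) : C := \prod_q en rho (word y q).2 (word y q).1.

Lemma beta_neq0 y : beta_ y != 0.
Proof. by apply/prodf_neq0 => q _; exact: word0. Qed.

(** The copies are arranged in [Nc] disjoint groups of [l] for each [y]; the matrix units of
    [word y] act on group [c] of [y], and nothing acts elsewhere. *)
Definition bop (y : Y) (c : 'I_Nc) (i : I) : op T T :=
  if i.1 == (y, c) then dlt (word y i.2).1 (word y i.2).2 else 1%:M.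
Definition Bop y c : op F F := prodop (bop y c).
Definition Aop y : op F F := (Nc%:R^-1 : R)%:C *: \sum_c (beta_ y)^-1 *: Bop y c.

Lemma Bop_pisom y c : Bop y c *m dag (Bop y c) *m Bop y c = Bop y c.
Proof.
rewrite prod_dag !prod_mul; apply: eq_prod => i; rewrite /bop; case: eqP => _.
  by rewrite dlt_dag !dlt_mul.
by rewrite dag1 !mul1mx.
Qed.

Lemma Bop_dpisom y c : dag (Bop y c) *m dag (dag (Bop y c)) *m dag (Bop y c) = dag (Bop y c).
Proof. by rewrite -[RHS](congr1 (@dag _ _ _) (Bop_pisom y c)) !dag_mul !dagK mulmxA. Qed.

Lemma raise_Bop y c : raise (hpow h) (hpow h) (wordD y) (Bop y c).
Proof.
have -> : wordD y = \sum_(i : I) (if i.1 == (y, c) then h (word y i.2).1 - h (word y i.2).2 else 0).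
  rewrite -(pair_bigA _ (fun (a : Y * 'I_Nc) q =>
     if a == (y, c) then h (word y q).1 - h (word y q).2 else 0)) /=.
  rewrite (bigD1 (y, c)) //= [X in _ + X]big1 => [|a na].
    by rewrite addr0; apply: eq_bigr => q _; rewrite eqxx.
  by rewrite big1 // => q _; rewrite (negbTE na).
apply: raise_prod => i; rewrite /bop; case: eqP => _; [exact: raise_dlt|exact: raise1].
Qed.

Lemma raise_Aop y : raise (hpow h) (hpow h) (wordD y) (Aop y).
Proof. by apply: raiseZ; apply: raise_sum => c _; apply: raiseZ; exact: raise_Bop. Qed.

Lemma pow_tr_mul (A B : I -> op T T) : (forall i, A i = 1%:M \/ B i = 1%:M) ->
  \tr (powop I rho *m (prodop A *m prodop B)) =
  \tr (powop I rho *m prodop A) * \tr (powop I rho *m prodop B).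
Proof.
move=> H; rewrite !prod_mul !prod_tr -big_split; apply: eq_bigr => i _ /=.
by case: (H i) => ->; rewrite !(mul1mx, mulmx1) rho1 ?mulr1 ?mul1r.
Qed.

Lemma tr_Bop y c : \tr (powop I rho *m Bop y c) = beta_ y.
Proof.
rewrite prod_mul prod_tr -(pair_bigA _ (fun (a : Y * 'I_Nc) q =>
     \tr (rho *m bop y c (a, q)))) /=.
rewrite (bigD1 (y, c)) //= [X in _ * X]big1 => [|a na]; last first.
  by rewrite big1 // => q _; rewrite /bop /= (negbTE na) mulmx1 rho1.
by rewrite mulr1; apply: eq_bigr => q _; rewrite /bop /= eqxx tr_dlt.
Qed.

Lemma powE : powop I rho = powop I w *m dag (powop I w).
Proof. by rewrite prod_dag prod_mul; apply: eq_prod => i. Qed.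

Lemma powh : dag (powop I rho) = powop I rho.
Proof. by rewrite powE dag_mul dagK. Qed.

Lemma powN2 : N2 (powop I w) = 1.
Proof.
by apply: dens_N2; rewrite -powE prod_tr big1.
Qed.

Lemma tr_dBop y c : \tr (powop I rho *m dag (Bop y c)) = conjc (beta_ y).
Proof. by rewrite -(tr_Bop y c) -tr_dag dag_mul powh mxtrace_mulC. Qed.

Let ob (y : Y) (c d : 'I_Nc) : c != d -> forall i, bop y c i = 1%:M \/ bop y d i = 1%:M.
Proof.
move=> ncd i; rewrite /bop; case: (eqVneq i.1 (y, c)) => [->|_]; last by left.
by right; rewrite xpair_eqE eqxx /= (negbTE ncd).
Qed.

Let wt (A B : op F F) : \tr (dag (A *m powop I w) *m (B *m powop I w)) = \tr (powop I rho *m (dag A *m B)).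
Proof. by rewrite powE dag_mul -(mulmxA (powop I w)) [RHS]mxtrace_mulC !mulmxA. Qed.

Let G y c : op F F := (beta_ y)^-1 *: Bop y c - 1%:M.

Let bi y : conjc (beta_ y)^-1 * conjc (beta_ y) = 1.
Proof. by rewrite -rmorphM /= mulVf ?beta_neq0 // rmorph1. Qed.

Let tr_cov (P Q : op F F) : \tr (powop I rho *m P) = 1 -> \tr (powop I rho *m Q) = 1 ->
  \tr (powop I rho *m (P *m Q)) = 1 -> \tr (powop I rho *m ((P - 1%:M) *m (Q - 1%:M))) = 0.
Proof.
move=> hP hQ hPQ.
rewrite [(P - 1%:M) *m _]mulmxBl (mulmxBr P) mulmx1 mul1mx !(mulmxBr (powop I rho)) mulmx1.
rewrite !raddfB /= hPQ hP hQ prod_tr big1 => [|i _]; last exact: rho1.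
by ring.
Qed.

Let tr_nB y c : \tr (powop I rho *m ((beta_ y)^-1 *: Bop y c)) = 1.
Proof. by rewrite -scalemxAr mxtraceZ tr_Bop mulVf ?beta_neq0. Qed.
Let tr_nBd y c : \tr (powop I rho *m (conjc (beta_ y)^-1 *: dag (Bop y c))) = 1.
Proof. by rewrite -scalemxAr mxtraceZ tr_dBop bi. Qed.

(** The normalized observables of two groups act on different copies, hence are uncorrelated in a
    product state; centred, they give orthogonal vectors. *)
Lemma Gorth y c d : c != d ->
  \tr (dag (G y c *m powop I w) *m (G y d *m powop I w)) = 0.
Proof.
move=> ncd; rewrite wt /G dagB dagZ dag1; apply: tr_cov; rewrite ?tr_nBd ?tr_nB //.
rewrite -!scalemxAl -!scalemxAr !mxtraceZ [dag (Bop y c)]prod_dag pow_tr_mul; last first.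
  by move=> i; case: (ob y ncd i) => ->; rewrite ?dag1; [left|right].
rewrite -prod_dag -/(Bop y c) -/(Bop y d) tr_Bop tr_dBop.
transitivity ((conjc (beta_ y)^-1 * conjc (beta_ y)) * ((beta_ y)^-1 * beta_ y)); first by ring.
by rewrite bi mulVf ?beta_neq0 // mulr1.
Qed.

Lemma Gdorth y c d : c != d ->
  \tr (dag (dag (G y c) *m powop I w) *m (dag (G y d) *m powop I w)) = 0.
Proof.
move=> ncd; rewrite wt dagK /G dagB dagZ dag1; apply: tr_cov; rewrite ?tr_nBd ?tr_nB //.
rewrite -!scalemxAl -!scalemxAr !mxtraceZ [dag (Bop y d)]prod_dag pow_tr_mul; last first.
  by move=> i; case: (ob y ncd i) => ->; rewrite ?dag1; [left|right].
rewrite -prod_dag -/(Bop y c) -/(Bop y d) tr_Bop tr_dBop.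
transitivity ((conjc (beta_ y)^-1 * conjc (beta_ y)) * ((beta_ y)^-1 * beta_ y)); first by ring.
by rewrite bi mulVf ?beta_neq0 // mulr1.
Qed.

Definition kap y : R := sqn (beta_ y)^-1.
Lemma kap_ge0 y : 0 <= kap y. Proof. exact: sqn_ge0. Qed.

Let avgw n k (v : 'M[C]_(n, k)) : (Nc%:R^-1 : R)%:C *: (v *+ Nc) = v.
Proof.
have -> : v *+ Nc = (Nc%:R : R)%:C *: v by rewrite rmorph_nat scaler_nat.
by rewrite scalerA -rmorphM mulVf ?scale1r // pnatr_eq0 -lt0n.
Qed.

Lemma Aop_close y : N2 (Aop y *m powop I w - powop I w) <= (2 * kap y + 2) / Nc%:R.
Proof.
have -> : Aop y *m powop I w - powop I w = (Nc%:R^-1 : R)%:C *: \sum_c G y c *m powop I w.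
  have -> : \sum_c G y c *m powop I w = \sum_c (((beta_ y)^-1 *: Bop y c) *m powop I w - powop I w).
    by apply: eq_bigr => c _; rewrite mulmxBl mul1mx.
  by rewrite sumrB sumr_const card_ord scalerBr avgw -mulmx_suml scalemxAl.
apply: N2_avg_orth => // [c|c d ncd]; last exact: Gorth.
rewrite /G mulmxBl mul1mx; apply: le_trans (N2B_le _ _) _.
rewrite powN2 mulr1 lerD2r ler_wpM2l // -scalemxAl N2Z -[leRHS]mulr1 ler_wpM2l ?kap_ge0 //.
by rewrite -powN2; apply: N2_pisom_le; exact: Bop_pisom.
Qed.

Lemma Aopd_close y : N2 (dag (Aop y) *m powop I w - powop I w) <= (2 * kap y + 2) / Nc%:R.
Proof.
have -> : dag (Aop y) *m powop I w - powop I w = (Nc%:R^-1 : R)%:C *: \sum_c dag (G y c) *m powop I w.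
  have -> : \sum_c dag (G y c) *m powop I w = \sum_c (dag ((beta_ y)^-1 *: Bop y c) *m powop I w - powop I w).
    by apply: eq_bigr => c _; rewrite dagB dag1 mulmxBl mul1mx.
  by rewrite sumrB sumr_const card_ord scalerBr avgw -mulmx_suml scalemxAl /Aop dagZ conjc_real dag_sum.
apply: N2_avg_orth => // [c|c d ncd]; last exact: Gdorth.
rewrite /G dagB dag1 mulmxBl mul1mx; apply: le_trans (N2B_le _ _) _.
rewrite powN2 mulr1 lerD2r ler_wpM2l // dagZ -scalemxAl N2Z sqnJ -[leRHS]mulr1 ler_wpM2l ?kap_ge0 //.
by rewrite -powN2; apply: N2_pisom_le; exact: Bop_dpisom.
Qed.

Lemma Aopd_bound y k (v : 'M[C]_(_, k)) : N2 (dag (Aop y) *m v) <= kap y * N2 v.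
Proof.
have -> : dag (Aop y) *m v = (Nc%:R^-1 : R)%:C *: \sum_c (conjc (beta_ y)^-1 *: (dag (Bop y c) *m v)).
  rewrite /Aop dagZ conjc_real -scalemxAl dag_sum mulmx_suml; congr (_ *: _).
  by apply: eq_bigr => c _; rewrite dagZ scalemxAl.
apply: N2_avg_le => // c; rewrite N2Z sqnJ ler_wpM2l ?kap_ge0 //.
by apply: N2_pisom_le; exact: Bop_dpisom.
Qed.

(** The defect of the Gram operator is that of [Aop y], passed through its bounded adjoint, plus
    that of the adjoint itself; [kap] bounds the squared norm of the adjoint uniformly in [Nc]. *)
Lemma Agram_close y : N2 (dag (Aop y) *m Aop y *m powop I w - powop I w)
  <= (2 * kap y + 2) ^+ 2 / Nc%:R.
Proof.
have -> : dag (Aop y) *m Aop y *m powop I w - powop I w =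
  dag (Aop y) *m (Aop y *m powop I w - powop I w) + (dag (Aop y) *m powop I w - powop I w).
  by rewrite mulmxBr !mulmxA subrKA.
apply: le_trans (N2D_le _ _) _.
have h1 := Aopd_bound y (Aop y *m powop I w - powop I w).
have h2 := Aop_close y; have h3 := Aopd_close y; have k0 := kap_ge0 y.
have h4 : kap y * N2 (Aop y *m powop I w - powop I w) <= kap y * ((2 * kap y + 2) / Nc%:R).
  exact: ler_wpM2l.
have -> : (2 * kap y + 2) ^+ 2 / Nc%:R = 2 * (kap y * ((2 * kap y + 2) / Nc%:R)) + 2 * ((2 * kap y + 2) / Nc%:R).
  by ring.
by apply: lerD; apply: ler_wpM2l => //; exact: le_trans h1 h4.
Qed.

(** Different [y] use disjoint copies. Commutation with the adjoint is included because polar parts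
    commute only under both relations. *)
Lemma Aop_comm y z : y != z -> Aop y *m Aop z = Aop z *m Aop y /\ dag (Aop y) *m Aop z = Aop z *m dag (Aop y).
Proof.
move=> nyz.
have K (c d : 'I_Nc) i : bop y c i = 1%:M \/ bop z d i = 1%:M.
  rewrite /bop; case: (eqVneq i.1 (y, c)) => [->|_]; last by left.
  by right; rewrite xpair_eqE (negbTE nyz).
have S (P Q : op F F) a b (f g : 'I_Nc -> op F F) : (forall c d, f c *m g d = g d *m f c) ->
   P = a *: \sum_c f c -> Q = b *: \sum_c g c -> P *m Q = Q *m P.
  move=> fg -> ->; rewrite -!scalemxAl -!scalemxAr !scalerA [b * a]mulrC; congr (_ *: _).
  rewrite mulmx_suml mulmx_sumr; apply: eq_bigr => c _.
  by rewrite mulmx_suml mulmx_sumr; apply: eq_bigr => d _.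
split.
  apply: S; [|by []|by []] => c d; rewrite -!scalemxAl -!scalemxAr !scalerA mulrC; congr (_ *: _).
  by rewrite !prod_mul; apply: eq_prod => i; case: (K c d i) => ->; rewrite mul1mx mulmx1.
apply: (S _ _ _ _ (fun c => dag ((beta_ y)^-1 *: Bop y c))); last 2 first.
- by rewrite dagZ dag_sum.
- by [].
move=> c d; rewrite dagZ -!scalemxAl -!scalemxAr !scalerA mulrC; congr (_ *: _).
rewrite prod_dag !prod_mul; apply: eq_prod => i.
by case: (K c d i) => ->; rewrite ?dag1 mul1mx mulmx1.
Qed.

End Avg.

(** * The phase reference and its commuting energy shifts *)

Section Frame.
Variable R : realType.
Local Notation C := R[i].
Local Notation op T U := 'M[C]_(#|{: T}|, #|{: U}|).

Lemma frame_arith (x y M A Q q : R) : x <= 2 * M + 2 * A -> y <= M -> A <= q -> M <= Q -> q <= Q ->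
  2 * x + 2 * y <= 10 * Q.
Proof. by lra. Qed.

Lemma polar_comm2 n (A B : 'M[C]_n) :
  A *m B = B *m A -> dag A *m B = B *m dag A ->
  polar A *m polar B = polar B *m polar A /\ dag (polar A) *m polar B = polar B *m dag (polar A).
Proof.
move=> h1 h2.
have h3 : dag B *m dag A = dag A *m dag B by rewrite -!dag_mul h1.
have h4 : dag B *m A = A *m dag B by have := congr1 (@dag _ _ _) h2; rewrite !dag_mul dagK.
have e1 := polar_comm h1 h2.
have e2 := polar_comm (esym h4) (esym h3).
split; first by symmetry; exact: (polar_comm (esym e1) (esym e2)).
have e3 : B *m dag (polar A) = dag (polar A) *m B.
  by have := congr1 (@dag _ _ _) e2; rewrite !dag_mul dagK.
have e4 : dag B *m dag (polar A) = dag (polar A) *m dag B.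
  by have := congr1 (@dag _ _ _) e1; rewrite !dag_mul.
by symmetry; exact: (polar_comm e3 e4).
Qed.

Lemma polar_raise (F : finType) (hF : F -> R) D (A : op F F) :
  raise hF hF D A -> raise hF hF D (polar A).
Proof.
move=> HA.
have gr : dag A *m A *m hdiag hF = hdiag hF *m (dag A *m A).
  by apply/econsE; rewrite /econs -(subrr D); exact: raise_mul (raise_dag HA) HA.
have gf : mxfun (@rsq R) (dag A *m A) *m hdiag hF = hdiag hF *m mxfun (@rsq R) (dag A *m A).
  by apply: mxfun_comm => //; rewrite dag_mul dagK.
by rewrite /polar -[D]add0r; apply: raise_mul HA _; exact/econsE.
Qed.

(** Polar parts of the averaged matrix units, completed on a ladder. The number of copies and the
    climb per shift are fixed by [eta] before the ladder height [Lm] is chosen, so the ladder can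
    later be fitted to any number of shifts. *)
Lemma frame_exists (T : finType) (h : T -> R) (rho : op T T) (Y : finType) (l : nat)
  (word : Y -> 'I_l -> T * T) (eta : R) :
  \tr rho = 1 -> (forall y q, en rho (word y q).2 (word y q).1 != 0) ->
  (forall y, 0 <= wordD h word y) -> 0 < eta ->
  exists (I : finType) (mstep : nat), forall (W : finType) (w : op T W), rho = w *m dag w ->
  forall Lm, exists Yop : Y -> op ({ffun I -> T} * ladder Y Lm) ({ffun I -> T} * ladder Y Lm),
  [/\ forall y, dag (Yop y) *m Yop y = 1%:M,
      forall y z, Yop y *m Yop z = Yop z *m Yop y,
      forall y, crz (wordD h word) (hpow h) mstep (wordD h word y) (Yop y) &
      forall y (U : finType) (wL : op (ladder Y Lm) U),
        N2 (Yop y *m tens (powop I w) wL - tens (powop I w) wL) <= eta * N2 wL].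
Proof.
move=> rho1 word0 Dpos eta0.
pose q y := 2 * kap rho word y + 2.
have q2 y : 2 <= q y by rewrite lerDr mulr_ge0 // kap_ge0.
(* Every group average has squared defect at most [q ^ 2 / Nc] for itself and for its Gram operator;
   the estimates for the polar part and for the completion multiply this by 10 in total
   ([frame_arith]). *)
pose Nc := (Num.truncn ((\sum_y 10 * (q y) ^+ 2) / eta)).+1.
have Nc0 : (0 < Nc)%N by [].
have hNc y : 10 * (q y) ^+ 2 / Nc%:R <= eta.
  rewrite ler_pdivrMr ?ltr0n // -ler_pdivrMl // [eta^-1 * _]mulrC.
  apply: le_trans (ltW (truncnS_gt _)); rewrite ler_pM2r ?invr_gt0 //.
  rewrite (bigD1 y) //= lerDl; apply: sumr_ge0 => z _.
  by rewrite mulr_ge0 // sqr_ge0.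
pose I : finType := (Y * 'I_Nc * 'I_l)%type.
pose A y := Aop rho Nc word y.
pose X y := polar (A y).
have HA y : raise (hpow h) (hpow h) (wordD h word y) (A y) by exact: raise_Aop.
have HX y : raise (hpow h) (hpow h) (wordD h word y) (X y) by apply: polar_raise; exact: HA.
have Xcomm y z : y != z -> X y *m X z = X z *m X y /\ dag (X y) *m X z = X z *m dag (X y).
  move=> nyz; have [c1 c2] := Aop_comm rho Nc word nyz.
  exact: polar_comm2.
have Xp y : X y *m dag (X y) *m X y = X y by exact: polar_pisom.
have Xc y (W : finType) (w : op T W) : rho = w *m dag w ->
    2 * N2 (X y *m powop I w - powop I w) + 2 * N2 (powop I w - dag (X y) *m X y *m powop I w) <= eta.
  move=> Ew.
  have a1 := polar_close (A y) (powop I w); have a2 := polar_def (A y) (powop I w).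
  have b1 := Aop_close Ew rho1 word0 Nc0 y.
  have b2 := Agram_close Ew rho1 word0 Nc0 y.
  apply: le_trans (hNc y).
  have qq : q y / Nc%:R <= (q y) ^+ 2 / Nc%:R.
    rewrite ler_pM2r ?invr_gt0 ?ltr0n // expr2 ler_peMr //.
      by apply: le_trans (q2 y).
    by apply: le_trans (q2 y); rewrite ler1n.
  rewrite -/(q y) in b1 b2.
  by rewrite -mulrA; exact: (frame_arith a1 a2 b1 b2 qq).
clearbody X; clear HA A hNc.
have [m Hm] : exists m : Y -> nat, forall y, wordD h word y != 0 -> mpow (dag (X y)) (m y) = 0.
  apply: (@fin_all_exists _ (fun=> nat) (fun y mm => wordD h word y != 0 -> mpow (dag (X y)) mm = 0)) => y.
  case: (eqVneq (wordD h word y) 0) => [E|D0]; first by exists 0%N => D0; case/eqP: D0.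
  have D0' : - wordD h word y != 0 by rewrite oppr_eq0.
  have [mm H] := raise_nilp (raise_dag (HX y)) D0'.
  by exists mm => _; exact: H.
exists I, (\max_y (m y).+1) => W w Ew Lm.
(* For zero shift the nilpotency argument fails, but the identity already does what is required. *)
pose Yop y := if wordD h word y == 0 then 1%:M else Yiso Lm y (X y).
exists Yop; split.
- move=> y; rewrite /Yop; case: eqP => [_|/eqP D0]; first by rewrite dag1 mul1mx.
  by apply: Yiso_isom => //; exact: Hm.
- move=> y z; rewrite /Yop; case: (eqVneq (wordD h word y) 0) => [_|Dy]; first by rewrite mul1mx mulmx1.
  case: (eqVneq (wordD h word z) 0) => [_|Dz]; first by rewrite mul1mx mulmx1.
  have [->//|nyz] := eqVneq y z.
  have [x1 x2] := Xcomm _ _ nyz.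
  have nzy : z != y by rewrite eq_sym.
  have [x3 x4] := Xcomm _ _ nzy.
  have k1 : tens (X z) (dag (lT R Lm z)) *m Yiso Lm y (X y) = Yiso Lm y (X y) *m tens (X z) (dag (lT R Lm z)).
    apply: Yiso_comm => //; first exact: Hm.
    + by rewrite !tens_mul mul1mx mulmx1 lT_commd.
    + rewrite !tens_mul x3; congr (tens _ _).
      by have := lT_comm R Lm y z => /(congr1 (@dag _ _ _)); rewrite !dag_mul => ->.
    + by rewrite tens_dag dagK !tens_mul x2 lT_commd.
  have k2 : dag (tens (X z) (dag (lT R Lm z))) *m Yiso Lm y (X y) = Yiso Lm y (X y) *m dag (tens (X z) (dag (lT R Lm z))).
    rewrite tens_dag dagK; apply: Yiso_comm => //; first exact: Hm.
    + by rewrite !tens_mul mul1mx mulmx1 lT_comm.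
    + by rewrite !tens_mul x4 lT_commd.
    + rewrite tens_dag dagK !tens_mul lT_comm; congr (tens _ _).
      by have := congr1 (@dag _ _ _) x1; rewrite !dag_mul.
  apply: Yiso_comm => //; first exact: Hm.
  by rewrite -(Yiso_commT _ _ (Hm y Dy)).
- move=> y; rewrite /Yop; case: (eqVneq (wordD h word y) 0) => [->|Dy].
    by apply: (crz_le (leq0n _)); exact: crz1.
  apply: (@crz_le _ _ _ _ _ _ (m y).+1); last by apply: Yiso_crz => //; exact: Hm.
  by rewrite (leq_bigmax (F := fun y => (m y).+1)).
- move=> y U wL; rewrite /Yop; case: (eqVneq (wordD h word y) 0) => [_|Dy].
    by rewrite mul1mx subrr N2_0 mulr_ge0 ?N2_ge0 // ltW.
  apply: le_trans (Yiso_close _ (Xp y) (Hm y Dy) _ _) _.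
  by apply: ler_wpM2r; [exact: N2_ge0|exact: Xc].
Qed.

End Frame.

(** * A finite bath exchanging source labels for target labels *)

Section Reservoir.
Variable R : realType.

Lemma card_ffun_eq (P : finType) (L : nat) (p : P) (v : 'I_L.+1) :
  (#|[set k : {ffun P -> 'I_L.+1} | k p == v]| * L.+1 = #|{: {ffun P -> 'I_L.+1}}|)%N.
Proof.
pose F q : pred 'I_L.+1 := if q == p then pred1 v else predT.
have -> : #|[set k : {ffun P -> 'I_L.+1} | k p == v]| = #|family F|.
  rewrite -[RHS]cardsE; apply: eq_card => k; rewrite !inE; apply/idP/familyP => [/eqP E q|/(_ p)].
    by rewrite /F; case: eqP => [->|//]; rewrite inE E.
  by rewrite /F eqxx inE.
rewrite card_family card_ffun card_ord -[(_ ^ #|P|)%N]prod_nat_const foldrE big_map.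
rewrite big_enum (bigD1 p) //= [RHS](bigD1 p) //= {1}/F eqxx card1 mul1n mulnC; congr (_ * _)%N.
by apply: eq_bigr => q nq; rewrite /F (negbTE nq) card_ord.
Qed.

(** The bath counts how often each exchange of [x] for [j] has occurred and stores the energy
    released. Level degeneracies grow with the Boltzmann factor, so the Gibbs weight is nearly flat
    over counters. The hypothesis says that all sources [(x, r, a)] with a given [j] arriving at one
    level fit into the pairs [(r', a')] available there. Injectivity is asked only for equal [jj a],
    since distinct [j] will be told apart by orthogonal target vectors. *)
Lemma reservoir (X J A : finType) (e : X -> R) (tau : J -> R) (jj : A -> J) (beta eps : R) :
  (0 < #|A|)%N -> 0 < eps ->
  (forall j, (#|[set a | jj a == j]|%:R / #|A|%:R) * expR (beta * tau j) *
     (\sum_x expR (- (beta * e x))) <= 2^-1) ->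
  exists (Q : finType) (hQ : Q -> R) (dom : pred Q) (stuff : X -> Q -> A -> Q * A),
  [/\ forall x r a, dom r -> e x + hQ r = tau (jj a) + hQ (stuff x r a).1,
      forall x x' r r' a a', dom r -> dom r' -> jj a = jj a' ->
        stuff x r a = stuff x' r' a' -> [/\ x = x', r = r' & a = a'],
      0 < \sum_r expR (- (beta * hQ r)) &
      \sum_(r | ~~ dom r) expR (- (beta * hQ r)) <= eps * \sum_r expR (- (beta * hQ r))].
Proof.
move=> A0 eps0 Hj.
pose P : finType := (X * J)%type.
(* A fraction at most [#|P| / (L + 1)] of the counters has some entry at the top, where a further
   increment would overflow; [L] makes this at most [eps / 2]. *)
pose L := (Num.truncn (2 * #|P|%:R / eps)).+1.
pose K : finType := {ffun P -> 'I_L.+1}.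
pose rk (k : K) : R := \sum_p (k p)%:R * (e p.1 - tau p.2).
pose Cc : R := \sum_k expR (- (beta * rk k)).
(* The ideal degeneracy, of Gibbs weight exactly [Cc] at every level. The choice of [Cc] gives
   [v k >= 1], so rounding down to [g k] loses at most a factor 2. *)
pose v k := Cc * expR (beta * rk k).
have v1 k : 1 <= v k.
  rewrite /v -ler_pdivrMr ?expR_gt0 // div1r -expRN /Cc (bigD1 k) //= lerDl.
  by apply: sumr_ge0 => *; exact: expR_ge0.
have v0 k : 0 <= v k by apply: le_trans (v1 k).
pose g k := Num.truncn (v k).
have gv k : (g k)%:R <= v k by rewrite /g truncn_le.
have vg k : v k <= 2 * (g k)%:R.
  have h1 : (1 <= g k)%N by rewrite /g truncn_gt0.
  have h2 : v k < (g k).+1%:R by exact: truncnS_gt.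
  have h3 : (1 : R) <= (g k)%:R by rewrite ler1n.
  by move: h2; rewrite -natr1; lra.
pose Q : finType := {k : K & 'I_(g k)}.
pose hQ (r : Q) := rk (tag r).
pose domK (k : K) := [forall p, (k p < L)%N].
pose dom (r : Q) := domK (tag r).
pose inc (p : P) (k : K) : K := [ffun q => if q == p then inord (k q).+1 else k q].
have incE p k : domK k -> rk (inc p k) = rk k + (e p.1 - tau p.2).
  move=> /forallP hk; rewrite /rk (bigD1 p) //= [in RHS](bigD1 p) //= ffunE eqxx inordK; last first.
    by rewrite ltnS; exact: hk.
  rewrite -natr1 mulrDl mul1r addrAC; congr (_ + _ + _).
  by apply: eq_bigr => q nq; rewrite ffunE (negbTE nq).
have incI p k k' : domK k -> domK k' -> inc p k = inc p k' -> k = k'.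
  move=> /forallP hk /forallP hk' E; apply/ffunP => q.
  move/ffunP: E => /(_ q); rewrite !ffunE; case: eqP => [_|//].
  move=> /(congr1 val) /=; rewrite !inordK ?ltnS; [|exact: hk'|exact: hk].
  by case=> h; apply: val_inj.
pose S (j : J) (k' : K) : {set X * Q * A} :=
  [set s | [&& jj s.2 == j, dom s.1.2 & inc (s.1.1, j) (tag s.1.2) == k']].
pose Tg (k' : K) : {set Q * A} := [set p | tag p.1 == k'].
have sumQ (F : K -> R) : \sum_(r : Q) F (tag r) = \sum_k (g k)%:R * F k.
  rewrite -(@sig_big_dep _ _ _ _ (fun k => 'I_(g k)) predT (fun=> predT) (fun i _ => F i)) /=.
  by apply: eq_bigr => k _; rewrite sumr_const card_ord mulr_natl.
have cTg k' : #|Tg k'|%:R = (g k')%:R * #|A|%:R :> R.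
  rewrite -sum1_card natr_sum.
  transitivity (\sum_(p : Q * A) ((tag p.1 == k')%:R : R)).
    rewrite [LHS]big_mkcond; apply: eq_bigr => p _; rewrite inE; by case: ifP.
  rewrite -(pair_bigA _ (fun (r : Q) (a : A) => ((tag r == k')%:R : R))) /=.
  under eq_bigr => r _ do rewrite sumr_const.
  rewrite (sumQ (fun k => (k == k')%:R *+ #|A|)) (bigD1 k') //= eqxx big1 ?addr0.
    by rewrite mulr_natr.
  by move=> k nk; rewrite (negbTE nk) mul0rn mulr0.
(* For each [x] only one level can reach [k'], with degeneracy at most [v k'] times the Boltzmann
   factor of the energy difference. *)
have cS j k' : #|S j k'|%:R <= v k' * expR (beta * tau j) * (\sum_x expR (- (beta * e x))) * #|[set a | jj a == j]|%:R.
  rewrite -sum1_card natr_sum.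
  have -> : \sum_(s in S j k') (1%:R : R) = \sum_x (\sum_(k | domK k && (inc (x, j) k == k')) (g k)%:R) * #|[set a | jj a == j]|%:R.
    rewrite big_mkcond /=.
    transitivity (\sum_x \sum_(r : Q) \sum_a (if ((x, r), a) \in S j k' then 1%:R else 0 : R)).
      by rewrite pair_bigA pair_bigA /=; apply: eq_bigr => -[[x r] a].
    apply: eq_bigr => x _.
    pose F k : R := if domK k && (inc (x, j) k == k') then #|[set a | jj a == j]|%:R else 0.
    transitivity (\sum_(r : Q) F (tag r)).
      apply: eq_bigr => r _; rewrite /F; case: ifP => [/andP[h1 h2]|h].
        rewrite -sum1_card natr_sum [RHS]big_mkcond; apply: eq_bigr => a _.
        by rewrite !inE /= /dom h1 h2 !andbT.
      rewrite big1 // => a _; rewrite !inE /= /dom h andbF //.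
    rewrite sumQ [in RHS]big_mkcond mulr_suml; apply: eq_bigr => k _.
    by rewrite /F; case: ifP => _; rewrite ?mulr0 ?mul0r.
  rewrite -mulr_suml ler_wpM2r ?ler0n // mulr_sumr; apply: ler_sum => x _.
  have rhs0 : 0 <= v k' * expR (beta * tau j) * expR (- (beta * e x)).
    by apply: mulr_ge0; [apply: mulr_ge0|]; rewrite ?expR_ge0 ?v0.
  case: (pickP (fun k => domK k && (inc (x, j) k == k'))) => [k0 /andP[d0 /eqP e0]|h]; last first.
    by rewrite big_pred0 ?rhs0 // => k; exact: h.
  rewrite (bigD1 k0) ?d0 ?e0 ?eqxx //= big1 ?addr0; last first.
    move=> k /andP[/andP[dk /eqP ek] nk]; case/eqP: nk.
    by apply: (incI (x, j)) => //; rewrite e0.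
  apply: le_trans (gv _) _.
  have -> : v k' = v k0 * expR (beta * (e x - tau j)).
    by rewrite /v -e0 incE //= mulrDr expRD mulrA.
  rewrite -!mulrA -!expRD.
  have -> : beta * (e x - tau j) + (beta * tau j + - (beta * e x)) = 0 by ring.
  by rewrite addr0.
have ST j k' : (#|S j k'| <= #|Tg k'|)%N.
  rewrite -(ler_nat R) cTg; apply: le_trans (cS j k') _.
  have A0' : (0 : R) < #|A|%:R by rewrite ltr0n.
  have := Hj j; set n_j : R := #|_|%:R; set E1 := expR _; set E2 := \sum_x _ => H.
  have : n_j * E1 * E2 <= 2^-1 * #|A|%:R.
    rewrite -ler_pdivrMr //; apply: le_trans H.
    by rewrite le_eqVlt; apply/orP; left; apply/eqP; ring.
  move=> H'; have H2 := ler_wpM2l (v0 k') H'.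
  have -> : v k' * E1 * E2 * n_j = v k' * (n_j * E1 * E2) by ring.
  apply: le_trans H2 _.
  have -> : v k' * (2^-1 * #|A|%:R) = (v k' / 2) * #|A|%:R by ring.
  rewrite ler_pM2r // ler_pdivrMr // mulrC; exact: vg.
(* Any injection of sources into available places will do; here a source goes to the place of equal
   rank in the enumerations. The default [(r, a)] is never reached on [dom]. *)
pose stuff x (r : Q) a : Q * A :=
  nth (r, a) (enum (Tg (inc (x, jj a) (tag r)))) (index (x, r, a) (enum (S (jj a) (inc (x, jj a) (tag r))))).
have inS x r a : dom r -> (x, r, a) \in S (jj a) (inc (x, jj a) (tag r)).
  by move=> dr; rewrite inE /= eqxx dr eqxx.
have idx x r a : dom r -> (index (x, r, a) (enum (S (jj a) (inc (x, jj a) (tag r)))) < size (enum (Tg (inc (x, jj a) (tag r)))))%N.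
  move=> dr; rewrite -cardE; apply: leq_trans (ST (jj a) _).
  by rewrite [X in (_ < X)%N]cardE index_mem mem_enum inS.
have stT x r a : dom r -> tag (stuff x r a).1 = inc (x, jj a) (tag r).
  move=> dr; have := mem_nth (r, a) (idx x r a dr).
  by rewrite -/(stuff x r a) mem_enum inE => /eqP.
have totQ : \sum_r expR (- (beta * hQ r)) = \sum_k (g k)%:R * expR (- (beta * rk k)).
  exact: (sumQ (fun k => expR (- (beta * rk k)))).
have vE k : v k * expR (- (beta * rk k)) = Cc.
  by rewrite /v -mulrA -expRD subrr expR0 mulr1.
have Cc0 : 0 < Cc.
  rewrite /Cc (bigD1 [ffun=> ord0]) //= ltr_pwDl ?expR_gt0 //.
  by apply: sumr_ge0 => *; exact: expR_ge0.
have tot_ge : Cc / 2 * #|K|%:R <= \sum_r expR (- (beta * hQ r)).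
  rewrite totQ; have -> : Cc / 2 * #|K|%:R = \sum_(k : K) Cc / 2.
    by rewrite sumr_const mulr_natr.
  apply: ler_sum => k _; rewrite -(vE k) mulrAC ler_pM2r ?expR_gt0 //.
  by rewrite ler_pdivrMr // mulrC vg.
have K0 : (0 : R) < #|K|%:R.
  by rewrite ltr0n; apply/card_gt0P; exists [ffun=> ord0].
exists Q, hQ, dom, stuff; split.
- move=> x r a dr; rewrite /hQ stT // incE //=; ring.
- move=> x x' r r' a a' dr dr' ja E.
  have Ek : inc (x, jj a) (tag r) = inc (x', jj a') (tag r') by rewrite -!stT // E.
  have h1 := idx x r a dr; have h2 := idx x' r' a' dr'.
  rewrite -Ek -ja in h2.
  move: E; rewrite /stuff -Ek -ja (set_nth_default (r', a') _ h1) => /eqP.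
  rewrite nth_uniq ?enum_uniq // => /eqP E.
  have m1 : (x, r, a) \in enum (S (jj a) (inc (x, jj a) (tag r))) by rewrite mem_enum inS.
  have m2 : (x', r', a') \in enum (S (jj a) (inc (x, jj a) (tag r))).
    by rewrite mem_enum Ek ja inS.
  have := nth_index (x, r, a) m1; rewrite E nth_index // => -[-> -> ->].
  by [].
- by apply: lt_le_trans tot_ge; rewrite mulr_gt0 // divr_gt0.
- apply: le_trans (_ : Cc * #|[set k | ~~ domK k]|%:R <= _).
    have -> : \sum_(r | ~~ dom r) expR (- (beta * hQ r)) = \sum_k (g k)%:R * (if domK k then 0 else expR (- (beta * rk k))).
      rewrite -(sumQ (fun k => if domK k then 0 else expR (- (beta * rk k)))) big_mkcond /=.
      by apply: eq_bigr => r _; rewrite if_neg.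
    rewrite -sum1_card natr_sum mulr_sumr [leRHS]big_mkcond /=; apply: ler_sum => k _.
    rewrite inE if_neg; case: ifP => _; first by rewrite mulr0.
    by rewrite mulr1 -(vE k) ler_pM2r ?expR_gt0.
  apply: le_trans (_ : eps * (Cc / 2 * #|K|%:R) <= _); last by rewrite ler_pM2l.
  have -> : eps * (Cc / 2 * #|K|%:R) = Cc * (eps / 2 * #|K|%:R) by ring.
  rewrite ler_pM2l //.
  have : #|[set k | ~~ domK k]|%:R <= \sum_(p : P) (#|[set k : K | k p == ord_max]|%:R : R).
    rewrite -sum1_card natr_sum.
    have -> : \sum_p (#|[set k : K | k p == ord_max]|%:R : R) = \sum_(k : K) \sum_p ((k p == ord_max)%:R : R).
      rewrite exchange_big; apply: eq_bigr => p _; rewrite -sum1_card natr_sum big_mkcond /=.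
      by apply: eq_bigr => k _; rewrite inE; case: ifP.
    rewrite big_mkcond /=; apply: ler_sum => k _; rewrite inE; case: ifP => [|_]; last first.
      by apply: sumr_ge0 => p _; rewrite ler0n.
    rewrite negb_forall => /existsP [p hp].
    rewrite (bigD1 p) //=.
    have -> : k p = ord_max :> 'I_L.+1 by apply/val_inj/eqP; rewrite eqn_leq -ltnS ltn_ord /= leqNgt.
    by rewrite eqxx lerDl; apply: sumr_ge0 => q _; rewrite ler0n.
  move=> /le_trans; apply.
  have L0 : (0 : R) < L.+1%:R by rewrite ltr0n.
  have cp (p : P) : #|[set k : K | k p == ord_max]|%:R = #|K|%:R / L.+1%:R :> R.
    by rewrite -(card_ffun_eq p ord_max) natrM mulfK // gt_eqF.
  under eq_bigr => p _ do rewrite cp.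
  rewrite sumr_const -[_ *+ #|_|]mulr_natr.
  have -> : #|K|%:R / L.+1%:R * #|P|%:R = (#|P|%:R / L.+1%:R) * #|K|%:R :> R by ring.
  rewrite ler_pM2r // ler_pdivrMr //.
  have : 2 * #|P|%:R / eps < L%:R by exact: truncnS_gt.
  rewrite ltr_pdivrMr // -[L.+1%:R]natr1 => h; move: eps0 h; nra.
Qed.

End Reservoir.

(** * Elementary growth estimates and a Chernoff bound *)

Section WeakLaw.
Variable R : realType.

(** From [expR x <= 1 / (1 - x)], whose right side is below the quadratic when [x <= 1/2]. *)
Lemma expR_quad (x : R) : x <= 2^-1 -> expR x <= 1 + x + 2 * x ^+ 2.
Proof.
move=> hx; have h0 : 0 < 1 - x by lra.
have h1 : expR x <= (1 - x)^-1.
  rewrite -[x in expR x]opprK expRN lef_pV2 ?posrE ?expR_gt0 //.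
  exact: expR_ge1Dx.
apply: le_trans h1 _; rewrite -div1r ler_pdivrMr //.
have := sqr_ge0 x; nra.
Qed.

Lemma bernoulli_ge (s : R) n : 0 <= s -> 1 + n%:R * s <= (1 + s) ^+ n.
Proof.
move=> s0; elim: n => [|n IH]; first by rewrite mul0r addr0 expr0.
rewrite exprS -natr1; have h : 0 <= (n%:R : R) * s by rewrite mulr_ge0.
by nra.
Qed.

Lemma geo_small (t eps : R) : 0 < t -> t < 1 -> 0 < eps ->
  exists m0, forall m, (m0 <= m)%N -> t ^+ m <= eps.
Proof.
move=> t0 t1 e0; pose s := t^-1 - 1.
have s0 : 0 < s by rewrite subr_gt0 invf_gt1.
have E : t^-1 = 1 + s by rewrite /s addrC subrK.
exists (Num.truncn ((eps * s)^-1)).+1 => m hm.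
have h1 : (eps * s)^-1 < m%:R by apply: lt_le_trans (truncnS_gt _) _; rewrite ler_nat.
have h2 := bernoulli_ge m (ltW s0).
have h3 : eps^-1 <= m%:R * s.
  by move: (ltW h1); rewrite invfM -ler_pdivlMr ?invrK ?invr_gt0.
have h4 : eps^-1 <= (t^-1) ^+ m by rewrite E; lra.
by rewrite -[t]invrK exprVn -[eps]invrK lef_pV2 ?posrE ?exprn_gt0 ?invr_gt0.
Qed.

Lemma expR_large (K d : R) : 0 < d -> exists m0, forall m, (m0 <= m)%N -> K <= expR (m%:R * d).
Proof.
move=> d0; exists (Num.truncn (K / d)).+1 => m hm.
apply: le_trans (expR_ge1Dx _).
have : K / d < m%:R by apply: lt_le_trans (truncnS_gt _) _; rewrite ler_nat.
rewrite ltr_pdivrMr //; lra.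
Qed.

(** The linear bound [m + 1 <= expR (m a) / a] is raised to the power [k] with [a] so small that
    only half the exponent is used; the other half absorbs the constant. *)
Lemma poly_small (k : nat) (d : R) : 0 < d ->
  exists m0, forall m, (m0 <= m)%N -> (m.+1)%:R ^+ k <= expR (m%:R * d).
Proof.
case: k => [|k] d0.
  by exists 0%N => m _; rewrite expr0 -[X in X <= _]expR0 ler_expR mulr_ge0 // ltW.
pose a := Num.min 1 (d / (2 * k.+1%:R)).
have k0 : (0 : R) < 2 * k.+1%:R by rewrite mulr_gt0 // ltr0n.
have a0 : 0 < a by rewrite lt_min ltr01 divr_gt0.
have a1 : a <= 1 by rewrite ge_min lexx.
have a2 : a * k.+1%:R <= d / 2.
  have : a <= d / (2 * k.+1%:R) by rewrite ge_min lexx orbT.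
  rewrite (ler_pdivlMr _ _ k0) => h; rewrite ler_pdivlMr //; apply: le_trans h.
  by rewrite le_eqVlt; apply/orP; left; apply/eqP; ring.
have d2 : 0 < d / 2 by lra.
have [m0 H] := expR_large (a^-1 ^+ k.+1) d2.
exists m0 => m hm; have := H m hm => h1.
clearbody a; have h2 : (m.+1)%:R <= a^-1 * expR (m%:R * a).
  rewrite ler_pdivlMl // -natr1; apply: le_trans (expR_ge1Dx _).
  have : (0 : R) <= m%:R by [].
  nra.
have h3 : (m.+1)%:R ^+ k.+1 <= (a^-1 * expR (m%:R * a)) ^+ k.+1.
  by apply: lerXn2r => //; rewrite nnegrE ?ler0n // mulr_ge0 ?expR_ge0 // invr_ge0 ltW.
apply: le_trans h3 _; rewrite exprMn -expRM_natr.
have -> : expR (m%:R * d) = expR (m%:R * (d / 2)) * expR (m%:R * (d / 2)).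
  by rewrite -expRD; congr expR; field.
apply: ler_pM => //; rewrite ?expR_ge0 ?exprn_ge0 ?invr_ge0 ?(ltW a0) //.
by rewrite ler_expR -mulrA ler_wpM2l.
Qed.

Lemma sum_prod (O I : finType) (q : O -> R) (g : O -> R) :
  \sum_(y : {ffun I -> O}) \prod_i (q (y i) * g (y i)) = (\sum_o q o * g o) ^+ #|I|.
Proof.
by rewrite -(bigA_distr_bigA (fun (_ : I) o => q o * g o)) prodr_const.
Qed.

Lemma sum_prod1 (O I : finType) (q : O -> R) : \sum_o q o = 1 ->
  \sum_(y : {ffun I -> O}) \prod_i q (y i) = 1.
Proof.
move=> q1; rewrite -(bigA_distr_bigA (fun (_ : I) o => q o)) big1 // => i _; exact: q1.
Qed.

Lemma sum_prod_add (O I : finType) (q f : O -> R) : \sum_o q o = 1 ->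
  \sum_(y : {ffun I -> O}) (\prod_i q (y i)) * (\sum_i f (y i)) = #|I|%:R * (\sum_o q o * f o).
Proof.
move=> q1.
under eq_bigr => y _ do rewrite mulr_sumr.
rewrite exchange_big /= mulr_natl -sumr_const; apply: eq_bigr => i _.
transitivity (\sum_(y : {ffun I -> O}) \prod_j (q (y j) * (if j == i then f (y j) else 1))).
  apply: eq_bigr => y _; rewrite big_split /=; congr (_ * _).
  by rewrite (bigD1 i) //= eqxx big1 ?mulr1 // => j nj; rewrite (negbTE nj).
rewrite -(bigA_distr_bigA (fun j o => q o * (if j == i then f o else 1))) (bigD1 i) //= eqxx.
rewrite [X in _ * X]big1 ?mulr1 // => j nj.
by rewrite (negbTE nj); under eq_bigr => o _ do rewrite mulr1.
Qed.

(** Exponential Markov inequality: the tail is at most [th ^ #|I|] with [th < 1] depending only on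
    [q], [f] and [delta], hence uniform over index types. *)
Lemma weak_law (O : finType) (q f : O -> R) (delta eps : R) :
  (forall o, 0 <= q o) -> \sum_o q o = 1 -> 0 < delta -> 0 < eps ->
  exists m0, forall I : finType, (m0 <= #|I|)%N ->
    \sum_(y : {ffun I -> O} | #|I|%:R * (\sum_o q o * f o + delta) <= \sum_i f (y i))
      \prod_i q (y i) <= eps.
Proof.
move=> q0 q1 d0 e0; set mu := \sum_o q o * f o.
pose g o := f o - mu.
pose B : R := 1 + \sum_o `|g o|.
have gB o : `|g o| <= B.
  by rewrite /B (bigD1 o) //= addrCA lerDl addr_ge0 // sumr_ge0.
have B1 : 1 <= B by rewrite lerDl sumr_ge0.
have qg : \sum_o q o * g o = 0.
  rewrite /g; under eq_bigr => o _ do rewrite mulrBr.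
  by rewrite sumrB -mulr_suml q1 mul1r subrr.
(* The first bound keeps exponents below 1/2 for [expR_quad]; the second makes the quadratic term at
   most half of [t * delta], so that [th < 1]. *)
pose t := Num.min (2 * B)^-1 (delta / (4 * B ^+ 2)).
have B0 : 0 < B by apply: lt_le_trans B1.
have t0 : 0 < t by rewrite lt_min invr_gt0 divr_gt0 // ?mulr_gt0 // ?exprn_gt0.
have tB : t * B <= 2^-1.
  have : t <= (2 * B)^-1 by rewrite ge_min lexx.
  by rewrite invfM ler_pdivlMr.
have td : 4 * t * B ^+ 2 <= delta.
  have : t <= delta / (4 * B ^+ 2) by rewrite ge_min lexx orbT.
  by rewrite ler_pdivlMr ?mulr_gt0 ?exprn_gt0 // => h; nra.
pose th := (1 + 2 * t ^+ 2 * B ^+ 2) / (1 + t * delta).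
have td0 : 0 < t * delta by rewrite mulr_gt0.
have tt : 4 * t ^+ 2 * B ^+ 2 <= t * delta by have := ler_wpM2l (ltW t0) td; rewrite expr2; lra.
have tb0 : 0 <= t ^+ 2 * B ^+ 2 by rewrite mulr_ge0 ?sqr_ge0.
have th0 : 0 < th by rewrite divr_gt0 //; lra.
have th1 : th < 1 by rewrite ltr_pdivrMr; lra.
have [m0 H] := geo_small th0 th1 e0.
exists m0 => I hI; apply: le_trans (H _ hI).
have mgf : \sum_o q o * expR (t * (g o - delta)) <= th.
  have h1 : \sum_o q o * expR (t * g o) <= 1 + 2 * t ^+ 2 * B ^+ 2.
    have -> : 1 + 2 * t ^+ 2 * B ^+ 2 = \sum_o q o * (1 + t * g o + 2 * t ^+ 2 * B ^+ 2).
      under eq_bigr => o _ do rewrite mulrDr mulrDr mulr1 [q o * (t * g o)]mulrCA.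
      by rewrite !big_split /= q1 -mulr_sumr qg mulr0 addr0 -mulr_suml q1 mul1r.
    apply: ler_sum => o _; apply: ler_wpM2l => //.
    apply: le_trans (expR_quad _) _.
      apply: le_trans tB; apply: le_trans (ler_wpM2l (ltW t0) (gB o)).
      by rewrite ler_pM2l // ler_norm.
    rewrite lerD2l exprMn mulrA ler_wpM2l ?mulr_ge0 ?sqr_ge0 ?(ltW t0) //.
    by rewrite -real_normK ?num_real // lerXn2r ?nnegrE ?(ltW B0).
  have h2 : expR (- (t * delta)) <= (1 + t * delta)^-1.
    rewrite expRN lef_pV2 ?posrE ?expR_gt0 //; first exact: expR_ge1Dx.
    by rewrite addr_gt0.
  have -> : \sum_o q o * expR (t * (g o - delta)) = (\sum_o q o * expR (t * g o)) * expR (- (t * delta)).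
    by rewrite mulr_suml; apply: eq_bigr => o _; rewrite -mulrA -expRD mulrBr.
  apply: ler_pM => //; rewrite ?expR_ge0 //.
  by apply: sumr_ge0 => o _; rewrite mulr_ge0 ?expR_ge0.
have mgf0 : 0 <= \sum_o q o * expR (t * (g o - delta)).
  by apply: sumr_ge0 => o _; rewrite mulr_ge0 ?expR_ge0.
have := lerXn2r #|I| mgf0 (ltW th0) mgf.
apply: le_trans; rewrite -(@sum_prod O I) big_mkcond /=; apply: ler_sum => y _.
case: ifP => hy; last by apply: prodr_ge0 => i _; rewrite mulr_ge0 ?expR_ge0.
rewrite big_split /= -[leLHS]mulr1 ler_wpM2l ?prodr_ge0 //.
rewrite -expR_sum -mulr_sumr -[X in X <= _]expR0 ler_expR mulr_ge0 ?(ltW t0) //.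
rewrite sumrB sumr_const /g sumrB sumr_const -mulr_natl -[delta *+ _]mulr_natl.
by move: hy; rewrite mulrDr; lra.
Qed.

End WeakLaw.

(** * Spectral decompositions and populations over finite types *)

Section Spec.
Variable R : realType.
Local Notation C := R[i].
Local Notation op T U := 'M[C]_(#|{: T}|, #|{: U}|).

Lemma herm_spec (T : finType) (K : eqType) (kappa : T -> K) (A : op T T) :
  dag A = A -> (forall x y, en A x y != 0 -> kappa x = kappa y) ->
  exists (u : op T T) (d : T -> R) (c : T -> K),
    [/\ dag u *m u = 1%:M, A = u *m hdiag d *m dag u &
        forall x k, en u x k != 0 -> kappa x = c k].
Proof.
move=> Ah Hk; have [|U [d [c [UU E Hc]]]] := @spectral_class R _ K (fun i => kappa (enum_val i)) A Ah.
  by move=> i j nz; apply: Hk; rewrite /en !enum_valK.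
exists (dag U), (fun k => d (enum_rank k)), (fun k => c (enum_rank k)); split.
- by rewrite dagK; exact/mulmx1C.
- rewrite dagK {1}E; congr (_ *m _ *m _); apply/matrixP => i j; rewrite !mxE enum_valK.
  by rewrite (inj_eq enum_val_inj); case: eqP => _; rewrite ?mulr1n ?mulr0n.
- move=> x k; rewrite /en mxE conjc_eq0 => nz; rewrite -(Hc _ _ nz) enum_rankK.
  by [].
Qed.

Definition spec (T : finType) (rho u : op T T) (p : T -> R) : Prop :=
  [/\ dag u *m u = 1%:M, rho = u *m hdiag p *m dag u, forall k, 0 <= p k & \sum_k p k = 1].

Lemma en_hdiag (T : finType) (d : T -> R) x y : en (hdiag d) x y = if x == y then (d x)%:C else 0.
Proof. exact: en_mk. Qed.

Lemma tr_hdiag (T : finType) (d : T -> R) : \tr (hdiag d) = (\sum_k d k)%:C.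
Proof. by rewrite tr_en rc_sum; apply: eq_bigr => x _; rewrite en_hdiag eqxx. Qed.

Lemma conj_isom n (u A : 'M[C]_n) (B : 'M[C]_n) : dag u *m u = 1%:M ->
  A = u *m B *m dag u -> B = dag u *m A *m u.
Proof. by move=> uu ->; rewrite !mulmxA uu mul1mx -mulmxA uu mulmx1. Qed.

Lemma dens_spec_class (T : finType) (K : eqType) (kappa : T -> K) (rho : op T T) :
  dens rho -> (forall x y, en rho x y != 0 -> kappa x = kappa y) ->
  exists (u : op T T) (p : T -> R) (c : T -> K), spec rho u p /\
     forall x k, en u x k != 0 -> kappa x = c k.
Proof.
move=> drho Hk; have [W [w E]] := dens_en drho.
have rh : dag rho = rho by rewrite E dag_mul dagK.
have [u [d [c [uu Er Hc]]]] := herm_spec rh Hk.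
exists u, d, c; split=> //; split=> //.
- move=> k; have := conj_isom uu Er; rewrite E => H.
  have : en (hdiag d) k k = en (dag (dag w *m u) *m (dag w *m u)) k k.
    by rewrite H dag_mul dagK !mulmxA.
  rewrite en_hdiag eqxx en_mul => Ek.
  suff -> : d k = \sum_z sqn (en (dag w *m u) z k) by apply: sumr_ge0 => z _; exact: sqn_ge0.
  by apply: rcI; rewrite Ek rc_sum; apply: eq_bigr => z _; rewrite en_dag sqnE.
- apply: rcI; rewrite -tr_hdiag (conj_isom uu Er) mxtrace_mulC mulmxA (mulmx1C uu) mul1mx.
  exact: (proj2 drho).
Qed.

Lemma dens_spec (T : finType) (rho : op T T) : dens rho ->
  exists (u : op T T) (p : T -> R), spec rho u p.
Proof.
move=> d; have [|u [p [c [H _]]]] := @dens_spec_class T unit (fun=> tt) rho d; first by [].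
by exists u, p.
Qed.

Lemma hdiag_mul (T : finType) (d e : T -> R) : hdiag d *m hdiag e = hdiag (fun x => d x * e x).
Proof.
apply: enP => x y; rewrite hdiagl !en_hdiag; case: eqP => _; last by rewrite mulr0.
by rewrite rmorphM.
Qed.

Lemma eq_hdiag (T : finType) (d e : T -> R) : d =1 e -> hdiag d = hdiag e.
Proof. by move=> H; apply: enP => x y; rewrite !en_hdiag H. Qed.

Lemma hdiag1 (T : finType) : hdiag (fun _ : T => 1) = 1%:M :> op T T.
Proof. by apply: enP => x y; rewrite en_hdiag en1; case: eqP. Qed.

Lemma spec_amp (T : finType) (rho u : op T T) (p : T -> R) : spec rho u p ->
  let w := u *m hdiag (fun k => Num.sqrt (p k)) in rho = w *m dag w.
Proof.
move=> [uu E p0 p1] w; rewrite /w dag_mul hdiag_dag !mulmxA -(mulmxA u) hdiag_mul E.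
congr (_ *m _ *m _); apply: eq_hdiag => k /=.
by rewrite -expr2 sqr_sqrtr.
Qed.

Lemma spec_dens (T : finType) (rho u : op T T) (p : T -> R) : spec rho u p -> dens rho.
Proof.
move=> H; split; first by eexists; eexists; exact: spec_amp H.
case: H => uu -> _ p1; rewrite mxtrace_mulC mulmxA uu mul1mx tr_hdiag p1.
by [].
Qed.

Lemma spec_pow (I T : finType) (rho u : op T T) (p : T -> R) : spec rho u p ->
  spec (powop I rho) (powop I u) (fun k : {ffun I -> T} => \prod_i p (k i)).
Proof.
move=> [uu E p0 p1]; split.
- rewrite prod_dag prod_mul -prod1; apply: eq_prod => i; exact: uu.
- have -> : hdiag (fun k : {ffun I -> T} => \prod_i p (k i)) = prodop (fun=> hdiag p).
    apply: enP => x y; rewrite en_hdiag en_prod.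
    under [RHS]eq_bigr => i _ do rewrite en_hdiag.
    case: (eqVneq x y) => [<-|nxy].
      by rewrite rmorph_prod; apply: eq_bigr => i _; rewrite eqxx.
    have [i Hi] : exists i, x i != y i.
      apply/existsP; apply: contraNT nxy; rewrite negb_exists => /forallP H.
      by apply/eqP/ffunP => i; have := H i; rewrite negbK => /eqP.
    by rewrite (bigD1 i) //= (negbTE Hi) mul0r.
  rewrite prod_dag !prod_mul; apply: eq_prod => i; exact: E.
- by move=> k; exact: prodr_ge0.
- exact: sum_prod1.
Qed.

Lemma N2_hdiagl (T U : finType) (f : T -> R) (A : op T U) :
  N2 (hdiag f *m A) = \sum_x f x ^+ 2 * \sum_y sqn (en A x y).
Proof.
rewrite N2_en; apply: eq_bigr => x _; rewrite mulr_sumr; apply: eq_bigr => y _.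
by rewrite hdiagl sqnM sqnC.
Qed.

Lemma N2_hdiagr (T U : finType) (f : U -> R) (A : op T U) :
  N2 (A *m hdiag f) = \sum_y f y ^+ 2 * \sum_x sqn (en A x y).
Proof.
rewrite N2_en exchange_big; apply: eq_bigr => y _; rewrite mulr_sumr; apply: eq_bigr => x _.
by rewrite hdiagr mulrC sqnM sqnC.
Qed.

Definition pop (T : finType) (rho : op T T) (x : T) : R := complex.Re (en rho x x).

Lemma amp_pop (T U : finType) (w : op T U) x : en (w *m dag w) x x = (\sum_y sqn (en w x y))%:C.
Proof.
rewrite en_mul rc_sum; apply: eq_bigr => y _; rewrite en_dag mulrC sqnE.
by [].
Qed.

Lemma dens_popE (T : finType) (rho : op T T) x : dens rho -> en rho x x = (pop rho x)%:C.
Proof. by move=> d; have [U [w ->]] := dens_en d; rewrite /pop amp_pop. Qed.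

Lemma dens_pop0 (T : finType) (rho : op T T) x : dens rho -> 0 <= pop rho x.
Proof.
move=> d; have [U [w ->]] := dens_en d; rewrite /pop amp_pop /=.
by apply: sumr_ge0 => y _; exact: sqn_ge0.
Qed.

Lemma dens_pop1 (T : finType) (rho : op T T) : dens rho -> \sum_x pop rho x = 1.
Proof.
move=> d; apply: rcI; rewrite rc_sum -[RHS](proj2 d) tr_en.
by apply: eq_bigr => x _; rewrite (dens_popE x d).
Qed.

Lemma pop_pow (I T : finType) (rho : op T T) (x : {ffun I -> T}) : dens rho ->
  pop (powop I rho) x = \prod_i pop rho (x i).
Proof.
move=> d; apply: rcI; rewrite -(dens_popE x (dens_pow _ d)) en_prod rmorph_prod.
by apply: eq_bigr => i _; rewrite (dens_popE _ d).
Qed.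

Lemma N2_hdiag_pop (T U : finType) (w : op T U) (Q : pred T) : 
  N2 (hdiag (fun x => (Q x)%:R) *m w) = \sum_(x | Q x) pop (w *m dag w) x.
Proof.
rewrite N2_hdiagl [RHS]big_mkcond; apply: eq_bigr => x _.
by rewrite /pop amp_pop /=; case: (Q x); rewrite ?expr1n ?expr0n ?mul1r ?mul0r.
Qed.

(** The weight of [P] depends only on the state, so an arbitrary amplitude may be traded for the
    spectral one. *)
Lemma N2_proj_amp n k k' (P : 'M[C]_n) (w : 'M[C]_(n, k)) (w' : 'M[C]_(n, k')) :
  w *m dag w = w' *m dag w' -> N2 (P *m w) = N2 (P *m w').
Proof.
move=> E; apply: rcI; rewrite -!N2E' !dag_mul; congr (\tr _).
by rewrite -!mulmxA (mulmxA w) E !mulmxA.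
Qed.

End Spec.

Lemma sum_sig (V : nmodType) (I : finType) (Q : pred I) (F : I -> V) :
  \sum_(i | Q i) F i = \sum_(x : {x | Q x}) F (val x).
Proof.
rewrite (reindex_omap (val : {x | Q x} -> I) insub) => [|i Qi]; last by rewrite insubT.
by apply: eq_bigl => -[i iA] /=; rewrite insubT ?iA /= eqxx.
Qed.

(** * A typical subspace of the source spanned by energy eigenvectors *)

Section Source.
Variable R : realType.
Local Notation C := R[i].
Local Notation op T U := 'M[C]_(#|{: T}|, #|{: U}|).
Variables (T : finType) (h : T -> R) (beta : R) (rho u : op T T) (p : T -> R).
Hypothesis beta0 : 0 < beta.
Hypothesis sp : spec rho u p.

(** Beta times the free energy, computed from eigenvalues and energy populations (see
    [free_bfree]). *)
Definition bfree : R := \sum_k p k * ln (p k) + beta * \sum_x pop rho x * h x.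

Section Fixed.
Variables (I : finType) (S' H' : R).
Local Notation D := {ffun I -> T}.
Local Notation m := (#|I|).
Let P (k : D) : R := \prod_i p (k i).
Let typ (k : D) : bool := [forall i, 0 < p (k i)] && (\sum_i - ln (p (k i)) < m%:R * S').
Let U := powop I u.

(** The type of a string, i.e. its letter counts. Energy depends only on the type, and there are
    only polynomially many types. *)
Definition cnt (y : D) : {ffun T -> 'I_m.+1} := [ffun t => inord #|[set i | y i == t]|].
Definition ecnt (c : {ffun T -> 'I_m.+1}) : R := \sum_t (c t)%:R * h t.

Lemma ecntE y : ecnt (cnt y) = hpow h y.
Proof.
rewrite /ecnt /hpow.
have -> : \sum_i h (y i) = \sum_i \sum_t (y i == t)%:R * h t.
  apply: eq_bigr => i _; rewrite (bigD1 (y i)) //= eqxx mul1r big1 ?addr0 // => t nt.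
  by rewrite eq_sym (negbTE nt) mul0r.
rewrite exchange_big; apply: eq_bigr => t _; rewrite -mulr_suml; congr (_ * _).
rewrite ffunE inordK; last by rewrite ltnS max_card.
rewrite -sum1_card natr_sum big_mkcond /=; apply: eq_bigr => i _.
by rewrite inE; case: ifP.
Qed.

Let Top : op D D := U *m hdiag (fun k => (typ k)%:R) *m dag U.

Let spI := spec_pow I sp.

Lemma typ_card : #|[set k | typ k]|%:R <= expR (m%:R * S').
Proof.
case: spI => _ _ P0 P1.
have h1 k : typ k -> expR (- (m%:R * S')) <= P k.
  move=> /andP[/forallP pp hs].
  have -> : P k = expR (\sum_i ln (p (k i))).
    by rewrite expR_sum; apply: eq_bigr => i _; rewrite lnK // posrE.
  rewrite ler_expR; move: hs; rewrite sumrN; lra.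
have : \sum_(k in [set k | typ k]) expR (- (m%:R * S')) <= 1.
  rewrite -[X in _ <= X]P1 [leRHS](bigID (mem [set k | typ k])) /=.
  rewrite -[leLHS]addr0; apply: lerD; last by apply: sumr_ge0 => k _; exact: P0.
  by apply: ler_sum => k; rewrite inE => /h1.
rewrite sumr_const -[X in X <= _]mulr_natr expRN ler_pdivrMl ?expR_gt0 //.
by rewrite mulr1.
Qed.

(** The typical projector need not commute with the Hamiltonian, so it is pinched to the type
    blocks. Each block then has rank at most the number of typical eigenvectors, and polynomially
    many blocks of energy at least [m H'] give the partition function bound. The support of the
    pinched projector still contains the typical subspace. *)
Lemma source_fixed (W : finType) (w : op T W) : rho = w *m dag w ->
  exists (X : finType) (xi : op D X) (e : X -> R),
  [/\ dag xi *m xi = 1%:M,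
      forall s x, en xi s x != 0 -> hpow h s = e x,
      \sum_x expR (- (beta * e x)) <= (m.+1)%:R ^+ #|T| * expR (m%:R * S') * expR (- (beta * (m%:R * H'))) &
      N2 (powop I w - xi *m dag xi *m powop I w) <=
        \sum_(k : D | m%:R * S' <= \sum_i - ln (p (k i))) P k +
        \sum_(y : D | hpow h y < m%:R * H') \prod_i pop rho (y i)].
Proof.
move=> Ew.
have [UU EU P0 P1] := spI; rewrite -/U in UU EU.
(* The pinching of the typical projector to blocks of constant type. *)
pose G : op D D := mk (fun y y' => if cnt y == cnt y' then en Top y y' else 0).
have Td : dag Top = Top by rewrite /Top !dag_mul dagK hdiag_dag mulmxA.
have Gd : dag G = G.
  apply: enP => x y; rewrite en_dag !en_mk eq_sym.
  by case: eqP => _; rewrite ?conjc0 // -en_dag Td.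
have Gk x y : en G x y != 0 -> cnt x = cnt y.
  by rewrite en_mk; case: (eqVneq (cnt x) (cnt y)) => // _; rewrite eqxx.
have [v [g [c [vv EG Hc]]]] := herm_spec Gd Gk.
pose low (c : {ffun T -> 'I_m.+1}) := ecnt c < m%:R * H'.
pose inX (k : D) := (g k != 0) && ~~ low (c k).
pose X : finType := {k : D | inX k}.
pose xi : op D X := mk (fun s x => en v s (val x)).
have TG k k' : c k = c k' -> en (dag v *m Top *m v) k k' = en (dag v *m G *m v) k k'.
  move=> ck; rewrite -(mulmxA (dag v) Top v) -(mulmxA (dag v) G v) !(en_mul (dag v)); apply: eq_bigr => y _.
  have [->|] := eqVneq (en (dag v) k y) 0; first by rewrite !mul0r.
  rewrite en_dag conjc_eq0 => /Hc cy; congr (_ * _); rewrite (en_mul Top) (en_mul G); apply: eq_bigr => y' _.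
  have [->|/Hc cy'] := eqVneq (en v y' k') 0; first by rewrite !mulr0.
  by rewrite [en G _ _]en_mk cy cy' ck eqxx.
have vGv : dag v *m G *m v = hdiag g by rewrite -(conj_isom vv EG).
exists X, xi, (fun x => ecnt (c (val x))); split.
- apply: enP => x y; rewrite en_mul en1.
  have := congr1 (fun A => en A (val x) (val y)) vv; rewrite en_mul en1 (inj_eq val_inj) => <-.
  by apply: eq_bigr => s _; rewrite !en_dag !en_mk.
- by move=> s x; rewrite en_mk => /Hc <-; rewrite ecntE.
(* Eigenvectors of type [cc] with nonzero eigenvalue have, in typical coordinates, an invertible
   diagonal Gram matrix, so they are no more numerous than the typical strings. *)
- have cX cc : #|[set x : X | c (val x) == cc]|%:R <= expR (m%:R * S').
    apply: le_trans typ_card; rewrite ler_nat.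
    pose A := [set x : X | c (val x) == cc]; pose B := [set k | typ k].
    pose Z : 'M[C]_(#|B|, #|A|) := \matrix_(i, j) en (dag U *m v) (enum_val i) (val (enum_val j)).
    have ZZ : dag Z *m Z = diag_mx (\row_j (g (val (enum_val j)))%:C).
      apply/matrixP => i j; rewrite mxE.
      have ci : c (val (enum_val i)) = cc by have := enum_valP i; rewrite inE => /eqP.
      have cj : c (val (enum_val j)) = cc by have := enum_valP j; rewrite inE => /eqP.
      transitivity (en (dag v *m Top *m v) (val (enum_val i)) (val (enum_val j))).
        have -> : dag v *m Top *m v = dag (dag U *m v) *m (hdiag (fun k => (typ k)%:R) *m (dag U *m v)).
          by rewrite dag_mul dagK /Top !mulmxA.
        rewrite en_mul.
        under [RHS]eq_bigr => k _ do rewrite hdiagl.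
        rewrite (bigID typ) /= [X in _ = _ + X]big1 ?addr0; last first.
          by move=> k /negbTE ->; rewrite mul0r mulr0.
        have -> : \sum_(k | typ k) en (dag (dag U *m v)) (val (enum_val i)) k *
            ((typ k)%:R%:C * en (dag U *m v) k (val (enum_val j))) =
           \sum_(k in B) en (dag (dag U *m v)) (val (enum_val i)) k * en (dag U *m v) k (val (enum_val j)).
          by apply: eq_big => [k|k hk]; rewrite ?inE // hk mul1r.
        rewrite (big_enum_val (fun k => en (dag (dag U *m v)) (val (enum_val i)) k * en (dag U *m v) k (val (enum_val j)))) /=.
        by apply: eq_bigr => k _; rewrite !mxE en_dag.
      rewrite TG ?ci ?cj // vGv en_hdiag !mxE (inj_eq val_inj) (inj_eq enum_val_inj).
      by case: eqP => [->|]; rewrite ?mulr1n ?mulr0n.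
    have ru : \rank (dag Z *m Z) = #|A|.
      apply: mxrank_unit; rewrite ZZ unitmxE det_diag unitfE; apply/prodf_neq0 => j _.
      rewrite mxE; have := valP (enum_val j) => /andP[gn _].
      by apply: contra gn => /eqP [->].
    rewrite -[X in (X <= _)%N]ru; apply: leq_trans (mxrankM_maxl _ _) _.
    by apply: leq_trans (rank_leq_col _) _.
  apply: le_trans (_ : \sum_(x : X) expR (- (beta * (m%:R * H'))) <= _).
    apply: ler_sum => x _; rewrite ler_expR lerN2 ler_pM2l //.
    by have /andP[_] := valP x; rewrite /low -leNgt.
  rewrite sumr_const -[X in X <= _]mulr_natl ler_wpM2r ?expR_ge0 //.
  have -> : #|X|%:R = \sum_cc (#|[set x : X | c (val x) == cc]|%:R : R).
    rewrite -natr_sum; congr (_%:R); rewrite -[LHS]sum1_card.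
    rewrite (partition_big (fun x : X => c (val x)) predT) //=; apply: eq_bigr => cc _.
    by rewrite -[RHS]sum1_card; apply: eq_bigl => x; rewrite inE.
  apply: le_trans (ler_sum _ (fun cc _ => cX cc)) _.
  by rewrite sumr_const card_ffun card_ord -[X in X <= _]mulr_natl natrX.
- pose w0 := U *m hdiag (fun k => Num.sqrt (P k)).
  have Ew0 : powop I w *m dag (powop I w) = w0 *m dag w0.
    rewrite -[RHS](spec_amp spI) prod_dag prod_mul; apply: eq_prod => i.
    by rewrite Ew.
  have -> : powop I w - xi *m dag xi *m powop I w = (1%:M - xi *m dag xi) *m powop I w.
    by rewrite mulmxBl mul1mx.
  rewrite (N2_proj_amp _ Ew0).
  have Exi : xi *m dag xi = v *m hdiag (fun k => (inX k)%:R) *m dag v.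
    apply: enP => x y; rewrite !en_mul.
    under [RHS]eq_bigr => k _ do rewrite hdiagr en_dag.
    rewrite (bigID inX) /= [X in _ = _ + X]big1 ?addr0; last first.
      by move=> k /negbTE ->; rewrite mulr0 mul0r.
    rewrite [RHS]sum_sig; apply: eq_bigr => k _; rewrite en_dag !en_mk (valP k) mulr1.
    by [].
  have E1 : 1%:M - xi *m dag xi = v *m hdiag (fun k => (~~ inX k)%:R) *m dag v.
    rewrite Exi -(mulmx1C vv) -{1}[v]mulmx1 -hdiag1 -mulmxBl -mulmxBr; congr (_ *m _ *m _).
    apply: enP => x y; rewrite en_sub !en_hdiag; case: eqP => _; last by rewrite subr0.
    by case: (inX x); rewrite ?subrr ?subr0.
  rewrite E1 -!mulmxA N2_isom // N2_hdiagl.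
  pose F k j := P j * sqn (en (dag v *m U) k j).
  have EF k : \sum_y sqn (en (dag v *m w0) k y) = \sum_j F k j.
    apply: eq_bigr => j _; rewrite /w0 mulmxA hdiagr sqnM sqnC sqr_sqrtr ?P0 // mulrC.
    by [].
  under eq_bigr => k _ do rewrite EF.
  have F0 k j : 0 <= F k j by rewrite mulr_ge0 ?sqn_ge0 ?P0.
  pose A1 := \sum_k \sum_(j | ~~ typ j) F k j.
  pose A2 := \sum_(k | low (c k)) \sum_j F k j.
  apply: le_trans (_ : A1 + A2 <= _).
    rewrite /A1 /A2 [X in _ + X]big_mkcond -big_split /=; apply: ler_sum => k _.
    rewrite /inX negb_and negbK; case: (boolP (low (c k))) => hl.
      rewrite orbT expr1n mul1r lerDr; apply: sumr_ge0 => j _; exact: F0.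
    rewrite orbF addr0; case: eqP => [g0|_]; last first.
      by rewrite expr0n mul0r; apply: sumr_ge0 => j _; exact: F0.
    rewrite expr1n mul1r [leLHS](bigID typ) /= big1 ?add0r // => j tj.
    (* A zero eigenvalue is a zero expectation of the positive operator [Top], so this eigenvector
       overlaps no typical eigenvector. *)
    have : en (dag v *m Top *m v) k k = 0 by rewrite TG // vGv en_hdiag eqxx g0.
    have -> : dag v *m Top *m v = (dag v *m U *m hdiag (fun k => (typ k)%:R)) *m dag (dag v *m U *m hdiag (fun k => (typ k)%:R)).
      rewrite !dag_mul dagK hdiag_dag !mulmxA; congr (_ *m _ *m _).
      rewrite -!mulmxA hdiag_mul; congr (_ *m (_ *m _)); apply: eq_hdiag => z.
      by case: (typ z); rewrite ?mulr1 ?mulr0.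
    rewrite amp_pop => /rcI/eqP; rewrite psumr_eq0; last by move=> *; exact: sqn_ge0.
    move=> /allP /(_ j); rewrite mem_index_enum => /(_ isT) /=.
    by rewrite hdiagr tj mulr1 /F => /eqP ->; rewrite mulr0.
  apply: lerD.
    rewrite /A1 exchange_big /=.
    have -> : \sum_(j | ~~ typ j) \sum_k F k j = \sum_(j | ~~ typ j) P j.
      apply: eq_bigr => j _; rewrite -mulr_sumr -[RHS]mulr1; congr (_ * _).
      have : en (dag (dag v *m U) *m (dag v *m U)) j j = 1.
        by rewrite dag_mul dagK !mulmxA -(mulmxA (dag U)) (mulmx1C vv) mulmx1 UU en1 eqxx.
      rewrite en_mul => H; apply: rcI; rewrite rc_sum -[RHS]H; apply: eq_bigr => k _.
      by rewrite en_dag sqnE.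
    rewrite [leLHS]big_mkcond [leRHS]big_mkcond; apply: ler_sum => j _ /=.
    rewrite /typ negb_and -leNgt; case: (boolP [forall i, 0 < p (j i)]) => /= [_|nj]; first by [].
    suff -> : P j = 0 by case: ifP.
    move: nj; rewrite negb_forall; case/existsP => i; rewrite -leNgt => hi.
    case: (sp) => _ _ pp _.
    by apply/eqP/prodf_eq0; exists i => //; rewrite eq_le hi pp.
  have -> : A2 = N2 (hdiag (fun k => (low (c k))%:R) *m (dag v *m w0)).
    rewrite N2_hdiagl /A2 big_mkcond; apply: eq_bigr => k _; rewrite EF.
    by case: (low _); rewrite ?expr1n ?expr0n ?mul1r ?mul0r.
  have -> : hdiag (fun k => (low (c k))%:R) *m (dag v *m w0) = dag v *m (hdiag (fun y => (low (cnt y))%:R) *m w0).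
    rewrite [LHS]mulmxA [RHS]mulmxA; congr (_ *m _); apply: enP => k y.
    rewrite hdiagl hdiagr en_dag mulrC.
    have [->|/Hc ->] := eqVneq (en v y k) 0; first by rewrite conjc0 !mul0r.
    by [].
  rewrite N2_isom; last by rewrite dagK; exact/mulmx1C.
  rewrite N2_hdiag_pop -(spec_amp spI) le_eqVlt; apply/orP; left; apply/eqP.
  apply: eq_big => [y|y _]; first by rewrite /low ecntE.
  by rewrite pop_pow //; exact: spec_dens sp.
Qed.

End Fixed.
End Source.

(** * Asymptotics of the source; rounding of the target *)

Section SourceTarget.
Variable R : realType.
Local Notation C := R[i].
Local Notation op T U := 'M[C]_(#|{: T}|, #|{: U}|).

(** Entropy fluctuations, energy fluctuations and the polynomial number of types each consume a
    quarter of [delta] in the exponent. *)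
Lemma source_exists (T : finType) (h : T -> R) (beta : R) (rho u : op T T) (p : T -> R) (delta eps : R) :
  0 < beta -> spec rho u p -> 0 < delta -> 0 < eps ->
  exists m0, forall I : finType, (m0 <= #|I|)%N -> forall (W : finType) (w : op T W), rho = w *m dag w ->
  exists (X : finType) (xi : op {ffun I -> T} X) (e : X -> R),
  [/\ dag xi *m xi = 1%:M,
      forall s x, en xi s x != 0 -> hpow h s = e x,
      \sum_x expR (- (beta * e x)) <= expR (- (#|I|%:R * (bfree h beta rho p - delta))) &
      N2 (powop I w - xi *m dag xi *m powop I w) <= eps].
Proof.
move=> b0 sp d0 e0; have [uu Er p0 p1] := sp.
have drho := spec_dens sp.
have d4 : 0 < delta / 4 by rewrite divr_gt0.
have db4 : 0 < delta / (4 * beta) by rewrite divr_gt0 // mulr_gt0.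
have e2 : 0 < eps / 2 by rewrite divr_gt0.
have [m1 H1] := weak_law (fun k => - ln (p k)) p0 p1 d4 e2.
(* Only low energies inflate the partition function, hence the upper tail of [- h]. *)
have [m2 H2] := weak_law (fun x => - h x) (fun x => dens_pop0 x drho) (dens_pop1 drho) db4 e2.
have [m3 H3] := poly_small #|T| d4.
exists (m1 + m2 + m3)%N => I hI W w Ew.
have hI1 : (m1 <= #|I|)%N by lia.
have hI2 : (m2 <= #|I|)%N by lia.
have hI3 : (m3 <= #|I|)%N by lia.
set S := \sum_o p o * - ln (p o) in H1.
set Hm := \sum_o pop rho o * - h o in H2.
have [X [xi [e [x1 x2 x3 x4]]]] := source_fixed h b0 sp I (S + delta / 4) (- (Hm + delta / (4 * beta))) Ew.
exists X, xi, e; split=> //.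
- apply: le_trans x3 _; apply: le_trans (_ : expR (#|I|%:R * (delta / 4)) * expR (#|I|%:R * (S + delta / 4)) *
    expR (- (beta * (#|I|%:R * - (Hm + delta / (4 * beta))))) <= _).
    by rewrite ler_wpM2r ?expR_ge0 // ler_wpM2r ?expR_ge0 // H3.
  rewrite -!expRD ler_expR.
  have -> : bfree h beta rho p = - S - beta * Hm.
    rewrite /bfree /S /Hm; congr (_ + _).
      by rewrite -sumrN; apply: eq_bigr => k _; rewrite mulrN opprK.
    rewrite -mulrN -sumrN; congr (_ * _); apply: eq_bigr => k _; by rewrite mulrN opprK.
  have bb : beta * (delta / (4 * beta)) = delta / 4 by field; rewrite gt_eqF.
  have -> : beta * (#|I|%:R * - (Hm + delta / (4 * beta))) = - (#|I|%:R * (beta * Hm + beta * (delta / (4 * beta)))) by ring.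
  rewrite bb -subr_ge0.
  have -> : - (#|I|%:R * (- S - beta * Hm - delta)) -
    (#|I|%:R * (delta / 4) + #|I|%:R * (S + delta / 4) -
      (- (#|I|%:R * (beta * Hm + delta / 4)))) = #|I|%:R * (delta / 4) by field.
  by rewrite mulr_ge0 // ltW.
- apply: le_trans x4 _; have -> : eps = eps / 2 + eps / 2 by field.
  apply: lerD; first exact: H1.
  apply: le_trans (H2 _ hI2); rewrite [leLHS]big_mkcond [leRHS]big_mkcond.
  apply: ler_sum => y _; have pp : 0 <= \prod_i pop rho (y i).
    by apply: prodr_ge0 => i _; exact: dens_pop0.
  case: ifP => [hy|_]; last by case: ifP.
  suff -> : #|I|%:R * (Hm + delta / (4 * beta)) <= \sum_i - h (y i) by [].
  by move: hy; rewrite /hpow sumrN mulrN ltrNr => /ltW.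
Qed.

Lemma tn_hdiag (T : finType) (f : T -> R) : tn (hdiag f) (\sum_x `|f x|).
Proof.
exists #|{: T}|, (hdiag (fun x => Num.sqrt `|f x|)), (hdiag (fun x => Num.sg (f x) * Num.sqrt `|f x|)).
have K (g : T -> R) : N2 (hdiag g) = \sum_x g x ^+ 2.
  rewrite -[hdiag g]mulmx1 N2_hdiagl; apply: eq_bigr => x _.
  rewrite (bigD1 x) //= en1 eqxx sqn1 big1 ?addr0 ?mulr1 // => y ny.
  by rewrite en1 eq_sym (negbTE ny) sqn0.
split.
- rewrite hdiag_dag hdiag_mul; apply: eq_hdiag => x.
  by rewrite mulrCA -expr2 sqr_sqrtr // -numEsg.
- by rewrite K; apply: ler_sum => x _; rewrite sqr_sqrtr.
- rewrite K; apply: ler_sum => x _; rewrite exprMn sqr_sqrtr // sqr_sg.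
  by case: eqP => [->|_]; rewrite ?mul0r ?mul1r ?normr0.
Qed.

(** * The target at fixed block length *)

Section TargetFixed.
Variables (I T : finType) (K : eqType) (kappa : T -> K) (h : T -> R) (rho u : op T T) (p : T -> R) (c : T -> K).
Hypothesis sp : spec rho u p.
Hypothesis uc : forall x k, en u x k != 0 -> kappa x = c k.
Local Notation D := {ffun I -> T}.
Variables (Pm Em a b : R).
Let P (k : D) : R := \prod_i p (k i).
Let typ (k : D) : bool := P k <= Pm.
Let win (y : D) : bool := hpow h y < Em.
Hypothesis Pm0 : 0 < Pm.
Hypothesis ha : \sum_(k | ~~ typ k) P k <= a.
Hypothesis hb : \sum_(y | ~~ win y) \prod_i pop rho (y i) <= b.
Hypothesis ab : a + b <= 2^-1.
Let class (y : D) : {ffun I -> K} := [ffun i => kappa (y i)].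
Let spI := spec_pow I sp.
Let U := powop I u.
Let w0 := U *m hdiag (fun k => Num.sqrt (P k)).
Let w1 := hdiag (fun y => (win y)%:R) *m w0 *m hdiag (fun k => (typ k)%:R).
Let Sg := w1 *m dag w1.

Let P0 k : 0 <= P k. Proof. by case: spI => _ _ H _; exact: H. Qed.

Let EN2 : N2 w0 - N2 w1 = N2 (w0 - w1) /\ N2 (w0 - w1) <= a + b /\ N2 w0 = 1.
Proof.
have EP (Q : pred D) : N2 (w0 *m hdiag (fun k => (Q k)%:R)) = \sum_(k | Q k) P k.
  rewrite /w0 -mulmxA hdiag_mul N2_isom; last by case: spI.
  rewrite -[hdiag _]mulmx1 N2_hdiagl [RHS]big_mkcond; apply: eq_bigr => k _.
  rewrite (bigD1 k) //= en1 eqxx sqn1 big1 ?addr0 ?mulr1; last first.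
    by move=> y ny; rewrite en1 eq_sym (negbTE ny) sqn0.
  by rewrite exprMn sqr_sqrtr //; case: (Q k); rewrite ?expr1n ?expr0n ?mulr1 ?mulr0.
have W1 x k : en w1 x k = (win x && typ k)%:R * en w0 x k.
  rewrite /w1 hdiagr hdiagl; case: (win x); case: (typ k); rewrite /= ?mul0r ?mulr0 ?mul1r ?mulr1 //.
have E0 : N2 w0 = 1.
  apply: dens_N2; rewrite -(spec_amp spI); exact: (proj2 (spec_dens spI)).
have E1 : N2 w0 - N2 w1 = N2 (w0 - w1).
  rewrite !N2_en -sumrB; apply: eq_bigr => x _; rewrite -sumrB; apply: eq_bigr => k _.
  rewrite en_sub W1; case: (_ && _); rewrite ?mul1r ?mul0r ?subrr ?subr0 ?sqn0 ?subr0 ?subrr //.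
split=> //; split=> //.
apply: le_trans (_ : N2 (hdiag (fun y => (~~ win y)%:R) *m w0) + N2 (w0 *m hdiag (fun k => (~~ typ k)%:R)) <= _).
  rewrite !N2_en -big_split /=; apply: ler_sum => x _; rewrite -big_split /=; apply: ler_sum => k _.
  rewrite en_sub W1 hdiagl [en (w0 *m _) x k]hdiagr; have := sqn_ge0 (en w0 x k).
  by case: (win x); case: (typ k); rewrite /= ?mul1r ?mul0r ?mulr1 ?mulr0 ?subrr ?subr0 ?sqn0 ?addr0 ?add0r ?lerDl //.
rewrite addrC; apply: lerD; first by rewrite EP.
apply: le_trans hb; rewrite (N2_hdiag_pop w0 (fun y => ~~ win y)) -(spec_amp spI).
by apply: ler_sum => y _; rewrite pop_pow //; exact: spec_dens sp.
Qed.

Let z := N2 w1.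
Let z1 : z <= 1. Proof. by have [E [_ e]] := EN2; rewrite /z -e -subr_ge0 E N2_ge0. Qed.
Let z2 : 1 - (a + b) <= z. Proof. by have [E [l e]] := EN2; move: l; rewrite -E e -/z; lra. Qed.

Let Sgd : dag Sg = Sg. Proof. by rewrite /Sg dag_mul dagK. Qed.

Let powc x k : en U x k != 0 -> class x = [ffun i => c (k i)].
Proof.
rewrite en_prod => /prodf_neq0 n0; apply/ffunP => i; rewrite !ffunE; apply: uc.
exact: n0.
Qed.

Let w1c x k : en w1 x k != 0 -> class x = [ffun i => c (k i)].
Proof.
rewrite /w1 hdiagr hdiagl /w0 hdiagr !mulf_eq0 !negb_or => /andP[/andP[_ /andP[nz _]] _].
exact: powc.
Qed.

Let Sgc x y : en Sg x y != 0 -> class x = class y.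
Proof.
rewrite /Sg en_mul => n0.
have [k /andP[n1 n2]] : exists k, (en w1 x k != 0) && (en (dag w1) k y != 0).
  apply/existsP; apply: contraNT n0; rewrite negb_exists => /forallP H; apply/eqP.
  rewrite big1 // => k _; have := H k; rewrite negb_and !negbK.
  by case/orP => /eqP ->; rewrite ?mul0r ?mulr0.
rewrite (w1c n1); move: n2; rewrite en_dag conjc_eq0 => n2.
by rewrite (w1c n2).
Qed.

(** The amplitude of the target is cut down to small eigenvalues and energies below [Em]. The
    resulting operator is diagonalized by vectors each within one class, with eigenvalues at most
    [Pm], which are rounded to multiples of a common fraction so that a uniform label in [A]
    reproduces them. In the error, [2 sqrt (a + b)] is the cut and the rest is rounding and
    renormalization. *)
Lemma target_fixed (Q : R) : 0 < Q ->
  exists (A J : finType) (jj : A -> J) (phi : op D J) (tau : J -> R) (Dd : D -> R),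
  [/\ (0 < #|A|)%N /\ dag phi *m phi = 1%:M,
      forall y j, en phi y j != 0 -> hpow h y + Dd y = tau j,
      forall y : D, exists y' : D, (forall i, kappa (y i) = kappa (y' i)) /\ Dd y = hpow h y' - hpow h y /\ 0 <= Dd y,
      forall j, #|[set x | jj x == j]|%:R / #|A|%:R <= 2 * (Pm + Q^-1) /\ tau j <= Em &
      tn (phi *m hdiag (fun j => #|[set x | jj x == j]|%:R / #|A|%:R) *m dag phi - powop I rho)
        (a + b + 2 * #|D|%:R / Q + 2 * Num.sqrt (a + b))].
Proof.
move=> Q0.
have [v [s [cc [vv Es Hc]]]] := herm_spec Sgd Sgc.
have sE j : s j = \sum_k sqn (en (dag v *m w1) j k).
  have := conj_isom vv Es; rewrite /Sg => H.
  have : en (hdiag s) j j = en ((dag v *m w1) *m dag (dag v *m w1)) j j.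
    by rewrite H [dag (dag v *m w1)]dag_mul dagK !mulmxA.
  by rewrite en_hdiag eqxx amp_pop => /rcI.
have s0 j : 0 <= s j by rewrite sE; apply: sumr_ge0 => k _; exact: sqn_ge0.
have sz : \sum_j s j = z.
  rewrite /z -(N2_isom (U := dag v)); last by rewrite dagK; exact/mulmx1C.
  by rewrite N2_en; apply: eq_bigr => j _; rewrite sE.
have sP j : s j <= Pm.
  pose B := dag v *m hdiag (fun y => (win y)%:R).
  have Ew1 : dag v *m w1 = B *m U *m hdiag (fun k => Num.sqrt (P k) * (typ k)%:R).
    by rewrite /w1 /w0 /B -!mulmxA hdiag_mul.
  have rowB : \sum_k sqn (en (B *m U) j k) <= 1.
    have UU' : U *m dag U = 1%:M by apply: mulmx1C; case: spI.
    have : en ((B *m U) *m dag (B *m U)) j j = en (B *m dag B) j j.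
      by rewrite dag_mul mulmxA -(mulmxA B) UU' mulmx1.
    rewrite !amp_pop => /rcI ->.
    have : en (dag v *m dag (dag v)) j j = 1 by rewrite dagK vv en1 eqxx.
    rewrite amp_pop => /(@rcI R _ 1) <-; apply: ler_sum => y _.
    rewrite /B hdiagr; case: (win y); rewrite ?mulr1 // mulr0 sqn0; exact: sqn_ge0.
  rewrite sE Ew1 -[leRHS]mulr1; apply: le_trans (ler_wpM2l (ltW Pm0) rowB).
  rewrite mulr_sumr; apply: ler_sum => k _; rewrite hdiagr sqnM sqnC mulrC.
  apply: ler_wpM2r; first exact: sqn_ge0.
  rewrite exprMn sqr_sqrtr //; case: (boolP (typ k)) => ht; rewrite ?expr1n ?expr0n ?mulr1 ?mulr0 //.
  exact: ltW.
pose inJ j := 0 < s j.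
pose J : finType := {j : D | inJ j}.
pose phi : op D J := mk (fun y j => en v y (val j)).
have phi1 : dag phi *m phi = 1%:M.
  apply: enP => x y; rewrite en_mul en1.
  have := congr1 (fun A => en A (val x) (val y)) vv; rewrite en_mul en1 (inj_eq val_inj) => <-.
  by apply: eq_bigr => k _; rewrite !en_dag !en_mk.
have ESg : Sg = phi *m hdiag (fun j : J => s (val j)) *m dag phi.
  rewrite Es; apply: enP => x y; rewrite !en_mul.
  under eq_bigr => k _ do rewrite hdiagr en_dag.
  rewrite (bigID inJ) /= [X in _ + X]big1 ?addr0; last first.
    move=> k; rewrite -leNgt => hk; have -> : s k = 0 by apply/le_anti; rewrite hk s0.
    by rewrite mulr0 mul0r.
  rewrite sum_sig; apply: eq_bigr => k _; rewrite hdiagr en_dag !en_mk.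
  by [].
(* Eigenvectors with nonzero eigenvalue lie in the range of [Sg], and so within the energy
   window. *)
have phiwin y j : en phi y j != 0 -> win y.
  rewrite en_mk; apply: contraNT => nw.
  have H : Sg *m v = v *m hdiag s by rewrite Es -mulmxA vv mulmx1.
  have := congr1 (fun A => en A y (val j)) H; rewrite hdiagr /Sg -mulmxA en_mul big1.
    move/esym/eqP; rewrite mulf_eq0 => /orP[//|/eqP /rcI E].
    by have := valP j; rewrite /inJ E ltxx.
  by move=> k _; rewrite /w1 hdiagr hdiagl (negbTE nw) !mul0r.
have phicl y j : en phi y j != 0 -> class y = cc (val j).
  by rewrite en_mk => /Hc.
(* Rounding [s * Q] upwards keeps every multiplicity positive and costs at most [1 / Q] per
   eigenvalue. *)
pose n (j : J) := (Num.truncn (s (val j) * Q)).+1.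
pose A : finType := {j : J & 'I_(n j)}.
have nA j : #|[set x : A | tag x == j]| = n j.
  rewrite -[LHS]sum1_card.
  have -> : (\sum_(x in [set x : A | tag x == j]) 1 = \sum_(x : A | (tag x == j) && true) 1)%N.
    by apply: eq_bigl => x; rewrite inE andbT.
  rewrite -(sig_big_dep (fun i => i == j) (fun=> predT) (fun _ _ => 1%N)) /= big_pred1_eq.
  by rewrite sum1_card card_ord.
have cA : #|A| = (\sum_j n j)%N.
  rewrite -[LHS]sum1_card -(@sig_big_dep _ _ _ _ (fun j => 'I_(n j)) predT (fun=> predT) (fun _ _ => 1%N)) /=.
  by apply: eq_bigr => j _; rewrite sum1_card card_ord.
have n1 j : s (val j) * Q <= (n j)%:R by apply: ltW; exact: truncnS_gt.
have n2 j : (n j)%:R <= s (val j) * Q + 1.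
  by rewrite -natr1 lerD2r truncn_le mulr_ge0 // ltW.
have szJ : \sum_(j : J) s (val j) = z.
  rewrite -sz [RHS](bigID inJ) /= [X in _ = _ + X]big1 ?addr0; last first.
    by move=> k; rewrite -leNgt => hk; apply/le_anti; rewrite hk s0.
  by rewrite [RHS]sum_sig.
have cJ : #|J|%:R <= #|D|%:R :> R by rewrite ler_nat card_sig max_card.
have A1 : z * Q <= #|A|%:R.
  by rewrite cA natr_sum -szJ mulr_suml; apply: ler_sum => j _.
have A2 : #|A|%:R <= z * Q + #|D|%:R.
  rewrite cA natr_sum; apply: le_trans (_ : \sum_(j : J) (s (val j) * Q + 1) <= _).
    by apply: ler_sum => j _.
  by rewrite big_split /= -mulr_suml szJ lerD2l sumr_const.
have zh : 2^-1 <= z by move: z2 ab; lra.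
have A0 : 0 < #|A|%:R :> R.
  by apply: lt_le_trans A1; rewrite mulr_gt0 //; move: zh; lra.
(* All configurations of a class are topped up to the highest energy found in the class within the
   window. This makes the added energy nonnegative, as the ladders require; outside the window the
   default [y] means adding nothing. *)
pose top (y : D) := if win y then [arg max_(y' > y | win y' && (class y' == class y)) hpow h y']%O else y.
have topP y : win y -> [/\ win (top y), class (top y) = class y &
    forall y', win y' -> class y' = class y -> hpow h y' <= hpow h (top y)].
  move=> wy; rewrite /top wy; case: arg_maxP; first by rewrite wy eqxx.
  move=> y' /andP[w' /eqP c'] H; split=> // y'' w'' c''; apply: H.
  by rewrite w'' c'' eqxx.
have topE y y' : win y -> win y' -> class y = class y' -> hpow h (top y) = hpow h (top y').
  move=> wy wy' cyy'; have [t1 t2 t3] := topP _ wy; have [t1' t2' t3'] := topP _ wy'.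
  by apply/le_anti; rewrite t3' ?t3 // ?t2 ?t2' ?cyy'.
pose Dd y := hpow h (top y) - hpow h y.
have exy (j : J) : exists y, en phi y j != 0.
  apply/existsP; apply: contraT; rewrite negb_exists => /forallP H.
  have := congr1 (fun A => en A j j) phi1; rewrite en_mul en1 eqxx big1 => [/eqP|y _].
    by rewrite eq_sym oner_eq0.
  by have := H y; rewrite negbK => /eqP ->; rewrite mulr0.
pose tau j := hpow h (top (xchoose (exy j))).
exists A, J, (fun x => tag x), phi, tau, Dd; split.
- by split=> //; rewrite -(ltr_nat R).
- move=> y j nz; rewrite /Dd addrC subrK /tau; have nz' := xchooseP (exy j).
  apply: topE; [exact: phiwin nz|exact: phiwin nz'|].
  by rewrite (phicl _ _ nz) (phicl _ _ nz').
- move=> y; exists (top y); case: (boolP (win y)) => wy.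
    have [t1 t2 t3] := topP _ wy; split; last by split=> //; rewrite subr_ge0 t3.
    by move=> i; move/ffunP: t2 => /(_ i); rewrite !ffunE.
  by rewrite /Dd /top (negbTE wy); split=> //; rewrite subrr.
- move=> j; split; last first.
    have nz' := xchooseP (exy j); rewrite /tau.
    by have [t1 _ _] := topP _ (phiwin _ _ nz'); exact: ltW.
  rewrite nA ler_pdivrMr //.
  apply: le_trans (_ : 2 * (Pm + Q^-1) * (2^-1 * Q) <= _).
    have -> : 2 * (Pm + Q^-1) * (2^-1 * Q) = Pm * Q + 1 by field; rewrite gt_eqF.
    by apply: le_trans (n2 j) _; rewrite lerD2r ler_pM2r.
  apply: ler_wpM2l; first by rewrite mulr_ge0 // addr_ge0 ?invr_ge0 ?ltW.
  by apply: le_trans A1; rewrite ler_pM2r.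
- apply: (@tn_trans _ _ _ Sg); last first.
    rewrite (spec_amp spI) -/w0; have [E [l e]] := EN2.
    have ab0 : 0 <= a + b by apply: le_trans l; exact: N2_ge0.
    apply: tnBC; apply: tn_diff; rewrite ?sqrtr_ge0 ?e // sqr_sqrtr //.
  rewrite ESg -mulmxBl -mulmxBr.
  have -> : hdiag (fun j : J => #|[set x : A | tag x == j]|%:R / #|A|%:R) - hdiag (fun j : J => s (val j)) =
     hdiag (fun j : J => (n j)%:R / #|A|%:R - s (val j)).
    apply: enP => x y; rewrite en_sub !en_hdiag nA; case: eqP => _; last by rewrite subr0.
    by rewrite rmorphB.
  apply: tn_isom => //; apply: tn_le (tn_hdiag _).
  apply: le_trans (_ : \sum_(j : J) (`|(n j)%:R / #|A|%:R - (n j)%:R / Q| + Q^-1) <= _).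
    apply: ler_sum => j _.
    have -> : (n j)%:R / #|A|%:R - s (val j) = ((n j)%:R / #|A|%:R - (n j)%:R / Q) + ((n j)%:R / Q - s (val j)).
      by rewrite subrKA.
    apply: le_trans (ler_normD _ _) _; rewrite lerD2l ger0_norm; last first.
      by rewrite subr_ge0 ler_pdivlMr.
    rewrite lerBlDr ler_pdivrMr // mulrDl mulVf ?gt_eqF // addrC; exact: n2.
  rewrite big_split /= sumr_const.
  have -> : \sum_(j : J) `|(n j)%:R / #|A|%:R - (n j)%:R / Q| = `|1 - #|A|%:R / Q|.
    under eq_bigr => j _ do rewrite -mulrBr normrM ger0_norm ?ler0n //.
    rewrite -mulr_suml -natr_sum -cA -{1}[#|A|%:R]ger0_norm ?ler0n // -normrM mulrBr.
    by rewrite mulfV ?gt_eqF.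
  have h1 : `|1 - #|A|%:R / Q| <= a + b + #|D|%:R / Q.
    have g1 : z <= #|A|%:R / Q by rewrite ler_pdivlMr.
    have g2 : #|A|%:R / Q <= z + #|D|%:R / Q.
      by rewrite ler_pdivrMr // mulrDl divfK ?gt_eqF.
    have g3 : 0 <= #|D|%:R / Q by rewrite divr_ge0 // ltW.
    rewrite ler_norml; move: g1 g2 g3 z1 z2; lra.
  have h2 : Q^-1 *+ #|J| <= #|D|%:R / Q.
    by rewrite -[Q^-1 *+ _]mulr_natl ler_pM2r ?invr_gt0.
  have -> : 2 * #|D|%:R / Q = #|D|%:R / Q + #|D|%:R / Q by ring.
  by move: h1 h2; lra.
Qed.

End TargetFixed.
End SourceTarget.

(** * Asymptotics of the target *)

Section Target.
Variable R : realType.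
Local Notation C := R[i].
Local Notation op T U := 'M[C]_(#|{: T}|, #|{: U}|).

(** Eigenvalue fluctuations, energy fluctuations and the constant factor 4 from rounding each use a
    third of [delta]. *)
Lemma target_exists (T : finType) (K : eqType) (kappa : T -> K) (h : T -> R) (beta : R)
    (rho u : op T T) (p : T -> R) (c : T -> K) (delta eps : R) :
  0 < beta -> spec rho u p -> (forall x k, en u x k != 0 -> kappa x = c k) ->
  0 < delta -> 0 < eps ->
  exists (n : nat), let I := 'I_n.+1 in
  exists (A J : finType) (jj : A -> J) (phi : op {ffun I -> T} J) (tau : J -> R)
    (Dd : {ffun I -> T} -> R),
  [/\ (0 < #|A|)%N /\ dag phi *m phi = 1%:M,
      forall y j, en phi y j != 0 -> hpow h y + Dd y = tau j,
      forall y : {ffun I -> T}, exists y' : {ffun I -> T},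
        (forall i, kappa (y i) = kappa (y' i)) /\ Dd y = hpow h y' - hpow h y /\ 0 <= Dd y,
      forall j, (#|[set x | jj x == j]|%:R / #|A|%:R) * expR (beta * tau j)
        <= expR (#|I|%:R * (bfree h beta rho p + delta)) &
      tn (phi *m hdiag (fun j => #|[set x | jj x == j]|%:R / #|A|%:R) *m dag phi - powop I rho) eps].
Proof.
move=> b0 sp uc d0 e0; have [uu Er p0 p1] := sp.
have drho := spec_dens sp.
pose dl := delta / 3; have dl0 : 0 < dl by rewrite divr_gt0.
have dlb : 0 < dl / beta by rewrite divr_gt0.
(* The three bounds serve [a + b <= 1/2], [a + b <= eps / 3] and [2 sqrt (a + b) <= eps / 3]. *)
pose e1 := Num.min (4^-1) (Num.min (eps / 6) (eps ^+ 2 / 72)).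
have e10 : 0 < e1 by rewrite !lt_min invr_gt0 ltr0n /= !divr_gt0 ?exprn_gt0 ?ltr0n.
have e1a : e1 <= 4^-1 by rewrite ge_min lexx.
have e1b : e1 <= eps / 6 by rewrite !ge_min lexx orbT.
have e1c : e1 <= eps ^+ 2 / 72 by rewrite !ge_min lexx !orbT.
have [m1 H1] := weak_law (fun k => ln (p k)) p0 p1 dl0 e10.
have [m2 H2] := weak_law h (fun x => dens_pop0 x drho) (dens_pop1 drho) dlb e10.
have [m3 H3] := expR_large 4 dl0.
pose n := (m1 + m2 + m3)%N.
exists n => I; pose m : R := #|I|%:R.
have hI : #|I| = n.+1 by rewrite card_ord.
have hI1 : (m1 <= #|I|)%N by rewrite hI /n; lia.
have hI2 : (m2 <= #|I|)%N by rewrite hI /n; lia.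
have hI3 : (m3 <= #|I|)%N by rewrite hI /n; lia.
set S := \sum_o p o * ln (p o) in H1.
set Hm := \sum_o pop rho o * h o in H2.
pose Pm := expR (m * (S + dl)).
pose Em := m * (Hm + dl / beta).
have Pm0 : 0 < Pm by exact: expR_gt0.
pose D : finType := {ffun I -> T}.
(* The first term gives [1 / Q <= Pm], the second makes the rounding error at most [eps / 3]. *)
pose Q := Pm^-1 + 6 * #|D|%:R / eps.
have DQ : 0 <= 6 * #|D|%:R / eps by apply: divr_ge0; [exact: mulr_ge0|exact: ltW].
have Q0 : 0 < Q by rewrite ltr_pwDl ?invr_gt0.
have ha : \sum_(k : {ffun I -> T} | ~~ (\prod_i p (k i) <= Pm)) \prod_i p (k i) <= e1.
  apply: le_trans (H1 I hI1); rewrite [leLHS]big_mkcond [leRHS]big_mkcond /=.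
  apply: ler_sum => k _; have pp : 0 <= \prod_i p (k i) by apply: prodr_ge0.
  case: ifP => [hk|_]; last by case: ifP.
  suff -> : #|I|%:R * (S + dl) <= \sum_i ln (p (k i)) by [].
  move: hk; rewrite -ltNge => hk.
  have kp i : 0 < p (k i).
    rewrite lt0r p0 andbT; apply/eqP => E.
    have := lt_trans Pm0 hk; rewrite (bigD1 i) //= E mul0r ltxx.
    by [].
  have -> : \sum_i ln (p (k i)) = ln (\prod_i p (k i)).
    have -> : \prod_i p (k i) = expR (\sum_i ln (p (k i))).
      by rewrite expR_sum; apply: eq_bigr => i _; rewrite lnK // posrE.
    by rewrite expRK.
  rewrite -ler_expR lnK ?posrE; last exact: lt_trans hk.
  exact: ltW.
have hb : \sum_(y : {ffun I -> T} | ~~ (hpow h y < Em)) \prod_i pop rho (y i) <= e1.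
  apply: le_trans (H2 I hI2); rewrite [leLHS]big_mkcond [leRHS]big_mkcond /=.
  by apply: ler_sum => k _; rewrite -leNgt /hpow /Em /m.
have ab : e1 + e1 <= 2^-1 by move: e1a; lra.
have [A [J [jj [phi [tau [Dd [t1 t2 t3 t4 t5]]]]]]] := target_fixed sp uc Pm0 ha hb ab Q0.
exists A, J, jj, phi, tau, Dd; split=> //.
- move=> j; have [q1 q2] := t4 j.
  have Qi : Q^-1 <= Pm.
    rewrite -[Pm]invrK lef_pV2 ?posrE ?invr_gt0 // lerDl; exact: DQ.
  apply: le_trans (_ : 4 * Pm * expR (beta * Em) <= _).
    apply: ler_pM => //; rewrite ?expR_ge0 ?divr_ge0 //.
      by apply: le_trans q1 _; move: Qi; lra.
    by rewrite ler_expR ler_pM2l.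
  apply: le_trans (_ : expR (m * dl) * Pm * expR (beta * Em) <= _).
    rewrite ler_pM2r ?expR_gt0 // ler_pM2r //; exact: H3.
  rewrite /Pm -!expRD ler_expR /Em /bfree -/S -/Hm.
  have bb : beta * (m * (Hm + dl / beta)) = m * (beta * Hm + dl).
    by field; rewrite gt_eqF.
  have dd : delta = 3 * dl by rewrite /dl; field.
  by rewrite bb -/m dd le_eqVlt; apply/orP; left; apply/eqP; ring.
- apply: tn_le t5.
  have s1 : Num.sqrt (e1 + e1) <= eps / 6.
    have e6 : 0 <= eps / 6 by apply: divr_ge0; [exact: ltW|].
    rewrite -[leRHS](ger0_norm e6) -sqrtr_sqr ler_sqrt ?sqr_ge0 //.
    by move: e1c; rewrite expr_div_n; lra.
  have s2 : 2 * #|D|%:R / Q <= eps / 3.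
    rewrite ler_pdivrMr // mulrDr.
    have -> : eps / 3 * (6 * #|D|%:R / eps) = 2 * #|D|%:R by field; rewrite gt_eqF.
    by rewrite lerDr mulr_ge0 ?divr_ge0 ?invr_ge0 ?(ltW e0) ?(ltW Pm0).
  by move: s1 s2 e1b; rewrite -/D; lra.
Qed.

End Target.

(** * Thermal maps and the cyclic catalyst *)

Section Gibbs.
Variable R : realType.
Local Notation C := R[i].
Local Notation op T U := 'M[C]_(#|{: T}|, #|{: U}|).

Lemma sum_pair (V : nmodType) (T U : finType) (F : T * U -> V) : \sum_p F p = \sum_a \sum_b F (a, b).
Proof. by rewrite pair_bigA; apply: eq_bigr => -[a b]. Qed.

Definition gibbsp (E : finType) (beta : R) (h : E -> R) (x : E) : R :=
  expR (- (beta * h x)) / \sum_y expR (- (beta * h y)).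
Definition gibbsop (E : finType) (beta : R) (h : E -> R) : op E E := hdiag (gibbsp beta h).

Lemma gibbs_sum0 (E : finType) (beta : R) (h : E -> R) (x : E) : 0 < \sum_y expR (- (beta * h y)).
Proof. by rewrite (bigD1 x) //= ltr_wpDr ?expR_gt0 //; apply: sumr_ge0 => *; exact: expR_ge0. Qed.

Lemma gibbsp_gt0 (E : finType) (beta : R) (h : E -> R) x : 0 < gibbsp beta h x.
Proof. by rewrite divr_gt0 ?expR_gt0 // (gibbs_sum0 _ _ x). Qed.

Lemma gibbsp_sum (E : finType) (beta : R) (h : E -> R) : (0 < #|E|)%N -> \sum_x gibbsp beta h x = 1.
Proof.
move=> /card_gt0P[x _]; rewrite -mulr_suml divff // gt_eqF //; exact: gibbs_sum0 x.
Qed.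

Lemma dens_hdiag (E : finType) (p : E -> R) : (forall x, 0 <= p x) -> \sum_x p x = 1 -> dens (hdiag p).
Proof.
move=> p0 p1; split; last by rewrite tr_hdiag p1.
exists #|E|, (hdiag (fun x => Num.sqrt (p x))); rewrite hdiag_dag hdiag_mul; apply: eq_hdiag => x.
by rewrite -expr2 sqr_sqrtr.
Qed.

Lemma dens_gibbs (E : finType) (beta : R) (h : E -> R) : (0 < #|E|)%N -> dens (gibbsop beta h).
Proof. by move=> E0; apply: dens_hdiag => [x|]; [exact/ltW/gibbsp_gt0|exact: gibbsp_sum]. Qed.

Definition thmap (S E : finType) (beta : R) (hE : E -> R) (U : op (S * E) (S * E)) (X : op S S) : op S S :=
  pt2 (U *m tens X (gibbsop beta hE) *m dag U).

Lemma dens_thmap (S E : finType) beta (hE : E -> R) (U : op (S * E) (S * E)) X :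
  (0 < #|E|)%N -> dag U *m U = 1%:M -> dens X -> dens (thmap beta hE U X).
Proof.
by move=> E0 U1 dX; apply/dens_pt2/dens_isom => //; apply: dens_tens => //; exact: dens_gibbs.
Qed.

Lemma tn_thmap (S E : finType) beta (hE : E -> R) (U : op (S * E) (S * E)) X e :
  (0 < #|E|)%N -> dag U *m U = 1%:M -> tn X e -> tn (thmap beta hE U X) e.
Proof.
by move=> E0 U1 dX; apply/tn_pt2/tn_isom => //; apply: tn_tensr => //; exact: dens_gibbs.
Qed.

Lemma pt2K_tens (T T' E : finType) (K : op T T') u : @pt2K R T E u *m tens K 1%:M = K *m @pt2K R T' E u.
Proof.
apply: enP => x [y v]; rewrite !en_mul sum_pair.
transitivity (en K x y * (u == v)%:R).
  rewrite (bigD1 x) //= [X in _ + X]big1 ?addr0 => [|x' nx]; last first.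
    by rewrite big1 // => b _; rewrite en_mk /= eq_sym (negbTE nx) mul0r.
  rewrite (bigD1 u) //= big1 ?addr0 => [|b nb]; last by rewrite en_mk /= [u == b]eq_sym (negbTE nb) andbF mul0r.
  by rewrite en_mk /= !eqxx mul1r en_tens en1.
rewrite (bigD1 y) //= big1 ?addr0 => [|z nz]; last by rewrite en_mk /= (negbTE nz) mulr0.
by rewrite en_mk /= eqxx.
Qed.

Lemma pt2_conj (T T' E : finType) (K K' : op T T') (X : op (T' * E) (T' * E)) :
  pt2 (tens K 1%:M *m X *m dag (tens K' 1%:M)) = K *m pt2 X *m dag K'.
Proof.
rewrite -!pt2KE /krausmap mulmx_sumr mulmx_suml; apply: eq_bigr => u _.
by rewrite !mulmxA pt2K_tens -mulmxA -[X in _ *m X]dag_mul pt2K_tens dag_mul !mulmxA.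
Qed.

Lemma pt1_conj (T E E' : finType) (K : op E E') (X : op (T * E') (T * E')) :
  pt1 (tens 1%:M K *m X *m dag (tens 1%:M K)) = K *m pt1 X *m dag K.
Proof.
have HK u : @pt1K R T E u *m tens 1%:M K = K *m @pt1K R T E' u.
  apply: enP => x [y v]; rewrite !en_mul sum_pair.
  transitivity (en K x v * (u == y)%:R).
    rewrite (bigD1 u) //= [X in _ + X]big1 ?addr0 => [|x' nx]; last first.
      by rewrite big1 // => b _; rewrite en_mk /= [u == x']eq_sym (negbTE nx) mul0r.
    rewrite (bigD1 x) //= big1 ?addr0 => [|b nb]; last by rewrite en_mk /= [x == b]eq_sym (negbTE nb) andbF mul0r.
    by rewrite en_mk /= !eqxx mul1r en_tens en1 mulrC.
  rewrite (bigD1 v) //= big1 ?addr0 => [|z nz]; last by rewrite en_mk /= (negbTE nz) andbF mulr0.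
  by rewrite en_mk /= eqxx andbT.
rewrite -!pt1KE /krausmap mulmx_sumr mulmx_suml; apply: eq_bigr => u _.
by rewrite !mulmxA HK -mulmxA -[X in _ *m X]dag_mul HK dag_mul !mulmxA.
Qed.

Lemma pt1_sum (T U I : finType) (X : I -> op (T * U) (T * U)) : pt1 (\sum_i X i) = \sum_i pt1 (X i).
Proof.
apply: enP => x y; rewrite [LHS]en_mk; under eq_bigr => t _ do rewrite en_sum.
by rewrite exchange_big [RHS]en_sum; apply: eq_bigr => i _; rewrite en_mk.
Qed.
Lemma pt2_sum (T U I : finType) (X : I -> op (T * U) (T * U)) : pt2 (\sum_i X i) = \sum_i pt2 (X i).
Proof.
apply: enP => x y; rewrite [LHS]en_mk; under eq_bigr => t _ do rewrite en_sum.
by rewrite exchange_big [RHS]en_sum; apply: eq_bigr => i _; rewrite en_mk.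
Qed.
Lemma pt1Z (T U : finType) a (X : op (T * U) (T * U)) : pt1 (a *: X) = a *: pt1 X.
Proof. by apply: enP => x y; rewrite en_scale !en_mk mulr_sumr; apply: eq_bigr => t _; rewrite en_scale. Qed.
Lemma pt2Z (T U : finType) a (X : op (T * U) (T * U)) : pt2 (a *: X) = a *: pt2 X.
Proof. by apply: enP => x y; rewrite en_scale !en_mk mulr_sumr; apply: eq_bigr => t _; rewrite en_scale. Qed.
Lemma tens_sumr (T T' U U' I : finType) (A : op T T') (B : I -> op U U') :
  tens A (\sum_i B i) = \sum_i tens A (B i).
Proof.
apply: enP => x y; rewrite en_sum en_tens en_sum mulr_sumr.
by apply: eq_bigr => i _; rewrite en_tens.
Qed.

(** Exact return of the catalyst, together with closeness of the joint output to a product. This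
    single estimate controls both the accuracy and the correlation. *)
Definition Cat (T : finType) (beta : R) (h : T -> R) (rho sigma : op T T) (eps : R) : Prop :=
  exists (K E : finType) (hK : K -> R) (hE : E -> R) (c : op K K) (U : op ((T * K) * E) ((T * K) * E)),
  [/\ (0 < #|E|)%N /\ dens c, dag U *m U = 1%:M, econs (hsum2 (hsum2 h hK) hE) U,
      pt1 (thmap beta hE U (tens rho c)) = c &
      tn (thmap beta hE U (tens rho c) - tens sigma c) eps].

Section Duan.
Variables (T G E : finType) (beta : R) (h : T -> R) (hG : G -> R) (hE : E -> R) (n : nat).
Local Notation N := n.+1.
Variables (rho sigma : op T T) (c : nat -> op G G) (W : nat -> op ((T * G) * E) ((T * G) * E)) (e : nat -> R).
Hypothesis E0 : (0 < #|E|)%N.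
Hypothesis W1 : forall k, dag (W k) *m W k = 1%:M.
Hypothesis We : forall k, econs (hsum2 (hsum2 h hG) hE) (W k).
Hypothesis dc : forall k, (k < N)%N -> dens (c k).
Let out k := thmap beta hE (W k) (tens rho (c k)).
Hypothesis cS : forall k, (k < N)%N -> pt1 (out k) = c k.+1.
Hypothesis cN : c N = c 0.
Hypothesis he : forall k, (k < N)%N -> tn (out k - tens sigma (c k.+1)) (e k).

Definition inj (k : 'I_N) : op (G * 'I_N) G := mk (fun p g => (p == (g, k))%:R).

Lemma inj_gram k l : dag (inj k) *m inj l = if k == l then 1%:M else 0.
Proof.
apply: enP => x y; rewrite en_mul (bigD1 (x, k)) //= big1 ?addr0 => [|p np]; last first.
  by rewrite en_dag en_mk (negbTE np) conjc0 mul0r.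
rewrite en_dag !en_mk eqxx conjc1 mul1r xpair_eqE.
by case: (k == l); rewrite ?andbT ?andbF ?en1 ?en_0.
Qed.

Lemma inj_sum : \sum_k inj k *m dag (inj k) = 1%:M.
Proof.
apply: enP => -[x k] [y l]; rewrite en_sum en1 (bigD1 k) //= [X in _ + X]big1 ?addr0 => [|j nj].
  rewrite en_mul (bigD1 x) //= big1 ?addr0 => [|z nz].
    rewrite en_dag !en_mk !xpair_eqE !eqxx mul1r [y == x]eq_sym [l == k]eq_sym.
    by case: (_ && _); rewrite ?conjc1 ?conjc0.
  by rewrite en_mk xpair_eqE eq_sym (negbTE nz) mul0r.
rewrite en_mul big1 // => z _.
by rewrite en_mk xpair_eqE [k == j]eq_sym (negbTE nj) andbF mul0r.
Qed.

Lemma inj_raise k : raise (hsum2 hG (fun=> 0)) hG 0 (inj k).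
Proof.
move=> p g; rewrite en_mk; case: (eqVneq p (g, k)) => [->|_]; last by rewrite mulr0n eqxx.
by rewrite /hsum2.
Qed.

Definition Ji k : op ((T * (G * 'I_N)) * E) ((T * G) * E) := tens (tens 1%:M (inj k)) 1%:M.

Lemma Ji_gram k l : dag (Ji k) *m Ji l = if k == l then 1%:M else 0.
Proof.
rewrite !tens_dag !tens_mul !dag1 !mul1mx inj_gram; case: (k == l); first by rewrite !tens11.
apply: enP => -[[a b] d] [[a' b'] d']; rewrite !en_tens /= !en_0; by rewrite mulr0 mul0r.
Qed.

Lemma Ji_sum : \sum_k Ji k *m dag (Ji k) = 1%:M.
Proof.
under eq_bigr => k _ do rewrite !tens_dag !tens_mul !dag1 !mul1mx.
by rewrite -tens_suml -tens_sumr inj_sum !tens11.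
Qed.

(** Applies [W k] when the clock shows [k] and advances the clock, whose Hamiltonian is trivial. *)
Definition Ucyc := \sum_k Ji (ordS k) *m W k *m dag (Ji k).

Lemma UcycJ k : Ucyc *m Ji k = Ji (ordS k) *m W k.
Proof.
rewrite mulmx_suml (bigD1 k) //= big1 ?addr0 => [|l nl].
  by rewrite -mulmxA Ji_gram eqxx mulmx1.
by rewrite -mulmxA Ji_gram (negbTE nl) mulmx0.
Qed.

Lemma Ucyc1 : dag Ucyc *m Ucyc = 1%:M.
Proof.
rewrite -Ji_sum {2}/Ucyc mulmx_sumr; apply: eq_bigr => k _.
have -> : dag Ucyc *m (Ji (ordS k) *m W k *m dag (Ji k)) = dag Ucyc *m (Ucyc *m Ji k) *m dag (Ji k).
  by rewrite UcycJ !mulmxA.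
rewrite UcycJ; congr (_ *m _).
rewrite /Ucyc dag_sum mulmx_suml (bigD1 k) //= big1 ?addr0 => [|l nl].
  rewrite !dag_mul dagK -!mulmxA (mulmxA (dag (Ji _)) (Ji _)) Ji_gram eqxx mul1mx.
  by rewrite W1 mulmx1.
rewrite !dag_mul dagK -!mulmxA (mulmxA (dag (Ji _)) (Ji _)) Ji_gram.
case: eqP => [/(can_inj (@ordSK _)) E1|_]; first by rewrite E1 eqxx in nl.
by rewrite mul0mx !mulmx0.
Qed.

Lemma Ji_raise k : raise (hsum2 (hsum2 h (hsum2 hG (fun=> 0))) hE) (hsum2 (hsum2 h hG) hE) 0 (Ji k).
Proof.
by have := raise_tens (raise_tens (@raise1 _ _ h) (@inj_raise k)) (@raise1 _ _ hE); rewrite !addr0.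
Qed.

Lemma Ucyce : econs (hsum2 (hsum2 h (hsum2 hG (fun=> 0))) hE) Ucyc.
Proof.
apply: raise_sum => k _.
by have := raise_mul (raise_mul (@Ji_raise (ordS k)) (@We k)) (raise_dag (@Ji_raise k)); rewrite oppr0 !addr0.
Qed.

Definition cmix : op (G * 'I_N) (G * 'I_N) := \sum_(k < N) (N%:R^-1)%:C *: (inj k *m c k *m dag (inj k)).

Lemma dens_cmix : dens cmix.
Proof.
apply: (dens_mix (p := fun=> N%:R^-1)) => [_||k].
- by rewrite invr_ge0 ler0n.
- by rewrite sumr_const card_ord -[_ *+ _]mulr_natr mulVf // pnatr_eq0.
- by apply: dens_isom; [rewrite inj_gram eqxx|exact: dc].
Qed.

Lemma tens_conj (A : op T T) (B : op G G) k :
  tens A (inj k *m B *m dag (inj k)) = tens 1%:M (inj k) *m tens A B *m dag (tens 1%:M (inj k)).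
Proof. by rewrite tens_dag !tens_mul dag1 mul1mx mulmx1. Qed.

Lemma thmap_cyc k :
  thmap beta hE Ucyc (tens rho (inj k *m c k *m dag (inj k))) =
  tens 1%:M (inj (ordS k)) *m out k *m dag (tens 1%:M (inj (ordS k))).
Proof.
rewrite /out /thmap -pt2_conj; congr pt2.
have -> : tens (tens rho (inj k *m c k *m dag (inj k))) (gibbsop beta hE) =
   Ji k *m tens (tens rho (c k)) (gibbsop beta hE) *m dag (Ji k).
  by rewrite tens_conj /Ji [dag (tens (tens _ _) _)]tens_dag !tens_mul dag1 !mul1mx !mulmx1.
rewrite -[dag (Ji k) in LHS]/(dag (Ji k)) !mulmxA UcycJ -mulmxA -[dag (Ji k) *m dag Ucyc]dag_mul UcycJ dag_mul.
by rewrite !mulmxA.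
Qed.

Lemma thmap_sum (S F : finType) (hF : F -> R) (U : op (S * F) (S * F)) (I : finType) (X : I -> op S S) :
  thmap beta hF U (\sum_i X i) = \sum_i thmap beta hF U (X i).
Proof. by rewrite /thmap tens_suml mulmx_sumr mulmx_suml pt2_sum. Qed.

Lemma thmapZ (S F : finType) (hF : F -> R) (U : op (S * F) (S * F)) a (X : op S S) :
  thmap beta hF U (a *: X) = a *: thmap beta hF U X.
Proof. by rewrite /thmap tensZl -scalemxAr -scalemxAl pt2Z. Qed.

Lemma cS' (k : 'I_N) : c k.+1 = c (ordS k).
Proof.
rewrite /=; have := ltn_ord k; rewrite ltnS leq_eqVlt => /orP[/eqP ->|lk]; first by rewrite modnn cN.
by rewrite modn_small.
Qed.

Lemma thmap_cmix : thmap beta hE Ucyc (tens rho cmix) =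
  \sum_k (N%:R^-1)%:C *: (tens 1%:M (inj (ordS k)) *m out k *m dag (tens 1%:M (inj (ordS k)))).
Proof.
rewrite /cmix tens_sumr thmap_sum; apply: eq_bigr => k _.
by rewrite tensZr thmapZ thmap_cyc.
Qed.

Lemma cmixS : cmix = \sum_(k < N) (N%:R^-1)%:C *: (inj (ordS k) *m c k.+1 *m dag (inj (ordS k))).
Proof.
rewrite /cmix (reindex_inj (can_inj (@ordSK _))); apply: eq_bigr => k _.
by rewrite -cS'.
Qed.

(** With a uniformly random clock the components move one place round the cycle, so [cN] makes their
    mixture return exactly, while the errors of the branches are averaged. *)
Lemma duan_core eps : \sum_(k < N) e k <= N%:R * eps -> Cat beta h rho sigma eps.
Proof.
move=> He; exists (G * 'I_N)%type, E, (hsum2 hG (fun=> 0)), hE, cmix, Ucyc.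
split; [by split; [|exact: dens_cmix]|exact: Ucyc1|exact: Ucyce| |].
  rewrite thmap_cmix pt1_sum [RHS]cmixS; apply: eq_bigr => k _.
  by rewrite pt1Z pt1_conj cS.
rewrite thmap_cmix cmixS tens_sumr -sumrB.
have -> : eps = N%:R^-1 * (N%:R * eps) by rewrite mulrA mulVf ?mul1r // pnatr_eq0.
apply: (@tn_le _ _ _ (\sum_(k < N) N%:R^-1 * e k)).
  by rewrite -mulr_sumr ler_wpM2l ?invr_ge0 ?ler0n.
apply: tn_sum => k _; rewrite tensZr -scalerBr; apply: tnZ; first by rewrite invr_ge0 ler0n.
rewrite tens_conj -mulmxBl -mulmxBr; apply: tn_isom; last exact: he.
by rewrite tens_dag tens_mul dag1 mul1mx inj_gram eqxx tens11.
Qed.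

End Duan.
End Gibbs.

(** * Unitaries that relabel basis states *)

Section Bij.
Variable R : realType.
Local Notation C := R[i].
Local Notation op T U := 'M[C]_(#|{: T}|, #|{: U}|).

Definition bij (T U : finType) (f : T -> U) : op T U := mk (fun p q => (f p == q)%:R).

Lemma bijl (T U V : finType) (f : T -> U) (X : op U V) p q : en (bij f *m X) p q = en X (f p) q.
Proof. by rewrite en_mul; under eq_bigr => z _ do rewrite en_mk; rewrite sum_pick. Qed.

Lemma bijr (T U V : finType) (f : T -> U) (X : op V U) p q : en (X *m dag (bij f)) p q = en X p (f q).
Proof.
rewrite en_mul; under eq_bigr => z _ do rewrite en_dag en_mk conjc_natr.
exact: sum_pickr.
Qed.

Lemma bij_isom' (T U : finType) (f : T -> U) : injective f -> bij f *m dag (bij f) = 1%:M.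
Proof. by move=> fi; apply: enP => p q; rewrite bijr en_mk en1 (inj_eq fi). Qed.

Lemma bij_isom (T U : finType) (f : T -> U) (g : U -> T) : cancel f g -> cancel g f ->
  dag (bij f) *m bij f = 1%:M.
Proof.
move=> fg gf; have -> : bij f = dag (bij g).
  by apply: enP => p q; rewrite en_dag !en_mk conjc_natr -(can_eq gf) fg eq_sym.
by rewrite dagK; apply: bij_isom' => x y /(congr1 f); rewrite !gf.
Qed.

Lemma bij_raise (T U : finType) (hT : T -> R) (hU : U -> R) (f : T -> U) :
  (forall p, hU (f p) = hT p) -> raise hT hU 0 (bij f).
Proof.
by move=> H p q; rewrite en_mk; case: (eqVneq (f p) q) => [<- _|]; rewrite ?H ?addr0 // mulr0n eqxx.
Qed.

End Bij.

(** * Extending an operation to a bystander system *)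

Section Local.
Variable R : realType.
Local Notation C := R[i].
Local Notation op T U := 'M[C]_(#|{: T}|, #|{: U}|).
Variables (T G E : finType) (beta : R) (h : T -> R) (hG : G -> R) (hE : E -> R).

Lemma pt1K_gram (t s : T) : @pt1K R T G t *m dag (@pt1K R T G s) = if t == s then 1%:M else 0.
Proof.
apply: enP => x y; rewrite en_mul sum_pair (bigD1 t) //= [X in _ + X]big1 ?addr0 => [|t' nt]; last first.
  by rewrite big1 // => u _; rewrite en_mk /= eq_sym (negbTE nt) mul0r.
rewrite (bigD1 x) //= big1 ?addr0 => [|u nu]; last first.
  by rewrite en_mk /= [x == u]eq_sym (negbTE nu) andbF mul0r.
rewrite en_dag !en_mk /= !eqxx mul1r conjc_natr [s == t]eq_sym.
by case: (t == s); rewrite ?en_0 // en1 eq_sym.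
Qed.

Definition Kt t : op (G * E) ((T * G) * E) := tens (@pt1K R T G t) 1%:M.

Lemma Kt_gram t s : Kt t *m dag (Kt s) = if t == s then 1%:M else 0.
Proof.
rewrite tens_dag tens_mul dag1 mul1mx pt1K_gram; case: (t == s); first exact: tens11.
exact: tens0l.
Qed.

Lemma Kt_sum : \sum_t dag (Kt t) *m Kt t = 1%:M.
Proof.
under eq_bigr => t _ do rewrite tens_dag tens_mul dag1 mul1mx.
by rewrite -tens_suml pt1K1 tens11.
Qed.

(** The identity on [T] tensor [U], written as a sum over bras because the bracketing [(T * G) * E]
    does not expose it as a tensor product. *)
Definition loc (U : op (G * E) (G * E)) := \sum_t dag (Kt t) *m U *m Kt t.
Variable U : op (G * E) (G * E).

Lemma loc_Kt t : Kt t *m loc U = U *m Kt t.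
Proof.
rewrite mulmx_sumr (bigD1 t) //= big1 ?addr0 => [|s ns].
  by rewrite !mulmxA Kt_gram eqxx mul1mx.
by rewrite !mulmxA Kt_gram eq_sym (negbTE ns) !mul0mx.
Qed.

Lemma loc_dKt t : loc U *m dag (Kt t) = dag (Kt t) *m U.
Proof.
rewrite mulmx_suml (bigD1 t) //= big1 ?addr0 => [|s ns].
  by rewrite -mulmxA Kt_gram eqxx mulmx1.
by rewrite -mulmxA Kt_gram (negbTE ns) mulmx0.
Qed.

Lemma loc_isom : dag U *m U = 1%:M -> dag (loc U) *m loc U = 1%:M.
Proof.
move=> U1; rewrite -Kt_sum {2}/loc mulmx_sumr; apply: eq_bigr => t _.
by rewrite !mulmxA -dag_mul loc_Kt dag_mul -(mulmxA (dag (Kt t))) U1 mulmx1.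
Qed.

Lemma Kt_raise t : raise (hsum2 hG hE) (hsum2 (hsum2 h hG) hE) (- h t) (Kt t).
Proof.
move=> [g x] [[t' g'] x']; rewrite en_tens en1 en_mk /= -natrM mulnb /hsum2 /=.
by case: (boolP (_ && _)) => [/andP[/andP[/eqP -> /eqP ->] /eqP ->] _|_]; [ring|rewrite eqxx].
Qed.

Lemma loc_econs : econs (hsum2 hG hE) U -> econs (hsum2 (hsum2 h hG) hE) (loc U).
Proof.
move=> He; apply: raise_sum => t _.
have := raise_mul (raise_mul (raise_dag (@Kt_raise t)) He) (@Kt_raise t).
by rewrite add0r opprK addNr.
Qed.

Lemma thmap_locK (Y : op (T * G) (T * G)) t :
  thmap beta hE U (@pt1K R T G t *m Y *m dag (@pt1K R T G t)) =
  @pt1K R T G t *m thmap beta hE (loc U) Y *m dag (@pt1K R T G t).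
Proof.
rewrite /thmap -pt2_conj; congr pt2.
have -> : tens (@pt1K R T G t *m Y *m dag (@pt1K R T G t)) (gibbsop beta hE) =
   Kt t *m tens Y (gibbsop beta hE) *m dag (Kt t).
  by rewrite /Kt tens_dag !tens_mul dag1 mul1mx mulmx1.
rewrite -/(Kt t) !mulmxA loc_Kt -!mulmxA; congr (_ *m (_ *m (_ *m _))).
by rewrite -!dag_mul loc_Kt.
Qed.

Lemma pt1_thmap_loc Y : pt1 (thmap beta hE (loc U) Y) = thmap beta hE U (pt1 Y).
Proof.
rewrite -!pt1KE /krausmap thmap_sum; apply: eq_bigr => t _; exact/esym/thmap_locK.
Qed.

Lemma tens_pt1K (A : op T T) (B : op G G) :
  tens A B = \sum_t \sum_s en A t s *: (dag (@pt1K R T G t) *m B *m @pt1K R T G s).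
Proof.
have Kl (V : finType) (t : T) (X : op G V) x g k : en (dag (@pt1K R T G t) *m X) (x, g) k = (t == x)%:R * en X g k.
  rewrite en_mul (bigD1 g) //= big1 ?addr0 => [|y ny].
    by rewrite en_dag en_mk /= eqxx andbT conjc_natr.
  by rewrite en_dag en_mk /= (negbTE ny) andbF conjc0 mul0r.
have Kr (V : finType) (t : T) (X : op V G) x g k : en (X *m @pt1K R T G t) k (x, g) = (t == x)%:R * en X k g.
  rewrite en_mul (bigD1 g) //= big1 ?addr0 => [|y ny].
    by rewrite en_mk /= eqxx andbT mulrC.
  by rewrite en_mk /= (negbTE ny) andbF mulr0.
apply: enP => -[x g] [y g']; rewrite en_tens en_sum /=.
transitivity (\sum_t (x == t)%:R * \sum_s (y == s)%:R * (en A t s * en B g g')).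
  by rewrite !sum_pick.
apply: eq_bigr => t _; rewrite en_sum mulr_sumr; apply: eq_bigr => s _.
by rewrite en_scale Kr Kl [x == t]eq_sym [y == s]eq_sym; ring.
Qed.

Lemma thmap_loc_tens (A : op T T) (B : op G G) :
  thmap beta hE (loc U) (tens A B) = tens A (thmap beta hE U B).
Proof.
rewrite !tens_pt1K thmap_sum; apply: eq_bigr => t _; rewrite thmap_sum; apply: eq_bigr => s _.
rewrite thmapZ; congr (_ *: _); rewrite /thmap.
rewrite -[@pt1K R T G s in RHS]dagK -pt2_conj; congr pt2.
have -> : tens (dag (@pt1K R T G t) *m B *m @pt1K R T G s) (gibbsop beta hE) =
   dag (Kt t) *m tens B (gibbsop beta hE) *m Kt s.
  by rewrite /Kt tens_dag !tens_mul dag1 mul1mx mulmx1.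
have E1 r : tens (dag (@pt1K R T G r)) (1%:M : op E E) = dag (Kt r) by rewrite /Kt tens_dag dag1.
rewrite !E1 dagK !mulmxA loc_dKt -!mulmxA; congr (_ *m (_ *m (_ *m _))).
by rewrite -[Kt s in LHS]dagK -dag_mul loc_dKt dag_mul dagK.
Qed.

Lemma thmap_mulK (S F : finType) (hF : F -> R) (V : op (S * F) (S * F)) (A X : op S S) :
  thmap beta hF (V *m tens A 1%:M) X = thmap beta hF V (A *m X *m dag A).
Proof.
rewrite /thmap; congr pt2; rewrite dag_mul tens_dag dag1 -!mulmxA; congr (_ *m _).
by rewrite !mulmxA !tens_mul mul1mx mulmx1.
Qed.

Lemma thmap1 (S F : finType) (hF : F -> R) (X : op S S) : (0 < #|F|)%N -> thmap beta hF 1%:M X = X.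
Proof.
by move=> F0; rewrite /thmap dag1 mul1mx mulmx1 pt2_tens (proj2 (dens_gibbs _ _ F0)) scale1r.
Qed.

Lemma thmapB (S F : finType) (hF : F -> R) (V : op (S * F) (S * F)) (X Y : op S S) :
  thmap beta hF V (X - Y) = thmap beta hF V X - thmap beta hF V Y.
Proof. by rewrite /thmap tensBl mulmxBr mulmxBl pt2B. Qed.

End Local.

(** * Registers with exchangeable slots *)

Section Slots.
Variable R : realType.
Local Notation C := R[i].
Local Notation op T U := 'M[C]_(#|{: T}|, #|{: U}|).
Variables (I T D : finType).
Local Notation B := {ffun I -> T}.
Local Notation G := (B * D)%type.

Definition upd (b : B) i t : B := [ffun j => if j == i then t else b j].

Lemma upd_id b i : upd b i (b i) = b.
Proof. by apply/ffunP => j; rewrite ffunE; case: eqP => [->|]. Qed.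
Lemma upd_upd b i t u : upd (upd b i t) i u = upd b i u.
Proof. by apply/ffunP => j; rewrite !ffunE; case: eqP. Qed.
Lemma upd_eq b i t : upd b i t i = t.
Proof. by rewrite ffunE eqxx. Qed.
Lemma upd_neq b i t j : j != i -> upd b i t j = b j.
Proof. by move=> n; rewrite ffunE (negbTE n). Qed.
Lemma upd_comm b i j t u : i != j -> upd (upd b i t) j u = upd (upd b j u) i t.
Proof.
move=> n; apply/ffunP => k; rewrite !ffunE.
by case: (eqVneq k j) => [->|//]; rewrite eq_sym (negbTE n).
Qed.

Definition swf i (p : T * G) : T * G := (p.2.1 i, (upd p.2.1 i p.1, p.2.2)).

Lemma swfK i : involutive (swf i).
Proof. by move=> [t [b d]]; rewrite /swf /= upd_eq upd_upd upd_id. Qed.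

Definition swp i := @bij R _ _ (swf i).

Lemma swp_isom i : dag (swp i) *m swp i = 1%:M.
Proof. exact: bij_isom (swfK i) (swfK i). Qed.

Lemma swp_econs (h : T -> R) (hD : D -> R) i : econs (hsum2 h (hsum2 (hpow h) hD)) (swp i).
Proof.
apply: bij_raise => -[t [b d]]; rewrite /hsum2 /swf /=.
rewrite /hpow (bigD1 i) //= [in RHS](bigD1 i) //= upd_eq.
rewrite (eq_bigr (fun j => h (b j))) => [|j nj]; last by rewrite upd_neq.
by ring.
Qed.

(** Slot [i] is discarded and refilled with a fresh [s]. The distance of [X] from its image measures
    how far slot [i] is from being in state [s] and decoupled. *)
Definition Rep i (s : op T T) (X : op G G) : op G G := pt1 (swp i *m tens s X *m dag (swp i)).

Lemma en_Rep i s X b d b' d' : en (Rep i s X) (b, d) (b', d') =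
  en s (b i) (b' i) * \sum_t en X (upd b i t, d) (upd b' i t, d').
Proof.
rewrite en_mk mulr_sumr; apply: eq_bigr => t _.
by rewrite bijr bijl en_tens /=.
Qed.

Lemma dens_Rep i s X : dens s -> dens X -> dens (Rep i s X).
Proof.
by move=> ds dX; apply/dens_pt1/dens_isom; [exact: swp_isom|exact: dens_tens].
Qed.

Lemma tn_Rep i s X e : dens s -> tn X e -> tn (Rep i s X) e.
Proof.
by move=> ds dX; apply/tn_pt1/tn_isom; [exact: swp_isom|exact: tn_tensl].
Qed.

Lemma RepB i s X Y : Rep i s (X - Y) = Rep i s X - Rep i s Y.
Proof. by rewrite /Rep tensBr mulmxBr mulmxBl pt1B. Qed.

Lemma Rep_comm i j s r X : i != j -> Rep i s (Rep j r X) = Rep j r (Rep i s X).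
Proof.
move=> n; apply: enP => -[b d] [b' d']; rewrite [LHS]en_Rep [RHS]en_Rep.
transitivity (\sum_t \sum_u en s (b i) (b' i) * en r (b j) (b' j) * en X (upd (upd b i t) j u, d) (upd (upd b' i t) j u, d')).
  rewrite mulr_sumr; apply: eq_bigr => t _; rewrite en_Rep !upd_neq ?[j == i]eq_sym // mulrA mulr_sumr.
  by [].
rewrite exchange_big mulr_sumr; apply: eq_bigr => u _; rewrite en_Rep !upd_neq // mulrA mulr_sumr.
by apply: eq_bigr => t _; rewrite [_ * en s _ _]mulrC !(upd_comm _ _ _ n).
Qed.

Lemma Rep_fix i s (X : op G G) (N : B -> B -> D -> D -> C) : \tr s = 1 ->
  (forall (b : B) d (b' : B) d', en X (b, d) (b', d') = en s (b i) (b' i) * N b b' d d') ->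
  (forall b b' d d' t, N (upd b i t) (upd b' i t) d d' = N b b' d d') -> Rep i s X = X.
Proof.
move=> s1 H HN; apply: enP => -[b d] [b' d']; rewrite en_Rep H; congr (_ * _).
under eq_bigr => t _ do rewrite H !upd_eq HN.
by rewrite -mulr_suml -tr_en s1 mul1r.
Qed.

Lemma Rep_pow i s (Y : op D D) : \tr s = 1 -> Rep i s (tens (powop I s) Y) = tens (powop I s) Y.
Proof.
move=> s1; apply: (@Rep_fix i s _ (fun b b' d d' => (\prod_(j | j != i) en s (b j) (b' j)) * en Y d d')) => //.
  by move=> b d b' d'; rewrite en_tens en_prod /= (bigD1 i) //= mulrA.
move=> b b' d d' t; congr (_ * _); apply: eq_bigr => j nj; by rewrite !upd_neq.
Qed.

Lemma tn_Rep_fix i s X Y e : dens s -> Rep i s Y = Y -> tn (X - Y) e -> tn (X - Rep i s X) (e + e).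
Proof.
move=> ds EY t; have -> : X - Rep i s X = (X - Y) - Rep i s (X - Y) by rewrite RepB EY opprB addrA subrK.
by apply: tnB => //; exact: tn_Rep.
Qed.

(* The joint state of the fresh system and the register after the swap differs from a product
   only through the failure of slot [i] to be decoupled. *)
Lemma swp_out i s r X : swp i *m tens r X *m dag (swp i) - tens s (Rep i r X) =
  swp i *m tens r (X - Rep i s X) *m dag (swp i).
Proof.
apply: enP => -[t [b d]] [t' [b' d']]; rewrite en_sub [X in X - _]bijr [X in X - _]bijl [RHS]bijr [RHS]bijl ![en (tens _ _) _ _]en_tens /= en_sub ![en (Rep _ _ _) _ _]en_Rep mulrBr.
rewrite !upd_eq; congr (_ - _); rewrite mulrCA; congr (_ * (_ * _)).
by apply: eq_bigr => u _; rewrite !upd_upd.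
Qed.

Variable rho : op T T.

Definition Reps (l : seq I) X := foldl (fun X i => Rep i rho X) X l.

Lemma Reps_cons j l X : Reps (j :: l) X = Reps l (Rep j rho X).
Proof. by rewrite /Reps [LHS]/=. Qed.

Lemma Reps_comm l i s X : i \notin l -> Rep i s (Reps l X) = Reps l (Rep i s X).
Proof.
elim: l X => [//|j l IH] X; rewrite inE negb_or => /andP[n nl].
by rewrite !Reps_cons (IH (Rep j rho X) nl) (Rep_comm s rho X n).
Qed.

Lemma dens_Reps l X : dens rho -> dens X -> dens (Reps l X).
Proof. by move=> dr; elim: l X => [//|j l IH] X dX; rewrite Reps_cons; apply/IH/dens_Rep. Qed.

Lemma tn_Reps l X e : dens rho -> tn X e -> tn (Reps l X) e.
Proof. by move=> dr; elim: l X => [//|j l IH] X dX; rewrite Reps_cons; apply/IH/tn_Rep. Qed.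

Lemma RepsB l X Y : Reps l (X - Y) = Reps l X - Reps l Y.
Proof. by elim: l X Y => [//|j l IH] X Y; rewrite !Reps_cons RepB IH. Qed.

Definition mrg (l : seq I) (s b : B) : B := [ffun j => if j \in l then s j else b j].

(** Refilled slots contribute entries of [rho] and carry a common summed index inside [X]; the other
    slots keep the outer indices. *)
Lemma en_Reps l X b d b' d' : uniq l -> en (Reps l X) (b, d) (b', d') =
  \sum_(s : B | [forall j, (j \in l) || (s j == b j)]) (\prod_(j <- l) en rho (b j) (b' j)) * en X (s, d) (mrg l s b', d').
Proof.
elim/last_ind: l b b' => [|l i IH] b b'.
  move=> _; rewrite (big_pred1 b) => [|s].
    rewrite big_nil mul1r /=; congr (en X _ (_, _)); apply/ffunP => j; by rewrite ffunE.
  rewrite [RHS]/=; apply/forallP/idP => [H|/eqP -> j]; last by rewrite eqxx orbT.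
  by apply/eqP/ffunP => j; exact/eqP/(H j).
rewrite rcons_uniq => /andP[nil ul]; rewrite /Reps foldl_rcons -/(Reps l X) en_Rep.
rewrite (partition_big (fun s : B => s i) predT) //= mulr_sumr; apply: eq_bigr => t _.
rewrite IH // mulr_sumr; apply: eq_big => [s|s H].
  apply/forallP/andP => [H|[/forallP H /eqP si] j].
    split; last by have := H i; rewrite (negbTE nil) upd_eq.
    apply/forallP => j; rewrite mem_rcons inE; case: (eqVneq j i) => //= nj.
    by have := H j; rewrite upd_neq.
  have := H j; rewrite mem_rcons inE; case: (eqVneq j i) => [-> _|nj] /=; last by rewrite upd_neq.
  by rewrite upd_eq si eqxx orbT.
have si : s i = t by have /forallP /(_ i) := H; rewrite (negbTE nil) upd_eq => /eqP.
rewrite -cats1 big_cat big_seq1 /= mulrA; congr (_ * _).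
  rewrite mulrC; congr (_ * _); apply: eq_big_seq => j jl.
  by rewrite !upd_neq //; apply: contraNneq nil => <-.
congr (en X _ (_, _)); apply/ffunP => j; rewrite !ffunE mem_cat inE.
by case: (j \in l) => //=; case: (eqVneq j i) => [->|].
Qed.

(** Once every slot has been refilled, all correlations of the register with the remaining factor
    are gone. *)
Lemma Reps_all X : Reps (enum I) X = tens (powop I rho) (pt1 X).
Proof.
apply: enP => -[b d] [b' d']; rewrite en_Reps ?enum_uniq // en_tens en_prod en_mk /= -mulr_sumr; congr (_ * _).
  by rewrite big_enum.
apply: eq_big => [s|s _]; first by apply/forallP => j; rewrite mem_enum.
by congr (en X _ (_, _)); apply/ffunP => j; rewrite ffunE mem_enum.
Qed.

End Slots.

(** * Catalysis from a collective operation with decoupled slots *)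

Section DuanSlots.
Variable R : realType.
Local Notation C := R[i].
Local Notation op T U := 'M[C]_(#|{: T}|, #|{: U}|).
Variables (I T D E : finType) (beta : R) (h : T -> R) (hD : D -> R) (hE : E -> R).
Local Notation B := {ffun I -> T}.
Local Notation G := (B * D)%type.
Variables (rho sigma : op T T) (c1 : op D D) (U : op (G * E) (G * E)) (e : I -> R).
Hypothesis E0 : (0 < #|E|)%N.
Hypothesis I0 : (0 < #|I|)%N.
Hypothesis dr : dens rho.
Hypothesis d1 : dens c1.
Hypothesis U1 : dag U *m U = 1%:M.
Hypothesis Ue : econs (hsum2 (hsum2 (hpow h) hD) hE) U.
Let Xi := thmap beta hE U (tens (powop I rho) c1).
Hypothesis Xi1 : pt1 Xi = c1.
Hypothesis dec : forall i, tn (Xi - Rep i sigma Xi) (e i).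

(** At clock time [k] the register is [Xi] with its first [k] slots refilled by [rho]. Swapping the
    system with the next slot outputs nearly [sigma], since slots refilled earlier do not affect the
    decoupling of later ones. After the last swap the register is the original input, and [U] turns
    it into [Xi] again. *)
Lemma duan_slots eps : \sum_i e i <= #|I|%:R * eps -> Cat beta h rho sigma eps.
Proof.
move=> He; have [i0 _] := card_gt0P I0.
have sz : size (enum I) = #|I|.-1.+1 by rewrite -cardE prednK.
pose n := #|I|.-1; pose ik k := nth i0 (enum I) k.
pose c k := Reps rho (take k (enum I)) Xi.
pose W k : op ((T * G) * E) ((T * G) * E) :=
  (if k == n then loc T U else 1%:M) *m tens (@swp R I T D (ik k)) 1%:M.
have dXi : dens Xi by apply: dens_thmap => //; apply: dens_tens => //; exact: dens_pow.
have dc k : dens (c k) by exact: dens_Reps.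
have cSw k : (k < n.+1)%N -> Rep (ik k) rho (c k) = Reps rho (take k.+1 (enum I)) Xi.
  by move=> kn; rewrite (take_nth i0) ?sz // /Reps foldl_rcons.
have full k : k = n -> Reps rho (take k.+1 (enum I)) Xi = tens (powop I rho) c1.
  by move=> ->; rewrite take_oversize ?sz // Reps_all Xi1.
have cN : c n.+1 = tens (powop I rho) c1 by rewrite /c full.
have outE k X : thmap beta hE (W k) X =
   if k == n then thmap beta hE (loc T U) (@swp R I T D (ik k) *m X *m dag (@swp R I T D (ik k)))
   else @swp R I T D (ik k) *m X *m dag (@swp R I T D (ik k)).
  by rewrite thmap_mulK; case: ifP => // _; rewrite thmap1.
(* Closes the cycle: after the last step the register is [Xi], because [U] has been applied to the
   fully refilled one. *)
pose c' k := if k == n.+1 then Xi else c k.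
have c'k k : (k < n.+1)%N -> c' k = c k by rewrite /c'; case: eqP => // ->; rewrite ltnn.
have c'S k : (k < n.+1)%N -> c' k.+1 = if k == n then Xi else Rep (ik k) rho (c k).
  by move=> kn; rewrite /c' eqSS; case: eqP => // _; exact/esym/cSw.
have hn : Rep (ik n) rho (c n) = tens (powop I rho) c1 by rewrite cSw // full.
have decn k : (k < n.+1)%N -> tn (c k - Rep (ik k) sigma (c k)) (e (ik k)).
  move=> kn; rewrite /c Reps_comm -?RepsB; first exact: tn_Reps.
  have := enum_uniq I; rewrite -{1}(cat_take_drop k (enum I)) (drop_nth i0) ?sz //.
  by rewrite cat_uniq /= negb_or => /andP[_ /andP[/andP[]]].
apply: (@duan_core R T G E beta h (hsum2 (hpow h) hD) hE n rho sigma c' W (fun k => e (ik k)) E0).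
- move=> k; rewrite /W dag_mul -mulmxA (mulmxA (dag (if _ then _ else _))).
  have -> : dag (if k == n then loc T U else 1%:M) *m (if k == n then loc T U else 1%:M) = 1%:M.
    by case: (k == n); [exact: loc_isom|rewrite dag1 mul1mx].
  by rewrite mul1mx tens_dag tens_mul swp_isom dag1 mul1mx tens11.
- move=> k; rewrite /W.
  have h1 : econs (hsum2 (hsum2 h (hsum2 (hpow h) hD)) hE) (if k == n then loc T U else 1%:M).
    by case: (k == n); [exact: loc_econs|exact: raise1].
  have := raise_mul h1 (raise_tens (@swp_econs R I T D h hD (ik k)) (@raise1 _ _ hE)).
  by rewrite !addr0.
- by move=> k kn; rewrite c'k.
- move=> k kn; rewrite outE c'k // c'S //; case: eqP => [kE|_]; last by [].
  by rewrite pt1_thmap_loc -/(Rep _ _ _) kE hn.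
- by rewrite /c' eqxx /= /c take0.
- move=> k kn; rewrite outE c'k // c'S //.
  have key : tn (@swp R I T D (ik k) *m tens rho (c k) *m dag (@swp R I T D (ik k)) - tens sigma (Rep (ik k) rho (c k))) (e (ik k)).
    by rewrite swp_out; apply: tn_isom; [exact: swp_isom|apply: tn_tensl => //; exact: decn].
  case: (eqVneq k n) => [kE|_]; last by [].
  have -> : Xi = thmap beta hE U (Rep (ik k) rho (c k)) by rewrite kE hn.
  rewrite -thmap_loc_tens -thmapB; apply: tn_thmap => //; exact: loc_isom.
- have -> : n.+1 = #|I| by rewrite prednK.
  rewrite (_ : \sum_(k < #|I|) e (ik k) = \sum_i e i) //.
  by rewrite -[RHS]big_enum (big_nth i0) -cardE big_mkord.
Qed.

End DuanSlots.

(** * Controlled operations *)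

Section Ctl.
Variable R : realType.
Local Notation C := R[i].
Local Notation op T U := 'M[C]_(#|{: T}|, #|{: U}|).
Variables Z G : finType.

Definition ctl (f : Z -> op G G) : op (Z * G) (Z * G) :=
  mk (fun p r => if p.1 == r.1 then en (f p.1) p.2 r.2 else 0).

Lemma en_ctl (f : Z -> op G G) p r : en (ctl f) p r = if p.1 == r.1 then en (f p.1) p.2 r.2 else 0.
Proof. exact: en_mk. Qed.

Lemma en_ctl_mul (U : finType) (f : Z -> op G G) (B : op (Z * G) U) z g k :
  en (ctl f *m B) (z, g) k = \sum_g' en (f z) g g' * en B (z, g') k.
Proof.
rewrite en_mul (eq_bigr (fun p => en (ctl f) (z, g) (p.1, p.2) * en B (p.1, p.2) k)); last by case.
rewrite -(pair_bigA _ (fun z' g' => en (ctl f) (z, g) (z', g') * en B (z', g') k)) /=.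
rewrite (bigD1 z) //= [X in _ + X]big1 ?addr0 => [|z' nz].
  by apply: eq_bigr => g' _; rewrite en_ctl /= eqxx.
by rewrite big1 // => g' _; rewrite en_ctl /= eq_sym (negbTE nz) mul0r.
Qed.

Lemma ctl_mul (f g : Z -> op G G) : ctl f *m ctl g = ctl (fun z => f z *m g z).
Proof.
apply: enP => -[z x] [z' x']; rewrite en_ctl_mul en_ctl /=.
case: (eqVneq z z') => [<-|nz].
  by rewrite en_mul; apply: eq_bigr => y _; rewrite en_ctl /= eqxx.
by rewrite big1 // => y _; rewrite en_ctl /= (negbTE nz) mulr0.
Qed.

Lemma ctl_dag (f : Z -> op G G) : dag (ctl f) = ctl (fun z => dag (f z)).
Proof.
apply: enP => -[z x] [z' x']; rewrite en_dag !en_ctl /= eq_sym.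
by case: (eqVneq z z') => [->|_]; rewrite ?conjc0 ?en_dag.
Qed.

Lemma eq_ctl (f g : Z -> op G G) : f =1 g -> ctl f = ctl g.
Proof. by move=> H; apply: enP => p r; rewrite !en_ctl H. Qed.

Lemma ctl_isom (f : Z -> op G G) : (forall z, dag (f z) *m f z = 1%:M) -> dag (ctl f) *m ctl f = 1%:M.
Proof.
move=> H; rewrite ctl_dag ctl_mul; apply: enP => -[z x] [z' x']; rewrite en_ctl en1 /= H en1 xpair_eqE.
by case: (z == z').
Qed.

Lemma ctl_close (U V : finType) (f : Z -> op G G) (v : op Z U) (G0 : op G V) (eta : R) :
  (forall z, N2 (f z *m G0 - G0) <= eta) ->
  N2 (ctl f *m tens v G0 - tens v G0) <= N2 v * eta.
Proof.
move=> H.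
have E z g k l : en (ctl f *m tens v G0 - tens v G0) (z, g) (k, l) = en v z k * en (f z *m G0 - G0) g l.
  rewrite en_sub en_ctl_mul en_tens /= en_sub mulrBr en_mul mulr_sumr; congr (_ - _).
  by apply: eq_bigr => g' _; rewrite en_tens /= mulrCA.
have -> : N2 (ctl f *m tens v G0 - tens v G0) = \sum_z \sum_k (sqn (en v z k) * N2 (f z *m G0 - G0)).
  rewrite N2_en (eq_bigr (fun p => \sum_q sqn (en (ctl f *m tens v G0 - tens v G0) (p.1, p.2) q))); last by case.
  rewrite -(pair_bigA _ (fun z g => \sum_q sqn (en (ctl f *m tens v G0 - tens v G0) (z, g) q))) /=.
  apply: eq_bigr => z _.
  transitivity (\sum_g \sum_k \sum_l (sqn (en v z k) * sqn (en (f z *m G0 - G0) g l))).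
    apply: eq_bigr => g _; rewrite pair_bigA /=; apply: eq_bigr => -[k l] _.
    by rewrite E sqnM.
  rewrite exchange_big; apply: eq_bigr => k _; rewrite N2_en mulr_sumr.
  by apply: eq_bigr => g _; rewrite mulr_sumr.
rewrite N2_en mulr_suml; apply: ler_sum => z _; rewrite mulr_suml; apply: ler_sum => k _.
by apply: ler_wpM2l => //; exact: sqn_ge0.
Qed.

Lemma en_mul_dctl (U : finType) (f : Z -> op G G) (B : op U (Z * G)) k z g :
  en (B *m dag (ctl f)) k (z, g) = \sum_g' en B k (z, g') * conjc (en (f z) g g').
Proof.
have -> : B *m dag (ctl f) = dag (ctl f *m dag B) by rewrite dag_mul dagK.
rewrite en_dag en_ctl_mul rmorph_sum; apply: eq_bigr => g' _.
by rewrite en_dag rmorphM /= conjcK mulrC.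
Qed.

Lemma en_ctl_conj (f : Z -> op G G) (A : op Z Z) (B : op G G) z g z' g' :
  en (ctl f *m tens A B *m dag (ctl f)) (z, g) (z', g') =
  en A z z' * en (f z *m B *m dag (f z')) g g'.
Proof.
rewrite en_mul_dctl [en (_ *m dag (f z')) _ _]en_mul mulr_sumr; apply: eq_bigr => k _.
rewrite en_ctl_mul en_dag mulrA; congr (_ * _); rewrite en_mul mulr_sumr; apply: eq_bigr => l _.
by rewrite en_tens /= mulrCA.
Qed.

End Ctl.

Lemma energy_balance (R : realFieldType) (ex q q0 t hs d u u0 : R) :
  ex + q0 = t + q -> hs + d = t -> u = u0 + d -> hs + q + u = ex + q0 + u0.
Proof. by move=> *; lra. Qed.

Lemma three_close (R : realFieldType) (a b c ep x : R) : 0 <= a -> 0 <= b -> 0 <= c -> 0 <= 1 - a -> 0 <= 1 - b ->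
  a <= ep -> b <= ep -> c <= ep -> 1 = (1 - a) * (1 - b) * (1 - c) + x -> x <= 3 * ep.
Proof.
move=> a0 b0 c0 a1 b1 ha hb hc E.
have h1 : 0 <= a * b by exact: mulr_ge0.
have h2 : (1 - a) * (1 - b) * c <= c.
  rewrite -[leRHS]mul1r ler_wpM2r // -[leRHS]mulr1; apply: ler_pM => //; lra.
have := h2; move: E; rewrite !mulrBl !mulrBr; lra.
Qed.

Lemma close_arith (R : realFieldType) (n1 n2 ep eta : R) : n2 <= eta -> n1 <= 3 * ep ->
  2 * n1 + 2 * n2 <= 6 * ep + 2 * eta.
Proof. by lra. Qed.

(** * The collective operation: bath exchange followed by reference shifts *)

Section VOp.
Variable R : realType.
Local Notation C := R[i].
Local Notation op T U := 'M[C]_(#|{: T}|, #|{: U}|).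
Variables (T : finType) (h : T -> R) (beta : R) (m : nat).
Local Notation S := {ffun 'I_m -> T}.
Variables (X : finType) (xi : op S X) (e : X -> R).
Hypothesis xi1 : dag xi *m xi = 1%:M.
Hypothesis xie : forall s x, en xi s x != 0 -> hpow h s = e x.
Variables (A0 J0 : finType) (jj0 : A0 -> J0) (phi0 : op T J0) (tau0 : J0 -> R) (D0 : T -> R).
Hypothesis phi01 : dag phi0 *m phi0 = 1%:M.
Hypothesis phi0e : forall y j, en phi0 y j != 0 -> h y + D0 y = tau0 j.
Local Notation A := {ffun 'I_m -> A0}.
Local Notation J := {ffun 'I_m -> J0}.
Definition jj (a : A) : J := [ffun i => jj0 (a i)].
Definition phi : op S J := prodop (fun=> phi0).
Variables (Q : finType) (hQ : Q -> R) (dom : pred Q) (stuff : X -> Q -> A -> Q * A).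
Hypothesis stuffe : forall x r a, dom r -> e x + hQ r = hpow tau0 (jj a) + hQ (stuff x r a).1.
Hypothesis stuffi : forall x x' r r' a a', dom r -> dom r' -> jj a = jj a' ->
        stuff x r a = stuff x' r' a' -> [/\ x = x', r = r' & a = a'].
Variables (IF : finType) (Lm b : nat).
Local Notation F := {ffun IF -> T}.
Local Notation L := (ladder T Lm).
Variable Yop : T -> op (F * L) (F * L).
Hypothesis Y1 : forall y, dag (Yop y) *m Yop y = 1%:M.
Hypothesis Yc : forall y z, Yop y *m Yop z = Yop z *m Yop y.
Hypothesis Ye : forall y, crz D0 (hpow h) b (D0 y) (Yop y).

Definition Ypr (s : seq T) : op (F * L) (F * L) := foldr (fun y Z => Yop y *m Z) 1%:M s.

Lemma Ypr1 s : dag (Ypr s) *m Ypr s = 1%:M.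
Proof.
elim: s => [|y s IH] /=; first by rewrite dag1 mul1mx.
by rewrite dag_mul -mulmxA (mulmxA (dag (Yop y))) Y1 mul1mx.
Qed.

Lemma Ypr_comm s z : Ypr s *m Yop z = Yop z *m Ypr s.
Proof.
elim: s => [|y s IH] /=; first by rewrite mul1mx mulmx1.
by rewrite -mulmxA IH !mulmxA Yc.
Qed.

Lemma Ypr_rem (I : eqType) (f : I -> T) i l : i \in l ->
  Ypr [seq f j | j <- l] = Ypr [seq f j | j <- rem i l] *m Yop (f i).
Proof.
elim: l => [//|j l IH]; rewrite inE /=; case: (eqVneq j i) => [->|nj].
  by rewrite ?eqxx /= => _; rewrite Ypr_comm.
by rewrite ?[i == j]eq_sym ?(negbTE nj) /= => /IH ->; rewrite mulmxA.
Qed.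

Lemma Ypr_crz s : crz D0 (hpow h) (size s * b) (\sum_(y <- s) D0 y) (Ypr s).
Proof.
elim: s => [|y s IH] /=; first by rewrite big_nil; exact: crz1.
by rewrite big_cons mulSn addrC; exact: crz_mul.
Qed.

Definition YS (s : S) := Ypr [seq s i | i <- enum 'I_m].
Definition YSi i (s : S) := Ypr [seq s j | j <- rem i (enum 'I_m)].

(** By commutation the shift of slot [i] can be moved to the far right, where it acts first on the
    fresh reference. *)
Lemma YSiE i s : YS s = YSi i s *m Yop (s i).
Proof. by apply: Ypr_rem; rewrite mem_enum. Qed.

Lemma YSi_indep i (s s' : S) : (forall j, j != i -> s j = s' j) -> YSi i s = YSi i s'.
Proof.
move=> H; rewrite /YSi; congr Ypr; apply/eq_in_map => j.
by rewrite mem_rem_uniq ?enum_uniq // inE => /andP[nj _]; apply: H.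
Qed.

Definition goodL (l : L) : bool := [forall y, l y + m * b <= Lm]%N.

(** Given source label [x], bath state and random label [a], outputs the target vector selected by
    [a] and lets the bath absorb [x]. *)
Definition Jout : op (S * (Q * A)) (X * (Q * A)) :=
  mk (fun p r => if dom r.2.1 then en phi p.1 (jj r.2.2) * (stuff r.1 r.2.1 r.2.2 == p.2)%:R else 0).
Definition Jm : op (S * (Q * A)) (S * (Q * A)) := Jout *m tens (dag xi) 1%:M.
Definition dQ : op (Q * A) (Q * A) := hdiag (fun r => (dom r.1)%:R).
Definition PL : op L L := hdiag (fun l => (goodL l)%:R).
Definition Cop : op ((S * (Q * A)) * (F * L)) ((S * (Q * A)) * (F * L)) := ctl (fun z => YS z.1).
(** Source label read by [xi], exchanged through [Jout], then the reference shifted according to the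
    configuration produced; [PL] excludes ladder states from which the shifts could wrap around. *)
Definition Vop := Cop *m tens Jm (tens 1%:M PL).
Definition Pi := tens (tens (xi *m dag xi) dQ) (tens (1%:M : op F F) PL).

Lemma phi1 : dag phi *m phi = 1%:M.
Proof. by rewrite prod_dag prod_mul -prod1; apply: eq_prod => i. Qed.

Lemma hdiag_bool (U : finType) (P : pred U) : hdiag (fun x => (P x)%:R) *m hdiag (fun x => (P x)%:R) = hdiag (fun x => (P x)%:R) :> op U U.
Proof. by rewrite hdiag_mul; apply: eq_hdiag => x; case: (P x); rewrite ?mul1r ?mul0r. Qed.

Lemma en_Jout p r : en Jout p r =
  if dom r.2.1 then en phi p.1 (jj r.2.2) * (stuff r.1 r.2.1 r.2.2 == p.2)%:R else 0.
Proof. exact: en_mk. Qed.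

(** Inputs with different target labels are separated by orthonormality of [phi], those with equal
    ones by injectivity of [stuff]. *)
Lemma Jout_gram : dag Jout *m Jout = tens 1%:M dQ.
Proof.
apply: enP => -[x [q a]] [x' [q' a']]; rewrite en_mul en_tens en1 en_hdiag /=.
case: (boolP (dom q)) => dq; last first.
  rewrite big1; first by case: (_ == _); rewrite ?mul1r ?mul0r //; case: ifP.
  by move=> p _; rewrite en_dag en_Jout /= (negbTE dq) conjc0 mul0r.
case: (boolP (dom q')) => dq'; last first.
  rewrite big1 => [|p _]; last by rewrite [en Jout _ _]en_Jout /= (negbTE dq') mulr0.
  case: eqP; rewrite ?mul0r // => _; case: eqP => [[E _]|]; last by rewrite mulr0.
  by rewrite -E dq in dq'.
have -> : \sum_p en (dag Jout) (x, (q, a)) p * en Jout p (x', (q', a')) =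
  \sum_s \sum_r (conjc (en phi s (jj a)) * en phi s (jj a')) * ((stuff x q a == r)%:R * (stuff x' q' a' == r)%:R).
  rewrite pair_bigA /=; apply: eq_bigr => -[s r] _; rewrite en_dag !en_Jout /= dq dq' rmorphM mulrACA.
  by congr (_ * (_ * _)); case: (stuff x q a == r); rewrite /= ?oppr0.
have -> : \sum_s \sum_r (conjc (en phi s (jj a)) * en phi s (jj a')) * ((stuff x q a == r)%:R * (stuff x' q' a' == r)%:R)
  = (jj a == jj a')%:R * (stuff x' q' a' == stuff x q a)%:R.
  under eq_bigr => s _ do rewrite -mulr_sumr sum_pick.
  rewrite -mulr_suml; congr (_ * _).
  have := congr1 (fun B => en B (jj a) (jj a')) phi1; rewrite en_mul en1 => <-.
  by apply: eq_bigr => s _; rewrite en_dag.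
rewrite -natrM mulnb; case: (boolP ((jj a == jj a') && _)) => [/andP[/eqP ja /eqP st]|H].
  by have [-> -> ->] := stuffi dq dq' ja (esym st); rewrite !eqxx mul1r.
case: eqP => [Ex|]; last by rewrite mul0r.
case: eqP => [[Eq Ea]|]; last by rewrite mulr0.
by move: H; rewrite Ex Eq Ea !eqxx.
Qed.

Lemma Jm_gram : dag Jm *m Jm = tens (xi *m dag xi) dQ.
Proof.
rewrite /Jm dag_mul tens_dag dagK dag1 -!mulmxA (mulmxA (dag Jout)) Jout_gram !tens_mul.
by rewrite !mul1mx mulmx1.
Qed.

Lemma PLd : dag PL = PL. Proof. exact: hdiag_dag. Qed.
Lemma PLP : PL *m PL = PL. Proof. exact: hdiag_bool. Qed.

Lemma Cop_isom : dag Cop *m Cop = 1%:M.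
Proof. by apply: ctl_isom => z; exact: Ypr1. Qed.

Lemma Vgram : dag Vop *m Vop = Pi.
Proof.
rewrite /Vop dag_mul -mulmxA (mulmxA (dag Cop)) Cop_isom mul1mx tens_dag tens_mul Jm_gram.
by rewrite tens_dag dag1 tens_mul mul1mx PLd PLP.
Qed.

Lemma Jm_proj : Jm *m tens (xi *m dag xi) dQ = Jm.
Proof.
rewrite /Jm -mulmxA tens_mul mulmxA xi1 !mul1mx.
have -> : tens (dag xi) dQ = tens 1%:M dQ *m tens (dag xi) 1%:M by rewrite tens_mul mul1mx mulmx1.
rewrite mulmxA; congr (_ *m _); apply: enP => p [x [q a]].
have -> : tens 1%:M dQ = hdiag (fun r : X * (Q * A) => (dom r.2.1)%:R).
  apply: enP => -[y [r c]] [y' [r' c']]; rewrite en_tens en1 !en_hdiag /= [in RHS]xpair_eqE.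
  by case: (y == y'); rewrite ?mul1r ?mul0r.
rewrite hdiagr !en_Jout /=; case: (dom q); by rewrite ?mulr1 ?mulr0.
Qed.

Lemma Vpisom : Vop *m dag Vop *m Vop = Vop.
Proof.
rewrite -mulmxA Vgram /Vop /Pi -mulmxA tens_mul Jm_proj tens_mul mul1mx.
by rewrite PLP.
Qed.

Definition hZ : (S * (Q * A)) * (F * L) -> R :=
  hsum2 (hsum2 (hpow h) (fun r : Q * A => hQ r.1)) (hsum2 (hpow h) (hlad D0)).

Lemma phie s j : en phi s j != 0 -> hpow h s + hpow D0 s = hpow tau0 j.
Proof.
rewrite en_prod => /prodf_neq0 n0; rewrite /hpow -big_split; apply: eq_bigr => i _.
by apply: phi0e; exact: n0.
Qed.

(** The bath exchange balances [e x] against [tau], the target vectors satisfy [h + D0 = tau], and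
    the reference gains exactly [D0] of the produced configuration because [goodL] leaves room for
    all [m] shifts. *)
Lemma Vecons : econs hZ Vop.
Proof.
move=> [[s [q a]] [f l]] [[s0 [q0 a0]] [f0 l0]]; rewrite addr0 en_ctl_mul => n0.
have [[f1 l1] /andP[n1 n2]] : exists g', (en (YS s) (f, l) g' != 0) &&
   (en (tens Jm (tens 1%:M PL)) (s, (q, a), g') (s0, (q0, a0), (f0, l0)) != 0).
  apply/existsP; apply: contraNT n0; rewrite negb_exists => /forallP H; apply/eqP.
  rewrite big1 // => z _; have := H z; rewrite negb_and !negbK /=.
  by case/orP => /eqP ->; rewrite ?mul0r ?mulr0.
move: n2; rewrite en_tens /= mulf_eq0 negb_or => /andP[nJ]; rewrite en_tens en1 en_hdiag /=.
case: (eqVneq f1 f0) => [Ef|_]; last by rewrite mul0r eqxx.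
case: (eqVneq l1 l0) => [El|_]; last by rewrite mulr0 eqxx.
rewrite mul1r; case: (boolP (goodL l1)) => gl; last by rewrite eqxx.
move=> _; subst f1 l1.
have sz : size [seq s i | i <- enum 'I_m] = m by rewrite size_map size_enum_ord.
have [|_ hE] := Ypr_crz n1; first by rewrite sz => y; have /forallP /(_ y) := gl.
rewrite big_map big_enum /= in hE.
have [x [n3 n4 dq0 st]] : exists x, [/\ en phi s (jj a0) != 0, en xi s0 x != 0, dom q0 & stuff x q0 a0 = (q, a)].
  move: nJ; rewrite /Jm en_mul => nJ.
  have [[x [q1 a1]] /andP[k1 k2]] : exists p, (en Jout (s, (q, a)) p != 0) && (en (tens (dag xi) 1%:M) p (s0, (q0, a0)) != 0).
    apply/existsP; apply: contraNT nJ; rewrite negb_exists => /forallP H; apply/eqP.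
    rewrite big1 // => z _; have := H z; rewrite negb_and !negbK /=.
    by case/orP => /eqP ->; rewrite ?mul0r ?mulr0.
  move: k2; rewrite en_tens en1 /= en_dag mulf_eq0 negb_or conjc_eq0 => /andP[k2].
  case: (eqVneq (q1, a1) (q0, a0)) => [[Eq Ea] _|_]; last by rewrite mulr0n eqxx.
  subst q1 a1; exists x; move: k1; rewrite en_Jout /=; case: (boolP (dom q0)); last by rewrite eqxx.
  by move=> _; rewrite mulf_eq0 negb_or => /andP[k1]; case: (eqVneq (stuff x q0 a0) (q, a)) => [->|_]; rewrite ?mulr0n ?eqxx.
have h1 := stuffe x a0 dq0; have h2 := phie n3; have h3 := xie n4.
have e1 : \sum_i D0 (s i) = hpow D0 s by [].
move: hE; rewrite e1 /hZ /hsum2 /= h3; move: h1 h2; rewrite st /=.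
exact: energy_balance.
Qed.

Variables (W : finType) (w : op T W).
Hypothesis w1 : N2 w = 1.

Definition gamp (E : finType) (hE : E -> R) : op E E := hdiag (fun x => Num.sqrt (gibbsp beta hE x)).
Definition hQA (r : Q * A) : R := hQ r.1.
Definition gL : op L L := gamp (fun l : L => hlad D0 l).
Definition vv := Jm *m tens (powop 'I_m w) (gamp hQA).
Definition G0 := tens (powop IF w) (PL *m gL).
Definition w_in := tens (tens (powop 'I_m w) (gamp hQA)) (tens (powop IF w) (gL)).
(** The mixture of the vectors [phi0] selected by a uniformly random label in [A0]. *)
Definition sig0 : op T T := phi0 *m hdiag (fun j => #|[set x | jj0 x == j]|%:R / #|A0|%:R) *m dag phi0.

Lemma VwE : Vop *m w_in = Cop *m tens vv G0.
Proof. by rewrite /Vop /w_in -mulmxA !tens_mul mul1mx. Qed.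

Lemma en_sig0 t t' : (0 < #|A0|)%N ->
  \sum_a en phi0 t (jj0 a) * conjc (en phi0 t' (jj0 a)) = #|A0|%:R * en sig0 t t'.
Proof.
move=> A00; rewrite /sig0 en_mul mulr_sumr (partition_big jj0 predT) //=; apply: eq_bigr => j _.
rewrite hdiagr en_dag (eq_bigr (fun=> en phi0 t j * conjc (en phi0 t' j))) => [|a /eqP -> //].
rewrite sumr_const -[LHS]mulr_natl rmorphM /= fmorphV !rmorph_nat cardsE.
have n0 : #|A0|%:R != 0 :> C by rewrite pnatr_eq0 -lt0n.
by field.
Qed.

Lemma en_vv s r k ra : en vv (s, r) (k, ra) =
  (\sum_x en Jout (s, r) (x, ra) * en (dag xi *m powop 'I_m w) x k) * (Num.sqrt (gibbsp beta hQA ra))%:C.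
Proof.
rewrite /vv /Jm -mulmxA tens_mul mul1mx en_mul sum_pair mulr_suml; apply: eq_bigr => x _.
rewrite (bigD1 ra) //= big1 ?addr0 => [|rb nb]; rewrite en_tens /= en_hdiag.
  by rewrite eqxx mulrA.
by rewrite (negbTE nb) !mulr0.
Qed.

Lemma Jout_inner s s' x x' ra :
  \sum_r en Jout (s, r) (x, ra) * conjc (en Jout (s', r) (x', ra)) =
  if dom ra.1 && (x == x') then en phi s (jj ra.2) * conjc (en phi s' (jj ra.2)) else 0.
Proof.
case: ra => q a; under eq_bigr => r _ do rewrite !en_Jout /=.
case: (boolP (dom q)) => dq /=; last by rewrite big1 // => r _; rewrite mul0r.
rewrite (eq_bigr (fun r => en phi s (jj a) * conjc (en phi s' (jj a)) * ((stuff x q a == r)%:R * (stuff x' q a == r)%:R))) => [|r _]; last first.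
  rewrite rmorphM mulrACA; congr (_ * (_ * _)); by case: (_ == r); rewrite /= ?oppr0.
rewrite -mulr_sumr sum_pick; case: (eqVneq x x') => [->|nx]; first by rewrite eqxx mulr1.
case: eqP => [E|_]; last by rewrite mulr0.
by have [E' _ _] := stuffi dq dq (erefl _) E; rewrite E' eqxx in nx.
Qed.

(** Tracing out the bath removes all interference between source labels, since the bath remembers
    [x]. The label [a] is uniform because its Hamiltonian is trivial, so what remains is a product
    of copies of [sig0]; [kap] is the weight surviving the projections. *)
Lemma vv_reduced : (0 < #|A0|)%N -> exists kap : C, forall s s',
  \sum_r en (vv *m dag vv) (s, r) (s', r) = kap * en (powop 'I_m sig0) s s'.
Proof.
move=> A00; pose al := dag xi *m powop 'I_m w.
exists ((N2 al)%:C * (\sum_(q | dom q) (expR (- (beta * hQ q)) / \sum_y expR (- (beta * hQA y)))%:C) * #|A0|%:R ^+ m) => s s'.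
pose pq q : R := expR (- (beta * hQ q)) / \sum_y expR (- (beta * hQA y)).
rewrite -/al; transitivity (\sum_k \sum_ra \sum_x \sum_x' (\sum_r en Jout (s, r) (x, ra) * conjc (en Jout (s', r) (x', ra)))
   * (en al x k * conjc (en al x' k) * (pq ra.1)%:C)).
  rewrite (eq_bigr (fun r => \sum_k \sum_ra en vv (s, r) (k, ra) * conjc (en vv (s', r) (k, ra)))) => [|r _]; last first.
    rewrite en_mul sum_pair; apply: eq_bigr => k _; apply: eq_bigr => ra _; by rewrite en_dag.
  rewrite exchange_big; apply: eq_bigr => k _; rewrite exchange_big; apply: eq_bigr => ra _.
  rewrite (eq_bigr (fun r => \sum_x \sum_x' (en Jout (s, r) (x, ra) * conjc (en Jout (s', r) (x', ra)))
   * (en al x k * conjc (en al x' k) * (pq ra.1)%:C))) => [|r _].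
    rewrite exchange_big; apply: eq_bigr => x _; rewrite exchange_big; apply: eq_bigr => x' _.
    by rewrite mulr_suml.
  rewrite !en_vv rmorphM mulrACA -/al rmorph_sum big_distrlr mulr_suml; apply: eq_bigr => x _.
  rewrite mulr_suml; apply: eq_bigr => x' _.
  rewrite [X in _ * X = _](_ : _ = (pq ra.1)%:C); first by rewrite rmorphM /=; ring.
  by rewrite /= oppr0 -rmorphM -expr2 sqr_sqrtr ?ltW ?gibbsp_gt0.
transitivity (\sum_ra (if dom ra.1 then en phi s (jj ra.2) * conjc (en phi s' (jj ra.2)) * (pq ra.1)%:C else 0) * (N2 al)%:C).
  rewrite exchange_big; apply: eq_bigr => ra _.
  rewrite N2_en [in RHS]exchange_big rc_sum mulr_sumr; apply: eq_bigr => k _.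
  rewrite rc_sum mulr_sumr; apply: eq_bigr => x _.
  under eq_bigr => x' _ do rewrite Jout_inner.
  rewrite (bigD1 x) //= big1 ?addr0 => [|x' nx].
    rewrite eqxx andbT; case: (dom ra.1); last by rewrite !mul0r.
    by rewrite -sqnE; ring.
  by rewrite [x == x']eq_sym (negbTE nx) andbF mul0r.
rewrite -mulr_suml sum_pair /= mulrC -!mulrA; congr (_ * _).
rewrite mulr_suml [RHS]big_mkcond; apply: eq_bigr => q _ /=.
case: (dom q); last by rewrite big1.
rewrite -mulr_suml mulrC; congr (_ * _).
rewrite en_prod -[X in _ ^+ X]card_ord -prodr_const -big_split /=.
rewrite (eq_bigr (fun i => \sum_a en phi0 (s i) (jj0 a) * conjc (en phi0 (s' i) (jj0 a)))) => [|i _]; last by rewrite en_sig0.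
rewrite bigA_distr_bigA; apply: eq_bigr => a _; rewrite !en_prod rmorph_prod -big_split.
by apply: eq_bigr => i _; rewrite !ffunE.
Qed.

(** The output amplitude with the shift belonging to slot [i] left out: the comparison state in
    which slot [i] is exactly decoupled. *)
Definition vi i := ctl (fun z : S * (Q * A) => YSi i z.1) *m tens vv G0.

Local Notation I := ('I_m + IF)%type.
Local Notation Dom := (({ffun I -> T} * unit) * ((Q * A) * L))%type.
Definition lft (b : {ffun I -> T}) : S := [ffun i => b (inl i)].
Definition rgt (b : {ffun I -> T}) : F := [ffun i => b (inr i)].
Definition glue (s : S) (f : F) : {ffun I -> T} := [ffun i => match i with inl i => s i | inr i => f i end].
(** Regroups target slots and reference copies into one register, since both are copies of [rho] to
    be refilled in the catalytic cycle. *)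
Definition dm (p : Dom) : (S * (Q * A)) * (F * L) := ((lft p.1.1, p.2.1), (rgt p.1.1, p.2.2)).
Definition dm' (z : (S * (Q * A)) * (F * L)) : Dom := ((glue z.1.1 z.2.1, tt), (z.1.2, z.2.2)).

Lemma dmK : cancel dm dm'.
Proof.
move=> [[b0 []] [r l]]; rewrite /dm' /dm /=; congr (_, _, _); apply/ffunP => -[i|i]; by rewrite !ffunE.
Qed.
Lemma dmK' : cancel dm' dm.
Proof.
move=> [[s r] [f l]]; rewrite /dm' /dm /=; congr (_, _, (_, _)); apply/ffunP => i; by rewrite !ffunE.
Qed.

Definition red (V : finType) (v : op ((S * (Q * A)) * (F * L)) V) : op ({ffun I -> T} * unit) ({ffun I -> T} * unit) :=
  pt2 (bij R dm *m (v *m dag v) *m dag (bij R dm)).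

Lemma tn_red (V : finType) (v v' : op ((S * (Q * A)) * (F * L)) V) d : 0 <= d -> N2 v <= 1 -> N2 v' <= 1 ->
  N2 (v - v') <= d ^+ 2 -> tn (red v - red v') (2 * d).
Proof.
move=> d0 h1 h2 h3; rewrite /red -pt2B -mulmxBl -mulmxBr; apply/tn_pt2/tn_isom.
  exact: bij_isom dmK dmK'.
exact: tn_diff.
Qed.

Lemma lft_upd b0 i t : lft (upd b0 (inl i) t) = [ffun j => if j == i then t else lft b0 j].
Proof. by apply/ffunP => j; rewrite !ffunE. Qed.
Lemma rgt_upd b0 i t : rgt (upd b0 (inl i) t) = rgt b0.
Proof. by apply/ffunP => j; rewrite !ffunE. Qed.

Lemma dens_sig0 : (0 < #|A0|)%N -> dens sig0.
Proof.
move=> A00; apply: dens_isom => //; apply: dens_hdiag => [j|]; first by rewrite divr_ge0.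
rewrite -mulr_suml -natr_sum.
have -> : (\sum_i #|[set x | jj0 x == i]|)%N = #|A0|.
  rewrite -sum1_card (partition_big jj0 predT) //=; apply: eq_bigr => j _.
  by rewrite -sum1_card; apply: eq_bigl => a; rewrite inE.
by rewrite divff // pnatr_eq0 -lt0n.
Qed.

(** Without its shift, slot [i] enters only through the reduced state of [vv], which is a product
    over slots. *)
Lemma red_vi i : (0 < #|A0|)%N -> Rep (inl i) sig0 (red (vi i)) = red (vi i).
Proof.
move=> A00; have [kap hk] := vv_reduced A00.
pose M s s' : op (F * L) (F * L) := YSi i s *m (G0 *m dag G0) *m dag (YSi i s').
apply: (@Rep_fix _ _ _ _ _ _ _ (fun b0 b1 _ _ =>
  kap * \prod_(j | j != i) en sig0 (b0 (inl j)) (b1 (inl j)) *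
  \sum_l en (M (lft b0) (lft b1)) (rgt b0, l) (rgt b1, l))).
- exact: proj2 (dens_sig0 A00).
- move=> b0 d b1 d'.
  transitivity (\sum_r \sum_l en (vv *m dag vv) (lft b0, r) (lft b1, r) *
     en (M (lft b0) (lft b1)) (rgt b0, l) (rgt b1, l)).
    rewrite en_mk sum_pair; apply: eq_bigr => r _; apply: eq_bigr => l _.
    rewrite bijr bijl /dm /= /vi dag_mul -!mulmxA [tens vv G0 *m _]mulmxA.
    by rewrite [dag (tens vv G0)]tens_dag tens_mul !mulmxA en_ctl_conj.
  transitivity ((\sum_r en (vv *m dag vv) (lft b0, r) (lft b1, r)) *
     \sum_l en (M (lft b0) (lft b1)) (rgt b0, l) (rgt b1, l)); first by rewrite big_distrlr.
  rewrite hk en_prod (bigD1 i) //= !ffunE -!mulrA mulrCA; congr (_ * (_ * (_ * _))).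
  by apply: eq_bigr => j _; rewrite !ffunE.
- move=> b0 b1 _ _ t; rewrite !rgt_upd; congr (_ * _ * _).
    by apply: eq_bigr => j nj; rewrite !upd_neq.
  rewrite /M; have e1 c : YSi i (lft (upd c (inl i) t)) = YSi i (lft c).
    by apply: YSi_indep => j nj; rewrite lft_upd ffunE (negbTE nj).
  by rewrite !e1.
Qed.

Hypothesis A00 : (0 < #|A0|)%N.
Hypothesis Q0 : (0 < #|Q|)%N.

Lemma gamp_dag (E : finType) (hE : E -> R) : dag (gamp hE) = gamp hE.
Proof. exact: hdiag_dag. Qed.

Lemma gamp_sq (E : finType) (hE : E -> R) : gamp hE *m dag (gamp hE) = gibbsop beta hE.
Proof.
rewrite gamp_dag hdiag_mul; apply: eq_hdiag => x.
by rewrite -expr2 sqr_sqrtr // ltW ?gibbsp_gt0.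
Qed.

Lemma N2_gamp (E : finType) (hE : E -> R) : (0 < #|E|)%N -> N2 (gamp hE) = 1.
Proof. by move=> E0; apply: dens_N2; rewrite gamp_sq (proj2 (dens_gibbs _ _ E0)). Qed.

Lemma N2_proj_gamp (E : finType) (hE : E -> R) (P : pred E) : (0 < #|E|)%N ->
  N2 (hdiag (fun x => (P x)%:R) *m gamp hE) = 1 - \sum_(x | ~~ P x) gibbsp beta hE x.
Proof.
move=> E0; have -> : 1 - \sum_(x | ~~ P x) gibbsp beta hE x = \sum_(x | P x) gibbsp beta hE x.
  by apply/eqP; rewrite subr_eq -(gibbsp_sum beta hE E0) (bigID P).
rewrite hdiag_mul N2_en [RHS]big_mkcond.
apply: eq_bigr => x _; rewrite (bigD1 x) //= big1 ?addr0 => [|y ny].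
  rewrite en_hdiag eqxx sqnC; case: (P x); last by rewrite mulr0n mul0r expr0n.
  by rewrite mulr1n mul1r sqr_sqrtr // ltW // gibbsp_gt0.
by rewrite en_hdiag eq_sym (negbTE ny) sqn0.
Qed.

Lemma N2_powop (J' : finType) : N2 (powop J' w) = 1.
Proof. by rewrite N2_prod big1. Qed.

Lemma QA0 : (0 < #|{: Q * A}|)%N.
Proof.
have [q _] := card_gt0P Q0; have [a _] := card_gt0P A00.
by apply/card_gt0P; exists (q, [ffun=> a]).
Qed.
Lemma L0 : (0 < #|{: L}|)%N.
Proof. by apply/card_gt0P; exists [ffun=> ord0]. Qed.

Lemma N2_win : N2 w_in = 1.
Proof. by rewrite !N2_tens !N2_powop !N2_gamp ?mul1r //; [exact: L0|exact: QA0]. Qed.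

Lemma PiH : dag Pi = Pi.
Proof. by rewrite !tens_dag dag_mul dagK dag1 hdiag_dag PLd. Qed.
Lemma PiP : Pi *m Pi = Pi.
Proof.
rewrite !tens_mul mul1mx PLP mulmxA -[xi *m dag xi *m xi]mulmxA xi1 mulmx1.
by congr (tens (tens _ _) _); exact: hdiag_bool.
Qed.

Lemma N2_gram m1 m2 k (B : 'M[C]_(m1, m2)) (P : 'M[C]_m2) (x : 'M[C]_(m2, k)) :
  dag B *m B = P -> dag P = P -> P *m P = P -> N2 (B *m x) = N2 (P *m x).
Proof.
move=> HB Ph PP; apply: rcI; rewrite -!N2E !dag_mul -!mulmxA [dag B *m _]mulmxA HB.
by rewrite [dag P *m _]mulmxA Ph PP.
Qed.

(** The source, the bath and the ladder each lose at most [ep] of their weight to the projection,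
    and the input is a product. *)
Lemma win_close ep : N2 (powop 'I_m w - xi *m dag xi *m powop 'I_m w) <= ep ->
  \sum_(r | ~~ dom r.1) gibbsp beta hQA r <= ep ->
  \sum_(l | ~~ goodL l) gibbsp beta (fun l : L => hlad D0 l) l <= ep ->
  N2 (w_in - Pi *m w_in) <= 3 * ep.
Proof.
move=> hs hq hl; have := N2_projD w_in PiH PiP; rewrite N2_win.
have H1 : dag (xi *m dag xi) = xi *m dag xi by rewrite dag_mul dagK.
have H2 : xi *m dag xi *m (xi *m dag xi) = xi *m dag xi.
  by rewrite mulmxA -[xi *m dag xi *m xi]mulmxA xi1 mulmx1.
have e1 : N2 (xi *m dag xi *m powop 'I_m w) = 1 - N2 (powop 'I_m w - xi *m dag xi *m powop 'I_m w).
  by have := N2_projD (powop 'I_m w) H1 H2; rewrite {1}N2_powop => ->; rewrite addrK.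
have e2 : N2 (dQ *m gamp hQA) = 1 - \sum_(r | ~~ dom r.1) gibbsp beta hQA r.
  by apply: (N2_proj_gamp hQA (fun r => dom r.1)); exact: QA0.
have e3 : N2 (PL *m gL) = 1 - \sum_(l | ~~ goodL l) gibbsp beta (fun l : L => hlad D0 l) l.
  by apply: (N2_proj_gamp _ goodL); exact: L0.
have -> : N2 (Pi *m w_in) = N2 (xi *m dag xi *m powop 'I_m w) * N2 (dQ *m gamp hQA) * N2 (PL *m gL).
  by rewrite !tens_mul !N2_tens mul1mx N2_powop mul1r.
rewrite e1 e2 e3; set a := N2 (powop 'I_m w - _) in hs *.
have a0 : 0 <= a by exact: N2_ge0.
have b0 : 0 <= \sum_(r | ~~ dom r.1) gibbsp beta hQA r by apply: sumr_ge0 => r _; exact/ltW/gibbsp_gt0.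
have c0 : 0 <= \sum_(l | ~~ goodL l) gibbsp beta (fun l : L => hlad D0 l) l by apply: sumr_ge0 => r _; exact/ltW/gibbsp_gt0.
have a1 : 0 <= 1 - a by rewrite -e1 N2_ge0.
have b1 : 0 <= 1 - \sum_(r | ~~ dom r.1) gibbsp beta hQA r by rewrite -e2 N2_ge0.
exact: three_close.
Qed.

Lemma N2_vv : N2 vv <= 1.
Proof.
have H1 : dag (tens (xi *m dag xi) dQ) = tens (xi *m dag xi) dQ.
  by rewrite tens_dag dag_mul dagK hdiag_dag.
have H2 : tens (xi *m dag xi) dQ *m tens (xi *m dag xi) dQ = tens (xi *m dag xi) dQ.
  rewrite tens_mul mulmxA -[xi *m dag xi *m xi]mulmxA xi1 mulmx1; congr tens; exact: hdiag_bool.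
rewrite (N2_gram _ Jm_gram H1 H2); apply: le_trans (N2_proj_le _ H1 H2) _.
by rewrite N2_tens N2_powop N2_gamp ?mul1r //; exact: QA0.
Qed.

Lemma N2_G0 : N2 G0 <= 1.
Proof.
rewrite N2_tens N2_powop mul1r; apply: le_trans (N2_proj_le _ PLd PLP) _.
by rewrite N2_gamp //; exact: L0.
Qed.

Lemma YSi_isom i s : dag (YSi i s) *m YSi i s = 1%:M.
Proof. exact: Ypr1. Qed.

Lemma N2_vi i : N2 (vi i) <= 1.
Proof.
rewrite N2_isom; last by apply: ctl_isom => z; exact: Ypr1.
by rewrite N2_tens -[leRHS](mulr1 1) ler_pM ?N2_ge0 ?N2_vv ?N2_G0.
Qed.

Lemma vi_close i eta : 0 <= eta -> (forall y, N2 (Yop y *m G0 - G0) <= eta) ->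
  N2 (Cop *m tens vv G0 - vi i) <= eta.
Proof.
move=> e0 H; have -> : Cop = ctl (fun z : S * (Q * A) => YSi i z.1) *m ctl (fun z : S * (Q * A) => Yop (z.1 i)).
  by rewrite ctl_mul; apply: eq_ctl => z; exact: YSiE.
rewrite /vi -mulmxA -mulmxBr N2_isom; last by apply: ctl_isom => z; exact: Ypr1.
apply: le_trans (ctl_close vv (fun z => H (z.1 i))) _.
by rewrite -[leRHS]mul1r ler_wpM2r // N2_vv.
Qed.

Definition hEE : (Q * A) * L -> R := hsum2 hQA (fun l : L => hlad D0 l).
Definition hDom : Dom -> R := hsum2 (hsum2 (hpow h) (fun=> 0)) hEE.

Lemma gibbsp_prod (E1 E2 : finType) (h1 : E1 -> R) (h2 : E2 -> R) p :
  gibbsp beta (hsum2 h1 h2) p = gibbsp beta h1 p.1 * gibbsp beta h2 p.2.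
Proof.
rewrite /gibbsp mulrACA -invfM; congr (_ / _); first by rewrite /hsum2 mulrDr opprD expRD.
rewrite sum_pair big_distrlr; apply: eq_bigr => x _; apply: eq_bigr => y _.
by rewrite /hsum2 mulrDr opprD expRD.
Qed.

Lemma hpow_sum (b0 : {ffun I -> T}) : hpow h b0 = hpow h (lft b0) + hpow h (rgt b0).
Proof. by rewrite /hpow big_sumType; congr (_ + _); apply: eq_bigr => i _; rewrite ffunE. Qed.

Section Completed.
Variable UZ : op ((S * (Q * A)) * (F * L)) ((S * (Q * A)) * (F * L)).
Hypothesis UZ1 : dag UZ *m UZ = 1%:M.
Hypothesis UZe : econs hZ UZ.
Hypothesis UZV : UZ *m (dag Vop *m Vop) = Vop.

Definition Uo := bij R dm *m UZ *m dag (bij R dm).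

Lemma Uo1 : dag Uo *m Uo = 1%:M.
Proof.
rewrite /Uo !dag_mul dagK -!mulmxA (mulmxA (dag (bij R dm))) (bij_isom _ dmK dmK') mul1mx.
by rewrite (mulmxA (dag UZ)) UZ1 mul1mx bij_isom' //; exact: can_inj dmK.
Qed.

Lemma Uo_econs : econs hDom Uo.
Proof.
have bd : raise hDom hZ 0 (bij R dm).
  apply: bij_raise => -[[b0 []] [r l]]; rewrite /hZ /hDom /hEE /hsum2 /= hpow_sum /hQA; ring.
have := raise_mul (raise_mul bd UZe) (raise_dag bd); by rewrite oppr0 !addr0.
Qed.

Lemma thmap_red : thmap beta hEE Uo (tens (powop I (w *m dag w)) 1%:M) = red (UZ *m w_in).
Proof.
rewrite /thmap /red; congr pt2.
have -> : tens (tens (powop I (w *m dag w)) 1%:M) (gibbsop beta hEE) =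
    bij R dm *m (w_in *m dag w_in) *m dag (bij R dm).
  apply: enP => -[[b0 u] [r l]] [[b1 v] [r' l']]; rewrite bijr bijl !tens_dag !tens_mul !gamp_sq.
  rewrite /powop !prod_dag !prod_mul !en_tens /= !en_prod en1 !en_hdiag big_sumType /=.
  case: u; case: v; rewrite ?eqxx mulr1n mulr1 xpair_eqE.
  rewrite (eq_bigr (fun i => en (w *m dag w) (lft b0 i) (lft b1 i))) => [|i _]; last by rewrite !ffunE.
  rewrite [X in _ * X * _](eq_bigr (fun i => en (w *m dag w) (rgt b0 i) (rgt b1 i))) => [|i _]; last by rewrite !ffunE.
  rewrite [RHS]mulrACA; congr (_ * _).
  case: (eqVneq r r') => _ /=; last by rewrite mul0r.
  case: (eqVneq l l') => _ /=; last by rewrite mulr0.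
  by rewrite -rmorphM gibbsp_prod.
rewrite /Uo !dag_mul !dagK -!mulmxA (mulmxA (dag (bij R dm)) (bij R dm)) (bij_isom _ dmK dmK') mul1mx.
by rewrite (mulmxA (dag (bij R dm)) (bij R dm)) (bij_isom _ dmK dmK') mul1mx.
Qed.

(** The true output differs from [vi] by the part of the input outside the initial space and by one
    reference shift; neither depends on the number of slots. The resulting distance [2 d] of reduced
    states counts twice, before and after refilling slot [i]. *)
Lemma decoupled_slot i ep eta d :
  N2 (powop 'I_m w - xi *m dag xi *m powop 'I_m w) <= ep ->
  \sum_(r | ~~ dom r.1) gibbsp beta hQA r <= ep ->
  \sum_(l | ~~ goodL l) gibbsp beta (fun l : L => hlad D0 l) l <= ep ->
  0 <= eta -> (forall y, N2 (Yop y *m G0 - G0) <= eta) -> 0 <= d -> 6 * ep + 2 * eta <= d ^+ 2 ->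
  let X' := thmap beta hEE Uo (tens (powop I (w *m dag w)) 1%:M) in
  tn (X' - Rep (inl i) sig0 X') (4 * d).
Proof.
move=> hs hq hl e0 he d0 hd X'; rewrite /X' thmap_red.
have hU : N2 (UZ *m w_in) <= 1 by rewrite N2_isom // N2_win.
have cl : N2 (UZ *m w_in - vi i) <= d ^+ 2.
  have -> : UZ *m w_in - vi i = UZ *m (w_in - Pi *m w_in) + (Cop *m tens vv G0 - vi i).
    by rewrite -VwE mulmxBr [UZ *m (Pi *m _)]mulmxA -Vgram UZV addrA subrK.
  apply: le_trans (N2D_le _ _) (le_trans _ hd); rewrite N2_isom //.
  by apply: close_arith; [exact: vi_close|exact: win_close].
have t1 := tn_red d0 hU (N2_vi i) cl.
have -> : 4 * d = 2 * d + 2 * d by rewrite -mulrDl -natrD.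
by apply: tn_Rep_fix t1; [exact: dens_sig0|exact: red_vi].
Qed.

End Completed.

Lemma decoupled_exists ep eta d :
  N2 (powop 'I_m w - xi *m dag xi *m powop 'I_m w) <= ep ->
  \sum_(r | ~~ dom r.1) gibbsp beta hQA r <= ep ->
  \sum_(l | ~~ goodL l) gibbsp beta (fun l : L => hlad D0 l) l <= ep ->
  0 <= eta -> (forall y, N2 (Yop y *m G0 - G0) <= eta) -> 0 <= d -> 6 * ep + 2 * eta <= d ^+ 2 ->
  exists (E : finType) (hE : E -> R)
    (U : op (({ffun I -> T} * unit) * E) (({ffun I -> T} * unit) * E)),
  let X' := thmap beta hE U (tens (powop I (w *m dag w)) (1%:M : op unit unit)) in
  [/\ (0 < #|E|)%N, dag U *m U = 1%:M, econs (hsum2 (hsum2 (hpow h) (fun=> 0)) hE) U &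
      forall i, tn (X' - Rep (inl i) sig0 X') (4 * d)].
Proof.
move=> hs hq hl e0 he d0 hd.
have [UZ [UZ1 UZe UZV]] := unitary_completion Vpisom Vecons.
exists ((Q * A) * L)%type, hEE, (Uo UZ) => X'; split.
- have /card_gt0P[r _] := QA0; have /card_gt0P[l _] := L0.
  by apply/card_gt0P; exists (r, l).
- exact: Uo1.
- exact: Uo_econs.
- by move=> i; apply: (decoupled_slot UZ1 UZV i hs hq hl e0 he d0 hd).
Qed.

End VOp.

(** * Thermal weight near the top of the ladders *)

Section LadderWeight.
Variable R : realType.
Variables (T : finType) (beta : R) (D0 : T -> R).
Hypothesis beta0 : 0 < beta.
Hypothesis D00 : forall y, 0 <= D0 y.

(** Each of the top [c] weights is at most each of the [K + 1] lower ones, hence at most their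
    average. *)
Lemma top_weight c K (q : 'I_(c + K).+1 -> R) : (forall i, 0 <= q i) -> \sum_i q i = 1 ->
  (forall i j : 'I_(c + K).+1, (i <= j)%N -> q j <= q i) ->
  \sum_(k : 'I_(c + K).+1 | (K < k)%N) q k <= c%:R / K.+1%:R.
Proof.
move=> q0 q1 qd; rewrite ler_pdivlMr ?ltr0n //.
have cl : (#|[pred j : 'I_(c + K).+1 | (j <= K)%N]| = K.+1)%N.
  rewrite -sum1_card; transitivity (\sum_(i < (c + K).+1 | (i < K.+1)%N) 1)%N; first exact: eq_bigl.
  by rewrite -(big_ord_widen (c + K).+1 (fun=> 1%N)) ?ltnS ?leq_addl // sum1_card card_ord.
have ch : (#|[pred k : 'I_(c + K).+1 | (K < k)%N]| = c)%N.
  have := cardC [pred j : 'I_(c + K).+1 | (j <= K)%N]; rewrite cl card_ord addSn => -[] H.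
  apply: (@addnI K); rewrite [RHS]addnC; apply: etrans H; congr (_ + _)%N.
  by apply: eq_card => k; rewrite !inE ltnNge.
have -> : (\sum_(k : 'I_(c + K).+1 | (K < k)%N) q k) * K.+1%:R = \sum_(k : 'I_(c + K).+1 | (K < k)%N) \sum_(j : 'I_(c + K).+1 | (j <= K)%N) q k.
  by rewrite mulr_suml; apply: eq_bigr => k _; rewrite sumr_const cl mulr_natr.
have : \sum_(k : 'I_(c + K).+1 | (K < k)%N) \sum_(j : 'I_(c + K).+1 | (j <= K)%N) q k <=
   \sum_(k : 'I_(c + K).+1 | (K < k)%N) \sum_(j : 'I_(c + K).+1 | (j <= K)%N) q j.
  by apply: ler_sum => k hk; apply: ler_sum => j hj; apply: qd; exact: leq_trans hj (ltnW hk).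
move=> /le_trans; apply; rewrite sumr_const ch -[leLHS]mulr_natl -[leRHS]mulr1 ler_wpM2l //.
rewrite -q1 [leRHS](bigID (fun j : 'I_(c + K).+1 => (j <= K)%N)) /=.
by rewrite lerDl; apply: sumr_ge0.
Qed.

Lemma gibbs_ladder Lm (l : ladder T Lm) :
  gibbsp beta (fun l : ladder T Lm => hlad D0 l) l =
  \prod_y gibbsp beta (fun k : 'I_Lm.+1 => D0 y * k%:R) (l y).
Proof.
have E (l' : ladder T Lm) : expR (- (beta * hlad D0 l')) = \prod_y expR (- (beta * (D0 y * (l' y)%:R))).
  by rewrite -expR_sum; congr expR; rewrite mulr_sumr sumrN.
rewrite /gibbsp prodf_div E; congr (_ / _).
by rewrite (bigA_distr_bigA (fun y (k : 'I_Lm.+1) => expR (- (beta * (D0 y * k%:R))))); apply: eq_bigr => l' _.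
Qed.

(** Union bound over the independent ladders. As rung energies are nonnegative, thermal weights
    decrease upwards. *)
Lemma ladder_bad c K :
  \sum_(l : ladder T (c + K) | ~~ [forall y, (l y + c <= c + K)%N]) gibbsp beta (fun l : ladder T (c + K) => hlad D0 l) l
  <= #|T|%:R * (c%:R / K.+1%:R).
Proof.
have g0 l : 0 <= gibbsp beta (fun l : ladder T (c + K) => hlad D0 l) l by exact/ltW/gibbsp_gt0.
apply: (@le_trans _ _ (\sum_y \sum_(l : ladder T (c + K) | (K < l y)%N) gibbsp beta (fun l : ladder T (c + K) => hlad D0 l) l)).
  rewrite [leRHS](exchange_big_dep predT) //= big_mkcond /=; apply: ler_sum => l _.
  case: ifP => [|_]; last by apply: sumr_ge0.
  rewrite negb_forall => /existsP[y]; rewrite addnC leq_add2l -ltnNge => ly.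
  by rewrite (bigD1 y) //= lerDl; apply: sumr_ge0.
rewrite mulr_natl -sumr_const; apply: ler_sum => y _.
rewrite big_mkcond /=.
pose q z (k : 'I_(c + K).+1) := gibbsp beta (fun k : 'I_(c + K).+1 => D0 z * k%:R) k.
have q1 z : \sum_k q z k = 1 by apply: gibbsp_sum; rewrite card_ord.
rewrite (eq_bigr (fun l : ladder T (c + K) => \prod_z (if (z == y) && ~~ (K < l z)%N then 0 else q z (l z)))); last first.
  move=> l _; rewrite gibbs_ladder; case: (boolP (K < l y)%N) => ly.
    by apply: eq_bigr => z _; case: (eqVneq z y) => [->|]; rewrite ?ly.
  by rewrite (bigD1 y) //= eqxx ly mul0r.
rewrite -(bigA_distr_bigA (fun z (k : 'I_(c + K).+1) => if (z == y) && ~~ (K < k)%N then 0 else q z k)).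
rewrite (bigD1 y) //= [X in _ * X]big1 ?mulr1 => [|z nz].
  rewrite eqxx /=; under eq_bigr => k _ do rewrite if_neg.
  rewrite -big_mkcond /=; apply: top_weight => // [k|i j ij]; first exact/ltW/gibbsp_gt0.
  rewrite /q /gibbsp ler_wpM2r //; first by rewrite invr_ge0; apply: sumr_ge0 => *; exact: expR_ge0.
  by rewrite ler_expR lerN2 (ler_wpM2l (ltW beta0)) // ler_wpM2l // ler_nat.
by rewrite (negbTE nz) /=; exact: q1.
Qed.

Lemma ladder_good m b K :
  \sum_(l : ladder T (m * b + K) | ~~ goodL m b l) gibbsp beta (fun l : ladder T (m * b + K) => hlad D0 l) l
  <= #|T|%:R * ((m * b)%:R / K.+1%:R).
Proof. exact: ladder_bad. Qed.

End LadderWeight.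

Lemma slot_arith (F : realFieldType) (a b e : F) : 0 <= b -> 0 < e -> b <= e / 3 * a ->
  a * (e / 3) + b * (1 + 1) <= (a + b) * e.
Proof.
move=> b0 e0 H; have h1 : 0 <= b * e by rewrite mulr_ge0 // ltW.
have h2 : e / 3 * a = (a * e) / 3 by field.
have h3 : a * (e / 3) = (a * e) / 3 by field.
by move: H; rewrite h2 h3 mulrDl; move: (a * e) (b * e) h1 => x y y0 H; lra.
Qed.

(** * Choice of parameters *)

Section Decouple.
Variable R : realType.
Local Notation C := R[i].
Local Notation op T U := 'M[C]_(#|{: T}|, #|{: U}|).

Lemma dens_tn1 n (X : 'M[C]_n) : dens X -> tn X 1.
Proof.
by move=> [[k [w E]] t]; exists k, w, w; split=> //; rewrite dens_N2 // -E.
Qed.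

Variables (T : finType) (h : T -> R) (beta : R) (rho u : op T T) (p : T -> R).
Variables (A0 J0 : finType) (jj0 : A0 -> J0) (phi0 : op T J0) (tau0 : J0 -> R) (l : nat)
  (word : T -> 'I_l -> T * T) (g : R).
Hypothesis beta0 : 0 < beta.
Hypothesis sp : spec rho u p.
Hypothesis A00 : (0 < #|A0|)%N.
Hypothesis phi01 : dag phi0 *m phi0 = 1%:M.
Hypothesis phi0e : forall y j, en phi0 y j != 0 -> h y + wordD h word y = tau0 j.
Hypothesis word0 : forall y q, en rho (word y q).2 (word y q).1 != 0.
Hypothesis wordp : forall y, 0 <= wordD h word y.
Hypothesis hj : forall j, (#|[set a | jj0 a == j]|%:R / #|A0|%:R) * expR (beta * tau0 j) <= expR g.
Hypothesis gF : g < bfree h beta rho p.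

Lemma jj_prob m (j : {ffun 'I_m -> J0}) :
  #|[set a : {ffun 'I_m -> A0} | jj jj0 a == j]|%:R / #|{: {ffun 'I_m -> A0}}|%:R =
  \prod_i (#|[set a | jj0 a == j i]|%:R / #|A0|%:R) :> R.
Proof.
rewrite prodf_div; congr (_ / _); last by rewrite prodr_const card_ffun natrX card_ord.
rewrite -sum1_card big_mkcond /= natr_sum.
transitivity (\sum_(a : {ffun 'I_m -> A0}) \prod_i ((jj0 (a i) == j i)%:R : R)).
  apply: eq_bigr => a _; rewrite inE; case: eqP => [<-|na].
    by rewrite big1 // => i _; rewrite ffunE eqxx.
  have [i ni] : exists i, jj0 (a i) != j i.
    apply/existsP; apply/contra_notT: na; rewrite negb_exists => /forallP H.
    by apply/ffunP => i; rewrite ffunE; have := H i; rewrite negbK => /eqP.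
  by rewrite (bigD1 i) //= (negbTE ni) mul0r.
rewrite -(bigA_distr_bigA (fun i a => (jj0 a == j i)%:R : R)); apply: eq_bigr => i _.
by rewrite -natr_sum -sum1_card [in RHS]big_mkcond; congr _%:R; apply: eq_bigr => a _; rewrite inE; case: eqP.
Qed.

Lemma res_bad (Q A : finType) (hQ : Q -> R) (dom : pred Q) ep : (0 < #|A|)%N ->
  0 < \sum_r expR (- (beta * hQ r)) ->
  \sum_(r | ~~ dom r) expR (- (beta * hQ r)) <= ep * \sum_r expR (- (beta * hQ r)) ->
  \sum_(r : Q * A | ~~ dom r.1) gibbsp beta (fun r : Q * A => hQ r.1) r <= ep.
Proof.
move=> nA Z0 H; rewrite /gibbsp -mulr_suml.
have e1 (P : pred Q) : \sum_(r : Q * A | P r.1) expR (- (beta * hQ r.1)) = #|A|%:R * \sum_(r | P r) expR (- (beta * hQ r)).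
  rewrite big_mkcond sum_pair mulr_sumr [RHS]big_mkcond; apply: eq_bigr => q _ /=.
  by case: (P q); [rewrite sumr_const mulr_natl|rewrite big1 ?mulr0].
have A1 : (#|A|%:R : R) != 0 by rewrite pnatr_eq0 -lt0n.
rewrite (e1 (predC dom)) (e1 predT) invfM mulrACA divff // mul1r ler_pdivrMr //.
Qed.

(** The order of choices matters: the reference from the accuracy, then [m] large compared with it,
    then the bath for [m] blocks, and last a ladder tall enough for [m] shifts. *)
Lemma decouple_exists eps : 0 < eps ->
  exists (m : nat) (IF E : finType) (hE : E -> R)
    (U : op (({ffun ('I_m + IF) -> T} * unit) * E) (({ffun ('I_m + IF) -> T} * unit) * E)),
  let X' := thmap beta hE U (tens (powop ('I_m + IF)%type rho) (1%:M : op unit unit)) in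
  [/\ (0 < #|E|)%N /\ (0 < m)%N, dag U *m U = 1%:M,
      econs (hsum2 (hsum2 (hpow h) (fun=> 0)) hE) U,
      forall i, tn (X' - Rep (inl i) (sig0 jj0 phi0) X') eps &
      #|IF|%:R <= eps * m%:R].
Proof.
move=> e0; have drho := spec_dens sp; have rho1 : \tr rho = 1 := proj2 drho.
(* Chosen so that [6 ep + 2 ep = d ^ 2] and the final slot error is [4 d]. *)
pose d := eps / 4; pose ep := d ^+ 2 / 8.
have d0 : 0 < d by rewrite divr_gt0.
have ep0 : 0 < ep by rewrite divr_gt0 // exprn_gt0.
have [IF [mstep HF]] := frame_exists rho1 word0 wordp ep0.
pose del := (bfree h beta rho p - g) / 2.
have del0 : 0 < del by rewrite divr_gt0 // subr_gt0.
have [m0 Hm] := source_exists h beta0 sp del0 ep0.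
(* Half of the free energy gap survives as the exponent [m del], which must beat the factor 2 in the
   hypothesis of [reservoir]. *)
have [m1 Hm1] := expR_large 2 del0.
pose m2 := (Num.truncn (#|IF|%:R / eps)).+1.
pose m := (m0 + m1 + m2)%N.
have m00 : (0 < m)%N by rewrite /m /m2; lia.
have IFm : #|IF|%:R <= eps * m%:R.
  rewrite -ler_pdivrMl // [eps^-1 * _]mulrC; apply: le_trans (ltW (truncnS_gt _)) _.
  by rewrite ler_nat /m /m2 leq_addl.
pose w := u *m hdiag (fun k => Num.sqrt (p k)).
have Ew : rho = w *m dag w by exact: spec_amp sp.
have w1 : N2 w = 1 by apply: dens_N2; rewrite -Ew.
have mI : (m0 <= #|'I_m|)%N by rewrite card_ord /m -addnA leq_addr.
have m1m : (m1 <= m)%N by rewrite /m addnAC leq_addl.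
have [X [xi [e [xi1 xie Zs hs]]]] := Hm _ mI _ w Ew.
pose A : finType := {ffun 'I_m -> A0}; pose J : finType := {ffun 'I_m -> J0}.
have nA : (0 < #|A|)%N by rewrite card_ffun expn_gt0 A00.
have cond (j : J) : (#|[set a : A | jj jj0 a == j]|%:R / #|A|%:R) * expR (beta * hpow tau0 j) *
     (\sum_x expR (- (beta * e x))) <= 2^-1.
  have -> : expR (beta * hpow tau0 j) = \prod_i expR (beta * tau0 (j i)) by rewrite /hpow mulr_sumr expR_sum.
  rewrite jj_prob -big_split /=.
  have h1 : \prod_(i < m) (#|[set a | jj0 a == j i]|%:R / #|A0|%:R * expR (beta * tau0 (j i))) <= expR (m%:R * g).
    rewrite expRM_natl -[X in _ ^+ X]card_ord -prodr_const; apply: ler_prod => i _.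
    by rewrite mulr_ge0 ?divr_ge0 ?expR_ge0 //= hj.
  apply: le_trans (ler_pM _ _ h1 Zs) _.
  - by apply: prodr_ge0 => i _; rewrite mulr_ge0 ?divr_ge0 ?expR_ge0.
  - by apply: sumr_ge0 => x _; exact: expR_ge0.
  rewrite -expRD card_ord (_ : _ + _ = - (m%:R * del)); last by rewrite /del; field.
  rewrite expRN lef_pV2 ?posrE ?expR_gt0 //; exact: Hm1.
have [Q [hQ [dom [stuff [stuffe stuffi Z0 hbad]]]]] := reservoir nA ep0 cond.
have Q0 : (0 < #|Q|)%N.
  by rewrite lt0n; apply: contraTneq Z0 => Q0; rewrite big_pred0 ?ltxx // => q; have := card0_eq Q0 q; rewrite inE.
(* The ladder has room for [m * mstep] rungs of climbing above [K] lower rungs, with [K] large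
   enough that the top part has thermal weight at most [ep]. *)
pose K := Num.truncn (#|T|%:R * (m * mstep)%:R / ep).
pose Lm := (m * mstep + K)%N.
have hl : \sum_(l : ladder T Lm | ~~ goodL m mstep l) gibbsp beta (fun l : ladder T Lm => hlad (wordD h word) l) l <= ep.
  apply: le_trans (ladder_good beta0 wordp m mstep K) _.
  rewrite mulrA ler_pdivrMr ?ltr0n // -ler_pdivrMl // [ep^-1 * _]mulrC; exact/ltW/truncnS_gt.
have [Yop [Y1 Yc Ye Yf]] := HF _ w Ew Lm.
have hq := res_bad nA Z0 hbad.
have he y : N2 (Yop y *m G0 beta m (wordD h word) IF Lm mstep w - G0 beta m (wordD h word) IF Lm mstep w) <= ep.
  apply: le_trans (Yf _ _ _) _; rewrite -[leRHS]mulr1 ler_wpM2l // ?(ltW ep0) //.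
  have := N2_G0 beta m (wordD h word) IF Lm mstep w1; rewrite N2_tens N2_prod big1 ?mul1r //.
have ar : 6 * ep + 2 * ep <= d ^+ 2 by rewrite /ep -mulrDl -natrD mulrC divfK ?pnatr_eq0.
have := @decoupled_exists _ _ _ _ _ _ _ _ xi1 xie _ _ _ _ _ _ phi01 phi0e _ _ _ _ stuffe stuffi _ _ _ _ Y1 Yc Ye _ _ w1 A00 Q0 ep ep d
  hs hq hl (ltW ep0) he (ltW d0) ar.
move=> [E [hE [U [n1 n2 n3 n4]]]]; exists m, IF, E, hE, U => X'; split=> // i.
have -> : eps = 4 * d by rewrite /d mulrC divfK ?pnatr_eq0.
by rewrite /X' Ew; exact: n4.
Qed.

(** Nothing better than the trivial error 2 is claimed for the reference slots, but they are so few
    that their share of the average is small. *)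
Lemma cat_decoupled eps : 0 < eps -> Cat beta h rho (sig0 jj0 phi0) eps.
Proof.
move=> e0; have e3 : 0 < eps / 3 by rewrite divr_gt0.
have drho := spec_dens sp.
have [m [IF [E [hE [U [[E0 m0] U1 Ue dec IFm]]]]]] := decouple_exists e3.
have d1 : dens (1%:M : op unit unit).
  split; last by rewrite mxtrace1 card_unit.
  by exists #|{: unit}|, 1%:M; rewrite dag1 mul1mx.
apply: (@duan_slots R _ T unit E beta h (fun=> 0) hE rho _ 1%:M U
  (fun i : 'I_m + IF => if i is inl _ then eps / 3 else 1 + 1)) => //.
- by rewrite card_sum card_ord addn_gt0 m0.
- apply: enP => -[] []; rewrite en1 eqxx.
  have dX := dens_thmap beta hE E0 U1 (dens_tens (dens_pow ('I_m + IF)%type drho) d1).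
  have := proj2 (dens_pt1 dX); rewrite tr_en (bigD1 tt) //= big1 ?addr0 => [-> //|[] //].
- case=> i; first exact: dec.
  apply: tnB; first by apply/dens_tn1/dens_thmap => //; apply: dens_tens => //; exact: dens_pow.
  apply/dens_tn1/dens_Rep; first exact: dens_sig0.
  by apply: dens_thmap => //; apply: dens_tens => //; exact: dens_pow.
rewrite big_sumType /= !sumr_const card_sum card_ord natrD.
rewrite -[X in X + _ <= _]mulr_natl -[X in _ + X <= _]mulr_natl.
exact: slot_arith.
Qed.

End Decouple.

(** * Coherence classes, and the passage from blocks to single copies *)

Section Main.
Variable R : realType.
Local Notation C := R[i].
Local Notation op T U := 'M[C]_(#|{: T}|, #|{: U}|).

Lemma ln_prod (I : finType) (f : I -> R) : (forall i, 0 < f i) -> ln (\prod_i f i) = \sum_i ln (f i).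
Proof.
move=> f0; rewrite (eq_bigr (fun i => expR (ln (f i)))) => [|i _]; last by rewrite lnK // posrE.
by rewrite -expR_sum expRK.
Qed.

(** The overlaps of two eigenbases form a doubly stochastic matrix linking only equal eigenvalues.
    This is needed because the eigenbasis of [rho'] is chosen anew to respect coherence classes. *)
Lemma spec_indep (T : finType) (rho u v : op T T) (p q : T -> R) (f : R -> R) :
  spec rho u p -> spec rho v q -> \sum_k f (p k) = \sum_k f (q k).
Proof.
move=> [uu Eu _ _] [vv Ev _ _]; pose W := dag u *m v.
have WW : W *m dag W = 1%:M.
  by rewrite /W dag_mul dagK -mulmxA (mulmxA v) (mulmx1C vv) mul1mx.
have HW : hdiag p *m W = W *m hdiag q.
  have -> : hdiag p *m W = dag u *m rho *m v by rewrite {1}Eu /W !mulmxA uu mul1mx.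
  by rewrite Ev /W -!mulmxA vv mulmx1.
have key k l : sqn (en W k l) * f (p k) = sqn (en W k l) * f (q l).
  have := congr1 (fun B => en B k l) HW; rewrite hdiagl hdiagr mulrC => E.
  have [->|nW] := eqVneq (en W k l) 0; first by rewrite sqn0 !mul0r.
  by have := mulfI nW E => /rcI ->.
have row1 k : \sum_l sqn (en W k l) = 1.
  by apply: rcI; rewrite -amp_pop WW en1 eqxx.
have col1 l : \sum_k sqn (en W k l) = 1.
  apply: rcI; under eq_bigr => k _ do rewrite -sqnJ -en_dag.
  by rewrite -amp_pop dagK (mulmx1C WW) en1 eqxx.
transitivity (\sum_k \sum_l sqn (en W k l) * f (p k)).
  by apply: eq_bigr => k _; rewrite -mulr_suml row1 mul1r.
rewrite exchange_big; apply: eq_bigr => l _.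
by under eq_bigr => k _ do rewrite key; rewrite -mulr_suml col1 mul1r.
Qed.

Lemma bfree_pow (I T : finType) (h : T -> R) beta (rho u : op T T) p : spec rho u p ->
  bfree (hpow h) beta (powop I rho) (fun k : {ffun I -> T} => \prod_i p (k i)) = #|I|%:R * bfree h beta rho p.
Proof.
move=> sp; have [uu E p0 p1] := sp; have drho := spec_dens sp.
rewrite /bfree mulrDr; congr (_ + _).
  rewrite -sum_prod_add //; apply: eq_bigr => k _.
  have [/existsP[i /eqP pi0]|] := boolP [exists i, p (k i) == 0].
    by rewrite (bigD1 i) //= pi0 !mul0r.
  rewrite negb_exists => /forallP H; rewrite ln_prod // => i.
  by rewrite lt_neqAle eq_sym H p0.
rewrite [RHS]mulrCA; congr (_ * _); rewrite -(sum_prod_add I _ (dens_pop1 drho)).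
by apply: eq_bigr => x _; rewrite pop_pow.
Qed.

Section Modes.
Variables (T : finType) (h : T -> R) (rho : op T T).
Hypothesis drho : dens rho.

Definition modespan (d : R) : Prop := exists s : seq (T * T),
  (forall q, q \in s -> en rho q.2 q.1 != 0) /\ d = \sum_(q <- s) (h q.1 - h q.2).

Lemma dens_dag : dag rho = rho.
Proof. by case: drho => -[k [w ->]] _; rewrite dag_mul dagK. Qed.

Lemma modespan0 : modespan 0.
Proof. by exists [::]; rewrite big_nil. Qed.

Lemma modespanN d : modespan d -> modespan (- d).
Proof.
move=> [s [H ->]]; exists [seq (q.2, q.1) | q <- s]; split.
  by move=> _ /mapP[q qs ->] /=; rewrite -dens_dag en_dag conjc_eq0; exact: H.
by rewrite big_map -sumrN; apply: eq_bigr => q _; rewrite opprB.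
Qed.

Lemma modespanD d e : modespan d -> modespan e -> modespan (d + e).
Proof.
move=> [s [H ->]] [t [K ->]]; exists (s ++ t); rewrite big_cat; split=> // q.
by rewrite mem_cat => /orP[/H|/K].
Qed.

Lemma modespan_sum (I : finType) (d : I -> R) : (forall i, modespan (d i)) -> modespan (\sum_i d i).
Proof.
by move=> H; elim/big_ind: _ => [|x y|i _]; [exact: modespan0|exact: modespanD|exact: H].
Qed.

(** A canonical representative of the levels whose distance from [x] is a resonant mode of [rho]: it
    turns the equivalence relation into a function, as the class-respecting diagonalization
    requires. *)
Definition modecl (x : T) : T := odflt x [pick y | `[< modespan (h x - h y) >]].

Lemma modeclP x y : modecl x = modecl y -> modespan (h x - h y).
Proof.
rewrite /modecl; case: pickP => [a /asboolP ha|/(_ x)]; last by rewrite subrr; move/asboolP: modespan0 => ->.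
case: pickP => [b /asboolP hb|/(_ y)]; last by rewrite subrr; move/asboolP: modespan0 => ->.
by move=> /= E; have := modespanD ha (modespanN hb); rewrite E opprB addrA subrK.
Qed.

Lemma modecl_eq x y : modespan (h x - h y) -> modecl x = modecl y.
Proof.
move=> H; rewrite /modecl; have E : (fun z => `[< modespan (h x - h z) >]) =1 (fun z => `[< modespan (h y - h z) >]).
  move=> z; apply/asboolP/asboolP => K.
    by have := modespanD (modespanN H) K; rewrite opprB addrA subrK.
  by have := modespanD H K; rewrite addrA subrK.
rewrite (eq_pick E); case: pickP => // /(_ y); by rewrite subrr; move/asboolP: modespan0 => ->.
Qed.

End Modes.

Section Assembly.
Variables (T : finType) (h : T -> R) (beta : R) (rho u rho' u' : op T T) (p p' : T -> R).
Hypothesis beta0 : 0 < beta.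
Hypothesis sp : spec rho u p.
Hypothesis sp' : spec rho' u' p'.
Hypothesis modes : forall x y, en rho' x y != 0 -> modespan h rho (h x - h y).

Lemma dens_diag_neq0 : exists x, en rho x x != 0.
Proof.
apply/existsP; apply: contraT; rewrite negb_exists => /forallP H.
have : \tr rho = 1 := proj2 (spec_dens sp); rewrite tr_en big1 => [/eqP|x _].
  by rewrite eq_sym oner_eq0.
by apply/eqP; have := H x; rewrite negbK.
Qed.

(** A single-copy energy gap is realized on a block by acting on the first copy and keeping the
    others at a level [x0] with nonzero population. *)
Lemma words n (Dd : {ffun 'I_n.+1 -> T} -> R) : (forall y, modespan h rho (Dd y)) ->
  exists l (word : {ffun 'I_n.+1 -> T} -> 'I_l -> {ffun 'I_n.+1 -> T} * {ffun 'I_n.+1 -> T}),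
   (forall y q, en (powop 'I_n.+1 rho) (word y q).2 (word y q).1 != 0) /\ forall y, wordD (hpow h) word y = Dd y.
Proof.
move=> /choice[s Hs]; have [x0 nx0] := dens_diag_neq0.
pose emb x : {ffun 'I_n.+1 -> T} := [ffun i => if i == ord0 then x else x0].
have hemb x y : hpow h (emb x) - hpow h (emb y) = h x - h y.
  rewrite /hpow (bigD1 ord0) //= [X in _ - X](bigD1 ord0) //= !ffunE eqxx.
  rewrite (eq_bigr (fun=> h x0)) => [|i ni]; last by rewrite ffunE (negbTE ni).
  rewrite [X in _ - (_ + X)](eq_bigr (fun=> h x0)) => [|i ni]; last by rewrite ffunE (negbTE ni).
  by rewrite opprD addrACA subrr addr0.
pose l := (\max_y size (s y))%N.
(* Shorter words are padded with the pair [(x0, x0)], which has a nonzero entry of [rho] and no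
   energy, so that all have length [l]. *)
pose word (y : {ffun 'I_n.+1 -> T}) (q : 'I_l) := let r := nth (x0, x0) (s y) q in (emb r.1, emb r.2).
exists l, word; split=> [y q|y].
  rewrite en_prod; apply/prodf_neq0 => i _; rewrite /= !ffunE; case: (i == ord0) => //.
  have [lq|lq] := ltnP q (size (s y)); last by rewrite nth_default.
  by apply: (proj1 (Hs y)); exact: mem_nth.
rewrite (proj2 (Hs y)) (big_nth (x0, x0)) big_mkord /wordD.
have ls : (size (s y) <= l)%N by exact: (@leq_bigmax _ (fun y => size (s y)) y).
rewrite (big_ord_widen l (fun i => h (nth (x0, x0) (s y) i).1 - h (nth (x0, x0) (s y) i).2) ls) [RHS]big_mkcond /=.
apply: eq_bigr => i _; rewrite hemb; case: ltnP => // lq.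
by rewrite nth_default //= subrr.
Qed.

Lemma cat_collective eps : bfree h beta rho' p' < bfree h beta rho p -> 0 < eps ->
  exists n, Cat beta (hpow h) (powop 'I_n.+1 rho) (powop 'I_n.+1 rho') eps.
Proof.
move=> FF e0; have drho := spec_dens sp; have drho' := spec_dens sp'.
have cl x y : en rho' x y != 0 -> modecl h rho x = modecl h rho y.
  by move=> /modes; exact: modecl_eq.
have [v [q [c [sq vc]]]] := dens_spec_class drho' cl.
have Fq : bfree h beta rho' q = bfree h beta rho' p' by rewrite /bfree (spec_indep (fun t => t * ln t) sq sp').
pose del := (bfree h beta rho p - bfree h beta rho' p') / 2.
have del0 : 0 < del by rewrite divr_gt0 // subr_gt0.
have e2 : 0 < eps / 2 by rewrite divr_gt0.
have [n [A [J [jj [phi [tau [Dd [[A0 phi1] phie DdP hj tnX]]]]]]]] := target_exists h beta0 sq vc del0 e2.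
have [|l [word [word0 wordE]]] := @words n Dd.
  move=> y; have [y' [ky [-> _]]] := DdP y; rewrite /hpow -sumrB; apply: modespan_sum => i.
  by apply: modeclP => //; rewrite ky.
have wp y : 0 <= wordD (hpow h) word y by rewrite wordE; have [y' [_ []]] := DdP y.
have phie' y j : en phi y j != 0 -> hpow h y + wordD (hpow h) word y = tau j by rewrite wordE; exact: phie.
have gF : #|'I_n.+1|%:R * (bfree h beta rho' q + del) < bfree (hpow h) beta (powop 'I_n.+1 rho) (fun k : {ffun 'I_n.+1 -> T} => \prod_i p (k i)).
  rewrite (bfree_pow 'I_n.+1 h beta sp) ltr_pM2l ?ltr0n ?card_ord // Fq /del; move: FF; lra.
exists n; have [K [E [hK [hE [c0 [U [[E0 dc] U1 Ue P1 P2]]]]]]] :=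
  cat_decoupled beta0 (spec_pow 'I_n.+1 sp) A0 phi1 phie' word0 wp hj gF e2.
exists K, E, hK, hE, c0, U; split=> //.
have -> : eps = eps / 2 + eps / 2 by rewrite -splitr.
by apply: tn_trans P2 _; rewrite -tensBl; apply: tn_tensr.
Qed.

(** The block conversion is itself a collective operation whose target is a product, so each of its
    slots is decoupled up to the block error, and the cyclic construction applies again with the
    block catalyst as extra factor. *)
Lemma cat_main eps : bfree h beta rho' p' < bfree h beta rho p -> 0 < eps -> Cat beta h rho rho' eps.
Proof.
move=> FF e0; have drho := spec_dens sp; have drho' := spec_dens sp'.
have e2 : 0 < eps / 2 by rewrite divr_gt0.
have [n [K [E [hK [hE [c [U [[E0 dc] U1 Ue P1 P2]]]]]]]] := cat_collective FF e2.
apply: (@duan_slots R 'I_n.+1 T K E beta h hK hE rho rho' c U (fun=> eps / 2 + eps / 2)) => //.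
- by rewrite card_ord.
- move=> i; apply: tn_Rep_fix P2 => //; apply: Rep_pow; exact: proj2 drho'.
- by rewrite sumr_const -splitr mulr_natl.
Qed.

End Assembly.
End Main.

(** * Klein's inequality with its equality case *)

Section Klein.
Variable R : realType.
Local Notation C := R[i].
Local Notation op T U := 'M[C]_(#|{: T}|, #|{: U}|).
Local Notation Re := (@complex.Re R).

(** The strict inequality [1 + x < expR x] at [x = ln (s / t)]; at [t = 0] it reduces to [0 < s]. *)
Lemma klein_term_lt (t s : R) : 0 <= t -> 0 < s -> t != s -> t * ln s < t * ln t + s - t.
Proof.
move=> t0 s0 ts; have [->|nt] := eqVneq t 0; first by rewrite !mul0r add0r subr0.
have tp : 0 < t by rewrite lt_neqAle eq_sym nt.
have q0 : 0 < s / t by rewrite divr_gt0.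
have nl : ln (s / t) != 0.
  apply: contra ts => /eqP l0; have := lnK q0; rewrite l0 expR0 => /eqP.
  by rewrite eq_sym -[1](divff nt) (inj_eq (mulIf (invr_neq0 nt))) eq_sym.
have := expR_gt1Dx nl; rewrite (lnK q0) ln_div ?posrE // => H.
have := H; rewrite -(ltr_pM2l tp) mulrCA divff // mulr1 !mulrDr mulr1 mulrN; lra.
Qed.

Lemma klein_term (t s : R) : 0 <= t -> 0 < s -> t * ln s <= t * ln t + s - t.
Proof.
move=> t0 s0; have [->|ts] := eqVneq t s; first by rewrite -addrA subrr addr0.
exact/ltW/klein_term_lt.
Qed.

Definition lnop (T : finType) (v : op T T) (q : T -> R) : op T T := v *m hdiag (fun k => ln (q k)) *m dag v.

Lemma Re_sum (I : finType) (F : I -> C) : Re (\sum_i F i) = \sum_i Re (F i).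
Proof. exact: (raddf_sum (@complex.Re R)). Qed.

Lemma ReD (x y : C) : Re (x + y) = Re x + Re y.
Proof. exact: (raddfD (@complex.Re R)). Qed.

Lemma ReZ (a : R) (x : C) : Re (a%:C * x) = a * Re x.
Proof. by case: x => x y /=; rewrite mul0r subr0. Qed.

Section Pair.
Variables (T : finType) (rho sigma u v : op T T) (p q : T -> R).
Hypothesis sp : spec rho u p.
Hypothesis sq : spec sigma v q.
Let W := dag u *m v.

Lemma ov_row k : \sum_l sqn (en W k l) = 1.
Proof.
have [uu _ _ _] := sp; have [vv _ _ _] := sq.
apply: rcI; rewrite -amp_pop /W dag_mul dagK -mulmxA (mulmxA v) (mulmx1C vv) mul1mx uu.
by rewrite en1 eqxx.
Qed.

Lemma ov_col l : \sum_k sqn (en W k l) = 1.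
Proof.
have [uu _ _ _] := sp; have [vv _ _ _] := sq.
apply: rcI; under eq_bigr => k _ do rewrite -sqnJ -en_dag.
rewrite -amp_pop dagK /W dag_mul dagK -mulmxA (mulmxA u) (mulmx1C uu) mul1mx vv.
by rewrite en1 eqxx.
Qed.

(** The squared overlaps of the two eigenbases are doubly stochastic and reduce the operator
    inequality to the scalar one. *)
Lemma tr_lnop : Re (\tr (rho *m lnop v q)) = \sum_k \sum_l sqn (en W k l) * (p k * ln (q l)).
Proof.
have [uu E _ _] := sp.
have -> : \tr (rho *m lnop v q) = \tr (hdiag p *m (W *m hdiag (fun k => ln (q k)) *m dag W)).
  by rewrite {1}E /lnop /W dag_mul dagK -!mulmxA mxtrace_mulC -!mulmxA.
rewrite tr_en Re_sum; apply: eq_bigr => k _.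
rewrite hdiagl ReZ en_mul Re_sum mulr_sumr; apply: eq_bigr => l _.
by rewrite hdiagr en_dag mulrAC [_ * conjc _]mulrC sqnE mulrC -rmorphM /=; ring.
Qed.

Lemma klein : (forall l, 0 < q l) -> Re (\tr (rho *m lnop v q)) <= \sum_k p k * ln (p k).
Proof.
move=> q0; rewrite tr_lnop; have [_ _ p0 p1] := sp; have [_ _ _ q1] := sq.
have -> : \sum_k p k * ln (p k) = \sum_k \sum_l sqn (en W k l) * (p k * ln (p k) + q l - p k).
  transitivity (\sum_k (p k * ln (p k) - p k) + \sum_l q l); first by rewrite sumrB p1 q1 subrK.
  have -> : \sum_l q l = \sum_k \sum_l sqn (en W k l) * q l.
    by rewrite exchange_big; apply: eq_bigr => l _; rewrite -mulr_suml ov_col mul1r.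
  rewrite -big_split; apply: eq_bigr => k _ /=.
  rewrite -[X in X + _]mul1r -(ov_row k) mulr_suml -big_split; apply: eq_bigr => l _ /=; ring.
apply: ler_sum => k _; apply: ler_sum => l _; apply: ler_wpM2l; first exact: sqn_ge0.
exact: klein_term.
Qed.

(** Strictness of the scalar inequality forces every overlap between unequal eigenvalues to vanish,
    so the overlap matrix intertwines the two diagonal forms. *)
Lemma klein_eq : (forall l, 0 < q l) -> Re (\tr (rho *m lnop v q)) = \sum_k p k * ln (p k) -> rho = sigma.
Proof.
move=> q0 Heq; have [uu Er p0 p1] := sp; have [vv Es _ q1] := sq.
have key k l : sqn (en W k l) * (p k - q l) = 0.
  have [->|npq] := eqVneq (p k) (q l); first by rewrite subrr mulr0.
  have [->|nW] := eqVneq (sqn (en W k l)) 0; first by rewrite mul0r.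
  have W0 : 0 < sqn (en W k l) by rewrite lt_neqAle eq_sym nW sqn_ge0.
  exfalso; move: Heq; apply/eqP; rewrite lt_eqF // tr_lnop.
  have -> : \sum_k p k * ln (p k) = \sum_k \sum_l sqn (en W k l) * (p k * ln (p k) + q l - p k).
    transitivity (\sum_k (p k * ln (p k) - p k) + \sum_l q l); first by rewrite sumrB p1 q1 subrK.
    have -> : \sum_l q l = \sum_k \sum_l sqn (en W k l) * q l.
      by rewrite exchange_big; apply: eq_bigr => l' _; rewrite -mulr_suml ov_col mul1r.
    rewrite -big_split; apply: eq_bigr => k' _ /=.
    rewrite -[X in X + _]mul1r -(ov_row k') mulr_suml -big_split; apply: eq_bigr => l' _ /=; ring.
  rewrite (bigD1 k) //= [ltRHS](bigD1 k) //=; apply: ltr_leD.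
    rewrite (bigD1 l) //= [ltRHS](bigD1 l) //=; apply: ltr_leD; first by rewrite ltr_pM2l // klein_term_lt.
    by apply: ler_sum => l' _; apply: ler_wpM2l; [exact: sqn_ge0|exact: klein_term].
  apply: ler_sum => k' _; apply: ler_sum => l' _; apply: ler_wpM2l; [exact: sqn_ge0|exact: klein_term].
have HW : hdiag p *m W = W *m hdiag q.
  apply: enP => k l; rewrite hdiagl hdiagr mulrC.
  have [->|nW] := eqVneq (en W k l) 0; first by rewrite !mul0r.
  congr (_ * _%:C); apply/eqP; rewrite -subr_eq0.
  by have /eqP := key k l; rewrite mulf_eq0 sqn_eq0 (negbTE nW).
have Ev : v = u *m W by rewrite /W mulmxA (mulmx1C uu) mul1mx.
rewrite Er Es Ev dag_mul -!mulmxA; congr (_ *m _).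
have WW : W *m dag W = 1%:M.
  by rewrite /W dag_mul dagK -mulmxA (mulmxA v) (mulmx1C vv) mul1mx.
by rewrite !mulmxA -HW -(mulmxA (hdiag p) W) WW mulmx1.
Qed.

End Pair.
End Klein.

Lemma mix_arith (F : realFieldType) (d beta a b s g e f z : F) : 0 < d -> d < 1 -> a <= s -> b <= g ->
  g + beta * f = - z ->
  (1 - d) * a + d * b + beta * ((1 - d) * e + d * f) <= (1 - d) * (s + beta * e) - d * z.
Proof.
move=> d0 d1 h1 h2 h3; have -> : z = - (g + beta * f) by rewrite h3 opprK.
have h4 : (1 - d) * a <= (1 - d) * s by rewrite ler_wpM2l // subr_ge0 ltW.
have h5 : d * b <= d * g by rewrite ler_wpM2l // ltW.
have -> : (1 - d) * (s + beta * e) - d * - (g + beta * f) = (1 - d) * s + d * g + beta * ((1 - d) * e + d * f) by ring.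
by rewrite lerD2r lerD.
Qed.

(** * Variational characterization of the Gibbs state *)

Section GibbsMin.
Variable R : realType.
Local Notation C := R[i].
Local Notation op T U := 'M[C]_(#|{: T}|, #|{: U}|).
Local Notation Re := (@complex.Re R).

Lemma Re_tr_hdiag (T : finType) (X : op T T) (f : T -> R) :
  Re (\tr (X *m hdiag f)) = \sum_x pop X x * f x.
Proof.
rewrite tr_en Re_sum; apply: eq_bigr => x _; rewrite hdiagr mulrC ReZ mulrC.
by [].
Qed.

Lemma spec_gibbs (T : finType) beta (h : T -> R) : (0 < #|T|)%N ->
  spec (gibbsop beta h) 1%:M (gibbsp beta h).
Proof.
move=> T0; split.
- by rewrite dag1 mul1mx.
- by rewrite dag1 mul1mx mulmx1.
- by move=> x; exact/ltW/gibbsp_gt0.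
- exact: gibbsp_sum.
Qed.

Definition lnZ (T : finType) beta (h : T -> R) : R := ln (\sum_y expR (- (beta * h y))).

Lemma ln_gibbsp (T : finType) beta (h : T -> R) x : ln (gibbsp beta h x) = - (beta * h x) - lnZ beta h.
Proof. by rewrite /gibbsp ln_div ?posrE ?expR_gt0 ?(gibbs_sum0 _ _ x) // expRK. Qed.

Lemma pop_gibbs (T : finType) beta (h : T -> R) x : pop (gibbsop beta h) x = gibbsp beta h x.
Proof. by rewrite /pop en_hdiag eqxx. Qed.

Lemma lnop_gibbs (T : finType) beta (h : T -> R) :
  lnop 1%:M (gibbsp beta h) = hdiag (fun x => - (beta * h x) - lnZ beta h).
Proof. by rewrite /lnop dag1 mul1mx mulmx1; apply: eq_hdiag => x; rewrite ln_gibbsp. Qed.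

Lemma tr_lnop_gibbs (T : finType) beta (h : T -> R) (X : op T T) : \tr X = 1 ->
  Re (\tr (X *m lnop 1%:M (gibbsp beta h))) = - (beta * \sum_x pop X x * h x) - lnZ beta h.
Proof.
move=> t1; rewrite lnop_gibbs Re_tr_hdiag.
under eq_bigr => x _ do rewrite mulrBr mulrN mulrCA.
rewrite sumrB sumrN -mulr_sumr -mulr_suml.
by have -> : \sum_x pop X x = 1; [rewrite -Re_sum -tr_en t1|rewrite mul1r].
Qed.

Lemma bfree_gibbs (T : finType) beta (h : T -> R) : (0 < #|T|)%N ->
  bfree h beta (gibbsop beta h) (gibbsp beta h) = - lnZ beta h.
Proof.
move=> T0; rewrite /bfree; under eq_bigr => x _ do rewrite ln_gibbsp mulrBr mulrN mulrCA.
rewrite sumrB sumrN -mulr_sumr -mulr_suml gibbsp_sum // mul1r.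
under [X in _ + beta * X]eq_bigr => x _ do rewrite pop_gibbs.
by rewrite addrAC addNr add0r.
Qed.

Lemma dens_card (T : finType) (rho : op T T) : dens rho -> (0 < #|T|)%N.
Proof.
move=> [_ t1]; rewrite lt0n; apply/eqP => T0; move: t1; rewrite tr_en big_pred0 => [/eqP|x].
  by rewrite eq_sym oner_eq0.
by have := card0_eq T0 x; rewrite inE.
Qed.

Lemma gibbs_min (T : finType) beta (h : T -> R) (rho u : op T T) p : spec rho u p ->
  - lnZ beta h <= bfree h beta rho p.
Proof.
move=> sp; have d := spec_dens sp.
have := klein sp (spec_gibbs beta h (dens_card d)) (fun x => gibbsp_gt0 beta h x).
by rewrite (tr_lnop_gibbs _ _ (proj2 d)) /bfree => H; rewrite -lerBlDr addrC.
Qed.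

Lemma gibbs_min_eq (T : finType) beta (h : T -> R) (rho u : op T T) p : spec rho u p ->
  bfree h beta rho p = - lnZ beta h -> rho = gibbsop beta h.
Proof.
move=> sp E; have d := spec_dens sp.
apply: (klein_eq sp (spec_gibbs beta h (dens_card d)) (fun x => gibbsp_gt0 beta h x)).
by rewrite (tr_lnop_gibbs _ _ (proj2 d)) -E /bfree addrC addrK.
Qed.

Lemma Re_trD (T : finType) (X Y Z : op T T) : Re (\tr ((X + Y) *m Z)) = Re (\tr (X *m Z)) + Re (\tr (Y *m Z)).
Proof. by rewrite mulmxDl mxtraceD ReD. Qed.
Lemma Re_trZ (T : finType) (a : R) (X Z : op T T) : Re (\tr ((a%:C *: X) *m Z)) = a * Re (\tr (X *m Z)).
Proof. by rewrite -scalemxAl mxtraceZ ReZ. Qed.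

Lemma popD (T : finType) (X Y : op T T) x : pop (X + Y) x = pop X x + pop Y x.
Proof. by rewrite /pop en_add ReD. Qed.
Lemma popZ (T : finType) a (X : op T T) x : pop (a%:C *: X) x = a * pop X x.
Proof. by rewrite /pop en_scale ReZ. Qed.

Lemma tr_lnop_same (T : finType) (rho u : op T T) p q : spec rho u p ->
  Re (\tr (rho *m lnop u q)) = \sum_k p k * ln (q k).
Proof.
move=> [uu E _ _]; rewrite {1}E /lnop.
have -> : u *m hdiag p *m dag u *m (u *m hdiag (fun k => ln (q k)) *m dag u) =
   u *m (hdiag p *m hdiag (fun k => ln (q k))) *m dag u.
  by rewrite !mulmxA -(mulmxA (u *m hdiag p) (dag u) u) uu mulmx1.
by rewrite mxtrace_mulC (mulmxA (dag u) u) uu mul1mx hdiag_mul tr_hdiag.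
Qed.

Lemma dens_mix2 (T : finType) (X Y : op T T) (d : R) : 0 <= d -> d <= 1 -> dens X -> dens Y ->
  dens ((1 - d)%:C *: X + d%:C *: Y).
Proof.
move=> d0 d1 dX dY.
have -> : (1 - d)%:C *: X + d%:C *: Y = \sum_(b : bool) (if b then d else 1 - d)%:C *: (if b then Y else X).
  by rewrite big_bool addrC.
apply: dens_mix => [b||b]; [case: b => //; rewrite subr_ge0 //|by rewrite big_bool /= addrC subrK|by case: b].
Qed.

(** Convexity of the free energy: Klein's inequality is applied to [rho] and to the Gibbs state
    against their mixture, which has positive spectrum thanks to its Gibbs part. *)
Lemma bfree_mix (T : finType) beta (h : T -> R) (rho u v : op T T) p r (d : R) :
  0 < d -> d < 1 -> spec rho u p ->
  spec ((1 - d)%:C *: rho + d%:C *: gibbsop beta h) v r ->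
  bfree h beta ((1 - d)%:C *: rho + d%:C *: gibbsop beta h) r <= (1 - d) * bfree h beta rho p - d * lnZ beta h.
Proof.
move=> d0 d1 sp sr; have drho := spec_dens sp; have T0 := dens_card drho.
set sg := _ + _ in sr *.
have r0 l : 0 < r l.
  have [vv Er _ _] := sr.
  have E : hdiag r = dag v *m sg *m v by exact: conj_isom vv Er.
  have {E} : r l = pop (dag v *m sg *m v) l by rewrite -E /pop en_hdiag eqxx.
  rewrite /sg mulmxDr mulmxDl -!scalemxAr -!scalemxAl popD !popZ => ->.
  apply: ltr_wpDl.
    apply: mulr_ge0; first by rewrite subr_ge0 ltW.
    have [W [w ->]] := dens_en drho.
    have -> : dag v *m (w *m dag w) *m v = (dag v *m w) *m dag (dag v *m w) by rewrite dag_mul dagK !mulmxA.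
    by rewrite /pop amp_pop /=; apply: sumr_ge0 => *; exact: sqn_ge0.
  apply: mulr_gt0 => //.
  have -> : pop (dag v *m gibbsop beta h *m v) l = \sum_x gibbsp beta h x * sqn (en v x l).
    rewrite /pop en_mul Re_sum; apply: eq_bigr => x _.
    by rewrite hdiagr en_dag mulrAC sqnE -rmorphM /= mulrC.
  have c1 : \sum_x sqn (en v x l) = 1.
    apply: rcI; under eq_bigr => k _ do rewrite -sqnJ -en_dag.
    by rewrite -amp_pop dagK vv en1 eqxx.
  have [x hx] : exists x, 0 < sqn (en v x l).
    apply/existsP; apply: contraT; rewrite negb_exists => /forallP H.
    have := oner_neq0 R; rewrite -c1 big1 ?eqxx // => x _.
    by apply/eqP; have := H x; rewrite lt_neqAle sqn_ge0 andbT negbK eq_sym.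
  rewrite (bigD1 x) /=; last by []. apply: ltr_pwDl; first by rewrite mulr_gt0 ?gibbsp_gt0.
  by apply: sumr_ge0 => y _; apply: mulr_ge0; [exact/ltW/gibbsp_gt0|exact: sqn_ge0].
have k1 := klein sp sr r0.
have k2 := klein (spec_gibbs beta h T0) sr r0.
have k3 := tr_lnop_same r sr; rewrite {1}/sg Re_trD !Re_trZ in k3.
have b1 := bfree_gibbs beta h T0.
have pe : \sum_x pop sg x * h x = (1 - d) * (\sum_x pop rho x * h x) + d * \sum_x pop (gibbsop beta h) x * h x.
  by rewrite !mulr_sumr -big_split; apply: eq_bigr => x _; rewrite /sg popD !popZ /=; ring.
rewrite /bfree in b1; rewrite /bfree pe -k3.
exact: mix_arith d0 d1 k1 k2 b1.
Qed.

End GibbsMin.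

Lemma converse_arith (F : realFieldType) (beta s sq sg s' l A B B' x x' e ec eg eg' z : F) :
  s' + l <= B -> sq + l <= B' -> A + B' + (- (beta * eg') - z) <= s + sq + sg ->
  e + ec + eg = x + ec + eg' -> sg + beta * eg = - z ->
  s' + beta * x' + 2 * l + (A - B + beta * (x - x')) <= s + beta * e.
Proof.
move=> h1 h2 h3 h4 h5; have e1 : eg' = e + eg - x by move: h4; lra.
have e2 : sg = - z - beta * eg by move: h5; lra.
move: h3; rewrite e1 e2 !mulrBr !mulrDr; move: h1 h2; lra.
Qed.

(** * Equal free energies, and the converse bound *)

Section Weak.
Variable R : realType.
Local Notation C := R[i].
Local Notation op T U := 'M[C]_(#|{: T}|, #|{: U}|).
Local Notation Re := (@complex.Re R).

Lemma dens_unit1 : dens (1%:M : op unit unit).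
Proof.
split; last by rewrite mxtrace1 card_unit.
by exists #|{: unit}|, 1%:M; rewrite dag1 mul1mx.
Qed.

(** The system is swapped with a bath that is a thermal copy of itself; the catalyst is trivial. *)
Lemma cat_gibbs (T : finType) (h : T -> R) beta (rho : op T T) : dens rho -> Cat beta h rho (gibbsop beta h) 0.
Proof.
move=> d; have T0 := dens_card d.
pose f (p : (T * unit) * T) : (T * unit) * T := ((p.2, p.1.2), p.1.1).
have fK : cancel f f by move=> [[t k] e].
have E : thmap beta h (bij R f) (tens rho 1%:M) = tens (gibbsop beta h) 1%:M.
  apply: enP => -[t k] [t' k']; rewrite en_mk en_tens /=.
  transitivity (\sum_e en rho e e * ((en (1%:M : op unit unit) k k') * en (gibbsop beta h) t t')).
    by apply: eq_bigr => e _; rewrite bijr bijl !en_tens /= mulrA.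
  by rewrite -mulr_suml -tr_en (proj2 d) mul1r mulrC.
exists unit, T, (fun=> 0), h, 1%:M, (bij R f); split.
- by split=> //; exact: dens_unit1.
- exact: (bij_isom _ fK fK).
- by apply: bij_raise => -[[t k] e]; rewrite /hsum2 /= !addr0 addrC.
- by rewrite E pt1_tens (proj2 (dens_gibbs beta h T0)) scale1r.
- by rewrite E subrr; exact: tn0.
Qed.

Lemma cat_close (T : finType) (h : T -> R) beta (rho sg sg' : op T T) e e' : Cat beta h rho sg e -> tn (sg - sg') e' ->
  Cat beta h rho sg' (e + e').
Proof.
move=> [K [E [hK [hE [c0 [U [[E0 dc] U1 Ue P1 P2]]]]]]] t.
exists K, E, hK, hE, c0, U; split=> //.
by apply: tn_trans P2 _; rewrite -tensBl; apply: tn_tensr.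
Qed.

(** When the free energies agree, either the target is the Gibbs state, or mixing a little of the
    Gibbs state into it creates a strict gap at small cost in distance. *)
Lemma cat_weak (T : finType) (h : T -> R) beta (rho u rho' u' : op T T) p p' eps : 0 < beta ->
  spec rho u p -> spec rho' u' p' -> (forall x y, en rho' x y != 0 -> modespan h rho (h x - h y)) ->
  bfree h beta rho' p' <= bfree h beta rho p -> 0 < eps -> Cat beta h rho rho' eps.
Proof.
move=> b0 sp sp' md; rewrite le_eqVlt => /orP[/eqP EF|FF] e0; last exact: (cat_main b0 sp sp' md FF e0).
have d := spec_dens sp; have d' := spec_dens sp'; have T0 := dens_card d.
have := gibbs_min beta h sp'; rewrite le_eqVlt => /orP[/eqP Eg|Fg].
  rewrite (gibbs_min_eq sp' (esym Eg)); have [K [E [hK [hE [c0 [U [H1 H2 H3 H4 H5]]]]]]] := cat_gibbs h beta d.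
  by exists K, E, hK, hE, c0, U; split=> //; exact: (tn_le (ltW e0) H5).
(* The mixture is within [2 dl <= eps / 2] of the target, leaving [eps / 2] for the conversion. *)
pose dl := Num.min (2^-1) (eps / 4).
have dl0 : 0 < dl by rewrite lt_min invr_gt0 ltr0n divr_gt0.
have dl1 : dl < 1 by rewrite gt_min invf_lt1 ?ltr1n ?ltr0n.
have dle : dl <= eps / 4 by rewrite ge_min lexx orbT.
pose sg := (1 - dl)%:C *: rho' + dl%:C *: gibbsop beta h.
have dg := dens_gibbs beta h T0.
have dsg : dens sg by apply: dens_mix2 => //; exact: ltW.
have [v [r sr]] := dens_spec dsg.
have Fs : bfree h beta sg r < bfree h beta rho p.
  rewrite -EF; apply: le_lt_trans (bfree_mix dl0 dl1 sp' sr) _.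
  rewrite mulrBl mul1r -addrA gtrDl -opprD oppr_lt0 -mulrDr mulr_gt0 //.
  by rewrite -ltrBlDr sub0r.
(* The Gibbs state is diagonal, so mixing it in creates no coherence outside that of the target. *)
have ms x y : en sg x y != 0 -> modespan h rho (h x - h y).
  have [->|nxy] := eqVneq x y; first by rewrite subrr => _; exact: modespan0.
  rewrite en_add !en_scale en_hdiag (negbTE nxy) mulr0 addr0 mulf_eq0 negb_or => /andP[_]; exact: md.
have e2 : 0 < eps / 2 by rewrite divr_gt0.
have -> : eps = eps / 2 + eps / 2 by rewrite -splitr.
apply: cat_close (cat_main b0 sp sr ms Fs e2) _.
have -> : sg - rho' = dl%:C *: (gibbsop beta h - rho').
  rewrite /sg rmorphB rmorph1 scalerBl scale1r scalerBr addrAC [rho' - _ - _]addrAC subrr sub0r addrC.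
  by [].
apply: (@tn_le _ _ _ (dl * (1 + 1))); first by move: dle; lra.
by apply: tnZ; [exact: ltW|apply: tnB; exact: dens_tn1].
Qed.

Lemma tr_pt2_mul (T U : finType) (X : op (T * U) (T * U)) (A : op T T) :
  \tr (X *m tens A 1%:M) = \tr (pt2 X *m A).
Proof.
rewrite !tr_en sum_pair; apply: eq_bigr => x _; rewrite en_mul.
under eq_bigr => y _ do rewrite en_mul sum_pair.
rewrite exchange_big; apply: eq_bigr => x' _; rewrite en_mk mulr_suml; apply: eq_bigr => y _.
rewrite (bigD1 y) //= big1 ?addr0 => [|y' ny]; rewrite en_tens en1 /=; first by rewrite eqxx mulr1.
by rewrite (negbTE ny) !mulr0.
Qed.

Lemma tr_pt1_mul (T U : finType) (X : op (T * U) (T * U)) (A : op U U) :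
  \tr (X *m tens 1%:M A) = \tr (pt1 X *m A).
Proof.
rewrite !tr_en sum_pair exchange_big; apply: eq_bigr => y _; rewrite en_mul.
under eq_bigr => x _ do rewrite en_mul sum_pair exchange_big.
rewrite exchange_big; apply: eq_bigr => y' _; rewrite en_mk mulr_suml; apply: eq_bigr => x _.
rewrite (bigD1 x) //= big1 ?addr0 => [|x' nx]; rewrite en_tens en1 /=; first by rewrite eqxx mul1r.
by rewrite (negbTE nx) !mul0r mulr0.
Qed.

Lemma tens_hdiag (T U : finType) (f : T -> R) (g : U -> R) :
  tens (hdiag f) (hdiag g) = hdiag (fun p : T * U => f p.1 * g p.2).
Proof.
apply: enP => -[x y] [x' y']; rewrite en_tens !en_hdiag xpair_eqE /=.
by case: (x == x'); case: (y == y'); rewrite ?mulr0 ?mul0r // -rmorphM.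
Qed.

Lemma hdiagD (T : finType) (f g : T -> R) : hdiag f + hdiag g = hdiag (fun x => f x + g x).
Proof.
apply: enP => x y; rewrite en_add !en_hdiag; case: (x == y); last by rewrite addr0.
by rewrite -rmorphD.
Qed.

Lemma spec_tens (T U : finType) (A u : op T T) (B v : op U U) p q : spec A u p -> spec B v q ->
  spec (tens A B) (tens u v) (fun k => p k.1 * q k.2).
Proof.
move=> [uu EA p0 p1] [vv EB q0 q1]; split.
- by rewrite tens_dag tens_mul uu vv tens11.
- by rewrite -tens_hdiag tens_dag !tens_mul -EA -EB.
- by move=> k; exact: mulr_ge0.
- rewrite sum_pair -p1; apply: eq_bigr => x _; by rewrite /= -mulr_sumr q1 mulr1.
Qed.

Lemma sum_ent_tens (T U : finType) (p : T -> R) (q : U -> R) : (forall k, 0 <= p k) -> (forall k, 0 <= q k) ->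
  \sum_k p k = 1 -> \sum_k q k = 1 ->
  \sum_(k : T * U) (p k.1 * q k.2) * ln (p k.1 * q k.2) = \sum_k p k * ln (p k) + \sum_k q k * ln (q k).
Proof.
move=> p0 q0 p1 q1; rewrite sum_pair.
transitivity (\sum_a \sum_b (p a * ln (p a) * q b + p a * (q b * ln (q b)))).
  apply: eq_bigr => a _; apply: eq_bigr => b _ /=.
  have [->|na] := eqVneq (p a) 0; first by rewrite !mul0r addr0.
  have [->|nb] := eqVneq (q b) 0; first by rewrite !mulr0 !mul0r mulr0 addr0.
  have pa : 0 < p a by rewrite lt_neqAle eq_sym na p0.
  have qb : 0 < q b by rewrite lt_neqAle eq_sym nb q0.
  by rewrite lnM ?posrE //; ring.
transitivity (\sum_a (p a * ln (p a) + p a * \sum_b q b * ln (q b))).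
  by apply: eq_bigr => a _; rewrite big_split mulr_sumr -[X in _ = X + _]mulr1 -q1 mulr_sumr.
by rewrite big_split /= -mulr_suml p1 mul1r.
Qed.

Lemma lnop_tens (T U : finType) (u : op T T) (v : op U U) p q : dag u *m u = 1%:M -> dag v *m v = 1%:M ->
  (forall k, 0 < p k) -> (forall k, 0 < q k) ->
  lnop (tens u v) (fun k => p k.1 * q k.2) = tens (lnop u p) 1%:M + tens 1%:M (lnop v q).
Proof.
move=> uu vv p0 q0; rewrite /lnop.
have -> : hdiag (fun k : T * U => ln (p k.1 * q k.2)) =
   tens (hdiag (fun k => ln (p k))) 1%:M + tens 1%:M (hdiag (fun k => ln (q k))) :> op _ _.
  rewrite -(hdiag1 R U) -(hdiag1 R T) !tens_hdiag hdiagD; apply: eq_hdiag => k.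
  by rewrite lnM ?posrE // mulr1 mul1r.
rewrite mulmxDr mulmxDl tens_dag !tens_mul !mulmx1.
by rewrite (mulmx1C uu) (mulmx1C vv).
Qed.

Lemma spec_mixI (T : finType) (rho u : op T T) p d : spec rho u p -> 0 < d -> d < 1 ->
  exists sg, spec sg u (fun k => (1 - d) * p k + d / #|T|%:R) /\ forall k, 0 < (1 - d) * p k + d / #|T|%:R.
Proof.
move=> sp d0 d1; have [uu E p0 p1] := sp; have T0 := dens_card (spec_dens sp).
have pos k : 0 < (1 - d) * p k + d / #|T|%:R.
  by apply: ltr_wpDl; [rewrite mulr_ge0 // subr_ge0 ltW|rewrite divr_gt0 // ltr0n].
exists (u *m hdiag (fun k => (1 - d) * p k + d / #|T|%:R) *m dag u); split=> //; split=> //.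
  by move=> k; exact: ltW.
rewrite big_split /= -mulr_sumr p1 mulr1 sumr_const -[X in _ + X]mulr_natr divfK ?subrK //.
by rewrite pnatr_eq0 -lt0n.
Qed.

(** Depolarizing lowers a logarithm by at most [- ln (1 - d)], whatever the dimension; this keeps
    the converse uniform in the catalyst. *)
Lemma ent_mixI (T : finType) (p : T -> R) d : 0 < d -> d < 1 -> (forall k, 0 <= p k) -> \sum_k p k = 1 ->
  \sum_k p k * ln (p k) + ln (1 - d) <= \sum_k p k * ln ((1 - d) * p k + d / #|T|%:R).
Proof.
move=> d0 d1 p0 p1; have -> : ln (1 - d) = \sum_k p k * ln (1 - d) by rewrite -mulr_suml p1 mul1r.
have dd : 0 < 1 - d by rewrite subr_gt0.
rewrite -big_split; apply: ler_sum => k _ /=; rewrite -mulrDr.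
have [->|nk] := eqVneq (p k) 0; first by rewrite !mul0r.
have pk : 0 < p k by rewrite lt_neqAle eq_sym nk p0.
apply: ler_wpM2l => //; rewrite addrC -lnM ?posrE // ler_ln ?posrE ?mulr_gt0 //.
  by rewrite lerDl divr_ge0 // ltW.
by apply: ltr_pwDl; [exact: mulr_gt0|rewrite divr_ge0 // ltW].
Qed.

Section Converse.
Variables (T K E : finType) (beta : R) (h : T -> R) (hK : K -> R) (hE : E -> R).
Variables (rho u rho' u' : op T T) (p p' : T -> R) (c : op K K) (U : op ((T * K) * E) ((T * K) * E)).
Hypothesis sp : spec rho u p.
Hypothesis sp' : spec rho' u' p'.
Hypothesis dc : dens c.
Hypothesis E0 : (0 < #|E|)%N.
Hypothesis U1 : dag U *m U = 1%:M.
Hypothesis Ue : econs (hsum2 (hsum2 h hK) hE) U.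
Let P := thmap beta hE U (tens rho c).
Hypothesis P1 : pt1 P = c.

(** The logarithm of the depolarized target plus beta times its Hamiltonian. It does not involve the
    catalyst, so small deviations of the system state have uniformly small effect. *)
Definition witness d := lnop u' (fun k => (1 - d) * p' k + d / #|T|%:R) + beta%:C *: hdiag h.

Lemma energy_split (X : op ((T * K) * E) ((T * K) * E)) :
  Re (\tr (X *m hdiag (hsum2 (hsum2 h hK) hE))) =
  Re (\tr (pt2 (pt2 X) *m hdiag h)) + Re (\tr (pt1 (pt2 X) *m hdiag hK)) + Re (\tr (pt1 X *m hdiag hE)).
Proof.
have -> : hdiag (hsum2 (hsum2 h hK) hE) =
    tens (tens (hdiag h) 1%:M + tens 1%:M (hdiag hK)) 1%:M + tens 1%:M (hdiag hE) :> op _ _.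
  rewrite -(hdiag1 R E) -(hdiag1 R K) -(hdiag1 R T) -(hdiag1 R (T * K)%type) !tens_hdiag hdiagD !tens_hdiag hdiagD.
  by apply: eq_hdiag => k; rewrite /hsum2 !mulr1 !mul1r.
by rewrite mulmxDr mxtraceD ReD tr_pt2_mul tr_pt1_mul mulmxDr mxtraceD ReD tr_pt2_mul tr_pt1_mul.
Qed.

(** Klein's inequality for the final state of system, catalyst and bath against the product of
    depolarized target, depolarized catalyst state and Gibbs state. The unitary keeps the spectrum
    and the mean energy, and the catalyst marginal is unchanged, so catalyst terms cancel; the two
    depolarizations cost [ln (1 - d)] each. *)
Lemma converse_bound d : 0 < d -> d < 1 ->
  bfree h beta rho' p' + 2 * ln (1 - d) + Re (\tr ((pt2 P - rho') *m witness d)) <= bfree h beta rho p.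
Proof.
move=> d0 d1; have drho := spec_dens sp; have drho' := spec_dens sp'.
have [uc [q sc]] := dens_spec dc.
pose g := gibbsp beta hE; have sg := spec_gibbs beta hE E0.
have sin := spec_tens (spec_tens sp sc) sg.
set uin := tens (tens u uc) _ in sin; set qin := (fun k => _) in sin.
pose X := tens (tens rho c) (gibbsop beta hE).
have sO : spec (U *m X *m dag U) (U *m uin) qin.
  have [a1 a2 a3 a4] := sin; split=> //.
    by rewrite dag_mul -mulmxA (mulmxA (dag U)) U1 mul1mx.
  by rewrite /X a2 dag_mul !mulmxA.
have [r [sr r0]] := spec_mixI sp' d0 d1; have [rc [src rc0]] := spec_mixI sc d0 d1.
have so := spec_tens (spec_tens sr src) sg.
have [vv _ _ _] := sp'; have [cc _ _ _] := sc.
have pos12 (k : T * K) : 0 < ((1 - d) * p' k.1 + d / #|T|%:R) * ((1 - d) * q k.2 + d / #|K|%:R) by exact: mulr_gt0.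
have kl := klein sO so (fun k => mulr_gt0 (pos12 k.1) (gibbsp_gt0 beta hE k.2)).
have i1 : dag (tens u' uc) *m tens u' uc = 1%:M by rewrite tens_dag tens_mul vv cc tens11.
have i2 : dag (1%:M : op E E) *m 1%:M = 1%:M by rewrite dag1 mul1mx.
rewrite (lnop_tens i1 i2 pos12 (fun k => gibbsp_gt0 beta hE k)) in kl.
rewrite (lnop_tens vv cc r0 rc0) mulmxDr mxtraceD ReD tr_pt2_mul tr_pt1_mul in kl.
rewrite mulmxDr mxtraceD ReD tr_pt2_mul tr_pt1_mul in kl.
have EP : pt2 (U *m X *m dag U) = P by [].
have t1 : \tr (pt1 (U *m X *m dag U)) = 1 by rewrite tr_pt1; exact: (proj2 (spec_dens sO)).
rewrite EP P1 (tr_lnop_gibbs _ _ t1) (tr_lnop_same _ sc) in kl.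
have [_ _ p0 p1] := sp; have [_ _ p0' p1'] := sp'; have [_ _ q0 q1] := sc.
have [_ _ pq0 pq1] := spec_tens sp sc.
rewrite (sum_ent_tens pq0 (fun k => ltW (gibbsp_gt0 beta hE k)) pq1 (gibbsp_sum _ _ E0)) in kl.
rewrite (sum_ent_tens p0 q0 p1 q1) in kl.
have en1 := energy_split (U *m X *m dag U).
have en2 := energy_split X.
have en12 : Re (\tr (U *m X *m dag U *m hdiag (hsum2 (hsum2 h hK) hE))) = Re (\tr (X *m hdiag (hsum2 (hsum2 h hK) hE))).
  have /econsE e1 := Ue.
  have e2 : dag U *m hdiag (hsum2 (hsum2 h hK) hE) = hdiag (hsum2 (hsum2 h hK) hE) *m dag U.
    have := congr1 (@dag R _ _) e1; by rewrite !dag_mul hdiag_dag.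
  by rewrite -mulmxA e2 mulmxA mxtrace_mulC !mulmxA U1 mul1mx.
rewrite en12 en2 EP P1 in en1.
have tg : \tr (gibbsop beta hE) = 1 := proj2 (dens_gibbs beta hE E0).
rewrite pt2_tens tg scale1r pt2_tens (proj2 dc) scale1r !pt1_tens (proj2 drho) scale1r tens_tr (proj2 drho) (proj2 dc) mulr1 scale1r in en1.
have bg := bfree_gibbs beta hE E0; rewrite /bfree in bg.
have -> : Re (\tr ((pt2 P - rho') *m witness d)) =
    Re (\tr (pt2 P *m lnop u' (fun k => (1 - d) * p' k + d / #|T|%:R))) - \sum_k p' k * ln ((1 - d) * p' k + d / #|T|%:R) +
    beta * (\sum_x pop (pt2 P) x * h x - \sum_x pop rho' x * h x).
  rewrite -(tr_lnop_same _ sp') -!Re_tr_hdiag /witness mulmxDr mxtraceD ReD -scalemxAr mxtraceZ ReZ !mulmxBl.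
  by rewrite !(raddfB (@mxtrace _ _)) !(raddfB (@complex.Re R)).
rewrite !Re_tr_hdiag in en1.
exact: converse_arith (ent_mixI d0 d1 p0' p1') (ent_mixI d0 d1 q0 q1) kl en1 bg.
Qed.

End Converse.
End Weak.

(** * Between Kronecker products on ordinals and finite types *)

Section Mixed.
Variable R : realType.
Local Notation C := R[i].
Local Notation op T U := 'M[C]_(#|{: T}|, #|{: U}|).
Local Notation Re := (@complex.Re R).

Definition pidx (a b : finType) (i : 'I_#|{: a * b}|) : 'I_(#|a| * #|b|) :=
  mxtens_index (enum_rank (enum_val i).1, enum_rank (enum_val i).2).
Definition pidx' (a b : finType) (i : 'I_(#|a| * #|b|)) : 'I_#|{: a * b}| :=
  enum_rank (enum_val (mxtens_unindex i).1, enum_val (mxtens_unindex i).2).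

Lemma pidxK a b : cancel (@pidx a b) (@pidx' a b).
Proof.
move=> i; rewrite /pidx /pidx' mxtens_indexK !enum_rankK -[RHS]enum_valK.
by case: (enum_val i).
Qed.
Lemma pidxK' a b : cancel (@pidx' a b) (@pidx a b).
Proof.
move=> i; rewrite /pidx /pidx' !enum_rankK !enum_valK -[RHS]mxtens_unindexK.
by case: (mxtens_unindex i).
Qed.

(** The tensor product of two changes of basis, with columns in Kronecker indexing and rows indexed
    by the product type. *)
Definition mt (a b : finType) n k (A : 'M[C]_(#|a|, n)) (B : 'M[C]_(#|b|, k)) : 'M[C]_(#|{: a * b}|, n * k) :=
  rowsub (@pidx a b) (A *t B).

Lemma dag_tensmx m n k l (A : 'M[C]_(m, n)) (B : 'M[C]_(k, l)) : dag (A *t B) = dag A *t dag B.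
Proof. by apply/matrixP => i j; rewrite !mxE rmorphM. Qed.

Lemma delta_tens n k (p q : 'I_n * 'I_k) :
  delta_mx (mxtens_index p) (mxtens_index q) = delta_mx p.1 q.1 *t delta_mx p.2 q.2 :> 'M[C]_(n * k).
Proof.
apply/matrixP => i j; case: (mxtens_indexP i) => a b; case: (mxtens_indexP j) => c d.
rewrite tensmxE !mxE !(can_eq (@mxtens_indexK _ _)); case: p => p1 p2; case: q => q1 q2.
by rewrite !xpair_eqE -natrM mulnb andbACA.
Qed.

Lemma tensmx11 m n : (1%:M : 'M[C]_m) *t (1%:M : 'M[C]_n) = 1%:M.
Proof.
apply/matrixP => i j; case: (mxtens_indexP i) => a b; case: (mxtens_indexP j) => c d.
by rewrite tensmxE !mxE (can_eq (@mxtens_indexK _ _)) xpair_eqE -natrM mulnb.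
Qed.

Lemma mt_mul (a b : finType) n k n' k' (A : 'M[C]_(#|a|, n)) (B : 'M[C]_(#|b|, k)) (X : 'M[C]_(n, n')) (Y : 'M[C]_(k, k')) :
  mt A B *m (X *t Y) = mt (A *m X) (B *m Y).
Proof. by rewrite /mt mul_rowsub_mx tensmx_mul. Qed.

Lemma mt_outer (a b : finType) n k (A A' : 'M[C]_(#|a|, n)) (B B' : 'M[C]_(#|b|, k)) :
  mt A B *m dag (mt A' B') = tens (A *m dag A') (B *m dag B').
Proof.
apply: enP => -[x y] [x' y'].
have -> : en (mt A B *m dag (mt A' B')) (x, y) (x', y') =
    ((A *t B) *m dag (A' *t B')) (pidx (enum_rank (x, y))) (pidx (enum_rank (x', y'))).
  by rewrite /en !mxE; apply: eq_bigr => i _; rewrite !mxE.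
by rewrite dag_tensmx tensmx_mul tensmxE !enum_rankK en_tens.
Qed.

Lemma mt_conj (a b : finType) n k (A A' : 'M[C]_(#|a|, n)) (B B' : 'M[C]_(#|b|, k)) X Y :
  mt A B *m (X *t Y) *m dag (mt A' B') = tens (A *m X *m dag A') (B *m Y *m dag B').
Proof. by rewrite mt_mul mt_outer. Qed.

Lemma mt_gram (a b : finType) n k (A : 'M[C]_(#|a|, n)) (B : 'M[C]_(#|b|, k)) :
  dag A *m A = 1%:M -> dag B *m B = 1%:M -> dag (mt A B) *m mt A B = 1%:M.
Proof.
move=> hA hB; rewrite -[RHS]tensmx11 -hA -hB -tensmx_mul -dag_tensmx.
apply/matrixP => i j; rewrite !mxE (reindex (@pidx a b)) /=.
  by apply: eq_bigr => x _; rewrite !mxE.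
by exists (@pidx' a b) => x _; [exact: pidxK|exact: pidxK'].
Qed.

Lemma mt_isom' (a b : finType) n k (A : 'M[C]_(#|a|, n)) (B : 'M[C]_(#|b|, k)) :
  A *m dag A = 1%:M -> B *m dag B = 1%:M -> mt A B *m dag (mt A B) = 1%:M.
Proof. by move=> hA hB; rewrite mt_outer hA hB tens11. Qed.

Lemma ptr2_linear n k : linear (@ptr2 R n k).
Proof.
move=> a X Y; apply/matrixP => i j; rewrite !mxE mulr_sumr -big_split.
by apply: eq_bigr => l _; rewrite !mxE.
Qed.
HB.instance Definition _ n k := GRing.isLinear.Build C 'M[C]_(n * k) 'M[C]_n _ (@ptr2 R n k) (@ptr2_linear n k).
Lemma ptr1_linear n k : linear (@ptr1 R n k).
Proof.
move=> a X Y; apply/matrixP => i j; rewrite !mxE mulr_sumr -big_split.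
by apply: eq_bigr => l _; rewrite !mxE.
Qed.
HB.instance Definition _ n k := GRing.isLinear.Build C 'M[C]_(n * k) 'M[C]_k _ (@ptr1 R n k) (@ptr1_linear n k).

Lemma ptr2_tens n k (A : 'M[C]_n) (B : 'M[C]_k) : ptr2 (A *t B) = \tr B *: A.
Proof.
apply/matrixP => i j; rewrite !mxE mulr_suml; apply: eq_bigr => l _.
by rewrite tensmxE mulrC.
Qed.
Lemma ptr1_tens n k (A : 'M[C]_n) (B : 'M[C]_k) : ptr1 (A *t B) = \tr A *: B.
Proof.
apply/matrixP => i j; rewrite !mxE mulr_suml; apply: eq_bigr => l _.
by rewrite tensmxE.
Qed.

(** Kronecker products span, so identities linear in [X] need only be checked on them. *)
Lemma tens_ind n k (P : 'M[C]_(n * k) -> Prop) : P 0 -> (forall X Y, P X -> P Y -> P (X + Y)) ->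
  (forall a X, P X -> P (a *: X)) -> (forall A B, P (A *t B)) -> forall X, P X.
Proof.
move=> P0 PD PZ PT X; rewrite (matrix_sum_delta X).
elim/big_ind: _ => // i _; elim/big_ind: _ => // j _; apply: PZ.
by rewrite -(mxtens_unindexK i) -(mxtens_unindexK j) delta_tens.
Qed.

Lemma pt2D (T U : finType) (X Y : op (T * U) (T * U)) : pt2 (X + Y) = pt2 X + pt2 Y.
Proof.
by apply: enP => x y; rewrite en_add !en_mk -big_split; apply: eq_bigr => u _; rewrite en_add.
Qed.
Lemma pt1D (T U : finType) (X Y : op (T * U) (T * U)) : pt1 (X + Y) = pt1 X + pt1 Y.
Proof.
by apply: enP => x y; rewrite en_add !en_mk -big_split; apply: eq_bigr => u _; rewrite en_add.
Qed.

Lemma tr_conj n k (A : 'M[C]_(n, k)) X : dag A *m A = 1%:M -> \tr (A *m X *m dag A) = \tr X.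
Proof. by move=> h; rewrite mxtrace_mulC mulmxA h mul1mx. Qed.

Lemma pt2_mt (a b : finType) n k (A : 'M[C]_(#|a|, n)) (B : 'M[C]_(#|b|, k)) (X : 'M[C]_(n * k)) :
  dag B *m B = 1%:M -> pt2 (mt A B *m X *m dag (mt A B)) = A *m ptr2 X *m dag A.
Proof.
move=> hB; elim/tens_ind: X => [|X Y hX hY|c X hX|Y Z].
- rewrite !linear0 ?mulmx0 ?mul0mx; by apply: enP => x y; rewrite en_mk big1 ?en_0 // => u _; rewrite en_0.
- by rewrite [ptr2 (X + Y)]linearD !mulmxDr !mulmxDl pt2D hX hY //.
- by rewrite [ptr2 (c *: X)]linearZ /= -!scalemxAr -!scalemxAl pt2Z hX.
- by rewrite mt_conj pt2_tens ptr2_tens tr_conj // -scalemxAr -scalemxAl.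
Qed.

Lemma pt1_mt (a b : finType) n k (A : 'M[C]_(#|a|, n)) (B : 'M[C]_(#|b|, k)) (X : 'M[C]_(n * k)) :
  dag A *m A = 1%:M -> pt1 (mt A B *m X *m dag (mt A B)) = B *m ptr1 X *m dag B.
Proof.
move=> hA; elim/tens_ind: X => [|X Y hX hY|c X hX|Y Z].
- rewrite !linear0 ?mulmx0 ?mul0mx; by apply: enP => x y; rewrite en_mk big1 ?en_0 // => u _; rewrite en_0.
- by rewrite [ptr1 (X + Y)]linearD !mulmxDr !mulmxDl pt1D hX hY //.
- by rewrite [ptr1 (c *: X)]linearZ /= -!scalemxAr -!scalemxAl pt1Z hX.
- by rewrite mt_conj pt1_tens ptr1_tens tr_conj // -scalemxAr -scalemxAl.
Qed.

Lemma hsum_conj (a b : finType) n k (A : 'M[C]_(#|a|, n)) (B : 'M[C]_(#|b|, k)) H1 H2 (h1 : a -> R) (h2 : b -> R) :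
  A *m dag A = 1%:M -> B *m dag B = 1%:M -> A *m H1 *m dag A = hdiag h1 -> B *m H2 *m dag B = hdiag h2 ->
  mt A B *m hsum H1 H2 *m dag (mt A B) = hdiag (hsum2 h1 h2).
Proof.
move=> hA hB e1 e2; rewrite /hsum mulmxDr mulmxDl !mt_conj e1 e2 !mulmx1 hA hB.
by rewrite -(hdiag1 R a) -(hdiag1 R b) !tens_hdiag hdiagD; apply: eq_hdiag => p; rewrite mulr1 mul1r.
Qed.

Lemma tr_ptr2 n k (X : 'M[C]_(n * k)) : \tr (ptr2 X) = \tr X.
Proof.
elim/tens_ind: X => [|X Y hX hY|c X hX|Y Z].
- by rewrite !linear0.
- by rewrite linearD !mxtraceD hX hY.
- by rewrite linearZ /= !mxtraceZ hX.
- rewrite ptr2_tens mxtraceZ mulrC /mxtrace mulr_sum; apply: eq_bigr => i _; by rewrite mxE.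
Qed.

End Mixed.

Lemma re_bound_arith (F : realFieldType) (e x w t : F) : 0 < e -> x <= e ^+ 2 -> 0 <= w ->
  0 <= x + e ^+ 2 * w + 2 * e * t -> - (e * (1 + w)) <= t.
Proof.
move=> e0 hx w0 h; rewrite -(ler_pM2l e0) -subr_ge0.
have h2 : 0 <= e ^+ 2 * w by rewrite mulr_ge0 // sqr_ge0.
have h3 : 0 <= e ^+ 2 by rewrite sqr_ge0.
have -> : e * t - e * - (e * (1 + w)) = e * t + e ^+ 2 + e ^+ 2 * w by ring.
have h' : 0 <= x + e ^+ 2 * w + 2 * (e * t) by rewrite mulrA.
by move: (e * t) (e ^+ 2 * w) (e ^+ 2) h' h2 h3 hx => a b c *; lra.
Qed.

(** * Energy eigenbases and the trace norm *)

Section Spectral.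
Variable R : realType.
Local Notation C := R[i].
Local Notation op T U := 'M[C]_(#|{: T}|, #|{: U}|).
Local Notation Re := (@complex.Re R).

(** Passes to the energy eigenbasis and at the same time from ordinal to finite-type indexing; [H]
    becomes diagonal with entries [eig H]. *)
Definition eigbasis n (H : 'M[C]_n) : 'M[C]_(#|'I_n|, n) := rowsub enum_val (spectralmx H).

Lemma eigbasis_isom' n (H : 'M[C]_n) : eigbasis H *m dag (eigbasis H) = 1%:M.
Proof.
apply/matrixP => i j; have := congr1 (fun B : 'M[C]_n => B (enum_val i) (enum_val j)) (spectral_isom' H).
rewrite !mxE (inj_eq enum_val_inj) => <-; by apply: eq_bigr => k _; rewrite !mxE.
Qed.

Lemma eigbasis_isom n (H : 'M[C]_n) : dag (eigbasis H) *m eigbasis H = 1%:M.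
Proof.
rewrite -(spectral_isom H); apply/matrixP => i j; rewrite !mxE sum_rank.
by apply: eq_bigr => k _; rewrite !mxE enum_rankK.
Qed.

Lemma eigbasis_mxfun n (H : 'M[C]_n) (f : R -> R) :
  eigbasis H *m mxfun f H *m dag (eigbasis H) = hdiag (fun k => f (eig H k)).
Proof.
have -> : eigbasis H *m mxfun f H = rowsub enum_val (diag_mx (\row_k (f (eig H k))%:C) *m spectralmx H).
  rewrite /eigbasis mul_rowsub_mx; congr (rowsub _ _).
  by rewrite /mxfun !mulmxA spectral_isom' mul1mx.
rewrite mul_diag_mx; apply: enP => x y; rewrite en_hdiag.
have := congr1 (fun B : 'M[C]_n => B x y) (spectral_isom' H); rewrite !mxE => E.
transitivity ((f (eig H x))%:C * \sum_j spectralmx H x j * dag (spectralmx H) j y).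
  rewrite /en mxE mulr_sumr; apply: eq_bigr => k _; by rewrite !mxE !enum_rankK mulrA.
by rewrite E; case: (x == y); rewrite ?mulr1 ?mulr0.
Qed.

Lemma eigbasis_diag n (H : 'M[C]_n) : dag H = H -> eigbasis H *m H *m dag (eigbasis H) = hdiag (eig H).
Proof. by move=> HH; rewrite -{2}(mxfun_id HH) eigbasis_mxfun. Qed.

Lemma tr_mxfun n (H : 'M[C]_n) (f : R -> R) : \tr (mxfun f H) = (\sum_k f (eig H k))%:C.
Proof. by rewrite -(tr_conj _ (eigbasis_isom H)) eigbasis_mxfun tr_hdiag. Qed.

Lemma eigbasis_gibbs n (H : 'M[C]_n) beta :
  eigbasis H *m gibbs beta H *m dag (eigbasis H) = gibbsop beta (eig H).
Proof.
rewrite /gibbs -scalemxAr -scalemxAl eigbasis_mxfun tr_mxfun -fmorphV; apply: enP => x y.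
rewrite en_scale !en_hdiag; case: (x == y); last by rewrite mulr0.
by rewrite -rmorphM mulrC.
Qed.

(* A diagonal Hamiltonian is diagonalized by the library in some unspecified basis. *)
Lemma mxfun_hdiag (E : finType) (h : E -> R) (f : R -> R) : mxfun f (hdiag h) = hdiag (fun x => f (h x)).
Proof.
set M := spectralmx (hdiag h); have E1 := spectral_isom (hdiag h); have E2 := spectral_isom' (hdiag h).
have HM : M *m hdiag h = diag_mx (\row_k (eig (hdiag h) k)%:C) *m M.
  by have Eh := spectral_herm (hdiag_dag h); rewrite -/M in Eh; rewrite [in LHS]Eh !mulmxA E2 mul1mx.
have key : diag_mx (\row_k (f (eig (hdiag h) k))%:C) *m M = M *m hdiag (fun x => f (h x)).
  apply/matrixP => k j; have := congr1 (fun B : 'M[C]_#|E| => B k j) HM.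
  rewrite !mul_diag_mx !mxE.
  have dg (g : E -> R) : \sum_j0 M k j0 * hdiag g j0 j = M k j * (g (enum_val j))%:C.
    rewrite (bigD1 j) //= big1 ?addr0 => [|i ni]; rewrite mxE ?eqxx //.
    by rewrite (inj_eq enum_val_inj) (negbTE ni) mulr0.
  rewrite !dg mulrC => e; have [->|nM] := eqVneq (M k j) 0; first by rewrite mulr0 mul0r.
  by have /rcI -> := mulIf nM e; rewrite mulrC.
by rewrite /mxfun -/M -mulmxA key mulmxA E1 mul1mx.
Qed.

Lemma gibbs_hdiag (E : finType) (h : E -> R) beta : gibbs beta (hdiag h) = gibbsop beta h.
Proof.
rewrite /gibbs mxfun_hdiag tr_hdiag -fmorphV; apply: enP => x y.
rewrite en_scale !en_hdiag; case: (x == y); last by rewrite mulr0.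
by rewrite -rmorphM mulrC.
Qed.

Lemma psd_eig n (A : 'M[C]_n) k : psd A -> 0 <= eig A k.
Proof.
move=> [HA pA]; have := pA (dag (row k (spectralmx A))).
have -> : (dag (dag (row k (spectralmx A))) *m A *m dag (row k (spectralmx A))) 0 0 =
   (spectralmx A *m A *m dag (spectralmx A)) k k.
  rewrite dagK !mxE; apply: eq_bigr => j _; rewrite !mxE; congr (_ * _).
  by apply: eq_bigr => l _; rewrite !mxE.
rewrite {2}(spectral_herm HA) !mulmxA spectral_isom' mul1mx -mulmxA spectral_isom' mulmx1 !mxE eqxx mulr1n.
by rewrite ler0c.
Qed.

Lemma eig_sum n (A : 'M[C]_n) : dag A = A -> \tr A = (\sum_k eig A k)%:C.
Proof. by move=> HA; rewrite -{1}(mxfun_id HA) tr_mxfun. Qed.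

Lemma spec_eig n (rho : 'M[C]_n) (J : 'M[C]_(#|'I_n|, n)) : density rho -> dag J *m J = 1%:M ->
  spec (J *m rho *m dag J) (J *m dag (eigbasis rho)) (eig rho).
Proof.
move=> [pr t1] JJ; have HA := proj1 pr; split.
- rewrite dag_mul dagK -mulmxA (mulmxA (dag J)) JJ mul1mx; exact: eigbasis_isom'.
- rewrite dag_mul dagK -(eigbasis_diag HA) !mulmxA -(mulmxA J (dag (eigbasis rho)) (eigbasis rho)) eigbasis_isom mulmx1.
  by rewrite -(mulmxA (J *m rho) (dag (eigbasis rho)) (eigbasis rho)) eigbasis_isom mulmx1.
- by move=> k; exact: psd_eig.
- by apply: rcI; rewrite -eig_sum.
Qed.

Lemma free_bfree n (H rho : 'M[C]_n) beta : dag H = H -> density rho -> 0 < beta ->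
  bfree (eig H) beta (eigbasis H *m rho *m dag (eigbasis H)) (eig rho) = beta * free_energy beta H rho.
Proof.
move=> HH dr b0; rewrite /bfree /free_energy /entropy mulrBr mulrCA divff ?gt_eqF // mulr1 opprK addrC.
congr (beta * _ + _); rewrite -Re_tr_hdiag -(eigbasis_diag HH).
congr (Re _); set J := eigbasis H.
have -> : J *m rho *m dag J *m (J *m H *m dag J) = J *m (rho *m H) *m dag J.
  by rewrite !mulmxA -(mulmxA (J *m rho) (dag J) J) eigbasis_isom mulmx1.
by rewrite tr_conj // eigbasis_isom.
Qed.

Lemma dens_density n (c : 'M[C]_n) : dens c -> density c.
Proof.
move=> [[k [w E]] t]; split=> //; split; first by rewrite /is_hermitian E dag_mul dagK.
move=> v; rewrite E.
have -> : dag v *m (w *m dag w) *m v = dag (dag w *m v) *m (dag w *m v) by rewrite dag_mul dagK !mulmxA.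
rewrite mxE; apply: sumr_ge0 => i _; rewrite mxE sqnE ler0c; exact: sqn_ge0.
Qed.

Lemma density_dens n (c : 'M[C]_n) : density c -> dens c.
Proof.
move=> d; have := spec_dens (spec_eig d (eigbasis_isom c)) => -[[k [w E]] t]; split; last exact: proj2 d.
exists k, (dag (eigbasis c) *m w).
rewrite dag_mul dagK !mulmxA -(mulmxA _ w) -E !mulmxA eigbasis_isom mul1mx -mulmxA eigbasis_isom.
by rewrite mulmx1.
Qed.

(** With [X = v dag w] the trace norm is the inner product of [v] with the image of [w] under the
    polar part, hence at most the mean of their squared norms. *)
Lemma trnorm_tn n (X : 'M[C]_n) e : tn X e -> trnorm X <= e.
Proof.
move=> [k [v [w [E hv hw]]]].
have M0 i := eig_gram_ge0 X i.
have polE : dag X *m polar X = mxfun Num.sqrt (dag X *m X).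
  have Mh : dag (dag X *m X) = dag X *m X by rewrite dag_mul dagK.
  rewrite /polar mulmxA -{1}(mxfun_id Mh) mxfunM; apply: mxfun_eq => i; rewrite /rsq.
  case: ltP => h; first by rewrite -[X in X / _](sqr_sqrtr (M0 i)) expr2 mulfK // gt_eqF // sqrtr_gt0.
  have -> : eig (dag X *m X) i = 0 by apply/eqP; rewrite eq_le h M0.
  by rewrite mul0r sqrtr0.
have trE : (trnorm X)%:C = \tr (dag v *m (polar X *m w)).
  rewrite /trnorm -tr_mxfun -polE {1}E dag_mul dagK -mulmxA mxtrace_mulC mulmxA; by [].
have P2 : N2 (polar X *m w) <= e.
  set Q := dag (polar X) *m polar X.
  have Qh : dag Q = Q by rewrite dag_mul dagK.
  have QQ : Q *m Q = Q by rewrite /Q -mulmxA (mulmxA (polar X)) polar_pisom.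
  apply: le_trans hw; rewrite (N2_gram w (erefl Q) Qh QQ); exact: N2_proj_le.
have h2 : 2 * trnorm X <= N2 v + N2 (polar X *m w).
  have := N2_ge0 (v - polar X *m w).
  have -> : N2 (v - polar X *m w) = N2 v + N2 (polar X *m w) - 2 * trnorm X; last by rewrite subr_ge0.
  apply: rcI; rewrite -N2E rmorphB rmorphD /= -!N2E rmorphM /= trE dagB mulmxBl !mulmxBr !raddfB /=.
  have -> : \tr (dag (polar X *m w) *m v) = \tr (dag v *m (polar X *m w)).
    have -> : dag (polar X *m w) *m v = dag (dag v *m (polar X *m w)) by rewrite [RHS]dag_mul dagK.
    have -> : \tr (dag (dag v *m (polar X *m w))) = conjc (\tr (dag v *m (polar X *m w))).
      by rewrite /mxtrace rmorph_sum; apply: eq_bigr => i _; rewrite mxE.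
    by rewrite -trE conjc_real.
  by rewrite rmorph_nat; ring.
rewrite -(ler_pM2l (ltr0n R 2)); apply: le_trans h2 _.
by rewrite mulr_natl mulr2n lerD.
Qed.

Lemma N2_trnorm n (X : 'M[C]_n) : N2 X <= trnorm X ^+ 2.
Proof.
have -> : N2 X = \sum_k (Num.sqrt (eig (dag X *m X) k)) ^+ 2.
  apply: rcI; rewrite -N2E eig_sum; last by rewrite dag_mul dagK.
  by rewrite !rc_sum; apply: eq_bigr => k _; rewrite sqr_sqrtr // eig_gram_ge0.
rewrite /trnorm expr2 mulr_suml; apply: ler_sum => k _; rewrite expr2 ler_wpM2l ?sqrtr_ge0 //.
by rewrite (bigD1 k) //= lerDl; apply: sumr_ge0 => *; exact: sqrtr_ge0.
Qed.

(** A form of Cauchy-Schwarz obtained by expanding the nonnegative squared norm of [dag X + e W]. *)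
Lemma Re_tr_bound n (X W : 'M[C]_n) e : 0 < e -> N2 X <= e ^+ 2 -> - (e * (1 + N2 W)) <= Re (\tr (X *m W)).
Proof.
move=> e0 hX.
have h : 0 <= N2 (dag X + e%:C *: W) by exact: N2_ge0.
have E : N2 (dag X + e%:C *: W) = N2 X + e ^+ 2 * N2 W + 2 * e * Re (\tr (X *m W)).
  have -> : N2 (dag X + e%:C *: W) = Re (\tr (dag (dag X + e%:C *: W) *m (dag X + e%:C *: W))) by rewrite N2E.
  rewrite dagD dagZ dagK conjc_real mulmxDl !mulmxDr !mxtraceD !ReD.
  rewrite -!scalemxAl -!scalemxAr !mxtraceZ !ReZ N2E' N2E /=.
  have -> : Re (\tr (dag W *m dag X)) = Re (\tr (X *m W)).
    rewrite -dag_mul.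
    have -> : \tr (dag (X *m W)) = conjc (\tr (X *m W)).
      by rewrite /mxtrace rmorph_sum; apply: eq_bigr => i _; rewrite mxE.
    by case: (\tr _).
  by ring.
exact: re_bound_arith e0 hX (N2_ge0 _) (eq_ind _ (fun t => 0 <= t) h _ E).
Qed.

End Spectral.

(** * Sufficiency for matrices *)

Section Final.
Variable R : realType.
Local Notation C := R[i].
Local Notation op T U := 'M[C]_(#|{: T}|, #|{: U}|).
Local Notation Re := (@complex.Re R).
Local Notation cj n H X := (eigbasis H *m X *m dag (eigbasis H) : op 'I_n 'I_n).

Lemma conj_mulmx n k (J : 'M[C]_(k, n)) (X Y : 'M[C]_n) : dag J *m J = 1%:M ->
  (J *m X *m dag J) *m (J *m Y *m dag J) = J *m (X *m Y) *m dag J.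
Proof. by move=> JJ; rewrite !mulmxA -(mulmxA (J *m X) (dag J) J) JJ mulmx1. Qed.

Lemma conj_inj n (H X : 'M[C]_n) : dag (eigbasis H) *m (cj n H X) *m eigbasis H = X.
Proof. by rewrite !mulmxA eigbasis_isom mul1mx -mulmxA eigbasis_isom mulmx1. Qed.

Lemma coh_modesP n (H rho : 'M[C]_n) d :
  coh_modes H rho d <-> exists x y, en (cj n H rho) x y != 0 /\ d = eig H x - eig H y.
Proof.
have E (E1 E2 : R) x y : en (cj n H (eproj H E1 *m rho *m eproj H E2)) x y =
    (if eig H x == E1 then 1 else 0)%:C * en (cj n H rho) x y * (if eig H y == E2 then 1 else 0)%:C.
  have -> : cj n H (eproj H E1 *m rho *m eproj H E2) = cj n H (eproj H E1) *m cj n H rho *m cj n H (eproj H E2).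
    by rewrite !conj_mulmx // eigbasis_isom.
  by rewrite /eproj !eigbasis_mxfun hdiagr hdiagl.
split=> [[E1 [E2 [-> n0]]]|[x [y [n0 ->]]]].
  have [/existsP[x /existsP[y nz]]|] := boolP [exists x, exists y, en (cj n H (eproj H E1 *m rho *m eproj H E2)) x y != 0].
    exists x, y; move: nz; rewrite E; case: (eqVneq (eig H x) E1) => [->|_]; last by rewrite !mul0r eqxx.
    case: (eqVneq (eig H y) E2) => [->|_]; last by rewrite mulr0 eqxx.
    by rewrite mulr1 mul1r.
  rewrite negb_exists => /forallP z; case: n0.
  rewrite -(conj_inj H (_ *m rho *m _)).
  suff -> : cj n H (eproj H E1 *m rho *m eproj H E2) = 0 by rewrite mulmx0 mul0mx.
  apply: enP => x y; rewrite en_0; apply/eqP.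
  by have := z x; rewrite negb_exists => /forallP /(_ y); rewrite negbK.
exists (eig H x), (eig H y); split=> // z.
have := E (eig H x) (eig H y) x y; rewrite z mulmx0 mul0mx en_0 !eqxx mul1r mulr1 => e.
by rewrite -e eqxx in n0.
Qed.

Lemma modespan_int (T : finType) (h : T -> R) (rho : op T T) d (m : int) : dens rho ->
  modespan h rho d -> modespan h rho (d *~ m).
Proof.
move=> dr md; have mn (k : nat) : modespan h rho (d *+ k).
  by elim: k => [|k IH]; [rewrite mulr0n; exact: modespan0|rewrite mulrS; exact: modespanD].
by case: m => k; [exact: mn|rewrite NegzE mulrNz; exact/modespanN/mn].
Qed.

(** Integer coefficients become repetitions of pairs of levels, a negative sign being a reversed
    pair, admissible since [rho] is Hermitian. *)
Lemma res_modes_span n (H rho : 'M[C]_n) d : dens (cj n H rho) ->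
  res_modes H rho d -> modespan (eig H) (cj n H rho) d.
Proof.
move=> dr [s [Hs ->]]; elim: s Hs => [|q s IH] Hs; first by rewrite big_nil; exact: modespan0.
rewrite big_cons; apply: modespanD; last by apply: IH => p ps; apply: Hs; rewrite inE ps orbT.
apply: modespan_int => //; have /coh_modesP[x [y [n0 ->]]] := Hs q (mem_head _ _).
exists [:: (x, y)]; rewrite big_seq1; split=> // p; rewrite inE => /eqP -> /=.
by rewrite -(dens_dag dr) en_dag conjc_eq0.
Qed.

Section Setting.
Variables (n : nat) (HS : 'M[C]_n) (beta : R) (rho rho' : 'M[C]_n).
Hypothesis HH : is_hermitian HS.
Hypothesis b0 : 0 < beta.
Hypothesis dr : density rho.
Hypothesis dr' : density rho'.
Let J := eigbasis HS.
Let JJ : dag J *m J = 1%:M := eigbasis_isom HS.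
Let JJ' : J *m dag J = 1%:M := eigbasis_isom' HS.

Lemma dens_cj (X : 'M[C]_n) : density X -> dens (cj n HS X).
Proof. by move=> dX; exact: spec_dens (spec_eig dX JJ). Qed.

Lemma thermal_catalysis eps : (forall x, res_modes HS rho' x -> res_modes HS rho x) ->
  free_energy beta HS rho' <= free_energy beta HS rho -> 0 < eps ->
  exists (k : nat) (HC : 'M[C]_k) (c : 'M[C]_k) (L : 'M[C]_(n * k) -> 'M[C]_(n * k)),
        [/\ is_hermitian HC, density c,
            thermal_op beta (hsum HS HC) (hsum HS HC) L,
            ptr1 (L (rho *t c)) = c &
            trnorm (ptr2 (L (rho *t c)) - rho') <= eps /\
            trnorm (L (rho *t c) - ptr2 (L (rho *t c)) *t c) <= eps].
Proof.
move=> md FF e0; have e2 : 0 < eps / 2 by rewrite divr_gt0.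
have md' x y : en (cj n HS rho') x y != 0 -> modespan (eig HS) (cj n HS rho) (eig HS x - eig HS y).
  move=> n0; apply: res_modes_span; first exact: dens_cj.
  apply: md; exists [:: (1%:Z, eig HS x - eig HS y)]; rewrite big_seq1 mulr1z; split=> // p.
  by rewrite inE => /eqP -> /=; apply/coh_modesP; exists x, y.
have FF' : bfree (eig HS) beta (cj n HS rho') (eig rho') <= bfree (eig HS) beta (cj n HS rho) (eig rho).
  by rewrite !free_bfree // ler_pM2l.
have [K [E [hK [hE [c [U [[E0 dc] U1 Ue P1 P2]]]]]]] := cat_weak b0 (spec_eig dr JJ) (spec_eig dr' JJ) md' FF' e2.
pose IK : 'M[C]_#|K| := 1%:M; pose IE : 'M[C]_#|E| := 1%:M.
have IKK : IK *m dag IK = 1%:M by rewrite dag1 mul1mx.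
have IKK' : dag IK *m IK = 1%:M by rewrite dag1 mul1mx.
have IEE : IE *m dag IE = 1%:M by rewrite dag1 mul1mx.
have IEE' : dag IE *m IE = 1%:M by rewrite dag1 mul1mx.
pose J2 := mt (J : 'M_(#|'I_n|, n)) IK; pose J3 := mt J2 IE.
have J2J : dag J2 *m J2 = 1%:M by exact: mt_gram.
have J2J' : J2 *m dag J2 = 1%:M by exact: mt_isom'.
have J3J : dag J3 *m J3 = 1%:M by exact: mt_gram.
have J3J' : J3 *m dag J3 = 1%:M by exact: mt_isom'.
have U1' : U *m dag U = 1%:M by exact: mulmx1C.
pose HC : 'M[C]_#|K| := hdiag hK; pose HE : 'M[C]_#|E| := hdiag hE.
have [V [J3V VJ3]] : exists V, J3 *m V = U *m J3 /\ V *m dag J3 = dag J3 *m U.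
  exists (dag J3 *m (U *m J3)); split; first by rewrite (mulmxA J3) J3J' mul1mx.
  by rewrite -!mulmxA J3J' mulmx1.
pose L X := ptr2 (V *m (X *t gibbs beta HE) *m dag V).
have IKc (B : 'M[C]_#|K|) : IK *m B *m dag IK = B by rewrite dag1 mul1mx mulmx1.
have IEc (B : 'M[C]_#|E|) : IE *m B *m dag IE = B by rewrite dag1 mul1mx mulmx1.
have h2 : J2 *m hsum HS HC *m dag J2 = hdiag (hsum2 (eig HS) hK).
  by apply: hsum_conj => //; exact: eigbasis_diag.
have h3 : J3 *m hsum (hsum HS HC) HE *m dag J3 = hdiag (hsum2 (hsum2 (eig HS) hK) hE).
  by apply: hsum_conj.
have V1 : dag V *m V = 1%:M.
  have -> : dag V *m V = dag (J3 *m V) *m (J3 *m V) by rewrite dag_mul -mulmxA (mulmxA (dag J3) J3) J3J mul1mx.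
  by rewrite J3V dag_mul -mulmxA (mulmxA (dag U) U) U1 mul1mx.
have Vcons : V *m hsum (hsum HS HC) HE = hsum (hsum HS HC) HE *m V.
  have -> : hsum (hsum HS HC) HE = dag J3 *m hdiag (hsum2 (hsum2 (eig HS) hK) hE) *m J3.
    by rewrite -h3 !mulmxA J3J mul1mx -mulmxA J3J mulmx1.
  rewrite !mulmxA VJ3 -[RHS]mulmxA J3V.
  by have /econsE e := Ue; rewrite -(mulmxA (dag J3) U) e !mulmxA.
have cL X : J2 *m L X *m dag J2 = thmap beta hE U (J2 *m X *m dag J2).
  rewrite /thmap -(pt2_mt J2 _ IEE') -/J3; congr pt2.
  have -> : tens (J2 *m X *m dag J2) (gibbsop beta hE) = J3 *m (X *t gibbs beta HE) *m dag J3.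
    by rewrite mt_conj IEc gibbs_hdiag.
  transitivity ((J3 *m V) *m (X *t gibbs beta HE) *m dag (J3 *m V)); first by rewrite dag_mul !mulmxA.
  by rewrite J3V dag_mul !mulmxA.
have trL X : \tr (L X) = \tr X.
  rewrite -(tr_conj _ J2J) cL /thmap tr_pt2 tr_conj // tens_tr (proj2 (dens_gibbs beta hE E0)) mulr1.
  by rewrite tr_conj.
have cin : J2 *m (rho *t c) *m dag J2 = tens (cj n HS rho) c by rewrite mt_conj IKc.
set P := thmap beta hE U _ in P1 P2.
have cP : J2 *m L (rho *t c) *m dag J2 = P by rewrite cL cin.
have pL1 : ptr1 (L (rho *t c)) = c.
  by rewrite -[LHS]IKc -(pt1_mt _ _ JJ) -/J2 cP.
have pL2 : cj n HS (ptr2 (L (rho *t c))) = pt2 P.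
  by rewrite -(pt2_mt _ _ IKK') -/J2 cP.
have tnJ (X : 'M[C]_n) e : tn (cj n HS X) e -> tn X e.
  move=> t; have EX : dag J *m cj n HS X *m dag (dag J) = X by rewrite dagK; exact: conj_inj.
  by rewrite -EX; apply: tn_isom t; rewrite dagK.
have dn : tn (pt2 P - cj n HS rho') (eps / 2).
  have -> : pt2 P - cj n HS rho' = pt2 (P - tens (cj n HS rho') c).
    by rewrite pt2B pt2_tens (proj2 dc) scale1r.
  exact: tn_pt2.
exists #|K|, HC, c, L; split.
- exact: hdiag_dag.
- exact: dens_density.
- exists #|E|, HE, V; split=> //; first exact: hdiag_dag.
  by rewrite -mulmxA V1 mulmx1.
- exact: pL1.
split.
  apply/trnorm_tn/tnJ; apply: (@tn_le _ _ _ (eps / 2)); first by rewrite ler_pdivrMr // ler_peMr ?ler1n // ltW.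
  by rewrite mulmxBr mulmxBl pL2.
apply: trnorm_tn; set Y := _ - _.
have -> : Y = dag J2 *m (J2 *m Y *m dag J2) *m dag (dag J2).
  by rewrite dagK !mulmxA J2J mul1mx -mulmxA J2J mulmx1.
apply: tn_isom; first by rewrite dagK.
rewrite /Y mulmxBr mulmxBl cP mt_conj IKc pL2.
(* Replacing the ideal target by the actual marginal costs a second [eps / 2]. *)
have -> : P - tens (pt2 P) c = (P - tens (cj n HS rho') c) - tens (pt2 P - cj n HS rho') c.
  by rewrite tensBl opprB addrA subrK.
have -> : eps = eps / 2 + eps / 2 by rewrite -splitr.
by apply: tnB => //; apply: tn_tensr.
Qed.

End Setting.
End Final.

(** * Necessity for matrices *)

Section Monotone.
Variable R : realType.
Local Notation C := R[i].
Local Notation op T U := 'M[C]_(#|{: T}|, #|{: U}|).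
Local Notation Re := (@complex.Re R).
Local Notation cj n H X := (eigbasis H *m X *m dag (eigbasis H) : op 'I_n 'I_n).

(* A projection whose complement has zero overlap with a full-rank diagonal operator is the identity. *)
Lemma proj_full_rank (T : finType) (Q : op T T) (f : T -> R) : dag Q = Q -> Q *m Q = Q ->
  (forall x, 0 < f x) -> \tr (hdiag f *m Q) = \tr (hdiag f) -> Q = 1%:M.
Proof.
move=> Qh QQ f0 tQ; pose P : op T T := 1%:M - Q.
have PP : dag P *m P = P.
  by rewrite /P dagB dag1 Qh mulmxBl mul1mx mulmxBr mulmx1 QQ subrr subr0.
have E : \sum_x f x * \sum_y sqn (en P y x) = 0.
  have PE x : en P x x = (\sum_y sqn (en P y x))%:C.
    by rewrite -{1}PP en_mul rc_sum; apply: eq_bigr => y _; rewrite en_dag sqnE.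
  apply: rcI; rewrite rc_sum; transitivity (\tr (hdiag f *m P)).
    by rewrite tr_en; apply: eq_bigr => x _; rewrite hdiagl PE -rmorphM.
  by rewrite /P mulmxBr mulmx1 raddfB /= tQ subrr.
have s0 x : 0 <= \sum_y sqn (en P y x) by apply: sumr_ge0 => *; exact: sqn_ge0.
have P0 : P = 0.
  apply: enP => y x; rewrite en_0; apply/eqP; rewrite -sqn_eq0.
  have /eqP : f x * \sum_z sqn (en P z x) = 0.
    by apply: (psumr_eq0P _ E) => // z _; apply: mulr_ge0 => //; exact: ltW.
  rewrite mulf_eq0 gt_eqF //= => /eqP h2.
  by apply/eqP; apply: (psumr_eq0P _ h2) => // z _; exact: sqn_ge0.
by apply/esym/eqP; rewrite -subr_eq0 -/P P0.
Qed.

Variables (n : nat) (HS : 'M[C]_n) (beta : R) (rho rho' : 'M[C]_n).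
Hypothesis HH : is_hermitian HS.
Hypothesis b0 : 0 < beta.
Hypothesis dr : density rho.
Hypothesis dr' : density rho'.
Let J := eigbasis HS.
Let JJ : dag J *m J = 1%:M := eigbasis_isom HS.
Let JJ' : J *m dag J = 1%:M := eigbasis_isom' HS.

(** The given operation is rewritten in energy eigenbases, where [converse_bound] applies; the
    deviation from [rho'] is paired with [witness], whose norm does not involve the catalyst. *)
Lemma catalysis_bound d eps k (HC c : 'M[C]_k) (L : 'M[C]_(n * k) -> 'M[C]_(n * k)) :
  0 < d -> d < 1 -> 0 < eps -> is_hermitian HC -> density c ->
  thermal_op beta (hsum HS HC) (hsum HS HC) L ->
  ptr1 (L (rho *t c)) = c -> trnorm (ptr2 (L (rho *t c)) - rho') <= eps ->
  beta * free_energy beta HS rho' + 2 * ln (1 - d) -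
    eps * (1 + N2 (witness beta (eig HS) (J *m dag (eigbasis rho') : op 'I_n 'I_n) (eig rho') d)) <= beta * free_energy beta HS rho.
Proof.
move=> d0 d1 e0 hHC dc [e [HE [V [hHE VVV Vc LE Ltr]]]] pc cl.
pose JC := eigbasis HC; pose JE := eigbasis HE.
have JCJ : dag JC *m JC = 1%:M := eigbasis_isom HC.
have JCJ' : JC *m dag JC = 1%:M := eigbasis_isom' HC.
have JEJ : dag JE *m JE = 1%:M := eigbasis_isom HE.
have JEJ' : JE *m dag JE = 1%:M := eigbasis_isom' HE.
pose J2 := mt (J : 'M_(#|'I_n|, n)) (JC : 'M_(#|'I_k|, k)); pose J3 := mt J2 (JE : 'M_(#|'I_e|, e)).
have J2J : dag J2 *m J2 = 1%:M by exact: mt_gram.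
have J2J' : J2 *m dag J2 = 1%:M by exact: mt_isom'.
have J3J : dag J3 *m J3 = 1%:M by exact: mt_gram.
have J3J' : J3 *m dag J3 = 1%:M by exact: mt_isom'.
have h2 : J2 *m hsum HS HC *m dag J2 = hdiag (hsum2 (eig HS) (eig HC)).
  by apply: hsum_conj => //; exact: eigbasis_diag.
have h3 : J3 *m hsum (hsum HS HC) HE *m dag J3 = hdiag (hsum2 (hsum2 (eig HS) (eig HC)) (eig HE)).
  by apply: hsum_conj => //; exact: eigbasis_diag.
have dcin : dens (tens (cj n HS rho) (cj k HC c)).
  by apply: dens_tens; [exact: (spec_dens (spec_eig dr JJ))|exact: (spec_dens (spec_eig dc JCJ))].
have cin : J2 *m (rho *t c) *m dag J2 = tens (cj n HS rho) (cj k HC c) by rewrite mt_conj.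
have cG X : J3 *m (X *t gibbs beta HE) *m dag J3 = tens (J2 *m X *m dag J2) (gibbsop beta (eig HE)).
  by rewrite mt_conj eigbasis_gibbs.
have tin : \tr (L (rho *t c)) = 1 by rewrite Ltr -(tr_conj _ J2J) cin (proj2 dcin).
(* An empty environment would make the output zero, contradicting its unit trace. *)
have E0 : (0 < #|'I_e|)%N.
  rewrite lt0n; apply/eqP; rewrite card_ord => e0'; move: tin; rewrite LE tr_ptr2 /mxtrace big1 => [/eqP|i _].
    by rewrite eq_sym oner_eq0.
  by exfalso; case: (mxtens_unindex i) => _ [q]; rewrite e0'.
have [U [J3V VJ3]] : exists U : op (('I_n * 'I_k) * 'I_e) (('I_n * 'I_k) * 'I_e), U *m J3 = J3 *m V /\ dag J3 *m U = V *m dag J3.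
  exists (J3 *m V *m dag J3); split; first by rewrite -(mulmxA (J3 *m V)) J3J mulmx1.
  by rewrite !mulmxA J3J mul1mx.
have UE : U = J3 *m V *m dag J3 by rewrite -J3V -mulmxA J3J' mulmx1.
have gramE : dag U *m U = J3 *m (dag V *m V) *m dag J3.
  have -> : dag U = J3 *m dag V *m dag J3 by rewrite UE !dag_mul dagK !mulmxA.
  by rewrite UE conj_mulmx.
have cL X : J2 *m L X *m dag J2 = thmap beta (eig HE) U (J2 *m X *m dag J2).
  rewrite LE /thmap -(pt2_mt J2 _ JEJ) -/J3; congr pt2; rewrite -cG.
  transitivity ((J3 *m V) *m (X *t gibbs beta HE) *m dag (J3 *m V)); first by rewrite dag_mul !mulmxA.
  by rewrite -J3V dag_mul !mulmxA.
(* Trace preservation on the identity operator shows that the initial projection carries the full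
   trace against a strictly positive diagonal operator. *)
have U1 : dag U *m U = 1%:M.
  apply: (@proj_full_rank _ _ (fun p : ('I_n * 'I_k) * 'I_e => 1 * gibbsp beta (eig HE) p.2)).
  - by rewrite dag_mul dagK.
  - rewrite gramE conj_mulmx //; congr (_ *m _ *m _).
    by rewrite -mulmxA (mulmxA V) VVV.
  - by move=> p; rewrite mul1r gibbsp_gt0.
  - rewrite -(tens_hdiag (fun=> 1)) hdiag1 mxtrace_mulC -mulmxA mxtrace_mulC.
    have := Ltr 1%:M; rewrite -(tr_conj _ J2J) cL mulmx1 J2J' /thmap tr_pt2 => ->.
    by rewrite -(tr_conj _ J2J) mulmx1 J2J' tens_tr (proj2 (dens_gibbs beta (eig HE) E0)) mulr1.
have Ue : econs (hsum2 (hsum2 (eig HS) (eig HC)) (eig HE)) U.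
  apply/econsE; rewrite -h3 UE conj_mulmx // conj_mulmx //; by rewrite Vc.
have pt1P : pt1 (thmap beta (eig HE) U (tens (cj n HS rho) (cj k HC c))) = cj k HC c.
  by rewrite -cin -cL (pt1_mt _ _ JJ) pc.
have := converse_bound (spec_eig dr JJ) (spec_eig dr' JJ) (spec_dens (spec_eig dc JCJ)) E0 U1 Ue pt1P d0 d1.
rewrite !free_bfree //; apply: le_trans; rewrite lerD2l.
apply: Re_tr_bound => //.
have -> : pt2 (thmap beta (eig HE) U (tens (cj n HS rho) (cj k HC c))) - cj n HS rho' =
   J *m (ptr2 (L (rho *t c)) - rho') *m dag J.
  by rewrite -cin -cL (pt2_mt _ _ JCJ) mulmxBr mulmxBl.
rewrite -mulmxA N2_isom // -N2_dag dag_mul dagK N2_isom // N2_dag.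
apply: le_trans (N2_trnorm _) _; rewrite ler_sqr ?nnegrE ?(ltW e0) //.
by apply: sumr_ge0 => i _; exact: sqrtr_ge0.
Qed.

Lemma catalysis_free_energy :
  (forall eps : R, 0 < eps ->
      exists (k : nat) (HC : 'M[C]_k) (c : 'M[C]_k)
             (L : 'M[C]_(n * k) -> 'M[C]_(n * k)),
        [/\ is_hermitian HC, density c,
            thermal_op beta (hsum HS HC) (hsum HS HC) L,
            ptr1 (L (rho *t c)) = c &
            trnorm (ptr2 (L (rho *t c)) - rho') <= eps]) ->
  free_energy beta HS rho' <= free_energy beta HS rho.
Proof.
move=> H; rewrite -(ler_pM2l b0) leNgt; apply/negP => lt.
pose t := beta * free_energy beta HS rho' - beta * free_energy beta HS rho.
have t0 : 0 < t by rewrite subr_gt0.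
(* For a supposed increase [t] of beta times the free energy, this [d] makes [2 ln (1 - d)] equal to
   [- t / 2], and the accuracy chosen below contributes a further [- t / 4]: together less than [t],
   a contradiction. *)
pose d := 1 - expR (- (t / 4)).
have ed : 1 - d = expR (- (t / 4)) by rewrite opprB addrC subrK.
have d0 : 0 < d by rewrite subr_gt0 -[X in _ < X]expR0 ltr_expR oppr_lt0 divr_gt0.
have d1 : d < 1 by rewrite gtrBl expR_gt0.
set W := N2 (witness beta (eig HS) (J *m dag (eigbasis rho') : op 'I_n 'I_n) (eig rho') d).
have W0 : 0 < 1 + W by rewrite ltr_pwDl // N2_ge0.
have e0 : 0 < t / 4 / (1 + W) by rewrite !divr_gt0.
have [k [HC [c [L [h1 h2 h3 h4 h5]]]]] := H _ e0.
have := catalysis_bound d0 d1 e0 h1 h2 h3 h4 h5; rewrite -/W ed expRK divfK ?gt_eqF //.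
by move: t0; rewrite /t; lra.
Qed.

End Monotone.

Theorem mainTheorem1 (R : realType) (n : nat) (HS : 'M[R[i]]_n) (beta : R)
  (rho rho' : 'M[R[i]]_n) :
  is_hermitian HS -> 0 < beta -> density rho -> density rho' ->
  (forall x, res_modes HS rho' x -> res_modes HS rho x) ->
  ((forall eps : R, 0 < eps ->
      exists (k : nat) (HC : 'M[R[i]]_k) (c : 'M[R[i]]_k)
             (L : 'M[R[i]]_(n * k) -> 'M[R[i]]_(n * k)),
        [/\ is_hermitian HC, density c,
            thermal_op beta (hsum HS HC) (hsum HS HC) L,
            ptr1 (L (rho *t c)) = c &
            trnorm (ptr2 (L (rho *t c)) - rho') <= eps])
   <-> free_energy beta HS rho' <= free_energy beta HS rho)
  /\
  (free_energy beta HS rho' <= free_energy beta HS rho ->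
   forall eps : R, 0 < eps ->
      exists (k : nat) (HC : 'M[R[i]]_k) (c : 'M[R[i]]_k)
             (L : 'M[R[i]]_(n * k) -> 'M[R[i]]_(n * k)),
        [/\ is_hermitian HC, density c,
            thermal_op beta (hsum HS HC) (hsum HS HC) L,
            ptr1 (L (rho *t c)) = c &
            trnorm (ptr2 (L (rho *t c)) - rho') <= eps /\
            trnorm (L (rho *t c) - ptr2 (L (rho *t c)) *t c) <= eps]).
Proof.
move=> HH b0 dr dr' md; split; last by move=> FF eps; exact: thermal_catalysis.
split; first exact: catalysis_free_energy.
move=> FF eps e0; have [k [HC [c [L [h1 h2 h3 h4 [h5 _]]]]]] := thermal_catalysis HH b0 dr dr' md FF e0.
by exists k, HC, c, L.
Qed.
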